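(* Let $(M^m,g,J)$ be a complete non-flat (connected) Kähler manifold of complex dimension $m\geq 2$. If $M$ has $\frac{3}{2}(m^2-1)$-nonnegative (respectively, $\frac{3}{2}(m^2-1)$-nonpositive) curvature operator of the second kind, then, up to scaling of the metric, $M$ is isometric to $(\mathbb{CP}^m,g_{FS})$ (respectively, a quotient of $(\mathbb{CH}^m,g_{\text{stand}})$).
   Context: Sign convention: the Riemann curvature tensor $R$ is normalized so that $R(X,Y,X,Y)$ is the sectional curvature of the plane spanned by orthonormal $X,Y$ (positive on round spheres). For a Riemannian manifold $(M^n,g)$ and $p\in M$, let $S^2_0(T_pM)$ be the space of traceless symmetric two-tensors on $T_pM$ with inner product $\langle A,B\rangle=\operatorname{tr}(A^TB)$, and let $N=\dim S^2_0(T_pM)=\frac{(n-1)(n+2)}{2}$. The curvature operator of the second kind is the symmetric bilinear form on $S^2_0(T_pM)$ given in an orthonormal basis by $\mathring{R}(\varphi,\psi)=\sum_{i,j,k,l=1}^n R_{ijkl}\varphi_{il}\psi_{jk}$. For a real number $\alpha\in[1,N]$, $(M,g)$ has $\alpha$-nonnegative (respectively, $\alpha$-nonpositive) curvature operator of the second kind if for every $p\in M$ and every orthonormal basis $\{\varphi_i\}_{i=1}^N$ of $S^2_0(T_pM)$, $$\sum_{i=1}^{\lfloor\alpha\rfloor}\mathring{R}(\varphi_i,\varphi_i)+(\alpha-\lfloor\alpha\rfloor)\mathring{R}(\varphi_{\lfloor\alpha\rfloor+1},\varphi_{\lfloor\alpha\rfloor+1})\geq0\quad(\text{respectively, }\leq0),$$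 where the last term is absent when $\alpha$ is an integer. A Kähler manifold of complex dimension $m$ has real dimension $n=2m$. $(\mathbb{CP}^m,g_{FS})$ is the complex projective space with the Fubini–Study metric of constant holomorphic sectional curvature $4$; $(\mathbb{CH}^m,g_{\text{stand}})$ is the complex hyperbolic space with its standard metric of constant negative holomorphic sectional curvature. *)

(* Defs.v *)
From HB Require Import structures.
From mathcomp Require Import all_boot all_order all_algebra.
From mathcomp Require Import complex generic_quotient.
From mathcomp Require Import all_classical all_reals all_analysis.

Set Implicit Arguments.
Unset Strict Implicit.
Unset Printing Implicit Defensive.

Import Order.TTheory GRing.Theory Num.Theory.
Import numFieldNormedType.Exports.

Local Open Scope quotient_scope.
Local Open Scope classical_set_scope.
Local Open Scope ring_scope.

(* Tangent vectors are written as row vectors of components with respect to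
   the coordinate frame of a chart; a linear map acts on them by right
   multiplication, and a bilinear form h by (u, v) |-> u *m h *m v^T. *)

Section Smoothness.
Variables (R : realType) (n : nat).

Definition partial (f : 'rV[R]_n -> R) (i : 'I_n) : 'rV[R]_n -> R :=
  fun x => 'D_(delta_mx 0 i) f x.

(* Meant for open sets [U]. *)
Fixpoint Ck (k : nat) (U : set 'rV[R]_n) (f : 'rV[R]_n -> R) : Prop :=
  (forall x, U x -> {for x, continuous f}) /\
  (if k is k'.+1 then
     forall i, (forall x, U x -> derivable f x (delta_mx 0 i)) /\
               Ck k' U (partial f i)
   else True).

Definition smooth (U : set 'rV[R]_n) (f : 'rV[R]_n -> R) : Prop :=
  forall k, Ck k U f.

End Smoothness.

Section Manifolds.
Variables (R : realType) (n : nat).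

(* The data of an n-manifold with a metric, without its axioms, which are the
   predicate [riemannian]. Each chart [c] has a domain [cdom c], a coordinate
   map [coord c], of which [param c] is the inverse on the domain, and the
   matrix [metric c x] of components of the metric at the point with
   coordinates [x]. The values of [coord c] outside of [cdom c], and of
   [param c] and [metric c] outside of [cimg c], are irrelevant. *)
Record riemData := RiemData {
  space :> topologicalType;
  chart : Type;
  cdom : chart -> set space;
  coord : chart -> space -> 'rV[R]_n;
  param : chart -> 'rV[R]_n -> space;
  metric : chart -> 'rV[R]_n -> 'M[R]_n
}.

Definition cimg (M : riemData) (c : chart M) : set 'rV[R]_n :=
  coord c @` cdom c.

Definition local_dom (M N : riemData) (f : M -> N) (c : chart M) (d : chart N) :
    set 'rV[R]_n :=
  coord c @` (cdom c `&` f @^-1` cdom d).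

Definition local_rep (M N : riemData) (f : M -> N) (c : chart M) (d : chart N) :
    'rV[R]_n -> 'rV[R]_n :=
  fun x => coord d (f (param c x)).

Definition smooth_fun (M N : riemData) (f : M -> N) : Prop :=
  continuous f /\
  forall c d (j : 'I_n),
    smooth (local_dom f c d) (fun x => local_rep f c d x 0 j).

(* f^* (metric N) = metric M *)
Definition preserves_metric (M N : riemData) (f : M -> N) : Prop :=
  forall c d x, local_dom f c d x ->
    metric c x = 'J (local_rep f c d) x *m metric d (local_rep f c d x)
                 *m ('J (local_rep f c d) x)^T.

Definition smooth_tensor (M : riemData) (T : chart M -> 'rV[R]_n -> 'M[R]_n) :
    Prop :=
  forall c i j, smooth (cimg c) (fun x => T c x i j).

(* With [f] the identity map, [smooth_fun] and [preserves_metric] speak about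
   the changes of charts. *)
Record riemannian (M : riemData) : Prop := Riemannian {
  riem_hausdorff : hausdorff_space M;
  riem_countable : @second_countable M;
  riem_cover : forall p : M, exists c : chart M, cdom c p;
  riem_open_dom : forall c : chart M, open (cdom c);
  riem_open_img : forall c : chart M, open (cimg c);
  riem_coordK : forall (c : chart M) p, cdom c p -> param c (coord c p) = p;
  riem_coord_cts : forall c : chart M, {within cdom c, continuous (coord c)};
  riem_param_cts : forall c : chart M, {within cimg c, continuous (param c)};
  riem_smooth : @smooth_fun M M id;
  riem_metric_smooth : smooth_tensor (@metric M);
  riem_metric_sym : forall (c : chart M) x, cimg c x ->
    (metric c x)^T = metric c x;
  riem_metric_pos : forall (c : chart M) x (v : 'rV[R]_n), cimg c x -> v != 0 ->
    0 < (v *m metric c x *m v^T) 0 0;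
  riem_metric_trans : @preserves_metric M M id
}.

Definition scale (k : R) (M : riemData) : riemData :=
  @RiemData (space M) (chart M) (@cdom M) (@coord M) (@param M)
            (fun c x => k *: metric c x).

Definition isometry (M N : riemData) (f : M -> N) : Prop :=
  [/\ smooth_fun f, preserves_metric f
    & exists g : N -> M, [/\ cancel f g, cancel g f & smooth_fun g]].

Definition isometric (M N : riemData) : Prop :=
  exists f : M -> N, isometry f.

Record free_isometry_group (N : riemData) (G : set (N -> N)) : Prop :=
  FreeIsometryGroup {
  fig_isometry : forall f, G f -> isometry f;
  fig_id : G id;
  fig_comp : forall f g, G f -> G g -> G (f \o g);
  fig_inv : forall f, G f -> exists2 g, G g & cancel f g /\ cancel g f;
  fig_free : forall f x, G f -> f x = x -> f = id;
  fig_proper : forall K : set N, compact K ->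
    finite_set [set f | G f /\ (f @` K) `&` K !=set0]
}.

(* [M] is isometric to N / G for a group [G] acting freely and properly
   discontinuously by isometries: [q] stands for the projection followed by
   the isometry, the metric of N / G being the one that makes the projection
   a local isometry. *)
Definition isometric_to_quotient (M N : riemData) : Prop :=
  exists G : set (N -> N), free_isometry_group G /\
  exists q : N -> M,
    [/\ set_surj setT setT q, smooth_fun q, preserves_metric q
      & forall x y, q x = q y <-> exists2 f, G f & f x = y].

(* Gamma^k_ij *)
Definition christoffel (M : riemData) (c : chart M) (k i j : 'I_n)
    (x : 'rV[R]_n) : R :=
  2^-1 * \sum_l invmx (metric c x) k l *
    (partial (fun y => metric c y j l) i x +
     partial (fun y => metric c y i l) j x -
     partial (fun y => metric c y i j) l x).

(* R(d_i, d_j) d_l = \sum_p (curv p l i j) d_p, where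
   R(X, Y) = [nabla_X, nabla_Y] - nabla_[X, Y]. *)
Definition curv (M : riemData) (c : chart M) (p l i j : 'I_n)
    (x : 'rV[R]_n) : R :=
  partial (christoffel c p j l) i x - partial (christoffel c p i l) j x +
  \sum_q (christoffel c p i q x * christoffel c q j l x -
          christoffel c p j q x * christoffel c q i l x).

(* R_ijkl = g(R(d_i, d_j) d_l, d_k), so that R_ijij > 0 on round spheres. *)
Definition riem (M : riemData) (c : chart M) (i j k l : 'I_n)
    (x : 'rV[R]_n) : R :=
  \sum_p metric c x k p * curv c p l i j x.

Definition flat (M : riemData) : Prop :=
  forall (c : chart M) x, cimg c x -> forall i j k l, riem c i j k l x = 0.

Definition curve_coord (M : riemData) (c : chart M) (gamma : R -> M)
    (k : 'I_n) : R -> R :=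
  fun t => coord c (gamma t) 0 k.

Definition geodesic (M : riemData) (gamma : R -> M) : Prop :=
  continuous gamma /\
  forall (c : chart M) t, cdom c (gamma t) -> forall k,
    let x := curve_coord c gamma in
    [/\ derivable (x k) t 1, derivable (derive1 (x k)) t 1
      & derive1 (derive1 (x k)) t +
        \sum_i \sum_j christoffel c k i j (coord c (gamma t)) *
                      derive1 (x i) t * derive1 (x j) t = 0].

Definition complete_riem (M : riemData) : Prop :=
  forall (c : chart M) p (v : 'rV[R]_n), cdom c p ->
  exists gamma : R -> M,
    [/\ geodesic gamma, gamma 0 = p
      & forall k, derive1 (curve_coord c gamma k) 0 = v 0 k].

(* [J c x] is the matrix of J in the chart [c]: J(d_i) = \sum_j (J c x i j) d_j.
   The last two fields are the tensoriality and the parallelism of J. *)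
Record kahler (M : riemData) (J : chart M -> 'rV[R]_n -> 'M[R]_n) : Prop :=
  Kahler {
  kahler_smooth : smooth_tensor J;
  kahler_square : forall c x, cimg c x -> J c x *m J c x = - 1%:M;
  kahler_hermitian : forall c x, cimg c x ->
    J c x *m metric c x *m (J c x)^T = metric c x;
  kahler_trans : forall c d x, @local_dom M M id c d x ->
    J c x *m 'J (@local_rep M M id c d) x =
    'J (@local_rep M M id c d) x *m J d (@local_rep M M id c d x);
  kahler_parallel : forall c x, cimg c x -> forall k i j,
    partial (fun y => J c y i j) k x +
    \sum_l (J c x i l * christoffel c j k l x -
            christoffel c l k i x * J c x l j) = 0
}.

(* The traceless symmetric two-tensors, as matrices of components in an
   orthonormal basis of the tangent space. *)
Definition S20 : {vspace 'M[R]_n} :=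
  (lker (linfun (idfun \- @trmx R n n)) :&: lker (linfun (@mxtrace R n)))%VS.

Lemma S20P (A : 'M[R]_n) : A \in S20 = (A^T == A) && (\tr A == 0).
Proof.
rewrite memv_cap !memv_ker !lfunE /= subr_eq0 [A == _]eq_sym.
by [].
Qed.

Definition orthonormal_basis (phi : seq 'M[R]_n) : Prop :=
  basis_of S20 phi /\
  forall i j, (i < size phi)%N -> (j < size phi)%N ->
    \tr ((phi`_i)^T *m phi`_j) = (i == j)%:R.

Definition frame (M : riemData) (c : chart M) (x : 'rV[R]_n) (E : 'M[R]_n) :
    Prop :=
  E *m metric c x *m E^T = 1%:M.

(* R(e_i, e_j, e_k, e_l) where e_a is the a-th row of E *)
Definition riem_frame (M : riemData) (c : chart M) (x : 'rV[R]_n)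
    (E : 'M[R]_n) (i j k l : 'I_n) : R :=
  \sum_a \sum_b \sum_d \sum_e
    E i a * E j b * E k d * E l e * riem c a b d e x.

Definition curv_op2 (M : riemData) (c : chart M) (x : 'rV[R]_n)
    (E phi psi : 'M[R]_n) : R :=
  \sum_i \sum_j \sum_k \sum_l
    riem_frame c x E i j k l * phi i l * psi j k.

(* For 1 <= alpha <= \dim S20. When alpha = \dim S20, the last term is the
   default value of nth, with coefficient 0. *)
Definition alpha_sum (M : riemData) (c : chart M) (x : 'rV[R]_n) (E : 'M[R]_n)
    (alpha : R) (phi : seq 'M[R]_n) : R :=
  let a := Num.truncn alpha in
  \sum_(i < a) curv_op2 c x E phi`_i phi`_i +
  (alpha - a%:R) * curv_op2 c x E phi`_a phi`_a.

Definition alpha_nonnegative (alpha : R) (M : riemData) : Prop :=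
  forall (c : chart M) x E phi, cimg c x -> frame c x E ->
    orthonormal_basis phi -> 0 <= alpha_sum c x E alpha phi.

Definition alpha_nonpositive (alpha : R) (M : riemData) : Prop :=
  forall (c : chart M) x E phi, cimg c x -> frame c x E ->
    orthonormal_basis phi -> alpha_sum c x E alpha phi <= 0.

End Manifolds.

Section ComplexCoordinates.
Variable R : realType.

(* C^k is identified with R^(k + k) by z = x + i y |-> (x, y). *)
Definition to_complex k (v : 'rV[R]_(k + k)) : 'rV[R[i]]_k :=
  \row_j (lsubmx v 0 j +i* rsubmx v 0 j)%C.

Definition of_complex k (z : 'rV[R[i]]_k) : 'rV[R]_(k + k) :=
  row_mx (\row_j complex.Re (z 0 j)) (\row_j complex.Im (z 0 j)).

Lemma of_complexK k : cancel (@of_complex k) (@to_complex k).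
Proof.
move=> z; apply/rowP=> j; rewrite /to_complex mxE row_mxKl row_mxKr !mxE.
by case: (z 0 j).
Qed.

Definition sqnorm n (v : 'rV[R]_n) : R := (v *m v^T) 0 0.

(* multiplication by i *)
Definition mul_i k (v : 'rV[R]_(k + k)) : 'rV[R]_(k + k) :=
  row_mx (- rsubmx v) (lsubmx v).

End ComplexCoordinates.

Section ProjectiveSpace.
Variables (R : realType) (m : nat).

Definition nonzero_vec : set 'rV[R]_(m.+1 + m.+1) := [set z | z != 0].

Definition same_line (z w : nonzero_vec) : bool :=
  `[< exists2 a : R[i], a != 0 &
      to_complex (val z) = a *: to_complex (val w) >].

Lemma same_line_equiv : equiv_class_of same_line.
Proof.
split=> [z|z w|w z t].
- by apply/asboolP; exists 1; rewrite ?oner_neq0 ?scale1r.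
- apply/asboolP/asboolP => -[a a0 e]; exists a^-1; rewrite ?invr_eq0// e.
    by rewrite scalerA mulVf ?scale1r.
  by rewrite scalerA mulVf ?scale1r.
- move=> /asboolP[a a0 e] /asboolP[b b0 e']; apply/asboolP.
  by exists (a * b); rewrite ?mulf_neq0// e e' scalerA.
Qed.

Definition same_line_rel : equiv_rel nonzero_vec :=
  EquivRelPack same_line_equiv.

(* (C^(m+1) minus 0) / C^* *)
Definition cp_space : topologicalType :=
  quotient_topology {eq_quot same_line_rel}.

Definition cp_repr (p : cp_space) : 'rV[R[i]]_m.+1 :=
  to_complex (val (repr (p : {eq_quot same_line_rel}))).

(* [w_0 : ... : 1 : ... : w_(m-1)], with 1 in position k *)
Definition cp_lift (k : 'I_m.+1) (w : 'rV[R]_(m + m)) :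
    'rV[R]_(m.+1 + m.+1) :=
  of_complex (\row_i if unlift k i is Some j then to_complex w 0 j else 1).

Lemma cp_lift_neq0 k w : cp_lift k w \in nonzero_vec.
Proof.
apply/mem_set/eqP => /(congr1 (@to_complex _ _)); rewrite of_complexK.
move=> /rowP/(_ k); rewrite !mxE unlift_none => /(congr1 (@complex.Re _)) /=.
by apply/eqP; rewrite oner_neq0.
Qed.

(* The Fubini-Study metric ((1 + |w|^2) |dw|^2 - |<dw, w>|^2) / (1 + |w|^2)^2
   in affine coordinates, of constant holomorphic sectional curvature 4. *)
Definition fubini_study (w : 'rV[R]_(m + m)) : 'M[R]_(m + m) :=
  (1 + sqnorm w) ^- 2 *:
    ((1 + sqnorm w)%:M - w^T *m w - (mul_i w)^T *m mul_i w).

Definition CP : riemData R (m + m) :=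
  @RiemData R (m + m) cp_space 'I_m.+1
    (fun k => [set p | cp_repr p 0 k != 0])
    (fun k p => of_complex (\row_j (cp_repr p 0 (lift k j) / cp_repr p 0 k)))
    (fun k w => \pi_({eq_quot same_line_rel})
                  (exist _ (cp_lift k w) (cp_lift_neq0 k w)))
    (fun _ => fubini_study).

End ProjectiveSpace.

Section HyperbolicSpace.
Variables (R : realType) (m : nat).

Definition unit_ball : set 'rV[R]_(m + m) := [set w | sqnorm w < 1].

Lemma ball_origin_subproof : 0 \in unit_ball.
Proof. by apply/mem_set; rewrite /unit_ball /sqnorm /= mul0mx mxE ltr01. Qed.

Definition ball_origin : unit_ball := exist _ 0 ball_origin_subproof.

(* The metric ((1 - |w|^2) |dw|^2 + |<dw, w>|^2) / (1 - |w|^2)^2 on the unit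
   ball of C^m, of constant holomorphic sectional curvature -4. *)
Definition bergman (w : 'rV[R]_(m + m)) : 'M[R]_(m + m) :=
  (1 - sqnorm w) ^- 2 *:
    ((1 - sqnorm w)%:M + w^T *m w + (mul_i w)^T *m mul_i w).

Definition CH : riemData R (m + m) :=
  @RiemData R (m + m) unit_ball unit
    (fun _ => setT)
    (fun _ => val)
    (fun _ => insubd ball_origin)
    (fun _ => bergman).

End HyperbolicSpace.

(* Main.v *)
(* The sum over suitable orthonormal bases forces the curvature operator of the second kind
to be that of a multiple of the model, so the holomorphic sectional curvature is constant.
Parallel frames of the flat bundle R^2 + TM develop M into the model, and completeness
extends the inverse development to a covering of M by it. *)
From HB Require Import structures.
From mathcomp Require Import all_boot all_order all_algebra.
From mathcomp Require Import complex generic_quotient.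
From mathcomp Require Import all_classical all_reals all_analysis.
From mathcomp Require Import ring lra.
Require Import Defs.

Set Implicit Arguments.
Unset Strict Implicit.
Unset Printing Implicit Defensive.

Import Order.TTheory GRing.Theory Num.Theory.
Import numFieldNormedType.Exports.

Local Open Scope classical_set_scope.
Local Open Scope ring_scope.

(** The constant is (m^2 - 1) + (m^2 - 1)/2. Traceless symmetric tensors split into those commuting
    with J, of dimension m^2 - 1 and trace -(m - 1)/(2m) T, and those anticommuting with J, of
    dimension m(m + 1) and trace T, where T is the scalar curvature. A basis of the first kind
    followed by (m^2 - 1)/2 average elements of the second sums exactly to 0. Partial sums of one
    sign and of zero average all vanish, so the operator is scalar on the second kind, and these
    tensors see the holomorphic sectional curvature. The bundle is flat only after a twist by a
    local potential of the Kähler form. Developments are thus determined up to a varying phase and a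
    constant unitary matrix, and only complex lines are compared. The sign [eps] treats both models
    at once. The covering comes from continuation along developed geodesics, not from a universal
    cover of [M]. In the projective case an affine chart misses a hyperplane, which requires gluing;
    the covering is then injective because a complex matrix has an eigenvector, so that every deck
    transformation has a fixed point. *)

Lemma near_forall (T : topologicalType) (I : finType) (x : T)
 (P : I -> T -> Prop) :
 (forall i, \forall y \near x, P i y) -> \forall y \near x, forall i, P i y.
exact: (@filter_forall _ _ P (nbhs x) (nbhs_filter x)). Qed.

(** * Sup norms, the mean value theorem and functions of class C^k *)

Section MatrixNorm.
Variables (R : realType) (p q : nat).

Lemma normmx_ge (A : 'M[R]_(p, q)) i j : `|A i j| <= `|A|.
rewrite [leRHS]/Num.Def.normr/= mx_normrE.
exact: (le_bigmax _ (fun ij : 'I_p * 'I_q => `|A ij.1 ij.2|) (i, j)).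
Qed.

Lemma normmx_le (A : 'M[R]_(p, q)) e :
 0 <= e -> (forall i j, `|A i j| <= e) -> `|A| <= e.
move=> e0 Ae; rewrite [leLHS]/Num.Def.normr/= mx_normrE.
by apply: bigmax_le => // -[i j] _; exact: Ae.
Qed.

Lemma normmx_lt (A : 'M[R]_(p, q)) e :
 0 < e -> (forall i j, `|A i j| < e) -> `|A| < e.
move=> e0 Ae; rewrite [ltLHS]/Num.Def.normr/= mx_normrE.
by apply: bigmax_lt => // -[i j] _; exact: Ae.
Qed.
End MatrixNorm.

(** The norm is the largest absolute value of an entry, so it is not submultiplicative: an entry of
    the product is a sum of [q] terms. *)
Lemma normmxM (R : realType) p q r (A : 'M[R]_(p, q)) (B : 'M[R]_(q, r)) :
 `|A *m B| <= q%:R * (`|A| * `|B|).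
apply: normmx_le => [|i j]; first by rewrite !mulr_ge0.
rewrite mxE (le_trans (ler_norm_sum _ _ _))//.
rewrite (le_trans (ler_sum _ (G := fun=> `|A| * `|B|) _))//.
by move=> k _; rewrite normrM ler_pM// normmx_ge.
by rewrite sumr_const card_ord mulr_natl.
Qed.

Section Lines.
Variables (R : realType) (V W : normedModType R).
Implicit Types (f : V -> W) (p v : V).

(** Restriction to a line leaves the difference quotients themselves unchanged, so derivability and
    the value of the derivative transfer together. *)
Lemma growth_line f p v (t : R) :
 (fun h : R => h^-1 *: (((fun t : R => f (p + t *: v)) \o shift t) (h *: 1) -
 f (p + t *: v))) =
 (fun h : R => h^-1 *: ((f \o shift (p + t *: v)) (h *: v) - f (p + t *: v))).
apply/funext => h /=; congr (_ *: (f _ - _)).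
by rewrite [h *: 1]mulr1 scalerDl addrCA addrA.
Qed.

Lemma derivable_line f p v (t : R) :
 derivable (fun t : R => f (p + t *: v)) t 1 <-> derivable f (p + t *: v) v.
by rewrite /derivable growth_line. Qed.
Lemma derive_line f p v (t : R) :
 'D_1 (fun t : R => f (p + t *: v)) t = 'D_v f (p + t *: v).
by rewrite /derive growth_line. Qed.
End Lines.

Lemma derivable1_cont (R : realType) (f : R -> R) (t : R) :
 derivable f t 1 -> {for t, continuous f}.
by move=> /derivable1_diffP; exact: differentiable_continuous. Qed.
Lemma mvt_line (R : realType) (V : normedModType R) (f : V -> R) (p v : V) (h : R) :
 (forall t : R, `|t| <= `|h| -> derivable f (p + t *: v) v) ->
 exists2 t : R, `|t| <= `|h| & f (p + h *: v) - f p = h * 'D_v f (p + t *: v).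
move=> df; pose g (t : R) := f (p + t *: v).
have dg (t : R) : `|t| <= `|h| -> is_derive t 1 g ('D_v f (p + t *: v)).
move=> th; rewrite -derive_line; apply: DeriveDef => //.
exact/derivable_line/df.
have cg (t : R) : `|t| <= `|h| -> {for t, continuous g}.
by move=> /dg[dg' _]; exact: derivable1_cont.
have g0 : g 0 = f p by rewrite /g scale0r addr0.
case: (leP 0 h) => h0.
- have sub (t : R) : 0 <= t <= h -> `|t| <= `|h|.
by case/andP => t0 th; rewrite !ger0_norm.
have [||t tin e] := @MVT_segment R g (fun t => 'D_v f (p + t *: v)) 0 h h0.
 + by move=> t; rewrite in_itv/= => /andP[t0 th]; apply: dg; rewrite sub// !ltW.
 + apply: continuous_in_subspaceT => t; rewrite inE/= in_itv/= => th.
by apply: cg; rewrite sub.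
exists t; first by rewrite sub// -in_itv.
by rewrite -g0 -[f (p + _)]/(g h) e subr0 mulrC.
- have sub (t : R) : h <= t <= 0 -> `|t| <= `|h|.
by case/andP => t0 th; rewrite !ler0_norm ?lerN2// ltW.
have [||t tin e] := @MVT_segment R g (fun t => 'D_v f (p + t *: v)) h 0 (ltW h0).
 + by move=> t; rewrite in_itv/= => /andP[t0 th]; apply: dg; rewrite sub// !ltW.
 + apply: continuous_in_subspaceT => t; rewrite inE/= in_itv/= => th.
by apply: cg; rewrite sub.
exists t; first by rewrite sub// -in_itv.
move: e; rewrite g0 sub0r -[f (p + _)]/(g h) => e.
by rewrite -opprB e mulrN opprK mulrC.
Qed.

Section Ck_basics.
Variables (R : realType) (n : nat).
Implicit Types (f g : 'rV[R]_n -> R) (U : set 'rV[R]_n) (k : nat).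
Notation dl i := (delta_mx 0 i : 'rV[R]_n).

Lemma Ck_cont k U f : Ck k U f -> forall x, U x -> {for x, continuous f}.
by case: k => [|k] []. Qed.
Lemma Ck_derivable k U f i : Ck k.+1 U f ->
 forall x, U x -> derivable f x (dl i).
by move=> [_ /(_ i)[]]. Qed.
Lemma Ck_partial k U f i : Ck k.+1 U f -> Ck k U (partial f i).
by move=> [_ /(_ i)[]]. Qed.
Lemma Ck_S k U f : Ck k.+1 U f -> Ck k U f.
elim: k f => [|k IH] f; first by case=> c _; split.
move=> fk; split=> [|i]; first exact: Ck_cont fk.
by split; [exact: Ck_derivable fk|apply: IH; exact: Ck_partial].
Qed.

Lemma Ck_le k l U f : (k <= l)%N -> Ck l U f -> Ck k U f.
by move=> /subnK <-; elim: (l - k)%N => //= m IH /Ck_S. Qed.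
Lemma Ck_sub k U V f : U `<=` V -> Ck k V f -> Ck k U f.
move=> UV; elim: k f => [|k IH] f fk; split=> //.
- by move=> x /UV; exact: Ck_cont fk x.
- by move=> x /UV; exact: Ck_cont fk x.
- move=> i; split; first by move=> x /UV; exact: Ck_derivable fk x.
by apply: IH; exact: Ck_partial.
Qed.

Lemma open_near U (P : 'rV[R]_n -> Prop) x : open U -> U x ->
 (forall y, U y -> P y) -> \forall y \near x, P y.
by move=> oU Ux UP; apply: filterS (open_nbhs_nbhs (conj oU Ux)). Qed.
Lemma partial_near f g i x : (\near x, f x = g x) -> partial f i x = partial g i x.
exact: near_eq_derive. Qed.
Lemma near_continuous f g x : (\near x, f x = g x) ->
 {for x, continuous f} -> {for x, continuous g}.
move=> fg cf; rewrite /prop_for /continuous_at -(nbhs_singleton fg).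
exact: cvg_trans (near_eq_cvg fg) cf.
Qed.

Lemma Ck_ext k U f g : open U -> (forall x, U x -> f x = g x) ->
 Ck k U f -> Ck k U g.
move=> oU; elim: k f g => [|k IH] f g fg fk;
have nfg x : U x -> \near x, f x = g x by (move=> Ux; exact: open_near fg).
by split=> // x Ux; apply: near_continuous (nfg x Ux) (Ck_cont fk Ux).
split=> [x Ux|i]; first exact: near_continuous (nfg x Ux) (Ck_cont fk Ux).
split=> [x Ux|]; first by apply: (@near_eq_derivable _ _ _ f); [exact: nfg|exact: Ck_derivable fk x Ux].
by apply: IH (Ck_partial i fk) => x Ux; exact/partial_near/nfg.
Qed.

Lemma Ck_cst k U (a : R) : Ck k U (cst a).
elim: k a => [|k IH] a; split=> //; [by move=> x _; exact: cst_continuous..|].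
move=> i; split=> [x _|]; first exact: derivable_cst.
rewrite (_ : partial _ _ = cst 0)//; apply/funext => x; exact: derive_cst.
Qed.

Lemma derivable_coord j x v : derivable (fun x : 'rV[R]_n => x 0 j) x v.
exact/diff_derivable/differentiable_coord. Qed.
Lemma derive_coord j x v : 'D_v (fun x : 'rV[R]_n => x 0 j) x = v 0 j.
have := @derive_mx R _ _ _ (id : 'rV[R]_n -> 'rV[R]_n) x v (@derivable_id _ _ x v).
by rewrite derive_id => /matrixP/(_ 0 j); rewrite mxE.
Qed.

Lemma Ck_coord k U j : Ck k U (fun x : 'rV[R]_n => x 0 j).
case: k => [|k]; split=> //; [by move=> x _; exact: coord_continuous..|].
move=> i; split=> [x _|]; first exact: derivable_coord.
rewrite (_ : partial _ _ = cst ((dl i) 0 j)); first exact: Ck_cst.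
by apply/funext => x; exact: derive_coord.
Qed.

Lemma CkD k U f g : open U -> Ck k U f -> Ck k U g -> Ck k U (f \+ g).
move=> oU; elim: k f g => [|k IH] f g fk gk.
by split=> // x Ux; apply: continuousD; [exact: Ck_cont fk x Ux|exact: Ck_cont gk x Ux].
split=> [x Ux|i].
by apply: continuousD; [exact: Ck_cont fk x Ux|exact: Ck_cont gk x Ux].
split=> [x Ux|].
by apply: derivableD; [exact: Ck_derivable fk x Ux|exact: Ck_derivable gk x Ux].
apply: (Ck_ext oU _ (IH _ _ (Ck_partial i fk) (Ck_partial i gk))) => x Ux /=.
by rewrite [RHS]deriveD//; [exact: Ck_derivable fk x Ux|exact: Ck_derivable gk x Ux].
Qed.

Lemma CkM k U f g : open U -> Ck k U f -> Ck k U g -> Ck k U (f \* g).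
move=> oU; elim: k f g => [|k IH] f g fk gk.
by split=> // x Ux; apply: continuousM; [exact: Ck_cont fk x Ux|exact: Ck_cont gk x Ux].
split=> [x Ux|i].
by apply: continuousM; [exact: Ck_cont fk x Ux|exact: Ck_cont gk x Ux].
split=> [x Ux|].
by apply: derivableM; [exact: Ck_derivable fk x Ux|exact: Ck_derivable gk x Ux].
apply: (Ck_ext oU _ (CkD oU (IH _ _ (Ck_S fk) (Ck_partial i gk))
 (IH _ _ (Ck_S gk) (Ck_partial i fk)))) => x Ux /=.
by rewrite [RHS]deriveM//; [exact: Ck_derivable fk x Ux|exact: Ck_derivable gk x Ux].
Qed.

Lemma Ck_sum k U (I : Type) (r : seq I) (P : pred I) (F : I -> 'rV[R]_n -> R) :
 open U -> (forall i, P i -> Ck k U (F i)) ->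
 Ck k U (fun x => \sum_(i <- r | P i) F i x).
move=> oU Fk; elim: r => [|a r IH].
by apply: Ck_ext (Ck_cst k U 0) => // x _; rewrite big_nil.
case: (boolP (P a)) => Pa.
by apply: (Ck_ext oU _ (CkD oU (Fk a Pa) IH)) => x _; rewrite big_cons Pa.
by apply: Ck_ext IH => // x _; rewrite big_cons (negbTE Pa).
Qed.

Lemma Ck_prod k U (I : Type) (r : seq I) (P : pred I) (F : I -> 'rV[R]_n -> R) :
 open U -> (forall i, P i -> Ck k U (F i)) ->
 Ck k U (fun x => \prod_(i <- r | P i) F i x).
move=> oU Fk; elim: r => [|a r IH].
by apply: Ck_ext (Ck_cst k U 1) => // x _; rewrite big_nil.
case: (boolP (P a)) => Pa.
by apply: (Ck_ext oU _ (CkM oU (Fk a Pa) IH)) => x _; rewrite big_cons Pa.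
by apply: Ck_ext IH => // x _; rewrite big_cons (negbTE Pa).
Qed.

Lemma CkV k U f : open U -> (forall x, U x -> f x != 0) -> Ck k U f ->
 Ck k U (fun x => (f x)^-1).
move=> oU f0; elim: k => [|k IH] fk.
by split=> // x Ux; apply: continuousV; [exact: f0|exact: Ck_cont fk x Ux].
split=> [x Ux|i]; first by apply: continuousV; [exact: f0|exact: Ck_cont fk x Ux].
split=> [x Ux|]; first by apply: derivableV; [exact: f0|exact: Ck_derivable fk x Ux].
have fV := IH (Ck_S fk).
apply: (Ck_ext oU _ (CkM oU (CkM oU (Ck_cst k U (-1)) (CkM oU fV fV)) (Ck_partial i fk))).
move=> x Ux /=; rewrite [RHS]deriveV; last exact: Ck_derivable fk x Ux; last exact: f0.
by rewrite /GRing.scale/= expr2 invfM mulN1r.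
Qed.

Lemma smooth_partial U f i : smooth U f -> smooth U (partial f i).
by move=> fs k; exact: Ck_partial (fs k.+1). Qed.
(** Go from [x] to [x + h] one coordinate at a time. Each increment is a partial derivative at an
    intermediate point by the mean value theorem, and these are uniformly close to the ones at [x].
    The tolerance is [e] over [n.+1] so that the division makes sense for n = 0. *)
Lemma C1_approx U f x : open U -> Ck 1 U f -> U x ->
 forall e, 0 < e -> exists2 d, 0 < d & forall h, `|h| < d ->
 `|f (x + h) - f x - \sum_i h 0 i * partial f i x| <= e * `|h|.
move=> oU f1 Ux e e0.
have e'0 : 0 < e / n.+1%:R by rewrite divr_gt0.
have : \forall y \near x, U y /\
 forall i, `|partial f i x - partial f i y| < e / n.+1%:R.
suff H : \forall y \near x, forall i,
 `|partial f i x - partial f i y| < e / n.+1%:R.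
by apply: filterI => //; exact: open_nbhs_nbhs.
apply: near_forall => i.
by have /cvgrPdist_lt := Ck_cont (Ck_partial i f1) Ux; apply.
move=> /nbhs_normP[d /= d0 xd]; exists d => // h hd.
(* The displacement that keeps the first [k] coordinates of [h], from 0 at k = 0 to [h] at k = n. *)
pose hk k : 'rV[R]_n := \row_j (if (j < k)%N then h 0 j else 0).
have hkS (i : 'I_n) : hk i.+1 = hk i + h 0 i *: dl i.
apply/rowP => j; rewrite !mxE eqxx/= ltnS leq_eqVlt.
have [->|ji] := eqVneq j i; first by rewrite eqxx ltnn mulr1 add0r.
have -> : (j == i :> nat) = false by apply: negbTE.
by rewrite mulr0 addr0.
have hk0 : hk 0%N = 0 by apply/rowP => j; rewrite !mxE.
have hkn : hk n = h by apply/rowP => j; rewrite !mxE ltn_ord.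
have small (i : 'I_n) (t : R) : `|t| <= `|h 0 i| ->
 `|hk i + t *: dl i| <= `|h|.
move=> th; apply: normmx_le => // a j; rewrite ord1 !mxE eqxx/=.
have [->|ji] := eqVneq j i.
by rewrite ltnn mulr1 add0r (le_trans th)// normmx_ge.
rewrite mulr0 addr0; case: ifP => _; first exact: normmx_ge.
by rewrite normr0.
have inball (i : 'I_n) (t : R) : `|t| <= `|h 0 i| ->
 ball_ Num.Def.normr x d (x + hk i + t *: dl i).
move=> /small th; rewrite /ball_/= -addrA opprD addNKr normrN.
exact: le_lt_trans th hd.
have -> : f (x + h) - f x = \sum_(i < n) (f (x + hk i.+1) - f (x + hk i)).
by rewrite -(big_mkord xpredT (fun i => f (x + hk i.+1) - f (x + hk i)))
 telescope_sumr// hkn hk0 addr0.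
rewrite -sumrB (le_trans (ler_norm_sum _ _ _))//.
rewrite (le_trans (ler_sum _ (G := fun=> `|h| * (e / n.+1%:R)) _))//.
move=> i _; rewrite hkS addrA.
have [t th ->] := @mvt_line R _ f (x + hk i) (dl i) (h 0 i) (fun t th =>
 Ck_derivable f1 (proj1 (xd _ (inball i t th)))).
rewrite -mulrBr normrM ler_pM ?normmx_ge//.
by rewrite distrC ltW//; case: (xd _ (inball i t th)).
rewrite sumr_const card_ord -(mulr_natl (_ * _)) mulrCA mulrC ler_wpM2r//.
have e0' := ltW e0; rewrite mulrCA ler_piMr// ler_pdivrMr ?ltr0Sn// mul1r ler_nat.
exact: leqnSn.
Qed.

(** The class [Ck] only speaks of the coordinate directions. The first-order expansion turns
    continuous partial derivatives into a differential, hence into derivatives along every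
    vector. *)
Lemma C1_derive U f x : open U -> Ck 1 U f -> U x ->
 differentiable f x /\
 forall v, 'D_v f x = \sum_i v 0 i * partial f i x.
move=> oU f1 Ux.
pose g : 'cV[R]_n := \col_i partial f i x.
pose df (v : 'rV[R]_n) : R := (v *m g) 0 0.
have dfE v : df v = \sum_i v 0 i * partial f i x.
by rewrite /df mxE; apply: eq_bigr => i _; rewrite mxE.
have lf : linear df by move=> a u v; rewrite /df mulmxDl -scalemxAl !mxE.
pose lin := GRing.isLinear.Build _ _ _ _ df lf.
pose dfL : {linear 'rV[R]_n -> R} := HB.pack df lin.
have cdf : continuous dfL.
move=> v; rewrite (_ : (dfL : _ -> _) = fun v => \sum_i v 0 i * partial f i x).
by apply: (Ck_cont (U := setT) (k := 0)) => //; apply: Ck_sum => [|i _];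
 [exact: openT|apply: CkM; [exact: openT|exact: Ck_coord|exact: Ck_cst]].
by apply/funext => u; rewrite -dfE.
have ex : f \o shift x = cst (f x) + (dfL : _ -> R) +o_ (0 : 'rV[R]_n) id.
apply/eqaddoP => e e0; have [d d0 H] := C1_approx oU f1 Ux e0.
have hd : \forall h \near (0 : 'rV[R]_n), `|h| < d by exact: nbhs0_lt.
near=> h; rewrite -[X in `|X|]/(f (h + x) - (f x + df h)) opprD addrA dfE addrC.
rewrite addrC [h + x]addrC; apply: H.
by near: h; exact: hd.
have dE := diff_unique cdf ex.
have dff : differentiable f x by apply/diff_locallyP; rewrite dE.
by split=> // v; rewrite deriveE// dE -dfE.
Unshelve. all: by end_near. Qed.
(** The mean value theorem is used twice: in direction [i] for the increment of [f] by [h] along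
    [j], then in direction [j] for the partial derivative obtained. Two displacements of size [h]
    add up, whence the radius d/2. *)
Lemma second_difference U f x i j : open U -> Ck 2 U f -> U x ->
 forall e, 0 < e -> exists2 d, 0 < d & forall h, 0 < h < d ->
 `|(f (x + h *: dl i + h *: dl j) - f (x + h *: dl i) - f (x + h *: dl j) + f x)
 - h * h * partial (partial f i) j x| <= h * h * e.
move=> oU f2 Ux e e0.
have : \forall y \near x, U y /\
 `|partial (partial f i) j x - partial (partial f i) j y| < e.
apply: filterI; first exact: open_nbhs_nbhs.
by have /cvgrPdist_lt := Ck_cont (Ck_partial j (Ck_partial i f2)) Ux; apply.
move=> /nbhs_normP[d /= d0 xd]; exists (d / 2); first by rewrite divr_gt0.
move=> h /andP[h0 hd].
have near (s t : R) : `|s| <= `|h| -> `|t| <= `|h| ->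
 ball_ Num.Def.normr x d (x + s *: dl i + t *: dl j).
move=> sh th; rewrite /ball_/= -addrA opprD addNKr normrN.
rewrite (le_lt_trans (ler_normD _ _))// !normrZ.
have dl1 a : `|dl a| <= 1.
apply: normmx_le => // b c; rewrite mxE ord1/=.
by case: eqP => _; rewrite ?normr1 ?normr0.
have hE : `|h| = h by rewrite gtr0_norm.
apply: (@le_lt_trans _ _ (h + h)); last by move: hd; lra.
by rewrite lerD// -[leRHS]mulr1 -hE ler_pM.
have dU (s t : R) : `|s| <= `|h| -> `|t| <= `|h| -> U (x + s *: dl i + t *: dl j).
by move=> sh th; have [] := xd _ (near s t sh th).
have h00 : `|0 : R| <= `|h| by rewrite normr0.
pose g y := f (y + h *: dl j) - f y.
have dg (s : R) : `|s| <= `|h| -> derivable g (x + s *: dl i) (dl i) /\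
 'D_(dl i) g (x + s *: dl i) =
 partial f i (x + s *: dl i + h *: dl j) - partial f i (x + s *: dl i).
move=> sh.
have U1 := dU s h sh (lexx _); have U2 := dU s 0 sh h00.
rewrite scale0r addr0 in U2.
have d1 : derivable f (x + s *: dl i + h *: dl j) (dl i).
exact: Ck_derivable f2 _ U1.
have d2 : derivable f (x + s *: dl i) (dl i) by exact: Ck_derivable f2 _ U2.
have E : (fun a : R => a^-1 *: (((f \o shift (h *: dl j)) \o
 shift (x + s *: dl i)) (a *: dl i) -
 (f \o shift (h *: dl j)) (x + s *: dl i))) =
 (fun a : R => a^-1 *: ((f \o shift (x + s *: dl i + h *: dl j)) (a *: dl i)
 - f (x + s *: dl i + h *: dl j))).
by apply/funext => a /=; rewrite !addrA.
have d1' : derivable (f \o shift (h *: dl j)) (x + s *: dl i) (dl i).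
by rewrite /derivable E; exact: d1.
have e1 : 'D_(dl i) (f \o shift (h *: dl j)) (x + s *: dl i) =
 partial f i (x + s *: dl i + h *: dl j) by rewrite /partial /derive E.
split; first exact: derivableB d1' d2.
by rewrite -e1 -[LHS]/('D_(dl i) ((f \o shift (h *: dl j)) \- f) _) deriveB.
have [s sh es] := mvt_line (h := h) (fun s sh => (dg s sh).1).
have [t th et] := @mvt_line R _ (partial f i) (x + s *: dl i) (dl j) h
 (fun t th => Ck_derivable (Ck_partial i f2) (dU s t sh th)).
have -> : f (x + h *: dl i + h *: dl j) - f (x + h *: dl i) -
 f (x + h *: dl j) + f x = h * (h * partial (partial f i) j
 (x + s *: dl i + t *: dl j)).
by rewrite [partial (partial f i) j]/partial -et -(dg s sh).2 -es /g; ring.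
rewrite mulrA -mulrBr normrM gtr0_norm ?mulr_gt0// ler_wpM2l ?mulr_ge0 ?ltW//.
by rewrite distrC; case: (xd _ (near s t sh th)).
Qed.

(** The second difference over a small square is symmetric in [i] and [j], and it approximates both
    mixed derivatives times the area h^2. *)
Lemma Schwarz U f x i j : open U -> Ck 2 U f -> U x ->
 partial (partial f i) j x = partial (partial f j) i x.
move=> oU f2 Ux; apply/eqP; rewrite -subr_eq0 -normr_le0; apply/ler_addgt0Pl => e e0.
have e2 : 0 < e / 2 by rewrite divr_gt0.
have [d d0 H] := second_difference i j oU f2 Ux e2.
have [d' d'0 H'] := second_difference j i oU f2 Ux e2.
have m0 : 0 < Num.min d d' by rewrite lt_min d0 d'0.
pose h := Num.min d d' / 2.
have h0 : 0 < h by rewrite divr_gt0.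
have hd : 0 < h < d.
rewrite h0 /h ltr_pdivrMr//; have : Num.min d d' <= d by rewrite ge_min lexx.
by lra.
have hd' : 0 < h < d'.
rewrite h0 /h ltr_pdivrMr//; have : Num.min d d' <= d' by rewrite ge_min lexx orbT.
by lra.
have {}H := H h hd; have {}H' := H' h hd'.
rewrite [x + _ + _]addrAC in H'.
rewrite addr0 -(@ler_pM2l _ (h * h)) ?mulr_gt0//.
set A := partial (partial f i) j x in H *; set B := partial (partial f j) i x in H' *.
have hh : h * h = `|h * h| by rewrite gtr0_norm// mulr_gt0.
rewrite {1}hh -normrM.
set D := f (x + h *: dl i + h *: dl j) in H H'.
set D1 := f (x + h *: dl i) in H H'; set D2 := f (x + h *: dl j) in H H'.
have -> : h * h * (A - B) = (D - D2 - D1 + f x - h * h * B) -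
 (D - D1 - D2 + f x - h * h * A) by ring.
apply: le_trans (ler_normB _ _) _; apply: le_trans (lerD H' H) _.
by rewrite -mulrDr -splitr.
Qed.
End Ck_basics.

(** * Chain rule and calculus of matrix-valued functions *)

Section Chain.
Variables (R : realType) (V : normedModType R) (p : nat).

Lemma continuous_mx (T : topologicalType) q r (g : T -> 'M[R]_(q, r)) x :
 (forall i j, {for x, continuous (fun y => g y i j)}) -> {for x, continuous g}.
move=> cg; apply/cvgrPdist_lt => e e0.
have : \forall y \near x, forall ij : 'I_q * 'I_r,
 `|g x ij.1 ij.2 - g y ij.1 ij.2| < e.
by apply: near_forall => -[i j]; move/cvgrPdist_lt : (cg i j); apply.
apply: filterS => y gy; apply: normmx_lt => // i j.
by rewrite !mxE; exact: (gy (i, j)).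
Qed.

Lemma differentiable_rV (g : V -> 'rV[R]_p) x :
 (forall j, differentiable (fun y => g y 0 j) x) -> differentiable g x.
move=> dg.
rewrite (_ : g = \sum_(j < p) (fun y => g y 0 j *: (delta_mx 0 j : 'rV[R]_p))).
apply: differentiable_sum => j; exact: differentiableZl.
by apply/funext => y; rewrite fct_sumE -row_sum_delta.
Qed.

Lemma chain_rule (g : V -> 'rV[R]_p) (f : 'rV[R]_p -> R) W x v :
 (forall j, differentiable (fun y => g y 0 j) x) ->
 open W -> Ck 1 W f -> W (g x) ->
 differentiable (f \o g) x /\
 'D_v (f \o g) x = \sum_j 'D_v (fun y => g y 0 j) x * partial f j (g x).
move=> dg oW f1 Wx; have [df fE] := C1_derive oW f1 Wx.
have dgx := differentiable_rV dg.
split; first exact: differentiable_comp.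
rewrite deriveE; last exact: differentiable_comp.
rewrite diff_comp//= -deriveE// -(deriveE v dgx) fE; apply: eq_bigr => j _.
by rewrite derive_mx ?mxE//; exact: diff_derivable.
Qed.
End Chain.

Lemma chain_rule1 (R : realType) p (g : R -> 'rV[R]_p) (f : 'rV[R]_p -> R) W t :
 (forall j, derivable (fun y => g y 0 j) t 1) ->
 open W -> Ck 1 W f -> W (g t) ->
 derivable (f \o g) t 1 /\
 'D_1 (f \o g) t = \sum_j 'D_1 (fun y => g y 0 j) t * partial f j (g t).
move=> dg oW f1 Wt.
have [|d e] := @chain_rule R R p g f W t 1 _ oW f1 Wt.
by move=> j; apply/derivable1_diffP/dg.
by split=> //; apply/derivable1_diffP.
Qed.

Section Ck_composition.
Variables (R : realType) (n p : nat).

Lemma Ck_comp k (U : set 'rV[R]_n) (W : set 'rV[R]_p) (g : 'rV[R]_n -> 'rV[R]_p) f :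
 open U -> open W -> (forall x, U x -> W (g x)) ->
 (forall j, Ck k U (fun x => g x 0 j)) -> Ck k W f -> Ck k U (f \o g).
move=> oU oW gUW; elim: k f => [|k IH] f gk fk;
have cfg x : U x -> {for x, continuous (f \o g)}.
- move=> Ux; apply: continuous_comp; last exact: Ck_cont fk _ (gUW x Ux).
by apply: continuous_mx => i j; rewrite ord1; exact: Ck_cont (gk j) x Ux.
- by split.
- move=> Ux; apply: continuous_comp; last exact: Ck_cont fk _ (gUW x Ux).
by apply: continuous_mx => i j; rewrite ord1; exact: Ck_cont (gk j) x Ux.
have ch i x (Ux : U x) := @chain_rule R _ p g f W x (delta_mx 0 i)
 (fun j => (C1_derive oU (Ck_le (ltn0Sn k) (gk j)) Ux).1) oW
 (Ck_le (ltn0Sn k) fk) (gUW x Ux).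
split=> [//|i]; split=> [x Ux|]; first exact/diff_derivable/(ch i x Ux).1.
apply: (@Ck_ext _ _ _ _ (fun x => \sum_j partial (fun y => g y 0 j) i x *
 (partial f j \o g) x)) => //.
by move=> x Ux; rewrite [RHS](ch i x Ux).2.
apply: Ck_sum => // j _; apply: CkM => //; first exact: Ck_partial.
by apply: IH => [j'|]; [exact: Ck_S|exact: Ck_partial].
Qed.

Lemma row_mulE (g : 'rV[R]_n -> 'rV[R]_p) x v (U : set 'rV[R]_n) :
 open U -> U x -> (forall j, Ck 1 U (fun x => g x 0 j)) ->
 [/\ differentiable g x, 'J g x = \matrix_(i, j) partial (fun y => g y 0 j) i x
 & 'D_v g x = v *m 'J g x].
move=> oU Ux g1.
have dg : differentiable g x.
by apply: differentiable_rV => j; exact: (C1_derive oU (g1 j) Ux).1.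
have JE u : 'D_u g x = u *m 'J g x by exact: deriveEjacobian.
split=> //; apply/matrixP => i j; rewrite [RHS]mxE.
have /rowP/(_ j) := JE (delta_mx 0 i); rewrite -rowE [RHS]mxE => <-.
by rewrite derive_mx ?mxE//; exact: diff_derivable.
Qed.
End Ck_composition.

(* The estimate is along a segment, for the sup norm. *)
Lemma lipschitz_segment (R : realType) n (U : set 'rV[R]_n) (f : 'rV[R]_n -> R) x y K :
 open U -> Ck 1 U f -> (forall t, 0 <= t <= 1 -> U (x + t *: (y - x))) ->
 (forall t i, 0 <= t <= 1 -> `|partial f i (x + t *: (y - x))| <= K) ->
 `|f y - f x| <= n%:R * K * `|y - x|.
move=> oU f1 Uxy bK.
pose g (t : R) := f (x + t *: (y - x)).
have dg (t : R) : 0 <= t <= 1 -> is_derive t 1 g ('D_(y - x) f (x + t *: (y - x))).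
move=> t01; rewrite -derive_line; apply: DeriveDef => //; apply/derivable_line.
exact/diff_derivable/(C1_derive oU f1 (Uxy t t01)).1.
have [||t t01 e] := @MVT_segment R g (fun t => 'D_(y - x) f (x + t *: (y - x))) 0 1 ler01.
- by move=> t; rewrite in_itv/= => /andP[t0 t1]; apply: dg; rewrite !ltW.
- apply: continuous_in_subspaceT => t; rewrite inE/= in_itv/= => t01.
by have [d _] := dg t t01; exact: derivable1_cont.
rewrite in_itv/= in t01.
have -> : f y - f x = g 1 - g 0 by rewrite /g scale1r scale0r addr0 [x + _]addrC subrK.
rewrite e subr0 mulr1 (C1_derive oU f1 (Uxy t t01)).2.
rewrite (le_trans (ler_norm_sum _ _ _))//.
rewrite (le_trans (ler_sum _ (G := fun=> `|y - x| * K) _))//.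
by move=> i _; rewrite normrM ler_pM// ?normmx_ge// bK.
by rewrite sumr_const card_ord -(mulr_natl (_ * _)) mulrA mulrAC.
Qed.

Section DeriveMatrix.
Variables (R : realType) (V : normedModType R).

Lemma derivable_mr (f g : V -> R) x v : derivable f x v -> derivable g x v ->
 derivable (fun y => f y * g y) x v /\
 'D_v (fun y => f y * g y) x = 'D_v f x * g x + f x * 'D_v g x.
move=> df dg; split; first exact: (derivableM df dg).
by have := deriveM df dg; rewrite addrC /GRing.scale/= [g x * _]mulrC.
Qed.

Lemma derivable_mulmx p q r (F : V -> 'M[R]_(p, q)) (G : V -> 'M[R]_(q, r)) x v :
 derivable F x v -> derivable G x v ->
 derivable (fun y => F y *m G y) x v /\
 'D_v (fun y => F y *m G y) x = 'D_v F x *m G x + F x *m 'D_v G x.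
move=> dF dG; have dFe i j := (derivable_mxP _ _ _).1 dF i j.
have dGe i j := (derivable_mxP _ _ _).1 dG i j.
have E i j : (fun y => (F y *m G y) i j) =
 \sum_k (fun y => F y i k * G y k j).
by apply/funext => y; rewrite mxE fct_sumE.
have dij i j : derivable (fun y => (F y *m G y) i j) x v.
by rewrite E; apply: derivable_sum => k; exact: (derivable_mr _ _).1.
have d : derivable (fun y => F y *m G y) x v by exact/derivable_mxP.
split=> //; apply/matrixP => i j; rewrite derive_mx// mxE E derive_sum; last first.
by move=> k; exact: (derivable_mr _ _).1.
rewrite !mxE -big_split/=; apply: eq_bigr => k _.
by rewrite (derivable_mr _ _).2// !derive_mx// !mxE.
Qed.

Lemma derivable_trmx p q (F : V -> 'M[R]_(p, q)) x v : derivable F x v ->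
 derivable (fun y => (F y)^T) x v /\ 'D_v (fun y => (F y)^T) x = ('D_v F x)^T.
move=> dF; have dFe i j := (derivable_mxP _ _ _).1 dF i j.
have E i j : (fun y => (F y)^T i j) = (fun y => F y j i).
by apply/funext => y; rewrite mxE.
have d : derivable (fun y => (F y)^T) x v.
by apply/derivable_mxP => i j; rewrite E.
by split=> //; apply/matrixP => i j; rewrite derive_mx// mxE E derive_mx// !mxE.
Qed.

Lemma derivable_scalemx p q (f : V -> R) (F : V -> 'M[R]_(p, q)) x v :
 derivable f x v -> derivable F x v ->
 derivable (fun y => f y *: F y) x v /\
 'D_v (fun y => f y *: F y) x = 'D_v f x *: F x + f x *: 'D_v F x.
move=> df dF; have dFe i j := (derivable_mxP _ _ _).1 dF i j.
have E i j : (fun y => (f y *: F y) i j) = (fun y => f y * F y i j).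
by apply/funext => y; rewrite mxE.
have d : derivable (fun y => f y *: F y) x v.
by apply/derivable_mxP => i j; rewrite E; exact: (derivable_mr df (dFe i j)).1.
split=> //; apply/matrixP => i j; rewrite (derive_mx d) mxE E.
by rewrite (derivable_mr df (dFe i j)).2 (derive_mx dF) !mxE.
Qed.

Lemma derivable_comp1 p q (F : V -> 'M[R]_(p, q)) x v i j :
 derivable F x v -> 'D_v (fun y => F y i j) x = 'D_v F x i j.
by move=> dF; rewrite derive_mx// mxE. Qed.
End DeriveMatrix.

(* Locked, as unification would otherwise unfold limits. *)
HB.lock Definition dmx (R : realType) n p q (F : 'rV[R]_n -> 'M[R]_(p, q))
 (i : 'I_n) (x : 'rV[R]_n) : 'M[R]_(p, q) := 'D_(delta_mx 0 i) F x.

Lemma dmx_def (R : realType) n p q (F : 'rV[R]_n -> 'M[R]_(p, q)) i x :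
 dmx F i x = 'D_(delta_mx 0 i) F x.
by rewrite dmx.unlock. Qed.

Section MatrixCk.
Variables (R : realType) (n : nat).
Implicit Types (U : set 'rV[R]_n) (k : nat).

Definition mxCk p q k U (F : 'rV[R]_n -> 'M[R]_(p, q)) :=
 forall i j, Ck k U (fun x => F x i j).

Definition mxsmooth p q U (F : 'rV[R]_n -> 'M[R]_(p, q)) :=
 forall i j, smooth U (fun x => F x i j).

Lemma mxsmoothP p q U (F : 'rV[R]_n -> 'M[R]_(p, q)) :
 mxsmooth U F <-> forall k, mxCk k U F.
by split=> [Fs k i j|Fs i j k]; exact: Fs. Qed.
Lemma mxCk_derivable p q U (F : 'rV[R]_n -> 'M[R]_(p, q)) x v :
 open U -> mxCk 1 U F -> U x -> derivable F x v.
move=> oU F1 Ux; apply/derivable_mxP => i j.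
exact/diff_derivable/(C1_derive oU (F1 i j) Ux).1.
Qed.

Lemma mxCk_cont p q U (F : 'rV[R]_n -> 'M[R]_(p, q)) k x :
 mxCk k U F -> U x -> {for x, continuous F}.
by move=> Fk Ux; apply: continuous_mx => i j; exact: Ck_cont (Fk i j) x Ux. Qed.
Lemma mxCk_le p q U (F : 'rV[R]_n -> 'M[R]_(p, q)) k l :
 (k <= l)%N -> mxCk l U F -> mxCk k U F.
by move=> kl Fl i j; exact: Ck_le kl (Fl i j). Qed.
Lemma mxCk_sub p q U V (F : 'rV[R]_n -> 'M[R]_(p, q)) k :
 U `<=` V -> mxCk k V F -> mxCk k U F.
by move=> UV Fl i j; exact: Ck_sub UV (Fl i j). Qed.
Lemma mxCk_ext p q U (F G : 'rV[R]_n -> 'M[R]_(p, q)) k :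
 open U -> (forall x, U x -> F x = G x) -> mxCk k U F -> mxCk k U G.
by move=> oU FG Fk i j; apply: Ck_ext (Fk i j) => // x Ux; rewrite FG.
Qed.

Lemma dmxE p q U (F : 'rV[R]_n -> 'M[R]_(p, q)) i x a b :
 open U -> mxCk 1 U F -> U x -> dmx F i x a b = partial (fun y => F y a b) i x.
by move=> oU F1 Ux; rewrite dmx_def derive_mx ?mxE//; exact: mxCk_derivable oU F1 Ux.
Qed.

Lemma mxCk_dmx p q U (F : 'rV[R]_n -> 'M[R]_(p, q)) i k :
 open U -> mxCk k.+1 U F -> mxCk k U (dmx F i).
move=> oU Fk a b; apply: Ck_ext (Ck_partial i (Fk a b)) => // x Ux.
by rewrite (dmxE _ _ _ oU)//; exact: mxCk_le Fk.
Qed.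

Lemma dmx_near p q (F G : 'rV[R]_n -> 'M[R]_(p, q)) i x :
 (\near x, F x = G x) -> dmx F i x = dmx G i x.
by rewrite !dmx_def; exact: near_eq_derive. Qed.
Lemma dmx_open p q U (F G : 'rV[R]_n -> 'M[R]_(p, q)) i x :
 open U -> (forall x, U x -> F x = G x) -> U x -> dmx F i x = dmx G i x.
by move=> oU FG Ux; apply/dmx_near/(open_near oU Ux FG). Qed.
Lemma mxCk_cst p q U k (A : 'M[R]_(p, q)) : mxCk k U (fun=> A).
by move=> i j; exact: Ck_cst. Qed.
Lemma mxCkD p q U k (F G : 'rV[R]_n -> 'M[R]_(p, q)) : open U ->
 mxCk k U F -> mxCk k U G -> mxCk k U (fun x => F x + G x).
by move=> oU Fk Gk i j; apply: Ck_ext (CkD oU (Fk i j) (Gk i j)) => // x _; rewrite mxE.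
Qed.

Lemma mxCkM p q r U k (F : 'rV[R]_n -> 'M[R]_(p, q)) (G : 'rV[R]_n -> 'M[R]_(q, r)) :
 open U -> mxCk k U F -> mxCk k U G -> mxCk k U (fun x => F x *m G x).
move=> oU Fk Gk i j; apply: (@Ck_ext _ _ _ _
 (fun x => \sum_k F x i k * G x k j)) => // [x _|]; first by rewrite mxE.
by apply: Ck_sum => // l _; exact: CkM.
Qed.

Lemma mxCkZ p q U k f (F : 'rV[R]_n -> 'M[R]_(p, q)) : open U ->
 Ck k U f -> mxCk k U F -> mxCk k U (fun x => f x *: F x).
by move=> oU fk Fk i j; apply: Ck_ext (CkM oU fk (Fk i j)) => // x _; rewrite mxE.
Qed.

Lemma mxCkN p q U k (F : 'rV[R]_n -> 'M[R]_(p, q)) : open U ->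
 mxCk k U F -> mxCk k U (fun x => - F x).
move=> oU Fk; apply: (mxCk_ext oU _ (mxCkZ oU (Ck_cst k U (-1)) Fk)) => x _.
by rewrite scaleN1r.
Qed.

Lemma mxCk_tr p q U k (F : 'rV[R]_n -> 'M[R]_(p, q)) : open U ->
 mxCk k U F -> mxCk k U (fun x => (F x)^T).
by move=> oU Fk i j; apply: Ck_ext (Fk j i) => // x _; rewrite mxE.
Qed.

Lemma mxCk_sum p q U k I (r : seq I) (F : I -> 'rV[R]_n -> 'M[R]_(p, q)) : open U ->
 (forall i, mxCk k U (F i)) -> mxCk k U (fun x => \sum_(i <- r) F i x).
move=> oU Fk a b; apply: (@Ck_ext _ _ _ _ (fun x => \sum_(i <- r) F i x a b)) => //.
by move=> x _; rewrite summxE.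
by apply: Ck_sum => // i _; exact: Fk.
Qed.

Lemma Ck_det p U k (F : 'rV[R]_n -> 'M[R]_p) : open U ->
 mxCk k U F -> Ck k U (fun x => \det (F x)).
move=> oU Fk; apply: Ck_sum => // s _; apply: CkM => //; first exact: Ck_cst.
by apply: Ck_prod => // i _; exact: Fk.
Qed.

Lemma mxCkV p U k (F : 'rV[R]_n -> 'M[R]_p) : open U ->
 (forall x, U x -> F x \in unitmx) -> mxCk k U F -> mxCk k U (fun x => invmx (F x)).
move=> oU uF Fk; apply: (@mxCk_ext _ _ _ (fun x => (\det (F x))^-1 *: \adj (F x))) => //.
by move=> x Ux; rewrite /invmx uF.
apply: mxCkZ => //.
apply: CkV => //; last exact: Ck_det.
by move=> x /uF; rewrite unitmxE unitfE.
move=> i j; apply: (@Ck_ext _ _ _ _ (fun x => cofactor (F x) j i)) => //.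
by move=> x _; rewrite mxE.
apply: CkM => //; first exact: Ck_cst.
apply: Ck_det => // a b; apply: Ck_ext (Fk (lift j a) (lift i b)) => // x _.
by rewrite !mxE.
Qed.

Lemma dmxM p q r U (F : 'rV[R]_n -> 'M[R]_(p, q)) (G : 'rV[R]_n -> 'M[R]_(q, r)) i x :
 open U -> mxCk 1 U F -> mxCk 1 U G -> U x ->
 dmx (fun y => F y *m G y) i x = dmx F i x *m G x + F x *m dmx G i x.
move=> oU F1 G1 Ux; rewrite !dmx_def.
by apply: (derivable_mulmx _ _).2; exact: mxCk_derivable oU _ Ux.
Qed.

Lemma dmxD p q U (F G : 'rV[R]_n -> 'M[R]_(p, q)) i x :
 open U -> mxCk 1 U F -> mxCk 1 U G -> U x ->
 dmx (fun y => F y + G y) i x = dmx F i x + dmx G i x.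
by move=> oU F1 G1 Ux; rewrite !dmx_def; apply: deriveD; exact: mxCk_derivable oU _ Ux.
Qed.

Lemma dmxN p q U (F : 'rV[R]_n -> 'M[R]_(p, q)) i x :
 open U -> mxCk 1 U F -> U x -> dmx (fun y => - F y) i x = - dmx F i x.
by move=> oU F1 Ux; rewrite !dmx_def; apply: deriveN; exact: mxCk_derivable oU _ Ux. Qed.
Lemma dmxZ p q U f (F : 'rV[R]_n -> 'M[R]_(p, q)) i x :
 open U -> Ck 1 U f -> mxCk 1 U F -> U x ->
 dmx (fun y => f y *: F y) i x = partial f i x *: F x + f x *: dmx F i x.
move=> oU f1 F1 Ux; rewrite !dmx_def; apply: (derivable_scalemx _ _).2; last exact: mxCk_derivable oU _ Ux.
exact: Ck_derivable f1 _ Ux.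
Qed.

Lemma dmx_tr p q U (F : 'rV[R]_n -> 'M[R]_(p, q)) i x :
 open U -> mxCk 1 U F -> U x -> dmx (fun y => (F y)^T) i x = (dmx F i x)^T.
by move=> oU F1 Ux; rewrite !dmx_def; apply: (derivable_trmx _).2; exact: mxCk_derivable oU _ Ux. Qed.
Lemma dmx_cst p q (A : 'M[R]_(p, q)) (i : 'I_n) (x : 'rV[R]_n) : dmx (fun=> A) i x = 0.
by rewrite dmx_def; exact: derive_cst. Qed.
Lemma dmx_coord (i : 'I_n) (x : 'rV[R]_n) : dmx id i x = delta_mx 0 i.
by rewrite dmx_def; exact: derive_id. Qed.
Lemma dmx_sum p q U m (F : 'I_m -> 'rV[R]_n -> 'M[R]_(p, q)) i x :
 open U -> (forall l, mxCk 1 U (F l)) -> U x ->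
 dmx (fun y => \sum_l F l y) i x = \sum_l dmx (F l) i x.
move=> oU F1 Ux; rewrite dmx_def.
rewrite (_ : (fun y => \sum_l F l y) = \sum_l F l); last first.
by apply/funext => y; rewrite fct_sumE.
rewrite derive_sum; first by apply: eq_bigr => l _; rewrite dmx_def.
by move=> l; exact: mxCk_derivable oU _ Ux.
Qed.

Lemma dmx_Schwarz p q U (F : 'rV[R]_n -> 'M[R]_(p, q)) i j x :
 open U -> mxCk 2 U F -> U x -> dmx (dmx F i) j x = dmx (dmx F j) i x.
move=> oU F2 Ux; apply/matrixP => a b.
have F1 : mxCk 1 U F by exact: mxCk_le F2.
rewrite [LHS](dmxE j a b oU (mxCk_dmx i oU F2) Ux).
rewrite [RHS](dmxE i a b oU (mxCk_dmx j oU F2) Ux).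
have E (l : 'I_n) : \near x, dmx F l x a b = partial (fun y => F y a b) l x.
by apply: (open_near oU Ux) => y Uy; rewrite (dmxE _ _ _ oU).
by rewrite [LHS](partial_near _ (E i)) [RHS](partial_near _ (E j)); exact: Schwarz oU (F2 a b) Ux.
Qed.
End MatrixCk.

Section MatrixChain.
Variables (R : realType) (n p : nat).

Lemma mxCk_comp q r k (U : set 'rV[R]_n) (W : set 'rV[R]_p) (g : 'rV[R]_n -> 'rV[R]_p)
 (F : 'rV[R]_p -> 'M[R]_(q, r)) :
 open U -> open W -> (forall x, U x -> W (g x)) -> mxCk k U g -> mxCk k W F ->
 mxCk k U (F \o g).
by move=> oU oW UW gk Fk i j; exact: (Ck_comp oU oW UW (gk 0) (Fk i j)).
Qed.

Lemma jac_mul (U : set 'rV[R]_n) (g : 'rV[R]_n -> 'rV[R]_p) x v :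
 open U -> mxCk 1 U g -> U x -> 'D_v g x = v *m 'J g x.
by move=> oU g1 Ux; have [] := row_mulE v oU Ux (g1 0). Qed.
Lemma jac_row (U : set 'rV[R]_n) (g : 'rV[R]_n -> 'rV[R]_p) x i :
 open U -> mxCk 1 U g -> U x -> row i ('J g x) = dmx g i x.
by move=> oU g1 Ux; rewrite dmx_def (jac_mul _ oU g1 Ux) rowE. Qed.
Lemma mxCk_jac k (U : set 'rV[R]_n) (g : 'rV[R]_n -> 'rV[R]_p) :
 open U -> mxCk k.+1 U g -> mxCk k U (fun x => 'J g x).
move=> oU gk i j; apply: Ck_ext (Ck_partial i (gk 0 j)) => // x Ux.
have [_ -> _] := row_mulE 0 oU Ux (mxCk_le (ltn0Sn k) gk 0).
by rewrite mxE.
Qed.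

Lemma dmx_comp q r (U : set 'rV[R]_n) (W : set 'rV[R]_p) (g : 'rV[R]_n -> 'rV[R]_p)
 (F : 'rV[R]_p -> 'M[R]_(q, r)) i x :
 open U -> open W -> (forall x, U x -> W (g x)) -> mxCk 1 U g -> mxCk 1 W F -> U x ->
 dmx (F \o g) i x = \sum_j 'J g x i j *: dmx F j (g x).
move=> oU oW UW g1 F1 Ux; apply/matrixP => a b.
have FG : mxCk 1 U (F \o g) by exact: mxCk_comp oU oW UW g1 F1.
rewrite (dmxE _ _ _ oU)// summxE.
have [j|_ e] := @chain_rule R _ p g (fun y => F y a b) W x (delta_mx 0 i) _ oW (F1 a b) (UW x Ux).
exact: (C1_derive oU (g1 0 j) Ux).1.
rewrite [LHS]e; apply: eq_bigr => j _; rewrite [RHS]mxE (dmxE j a b oW F1 (UW x Ux)).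
by have [_ -> _] := row_mulE 0 oU Ux (g1 0); rewrite mxE.
Qed.
End MatrixChain.

Lemma jac_comp (R : realType) n p q (U : set 'rV[R]_n) (W : set 'rV[R]_p)
 (f : 'rV[R]_n -> 'rV[R]_p) (g : 'rV[R]_p -> 'rV[R]_q) x :
 open U -> open W -> (forall x, U x -> W (f x)) -> mxCk 1 U f -> mxCk 1 W g -> U x ->
 'J (g \o f) x = 'J f x *m 'J g (f x).
move=> oU oW UW f1 g1 Ux; apply/row_matrixP => i; rewrite (jac_row _ oU)//; last first.
exact: mxCk_comp UW f1 g1.
rewrite (dmx_comp _ oU oW UW)// row_mul [row i _]row_sum_delta mulmx_suml.
by apply: eq_bigr => j _; rewrite -scalemxAl -rowE (jac_row _ oW) ?mxE//; exact: UW.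
Qed.

Lemma jac_id (R : realType) n (x : 'rV[R]_n) : 'J id x = 1%:M.
apply/row_matrixP => i; rewrite (@jac_row _ _ _ setT)//; last by move=> a j; rewrite ord1; exact: Ck_coord.
by rewrite dmx_coord rowE mulmx1.
exact: openT.
Qed.

Lemma partial_def (R : realType) n (f : 'rV[R]_n -> R) i x :
 partial f i x = 'D_(delta_mx 0 i) f x.
by []. Qed.

Global Opaque partial jacobian.

Lemma near_norm (R : realType) (V : normedModType R) (x : V) (e : R) :
 0 < e -> \forall y \near x, `|x - y| < e.
by move=> e0; exact: cvgr_dist_lt. Qed.

Section LinesAtZero.
Variables (R : realType) (V W : normedModType R).

Lemma derivable_line0 (f : V -> W) p v :
 derivable (fun t : R => f (p + t *: v)) 0 1 <-> derivable f p v.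
by have := derivable_line f p v 0; rewrite scale0r addr0. Qed.
Lemma derive_line0 (f : V -> W) p v :
 'D_1 (fun t : R => f (p + t *: v)) 0 = 'D_v f p.
by have := derive_line f p v 0; rewrite scale0r addr0. Qed.
End LinesAtZero.

Lemma continuous_eps (R : realType) (T : topologicalType) (V : normedModType R)
 (f : T -> V) x :
 (forall e, 0 < e -> \forall y \near x, `|f x - f y| <= e) ->
 {for x, continuous f}.
by move=> H; apply/cvgrPdist_le. Qed.

(** * Integrals over the unit segment, closed balls and radial averages *)

Section UnitIntegral.
Variables (R : realType).
Implicit Types f g : R -> R.
Notation mu := (@lebesgue_measure R).

Definition int01 f : R := \int[mu]_(t in `[0, 1]) f t.

Definition cont01 f := forall t : R, 0 <= t <= 1 -> {for t, continuous f}.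

Lemma cont01_within f : cont01 f -> {within `[0, 1], continuous f}.
by move=> cf; apply: continuous_in_subspaceT => t; rewrite inE/= in_itv/= => /cf.
Qed.

Lemma cont01_int f : cont01 f -> mu.-integrable `[0, 1] (EFin \o f).
move=> cf; apply: continuous_compact_integrable; first exact: segment_compact.
exact: cont01_within.
Qed.

Lemma eq_int01 f g : (forall t : R, 0 <= t <= 1 -> f t = g t) -> int01 f = int01 g.
by move=> fg; apply: eq_Rintegral => t; rewrite inE/= in_itv/= => /fg. Qed.
Lemma int01D f g : cont01 f -> cont01 g ->
 int01 (fun t => f t + g t) = int01 f + int01 g.
by move=> cf cg; apply: RintegralD => //; exact: cont01_int. Qed.
Lemma int01Z c f : cont01 f -> int01 (fun t => c * f t) = c * int01 f.
by move=> cf; apply: RintegralZl => //; exact: cont01_int. Qed.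
Lemma int01_cst c : int01 (fun=> c) = c.
have m1 : fine (mu `[0%R, 1%R]%classic) = 1.
by rewrite lebesgue_measure_itv/= lte_fin ltr01/= subr0.
by rewrite /int01 Rintegral_cst// m1 mulr1.
Qed.

Lemma int01_norm f K : cont01 f -> (forall t : R, 0 <= t <= 1 -> `|f t| <= K) ->
 `|int01 f| <= K.
move=> cf fK; rewrite /int01.
apply: le_trans (le_normr_Rintegral _ (cont01_int cf)) _ => //.
rewrite -[leRHS](int01_cst K) /int01; apply: le_Rintegral => //.
- by apply: cont01_int => t t01; apply: cvg_norm; exact: cf.
- by apply: cont01_int => t _; exact: cst_continuous.
Qed.

Lemma cont01D f g : cont01 f -> cont01 g -> cont01 (fun t => f t + g t).
by move=> cf cg t t01; apply: cvgD; [exact: cf|exact: cg]. Qed.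
Lemma cont01M f g : cont01 f -> cont01 g -> cont01 (fun t => f t * g t).
by move=> cf cg t t01; apply: (@continuousM R R); [exact: cf|exact: cg]. Qed.
Lemma cont01_cst c : cont01 (fun=> c).
by move=> t _; exact: cst_continuous. Qed.
Lemma cont01_sum I (s : seq I) (F : I -> R -> R) : (forall i, cont01 (F i)) ->
 cont01 (fun t => \sum_(i <- s) F i t).
move=> cF; elim: s => [|i s IH].
by under [X in cont01 X]eq_fun do rewrite big_nil; exact: cont01_cst.
by under [X in cont01 X]eq_fun do rewrite big_cons; exact: cont01D.
Qed.

Lemma int01_sum I (s : seq I) (F : I -> R -> R) : (forall i, cont01 (F i)) ->
 int01 (fun t => \sum_(i <- s) F i t) = \sum_(i <- s) int01 (F i).
move=> cF; elim: s => [|i s IH].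
by rewrite big_nil -[RHS](int01_cst 0); apply: eq_int01 => t _; rewrite big_nil.
rewrite big_cons -IH -int01D; [|exact: cF|exact: cont01_sum].
by apply: eq_int01 => t _; rewrite big_cons.
Qed.

Lemma int01_FTC F f : cont01 f ->
 (forall t : R, 0 <= t <= 1 -> derivable F t 1 /\ 'D_1 F t = f t) ->
 int01 f = F 1 - F 0.
move=> cf dF.
have cF (t : R) : 0 <= t <= 1 -> {for t, continuous F}.
by move=> /dF[d _]; exact: derivable1_cont.
have := @continuous_FTC2 R f F 0 1 ltr01 (cont01_within cf) _ _.
rewrite /int01 /Rintegral => -> //.
- split.
 + by move=> t; rewrite in_itv/= => /andP[t0 t1]; apply: (dF _ _).1; rewrite !ltW.
 + by apply: cvg_at_right_filter; apply: cF; rewrite lexx ler01.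
 + by apply: cvg_at_left_filter; apply: cF; rewrite lexx ler01.
- move=> t; rewrite in_itv/= => /andP[t0 t1]; rewrite derive1E.
by apply: (dF _ _).2; rewrite !ltW.
Qed.

Lemma int01_under (f : R -> R -> R) (e K : R) : 0 < e ->
 (forall s, `|s| < e -> cont01 (f s)) ->
 (forall s t : R, `|s| < e -> 0 <= t <= 1 -> derivable (f^~ t) s 1 /\
 `|'D_1 (f^~ t) s| <= K) ->
 derivable (fun s => int01 (f s)) 0 1 /\
 'D_1 (fun s => int01 (f s)) 0 = int01 (fun t => 'D_1 (f^~ t) 0).
move=> e0 cf df.
have se s : `]- e, e[%classic s -> `|s| < e by rewrite /= in_itv/= ltr_norml.
have in0 : `]- e, e[%classic (0 : R) by rewrite /= in_itv/= e0 oppr_lt0 e0.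
have H1 x : `]- e, e[%classic x -> mu.-integrable `[0, 1] (EFin \o f x).
by move=> /se xe; apply/cont01_int/cf.
have H2 x y : `]- e, e[%classic x -> `[0, 1]%classic y -> derivable (f^~ y) x 1.
by move=> /se xe; rewrite /= in_itv/= => y01; exact: (df x y xe y01).1.
(* A constant dominating function, integrable over the segment; the absolute value makes it
   nonnegative. *)
pose G (t : R) := `|K|.
have K0 y : 0 <= G y by exact: normr_ge0.
have H3 : mu.-integrable `[0, 1] (EFin \o G).
by apply: cont01_int => t _; exact: cst_continuous.
have H4 x y : `]- e, e[%classic x -> `[0, 1]%classic y ->
 `|partial1of2 f x y| <= G y.
move=> /se xe; rewrite /= in_itv/= => y01.
rewrite /partial1of2 derive1E; apply: le_trans (df x y xe y01).2 _.
exact: ler_norm.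
rewrite /int01; split.
by apply: (derivable_under_integral _ in0 H1 H2 K0 H3 H4); exact: measurable_itv.
rewrite -derive1E.
rewrite [LHS](@differentiation_under_integral R _ _ mu f `[0, 1]%classic
 (measurable_itv _) _ _ _ in0 H1 H2 _ K0 H3 H4).
by apply: eq_int01 => t t01; rewrite /partial1of2 derive1E.
Qed.
End UnitIntegral.

Section ClosedBalls.
Variables (R : realType) (n : nat).

(** For the sup norm a closed ball is a product of segments; a negative radius gives the empty
    set. *)
Lemma compact_cball (x0 : 'rV[R]_n) r : compact [set x | `|x - x0| <= r].
have := @rV_compact R n (fun i => `[x0 0 i - r, x0 0 i + r]%classic)
 (fun i => @segment_compact R _ _).
have [r0|r0] := leP 0 r; last first.
move=> _; rewrite (_ : mkset _ = set0); first exact: compact0.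
by apply/seteqP; split=> // x /= xr; have := le_lt_trans xr r0; rewrite normr_lt0.
congr compact; apply/seteqP; split=> x /=.
move=> H; apply: normmx_le => // i j; rewrite ord1 !mxE.
by have := H j; rewrite in_itv/= ler_norml => /andP[? ?]; apply/andP; split; lra.
move=> H j; have := le_trans (normmx_ge (x - x0) 0 j) H; rewrite !mxE in_itv/=.
by rewrite ler_norml => /andP[? ?]; apply/andP; split; lra.
Qed.

Lemma bounded_cball (x0 : 'rV[R]_n) r (f : 'rV[R]_n -> R) :
 (forall x, `|x - x0| <= r -> {for x, continuous f}) ->
 exists2 K, 0 <= K & forall x, `|x - x0| <= r -> `|f x| <= K.
move=> cf; have [r0|r0] := leP 0 r; last first.
by exists 0 => // x xr; have := le_lt_trans xr r0; rewrite normr_lt0.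
have [|||c cA cM] := @EVT_max_rV R n (fun x => `|f x|) [set x | `|x - x0| <= r].
- by exists x0; rewrite /= subrr normr0.
- exact: compact_cball.
- apply: continuous_in_subspaceT => x; rewrite inE/= => xr.
exact: cvg_norm (cf x xr).
- by exists `|f c| => // x xr; apply: cM; rewrite inE.
Qed.

Lemma open_ball_norm (x0 : 'rV[R]_n) r : open [set x | `|x - x0| < r].
have [r0|r0] := ltP 0 r; last first.
rewrite (_ : mkset _ = set0); first exact: open0.
by apply/seteqP; split=> // x /= xr; have := lt_le_trans xr r0; rewrite normr_lt0.
rewrite (_ : mkset _ = ball x0 r); first exact: ball_open.
by rewrite -ball_normE; apply/seteqP; split=> x /=; rewrite distrC.
Qed.
End ClosedBalls.

Section RadialIntegral.
Variables (R : realType) (n : nat) (x0 : 'rV[R]_n) (r : R).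
Notation dl i := (delta_mx 0 i : 'rV[R]_n).
Let U := [set x : 'rV[R]_n | `|x - x0| < r].
Notation pt t x := (x0 + t *: (x - x0)).

(** The weighted average along the segment from [x0] to [x] that enters the homotopy operator of the
    Poincaré lemma. Differentiating in [x] brings out one factor [t], so the exponent goes up by
    one. *)
Definition radial (p : nat) (a : 'rV[R]_n -> R) (x : 'rV[R]_n) : R :=
 int01 (fun t => t ^+ p * a (pt t x)).
Let oU : open U. exact: open_ball_norm. Qed.
Lemma radial_pt (t : R) x : 0 <= t <= 1 -> `|pt t x - x0| <= `|x - x0|.
move=> /andP[t0 t1]; rewrite addrAC subrr add0r normrZ ger0_norm//.
by rewrite ler_piMl.
Qed.

Lemma radial_in (t : R) x : 0 <= t <= 1 -> U x -> U (pt t x).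
by move=> t01 Ux; exact: le_lt_trans (radial_pt x t01) Ux. Qed.
Lemma cont_line (x y : 'rV[R]_n) : continuous (fun t : R => x + t *: y).
by move=> t; apply: cvgD; [exact: cvg_cst|apply: cvgZr_tmp; exact: cvg_id].
Qed.

Lemma radial_cont01 p a x : Ck 0 U a -> U x ->
 cont01 (fun t => t ^+ p * a (pt t x)).
move=> a0 Ux t t01; apply: (@continuousM R R (fun t => t ^+ p) (fun t => a (pt t x))).
exact: exprn_continuous.
apply: continuous_comp; first exact: cont_line.
exact: Ck_cont a0 _ (radial_in t01 Ux).
Qed.

Lemma radialD p a b x : Ck 0 U a -> Ck 0 U b -> U x ->
 radial p (fun y => a y + b y) x = radial p a x + radial p b x.
move=> ca cb Ux; rewrite /radial -int01D; [|exact: radial_cont01..].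
by apply: eq_int01 => t _; rewrite mulrDr.
Qed.

Lemma radialZ p c a x : Ck 0 U a -> U x ->
 radial p (fun y => c * a y) x = c * radial p a x.
move=> ca Ux; rewrite /radial -int01Z; last exact: radial_cont01.
by apply: eq_int01 => t _; rewrite mulrCA.
Qed.

Lemma eq_radial p a b x : (forall y, U y -> a y = b y) -> U x ->
 radial p a x = radial p b x.
by move=> ab Ux; apply: eq_int01 => t t01; rewrite ab//; exact: radial_in. Qed.
Lemma radial_norm p a x K : Ck 0 U a -> U x ->
 (forall y, U y -> `|a y| <= K) -> `|radial p a x| <= K.
move=> ca Ux aK; apply: int01_norm; first exact: radial_cont01.
move=> t t01; rewrite normrM -[leRHS]mul1r ler_pM//; last exact/aK/radial_in.
by case/andP: t01 => t0 t1; rewrite normrX ger0_norm// exprn_ile1.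
Qed.

(** Fundamental theorem of calculus for the function t^(p+1) a(x0 + t (x - x0)) on [0, 1]. *)
Lemma radial_parts p a x : Ck 1 U a -> U x ->
 a x = p.+1%:R * radial p a x +
 \sum_j (x - x0) 0 j * radial p.+1 (partial a j) x.
move=> a1 Ux.
have dat (t : R) : 0 <= t <= 1 -> derivable (fun t : R => a (pt t x)) t 1 /\
 'D_1 (fun t : R => a (pt t x)) t = \sum_j (x - x0) 0 j * partial a j (pt t x).
move=> t01; rewrite derive_line.
have [d ->] := C1_derive oU a1 (radial_in t01 Ux); split=> //.
by apply/derivable_line; exact: diff_derivable.
pose b (t : R) := p.+1%:R * (t ^+ p * a (pt t x)).
pose c (t : R) := \sum_j (x - x0) 0 j * (t ^+ p.+1 * partial a j (pt t x)).
have cp j : Ck 0 U (partial a j) by exact: Ck_partial.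
have cb : cont01 b.
move=> t t01; apply: (@continuousM R R (fun=> p.+1%:R)); first exact: cst_continuous.
exact: radial_cont01 (Ck_S a1) Ux t t01.
have cc1 j : cont01 (fun t : R => (x - x0) 0 j * (t ^+ p.+1 * partial a j (pt t x))).
by apply: cont01M; [exact: cont01_cst|exact: radial_cont01 (cp j) Ux].
have cc : cont01 c by exact: cont01_sum.
have xE : pt 1 x = x by rewrite scale1r addrC subrK.
have -> : a x = 1 ^+ p.+1 * a (pt 1 x) - 0 ^+ p.+1 * a (pt 0 x).
by rewrite xE expr1n expr0n mul1r mul0r subr0.
rewrite -(@int01_FTC R (fun t : R => t ^+ p.+1 * a (pt t x)) (fun t => b t + c t)).
- rewrite int01D// {1}/b int01Z; last exact: radial_cont01 (Ck_S a1) Ux.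
congr (_ + _); rewrite /c int01_sum//; apply: eq_bigr => j _.
by rewrite int01Z//; exact: radial_cont01 (cp j) Ux.
- exact: cont01D.
- move=> t t01; have [d e] := dat t t01.
have dX : derivable (fun t : R => t ^+ p.+1) t 1 by exact: exprn_derivable.
have [d' ->] := derivable_mr dX d; split=> //.
rewrite e exp_derive /b /c /GRing.scale/= mulr1 mulrA mulr_sumr.
congr (_ + _); apply: eq_bigr => j _; exact: mulrCA.
Qed.

Lemma radial_derive p a x i : Ck 1 U a -> U x ->
 derivable (radial p a) x (dl i) /\
 partial (radial p a) i x = radial p.+1 (partial a i) x.
move=> a1 Ux.
(* A radius strictly between the norm of [x - x0] and [r]: its closed ball is compact inside [U],
   which provides the uniform bound for differentiation under the integral. *)
pose rho := (`|x - x0| + r) / 2.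
have rx : `|x - x0| < rho < r by move: Ux; rewrite /U /rho/= => ?; apply/andP; split; lra.
case/andP: rx => xrho rhor.
have inU y : `|y - x0| <= rho -> U y by move=> h; exact: le_lt_trans rhor.
have [K K0 HK] := @bounded_cball R n x0 rho (partial a i)
 (fun y yr => Ck_cont (Ck_partial i a1) (inU y yr)).
have e0 : 0 < rho - `|x - x0| by rewrite subr_gt0.
have dl1 : `|dl i| <= 1.
apply: normmx_le => // b c; rewrite mxE ord1/=.
by case: eqP => _; rewrite ?normr1 ?normr0.
have near (s : R) : `|s| < rho - `|x - x0| -> `|x + s *: dl i - x0| <= rho.
move=> sr; rewrite addrAC (le_trans (ler_normD _ _))// normrZ.
have : `|s| * `|dl i| <= `|s| by rewrite ler_piMr.
by lra.
pose f (s t : R) := t ^+ p * a (pt t (x + s *: dl i)).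
have ptE (s t : R) : pt t (x + s *: dl i) = pt t x + s *: (t *: dl i).
by rewrite addrAC scalerDr addrA scalerA mulrC -scalerA.
have df (s t : R) : `|s| < rho - `|x - x0| -> 0 <= t <= 1 ->
 derivable (f^~ t) s 1 /\
 'D_1 (f^~ t) s = t ^+ p.+1 * partial a i (pt t (x + s *: dl i)).
move=> sr t01; have Us := radial_in t01 (inU _ (near s sr)).
have E : (f^~ t) = (fun s => t ^+ p * (fun s => a (pt t x + s *: (t *: dl i))) s).
by apply/funext => u; rewrite /f ptE.
have [d e] := C1_derive oU a1 Us.
have d1 : derivable (fun s : R => a (pt t x + s *: (t *: dl i))) s 1.
by apply/derivable_line; rewrite -ptE; exact: diff_derivable.
have [d2 e2] := @derivable_mr R R (fun=> t ^+ p)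
 (fun s : R => a (pt t x + s *: (t *: dl i))) s 1 (derivable_cst _ _ _) d1.
rewrite E; split; first exact: d2.
rewrite [LHS]e2 derive_cst mul0r add0r derive_line -ptE e exprSr -mulrA; congr (_ * _).
rewrite (bigD1 i)//= big1 ?addr0; first by rewrite !mxE !eqxx mulr1.
by move=> j ji; rewrite !mxE (negbTE ji) andbF mulr0 mul0r.
have [||d e] := @int01_under R f (rho - `|x - x0|) K e0.
- by move=> s sr; exact: radial_cont01 (Ck_S a1) (inU _ (near s sr)).
- move=> s t sr t01; have [d ->] := df s t sr t01; split=> //.
rewrite normrM -[leRHS]mul1r ler_pM//.
by case/andP: t01 => t0 t1; rewrite normrX ger0_norm// exprn_ile1.
by apply: HK; exact: le_trans (radial_pt _ t01) (near s sr).
have dl0 := (derivable_line0 (radial p a) x (dl i)).1 d.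
have el0 := derive_line0 (radial p a) x (dl i).
have xE : x + 0 *: dl i = x by rewrite scale0r addr0.
split; first exact: dl0.
apply: etrans (partial_def _ _ _) _; apply: etrans (esym el0) _; apply: etrans e _; apply: eq_int01 => t t01.
have s0 : `|0 : R| < rho - `|x - x0| by rewrite normr0.
by have := (df 0 t s0 t01).2; rewrite xE.
Qed.

Lemma radial_continuous p a x : Ck 1 U a -> U x -> {for x, continuous (radial p a)}.
move=> a1 Ux.
pose rho := (`|x - x0| + r) / 2.
have : `|x - x0| < rho < r by move: Ux; rewrite /U /rho/= => ?; apply/andP; split; lra.
case/andP=> xrho rhor.
have inU y : `|y - x0| <= rho -> U y by move=> h; exact: le_lt_trans rhor.
have bK j : exists K, 0 <= K /\ forall y, `|y - x0| <= rho -> `|partial a j y| <= K.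
have [K K0 HK] := @bounded_cball R n x0 rho (partial a j)
 (fun y yr => Ck_cont (Ck_partial j a1) (inU y yr)); by exists K.
have [Kf HKf] := boolp.choice bK.
pose K := \sum_j Kf j.
have HK j y : `|y - x0| <= rho -> `|partial a j y| <= K.
move=> yr; apply: le_trans ((HKf j).2 y yr) _; rewrite /K (bigD1 j)//= lerDl.
by apply: sumr_ge0 => l _; exact: (HKf l).1.
have K0 : 0 <= K by apply: sumr_ge0 => l _; exact: (HKf l).1.
apply: continuous_eps => e e0.
have c0 : 0 < e / (n%:R * K + 1) by rewrite divr_gt0// ltr_wpDl// mulr_ge0.
have near1 : \forall y \near x, `|x - y| < rho - `|x - x0|.
by apply: near_norm; rewrite subr_gt0.
have near2 : \forall y \near x, `|x - y| < e / (n%:R * K + 1) by exact: near_norm.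
near=> y.
have yr : `|y - x0| < rho.
have : `|x - y| < rho - `|x - x0| by near: y; exact: near1.
rewrite ltrBrDr; apply: le_lt_trans.
have -> : y - x0 = (x - x0) - (x - y) by apply/rowP => j; rewrite !mxE; ring.
by rewrite [leRHS]addrC; exact: ler_normB.
have Uy : U y by apply: inU; exact: ltW.
rewrite /radial -[- int01 _]mulN1r -int01Z; last exact: radial_cont01 (Ck_S a1) Uy.
rewrite -int01D; [|exact: radial_cont01 (Ck_S a1) Ux|]; last first.
by apply: cont01M; [exact: cont01_cst|exact: radial_cont01 (Ck_S a1) Uy].
apply: int01_norm.
apply: cont01D; first exact: radial_cont01 (Ck_S a1) Ux.
by apply: cont01M; [exact: cont01_cst|exact: radial_cont01 (Ck_S a1) Uy].
move=> t t01; rewrite mulN1r -mulrBr normrM -[leRHS]mul1r ler_pM//.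
by case/andP: t01 => t0 t1; rewrite normrX ger0_norm// exprn_ile1.
have seg (s : R) : 0 <= s <= 1 -> `|pt t y + s *: (pt t x - pt t y) - x0| <= rho.
move=> /andP[s0 s1].
have -> : pt t y + s *: (pt t x - pt t y) - x0 =
 (1 - s) *: (pt t y - x0) + s *: (pt t x - x0).
apply/rowP => j; rewrite !mxE; ring.
rewrite (le_trans (ler_normD _ _))// !normrZ !ger0_norm ?subr_ge0//.
have A := le_trans (radial_pt x t01) (ltW xrho).
have B := le_trans (radial_pt y t01) (ltW yr).
have -> : rho = (1 - s) * rho + s * rho by ring.
by rewrite lerD// ler_wpM2l ?subr_ge0.
apply: le_trans (@lipschitz_segment R n U a (pt t y) (pt t x) K oU a1 _ _) _.
- by move=> s s01; apply: inU; exact: seg.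
- by move=> s j s01; apply: HK; exact: seg.
have xyt : `|pt t x - pt t y| <= `|x - y|.
have -> : pt t x - pt t y = t *: (x - y) by apply/rowP => j; rewrite !mxE; ring.
by case/andP: t01 => t0 t1; rewrite normrZ ger0_norm// ler_piMl.
have xye : `|x - y| < e / (n%:R * K + 1) by near: y; exact: near2.
apply: (@le_trans _ _ ((n%:R * K + 1) * (e / (n%:R * K + 1)))).
rewrite ler_pM ?mulr_ge0// ?lerDl//; exact: le_trans xyt (ltW xye).
by rewrite mulrC divfK// gt_eqF// ltr_wpDl// mulr_ge0.
Unshelve. all: by end_near. Qed.
Lemma smooth_radial p a : smooth U a -> smooth U (radial p a).
move=> sa k; elim: k p a sa => [|k IH] p a sa.
by split=> // x Ux; exact: radial_continuous (sa 1) Ux.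
split=> [x Ux|i]; first exact: radial_continuous (sa 1) Ux.
split=> [x Ux|]; first exact: (radial_derive p i (sa 1) Ux).1.
apply: (Ck_ext oU _ (IH p.+1 (partial a i) _)).
by move=> x Ux; rewrite (radial_derive p i (sa 1) Ux).2.
exact: smooth_partial.
Qed.
End RadialIntegral.

Global Opaque int01 radial.

Section EntryRules.
Variables (R : pzRingType) (p q : nat).
Implicit Types A B : 'M[R]_(p, q).

Lemma addmxE A B i j : (A + B) i j = A i j + B i j. by rewrite mxE. Qed.
Lemma oppmxE A i j : (- A) i j = - A i j. by rewrite mxE. Qed.
Lemma zeromxE i j : (0 : 'M[R]_(p, q)) i j = 0. by rewrite mxE. Qed.
Lemma scalemxE a A i j : (a *: A) i j = a * A i j. by rewrite mxE. Qed.
End EntryRules.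

(* Proves identities between linear combinations of matrices, products of
 matrices being atoms. *)
Ltac mxatom e :=
 lazymatch e with
 | (?a + ?b)%R => first [mxatom a | mxatom b]
 | (- ?a)%R => mxatom a
 | (_ *: ?a)%R => mxatom a
 | 0%R => fail
 | _ => tryif is_var e then (progress (clearbody e))
 else (let x := fresh "x" in set x := e; clearbody x)
 end.

Ltac mxlin :=
 let i := fresh "i" in let j := fresh "j" in
 repeat match goal with |- ?l = ?r => first [mxatom l | mxatom r] end;
apply/matrixP => i j; rewrite !(addmxE, oppmxE, scalemxE, zeromxE);
 repeat match goal with |- context [fun_of_matrix ?A i j] =>
 let x := fresh "x" in set x := (fun_of_matrix A i j); clearbody x end;
ring.

(** * Limits with geometric error bounds *)

Section GeometricLimits.
Variables (R : realType).

(** Passage to the limit in an inequality with a geometric error: otherwise the Archimedean property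
    and m < 2^m give an index where the error is below [X - Y]. *)
Lemma le_geometric (X Y Z : R) : (forall k, X <= Y + Z * 2^-1 ^+ k) -> X <= Y.
move=> H; rewrite leNgt; apply/negP => YX.
have d0 : 0 < X - Y by rewrite subr_gt0.
have Z0 : 0 <= Z.
by have := H 0%N; rewrite expr0 mulr1; move: d0; lra.
have := archi_boundP (divr_ge0 Z0 (ltW d0)).
set m := Num.bound _; rewrite ltr_pdivrMr// => Zm.
have := H m; apply/negP; rewrite -ltNge -ltrBrDl.
rewrite exprVn ltr_pdivrMr ?exprn_gt0// (lt_trans Zm)// mulrC ltr_pM2l//.
by rewrite -natrX ltr_nat ltn_expl.
Qed.

(** The intervals of centre [u k] and radius D/2^k are nested, because a step costs at most half of
    the radius. The supremum of their left ends lies in all of them. *)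
Lemma geometric_limit (u : nat -> R) D :
 (forall k, `|u k.+1 - u k| <= D * 2^-1 ^+ k.+1) ->
exists l, forall k, `|l - u k| <= D * 2^-1 ^+ k.
move=> H.
have D0 : 0 <= D.
have p : 0 < (2^-1 : R) ^+ 1 by rewrite expr1 invr_gt0.
by have := le_trans (normr_ge0 _) (H 0%N); rewrite (pmulr_lge0 _ p).
pose w k := u k - D * 2^-1 ^+ k; pose v k := u k + D * 2^-1 ^+ k.
have Hk k : D * 2^-1 ^+ k = D * 2^-1 ^+ k.+1 + D * 2^-1 ^+ k.+1.
by rewrite exprS; field.
have wv k : w k <= v k by rewrite /w /v; have := normr_ge0 (u k.+1 - u k); have := H k; have := Hk k; lra.
have step k : w k <= w k.+1 /\ v k.+1 <= v k.
have := H k; rewrite ler_norml => /andP[h1 h2].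
by rewrite /w /v; have := Hk k; split; lra.
have incw i j : (i <= j)%N -> w i <= w j.
by move=> /subnK <-; elim: (j - i)%N => // m IH; exact: le_trans IH (step _).1.
have decv i j : (i <= j)%N -> v j <= v i.
by move=> /subnK <-; elim: (j - i)%N => // m IH; exact: le_trans (step _).2 IH.
have wle i j : w i <= v j.
have /orP[ij|ji] := leq_total i j.
exact: le_trans (incw _ _ ij) (wv j).
exact: le_trans (wv i) (decv _ _ ji).
have sw : has_sup (range w).
by split; [exists (w 0%N); exists 0%N|exists (v 0%N) => _ [i _ <-]].
exists (sup (range w)) => k; rewrite ler_norml; apply/andP; split.
have : w k <= sup (range w) by apply: sup_upper_bound => //; exists k.
by rewrite /w; lra.
have : sup (range w) <= v k by apply: sup_le_ub => [|_ [i _ <-]]; [exact: sw.1|].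
by rewrite /v; lra.
Qed.
End GeometricLimits.

Section UniformLimits.
Variables (R : realType) (n : nat) (U : set 'rV[R]_n)
 (f_ : nat -> 'rV[R]_n -> R) (f : 'rV[R]_n -> R) (D : R).
Hypotheses (oU : open U) (f_f : forall k x, U x -> `|f x - f_ k x| <= D * 2^-1 ^+ k).

Lemma uniform_continuous_limit : (forall k, Ck 0 U (f_ k)) ->
 forall x, U x -> {for x, continuous f}.
move=> cf x Ux; apply: continuous_eps => e e0.
have [k Hk] : exists k, 2 * D * 2^-1 ^+ k <= e / 2.
apply/not_existsP => H.
have : e / 2 <= 0.
apply: (@le_geometric _ _ _ (2 * D)) => k; rewrite add0r.
by have /negP := H k; rewrite -ltNge => /ltW.
by rewrite leNgt divr_gt0.
have H1 : \forall y \near x, U y by exact: open_nbhs_nbhs.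
have e2 : 0 < e / 2 by rewrite divr_gt0.
have H2 : \forall y \near x, `|f_ k x - f_ k y| < e / 2.
by have /cvgrPdist_lt := Ck_cont (cf k) Ux; apply.
apply: filterS (filterI H1 H2) => y [Uy].
have := f_f k Ux; have := f_f k Uy; rewrite distrC.
set d := D * _ => h1 h2 h3.
have -> : f x - f y = (f x - f_ k x) + (f_ k x - f_ k y) + (f_ k y - f y) by ring.
apply: le_trans (ler_normD _ _) _; apply: le_trans (lerD (ler_normD _ _) (lexx _)) _.
by move: Hk; rewrite -mulrA -/d; move: h1 h2 h3; lra.
Qed.

(** The mean value theorem is applied to [f_ k] between [x] and [x + h]. The geometric errors
    disappear first, for fixed [h]; what remains is the oscillation of [g], small by continuity. *)
Lemma uniform_derive_limit (i : 'I_n) (g : 'rV[R]_n -> R) :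
 (forall k, Ck 1 U (f_ k)) -> (forall x, U x -> {for x, continuous g}) ->
 (forall k x, U x -> `|partial (f_ k) i x - g x| <= D * 2^-1 ^+ k) ->
 forall x, U x -> derivable f x (delta_mx 0 i) /\ partial f i x = g x.
move=> f1 cg fg x Ux.
suff H : (fun h : R => h^-1 *: ((f \o shift x) (h *: (delta_mx 0 i : 'rV[R]_n)) - f x))
 @ 0^' --> g x.
by split; [apply/cvg_ex; exists (g x)|exact: cvg_lim H].
apply/cvgrPdist_le => e e0.
have H1 : \forall y \near x, U y /\ `|g x - g y| < e.
apply: filterI; first exact: open_nbhs_nbhs.
by have /cvgrPdist_lt := cg x Ux; apply.
case/nbhs_normP : H1 => d /= d0 xd.
have dl1 : `|delta_mx 0 i : 'rV[R]_n| <= 1.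
apply: normmx_le => // b c; rewrite mxE ord1/=.
by case: eqP => _; rewrite ?normr1 ?normr0.
have hd : \forall h \near (0 : R)^', h != 0 /\ `|h| < d.
by near=> h; split; near: h; [exact: nbhs_dnbhs_neq|exact: dnbhs0_lt].
apply: filterS hd => h [h0 hd]; rewrite /= [_ + x]addrC.
have near (t : R) : `|t| <= `|h| -> U (x + t *: delta_mx 0 i) /\
 `|g x - g (x + t *: delta_mx 0 i)| < e.
move=> th; apply: xd; rewrite /ball_/= opprD addrA subrr sub0r normrN normrZ.
by apply: le_lt_trans hd; rewrite -[leRHS]mulr1 ler_pM.
have key : `|f (x + h *: delta_mx 0 i) - f x - h * g x| <= `|h| * e.
apply: (@le_geometric _ _ _ (D + D + `|h| * D)) => k.
have [t th et] := @mvt_line R _ (f_ k) x (delta_mx 0 i) h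
 (fun t th => Ck_derivable (f1 k) (near t th).1).
have A1 := f_f k (near h (lexx _)).1; have A2 := f_f k Ux.
have A3 := fg k _ (near t th).1; have A4 := ltW (near t th).2.
set y := x + h *: delta_mx 0 i in A1 et *.
set z := x + t *: delta_mx 0 i in A3 A4 et *.
set dd := 2^-1 ^+ k in A1 A2 A3 *.
have -> : f y - f x - h * g x = (f y - f_ k y) + (f_ k x - f x) +
 h * ((partial (f_ k) i z - g z) + (g z - g x)).
by rewrite [partial _ _ _]partial_def; move: et; rewrite -/y; move=> e1; lra.
apply: le_trans (ler_normD _ _) _; apply: le_trans (lerD (ler_normD _ _) (lexx _)) _.
rewrite [`|f_ k x - f x|]distrC normrM.
have A5 : `|partial (f_ k) i z - g z + (g z - g x)| <= D * dd + e.
apply: le_trans (ler_normD _ _) _; apply: lerD => //.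
by rewrite distrC.
have A6 := ler_wpM2l (normr_ge0 h) A5.
have -> : `|h| * e + (D + D + `|h| * D) * dd =
 D * dd + D * dd + `|h| * (D * dd + e) by ring.
by rewrite lerD// lerD.
have -> : g x - h^-1 *: (f (x + h *: delta_mx 0 i) - f x) =
 - (h^-1 * (f (x + h *: delta_mx 0 i) - f x - h * g x)).
by rewrite /GRing.scale/=; field.
rewrite normrN normrM normfV mulrC ler_pdivrMr ?normr_gt0// mulrC.
by rewrite [g x * h]mulrC [e * _]mulrC.
Unshelve. all: by end_near. Qed.
End UniformLimits.

Section MatrixSmooth.
Variables (R : realType) (n : nat) (U : set 'rV[R]_n).
Hypotheses (oU : open U).

Lemma smooth_Ck p q (F : 'rV[R]_n -> 'M[R]_(p, q)) k : mxsmooth U F -> mxCk k U F.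
by move=> sF i j; exact: sF. Qed.
Lemma mxsmooth_intro p q (F : 'rV[R]_n -> 'M[R]_(p, q)) :
 (forall k, mxCk k U F) -> mxsmooth U F.
by move=> sF i j k; exact: sF. Qed.
Lemma mxsmooth_ext p q (F G : 'rV[R]_n -> 'M[R]_(p, q)) :
 (forall x, U x -> F x = G x) -> mxsmooth U F -> mxsmooth U G.
by move=> FG sF; apply: mxsmooth_intro => k; apply: (mxCk_ext oU FG); exact: smooth_Ck.
Qed.

Lemma mxsmooth_cst p q (A : 'M[R]_(p, q)) : mxsmooth U (fun=> A).
by apply: mxsmooth_intro => k; exact: mxCk_cst. Qed.
Lemma mxsmoothD p q (F G : 'rV[R]_n -> 'M[R]_(p, q)) :
 mxsmooth U F -> mxsmooth U G -> mxsmooth U (fun x => F x + G x).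
by move=> sF sG; apply: mxsmooth_intro => k; apply: (mxCkD oU); exact: smooth_Ck. Qed.
Lemma mxsmoothN p q (F : 'rV[R]_n -> 'M[R]_(p, q)) :
 mxsmooth U F -> mxsmooth U (fun x => - F x).
by move=> sF; apply: mxsmooth_intro => k; apply: (mxCkN oU); exact: smooth_Ck. Qed.
Lemma mxsmoothB p q (F G : 'rV[R]_n -> 'M[R]_(p, q)) :
 mxsmooth U F -> mxsmooth U G -> mxsmooth U (fun x => F x - G x).
by move=> sF sG; apply: mxsmoothD => //; exact: mxsmoothN. Qed.
Lemma mxsmoothM p q r (F : 'rV[R]_n -> 'M[R]_(p, q)) (G : 'rV[R]_n -> 'M[R]_(q, r)) :
 mxsmooth U F -> mxsmooth U G -> mxsmooth U (fun x => F x *m G x).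
by move=> sF sG; apply: mxsmooth_intro => k; apply: (mxCkM oU); exact: smooth_Ck. Qed.
Lemma mxsmoothZ p q f (F : 'rV[R]_n -> 'M[R]_(p, q)) :
 smooth U f -> mxsmooth U F -> mxsmooth U (fun x => f x *: F x).
by move=> sf sF; apply: mxsmooth_intro => k; apply: (mxCkZ oU) => //; exact: smooth_Ck. Qed.
Lemma mxsmooth_sum p q I (s : seq I) (F : I -> 'rV[R]_n -> 'M[R]_(p, q)) :
 (forall i, mxsmooth U (F i)) -> mxsmooth U (fun x => \sum_(i <- s) F i x).
by move=> sF; apply: mxsmooth_intro => k; apply: (mxCk_sum _ oU) => i; exact: smooth_Ck.
Qed.

Lemma mxsmooth_tr p q (F : 'rV[R]_n -> 'M[R]_(p, q)) :
 mxsmooth U F -> mxsmooth U (fun x => (F x)^T).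
by move=> sF; apply: mxsmooth_intro => k; apply: (mxCk_tr oU); exact: smooth_Ck. Qed.
Lemma mxsmoothV p (F : 'rV[R]_n -> 'M[R]_p) : (forall x, U x -> F x \in unitmx) ->
 mxsmooth U F -> mxsmooth U (fun x => invmx (F x)).
by move=> uF sF; apply: mxsmooth_intro => k; apply: (mxCkV oU uF); exact: smooth_Ck. Qed.
Lemma mxsmooth_dmx p q (F : 'rV[R]_n -> 'M[R]_(p, q)) i :
 mxsmooth U F -> mxsmooth U (dmx F i).
by move=> sF; apply: mxsmooth_intro => k; apply: (mxCk_dmx _ oU); exact: smooth_Ck. Qed.
Lemma mxsmooth_sub p q V (F : 'rV[R]_n -> 'M[R]_(p, q)) :
 U `<=` V -> mxsmooth V F -> mxsmooth U F.
by move=> UV sF i j k; exact: Ck_sub UV (sF i j k). Qed.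

(* Bootstrapping: a C^1 solution of a linear total differential system with
 smooth coefficients is smooth. *)
Lemma mxsmooth_bootstrap p q (F : 'rV[R]_n -> 'M[R]_(p, q)) :
 mxCk 1 U F ->
 (forall k, mxCk k U F -> forall i, mxCk k U (dmx F i)) ->
 mxsmooth U F.
move=> F1 H; apply: mxsmooth_intro; elim=> [|k IH]; first exact: mxCk_le F1.
move=> a b; split; first exact: Ck_cont (F1 a b).
move=> i; split; first exact: Ck_derivable (F1 a b).
by apply: (Ck_ext oU _ (H k IH i a b)) => x Ux; exact: (dmxE _ _ _ oU F1 Ux).
Qed.
End MatrixSmooth.

Section MatrixRadial.
Variables (R : realType) (n : nat) (x0 : 'rV[R]_n) (r : R) (q1 q2 : nat).
Let U := [set x : 'rV[R]_n | `|x - x0| < r].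
Let oU : open U. exact: open_ball_norm. Qed.
Implicit Types F G : 'rV[R]_n -> 'M[R]_(q1, q2).

Definition mradial p F (x : 'rV[R]_n) : 'M[R]_(q1, q2) :=
 \matrix_(a, b) radial x0 p (fun y => F y a b) x.

Lemma mradial_smooth p F : mxsmooth U F -> mxsmooth U (mradial p F).
move=> sF a b k; apply: (Ck_ext oU _ (smooth_radial p (sF a b) k)) => x _.
by rewrite mxE.
Qed.

Lemma mradial_dmx p F i x : mxsmooth U F -> U x ->
 dmx (mradial p F) i x = mradial p.+1 (dmx F i) x.
move=> sF Ux; apply/matrixP => a b.
have c1 : mxCk 1 U (mradial p F) by move=> ? ?; exact: mradial_smooth.
have f1 : mxCk 1 U F by move=> ? ?; exact: sF.
rewrite (dmxE _ _ _ oU c1 Ux) mxE.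
have E : (fun y => mradial p F y a b) = radial x0 p (fun y => F y a b).
by apply/funext => y; rewrite mxE.
rewrite E (radial_derive p i (f1 a b) Ux).2.
by apply: eq_radial Ux => y Uy; rewrite (dmxE _ _ _ oU f1 Uy).
Qed.

Lemma mradial_parts p F x : mxsmooth U F -> U x ->
 F x = p.+1%:R *: mradial p F x +
 \sum_j (x - x0) 0 j *: mradial p.+1 (dmx F j) x.
move=> sF Ux; apply/matrixP => a b.
have f1 : mxCk 1 U F by move=> ? ?; exact: sF.
rewrite (radial_parts p (f1 a b) Ux) !mxE summxE; congr (_ + _).
apply: eq_bigr => j _; rewrite !mxE; congr (_ * _).
by apply: eq_radial Ux => y Uy; rewrite (dmxE _ _ _ oU f1 Uy).
Qed.

Lemma mradial_norm p F x K : mxCk 0 U F -> U x -> 0 <= K ->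
 (forall y, U y -> `|F y| <= K) -> `|mradial p F x| <= K.
move=> cF Ux K0 FK; apply: normmx_le => // a b; rewrite mxE.
apply: (radial_norm _ _ Ux); first exact: cF.
by move=> y Uy; exact: le_trans (normmx_ge _ _ _) (FK y Uy).
Qed.

Lemma eq_mradial p F G x : (forall y, U y -> F y = G y) -> U x ->
 mradial p F x = mradial p G x.
move=> FG Ux; apply/matrixP => a b; rewrite !mxE.
by apply: eq_radial Ux => y Uy; rewrite FG.
Qed.

Lemma mradialB p F G x : mxCk 0 U F -> mxCk 0 U G -> U x ->
 mradial p (fun y => F y - G y) x = mradial p F x - mradial p G x.
move=> cF cG Ux; apply/matrixP => a b; rewrite !mxE.
have c1 : Ck 0 U (fun y => -1 * G y a b) by apply: (CkM oU); [exact: Ck_cst|exact: cG].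
have e1 := @radialZ R n x0 r p (-1) (fun y => G y a b) x (cG a b) Ux.
have e2 := @radialD R n x0 r p (fun y => F y a b) (fun y => -1 * G y a b) x
 (cF a b) c1 Ux.
rewrite e1 mulN1r in e2; rewrite -e2.
by apply: (@eq_radial _ _ _ r) => // y _; rewrite !mxE mulN1r.
Qed.
End MatrixRadial.

(** * The Frobenius theorem for flat linear total differential systems *)

Section Frobenius.
Variables (R : realType) (n N q : nat) (x0 : 'rV[R]_n) (r : R)
 (A : 'I_n -> 'rV[R]_n -> 'M[R]_N) (K0 : 'M[R]_(N, q)).
Let U := [set x : 'rV[R]_n | `|x - x0| < r].
Let oU : open U. exact: open_ball_norm. Qed.
Hypotheses (sA : forall i, mxsmooth U (A i)).
Hypothesis flatA : forall x i j, U x ->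
 dmx (A j) i x + A j x *m A i x = dmx (A i) j x + A i x *m A j x.
Variables (a : R).
Hypotheses (a0 : 0 <= a) (boundA : forall x i, U x -> `|A i x| <= a)
 (small_r : n%:R * (r * (N%:R * a)) <= 8^-1) (r0 : 0 < r).
Let smx p1 p2 F G := @mxsmoothB R n U oU p1 p2 F G.
Let smM p1 p2 p3 F G := @mxsmoothM R n U oU p1 p2 p3 F G.
Let sdmx p1 p2 F i := @mxsmooth_dmx R n U oU p1 p2 F i.
Let C1 p1 p2 (F : 'rV[R]_n -> 'M[R]_(p1, p2)) : mxsmooth U F -> mxCk 1 U F.
exact: smooth_Ck. Qed.
Let C0 p1 p2 (F : 'rV[R]_n -> 'M[R]_(p1, p2)) : mxsmooth U F -> mxCk 0 U F.
exact: smooth_Ck. Qed.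
(** The Picard operator: the integral of the 1-form sum_j A_j F dx_j along the straight segment from
    [x0]. By [small_r] it contracts by a factor 8. *)
Let S (F : 'rV[R]_n -> 'M[R]_(N, q)) (x : 'rV[R]_n) : 'M[R]_(N, q) :=
 \sum_j (x - x0) 0 j *: mradial x0 0 (fun y => A j y *m F y) x.
Let coordB j : smooth U (fun x => (x - x0) 0 j).
move=> k; apply: (Ck_ext oU _ (CkD oU (Ck_coord k U j) (Ck_cst k U (- x0 0 j)))).
by move=> x _; rewrite !mxE.
Qed.
Let S_smooth F : mxsmooth U F -> mxsmooth U (S F).
move=> sF; apply: (mxsmooth_sum oU) => j; apply: (mxsmoothZ oU); first exact: coordB.
by apply: mradial_smooth; exact: smM.
Qed.
Let S_bound (F : 'I_n -> 'rV[R]_n -> 'M[R]_(N, q)) p K x : U x -> 0 <= K ->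
 (forall j, mxsmooth U (F j)) -> (forall j y, U y -> `|F j y| <= K) ->
 `|\sum_j (x - x0) 0 j *: mradial x0 p (F j) x| <= n%:R * (r * K).
move=> Ux KK sF FK; apply: le_trans (ler_norm_sum _ _ _) _.
apply: le_trans (ler_sum _ (G := fun=> r * K) _) _; last first.
by rewrite sumr_const card_ord mulr_natl.
move=> j _; rewrite normrZ ler_pM//.
exact: le_trans (normmx_ge _ _ _) (ltW Ux).
by apply: (mradial_norm _ (C0 (sF j)) Ux KK) => y; exact: FK.
Qed.
(** After integration by parts the remainder involves d_i(A_j F) - d_j(A_i F). Flatness rewrites it
    through the defects dF - A F alone, so that the defects of an iterate control those of the next
    one. *)
Let S_derive F x i : mxsmooth U F -> U x ->
 dmx (S F) i x = A i x *m F x + \sum_j (x - x0) 0 j *: mradial x0 1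
 (fun y => A j y *m (dmx F i y - A i y *m F y) -
 A i y *m (dmx F j y - A j y *m F y)) x.
move=> sF Ux.
have sAF j : mxsmooth U (fun y => A j y *m F y) by exact: smM.
rewrite /S (dmx_sum _ oU) //; last first.
move=> j; apply: (mxCkZ oU); first exact: coordB.
by apply: C1; apply: mradial_smooth.
have -> : \sum_j dmx (fun y => (y - x0) 0 j *:
 mradial x0 0 (fun z => A j z *m F z) y) i x =
 mradial x0 0 (fun z => A i z *m F z) x +
 \sum_j (x - x0) 0 j *: mradial x0 1 (dmx (fun z => A j z *m F z) i) x.
under eq_bigr => j _.
rewrite (dmxZ _ oU _ _ Ux); [|exact: coordB|by apply: C1; exact: mradial_smooth].
rewrite (mradial_dmx _ _ (sAF j) Ux).
have -> : partial (fun y => (y - x0) 0 j) i x = (i == j)%:R.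
rewrite -[LHS](dmxE (F := fun y => y - x0) i 0 j oU _ Ux); last first.
by move=> b c; rewrite ord1; exact: coordB.
rewrite dmx_def deriveB; [|exact: derivable_id|exact: derivable_cst].
by rewrite derive_id derive_cst subr0 mxE eqxx eq_sym.
 over.
rewrite big_split/=; congr (_ + _); rewrite (bigD1 i)//= eqxx scale1r big1 ?addr0//.
by move=> j ji; rewrite eq_sym (negbTE ji) scale0r.
rewrite (mradial_parts 0 (sAF i) Ux) scale1r -!addrA; congr (_ + _).
rewrite -big_split/=; apply: eq_bigr => j _; rewrite -scalerDr; congr (_ *: _).
have sL : mxsmooth U (fun y => A j y *m (dmx F i y - A i y *m F y)).
by apply: smM => //; apply: smx; [exact: sdmx|exact: smM].
have sR : mxsmooth U (fun y => A i y *m (dmx F j y - A j y *m F y)).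
by apply: smM => //; apply: smx; [exact: sdmx|exact: smM].
have -> : mradial x0 1 (dmx (fun z => A j z *m F z) i) x =
 mradial x0 1 (fun y => dmx (fun z => A i z *m F z) j y -
 (A i y *m (dmx F j y - A j y *m F y) - A j y *m (dmx F i y - A i y *m F y))) x.
apply: (eq_mradial _ _ Ux) => y Uy.
rewrite (dmxM _ oU (C1 (sA j)) (C1 sF) Uy) (dmxM _ oU (C1 (sA i)) (C1 sF) Uy).
have := flatA i j Uy; move/(congr1 (fun X => X *m F y)).
rewrite !mulmxDl !mulmxBr !mulmxA => fl.
set X1 := dmx (A j) i y *m F y in fl *; set X2 := dmx (A i) j y *m F y in fl *.
have -> : X1 = X2 + A i y *m A j y *m F y - A j y *m A i y *m F y.
by rewrite -fl addrK.
by clearbody X1 X2; clear fl; mxlin.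
have sd : mxsmooth U (dmx (fun z => A i z *m F z) j) by exact: sdmx.
rewrite (@mradialB _ _ _ r _ _ _ _ _ _ (C0 sd) (C0 (smx sR sL)) Ux).
rewrite (@mradialB _ _ _ r _ _ _ _ _ _ (C0 sR) (C0 sL) Ux).
by rewrite (@mradialB _ _ _ r _ _ _ _ _ _ (C0 sL) (C0 sR) Ux) opprB.
Qed.
Let Phi_ k := iter k (fun F x => K0 + S F x) (fun=> K0).
Let Phi_smooth k : mxsmooth U (Phi_ k).
elim: k => [|k IH] /=; first exact: mxsmooth_cst.
by apply: (mxsmoothD oU); [exact: mxsmooth_cst|exact: S_smooth].
Qed.
Let Phi_step k x : U x -> `|Phi_ k.+1 x - Phi_ k x| <= `|K0| * 8^-1 ^+ k.+1.
elim: k x => [|k IH] x Ux.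
rewrite /= addrC addKr expr1.
rewrite /S; apply: le_trans (@S_bound (fun j y => A j y *m K0) 0 (N%:R * (a * `|K0|)) x Ux _ _ _) _.
 - by rewrite !mulr_ge0.
 - by move=> j; apply: smM => //; exact: mxsmooth_cst.
 - by move=> j y Uy; apply: le_trans (normmxM _ _) _; rewrite ler_wpM2l// ler_wpM2r// boundA.
have -> : n%:R * (r * (N%:R * (a * `|K0|))) = `|K0| * (n%:R * (r * (N%:R * a))) by ring.
exact: ler_wpM2l.
have -> : Phi_ k.+2 x - Phi_ k.+1 x = \sum_j (x - x0) 0 j *:
 mradial x0 0 (fun y => A j y *m (Phi_ k.+1 y - Phi_ k y)) x.
rewrite /= opprD addrACA subrr add0r -sumrB; apply: eq_bigr => j _.
rewrite -scalerBr; congr (_ *: _).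
rewrite -(@mradialB _ _ _ r _ _ _ _ _ _ (C0 (smM (sA j) (Phi_smooth k.+1)))
 (C0 (smM (sA j) (Phi_smooth k))) Ux).
by apply: (eq_mradial _ _ Ux) => y _; rewrite mulmxBr.
set dd := `|K0| * 8^-1 ^+ k.+1.
have dd0 : 0 <= dd by rewrite mulr_ge0// exprn_ge0// invr_ge0.
apply: le_trans (@S_bound (fun j y => A j y *m (Phi_ k.+1 y - Phi_ k y)) 0 (N%:R * (a * dd)) x Ux _ _ _) _.
- by rewrite !mulr_ge0.
- by move=> j; apply: smM => //; apply: smx; exact: Phi_smooth.
- move=> j y Uy; apply: le_trans (normmxM _ _) _.
by rewrite ler_wpM2l// ler_pM// ?boundA// IH.
have -> : n%:R * (r * (N%:R * (a * dd))) = dd * (n%:R * (r * (N%:R * a))) by ring.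
rewrite [leRHS](_ : _ = dd * 8^-1); last by rewrite /dd [in LHS]exprSr mulrA.
exact: ler_wpM2l.
Qed.
Let E_ k i (x : 'rV[R]_n) := dmx (Phi_ k) i x - A i x *m Phi_ k x.
(** [E_] is the defect of the k-th iterate in the equation to be solved. Passing to the next iterate
    costs 1/8 from the step between iterates and 2/8 from the integral, in total less than 1/2. *)
Let E_bound k i x : U x -> `|E_ k i x| <= N%:R * (a * `|K0|) * 2^-1 ^+ k.
set C := N%:R * (a * `|K0|).
have CC : 0 <= C by rewrite !mulr_ge0.
elim: k i x => [|k IH] i x Ux.
rewrite /E_ /= dmx_cst sub0r normrN expr0 mulr1; apply: le_trans (normmxM _ _) _.
by rewrite ler_wpM2l// ler_wpM2r// boundA.
have sE j : mxsmooth U (E_ k j) by apply: smx; [exact: sdmx|exact: smM].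
have -> : E_ k.+1 i x = - (A i x *m (Phi_ k.+1 x - Phi_ k x)) +
 \sum_j (x - x0) 0 j *: mradial x0 1
 (fun y => A j y *m E_ k i y - A i y *m E_ k j y) x.
have s1 : dmx (Phi_ k.+1) i x = dmx (S (Phi_ k)) i x.
rewrite /= (dmxD i oU _ (C1 (S_smooth (Phi_smooth k))) Ux); last exact: mxCk_cst.
by rewrite dmx_cst add0r.
rewrite {1}/E_ s1 (S_derive i (Phi_smooth k) Ux) mulmxBr opprB -!addrA.
by congr (_ + _); rewrite addrC.
apply: le_trans (ler_normD _ _) _; rewrite normrN.
set dd := 2^-1 ^+ k in IH *.
have dd0 : 0 <= dd by rewrite exprn_ge0// invr_ge0.
have h1 : `|A i x *m (Phi_ k.+1 x - Phi_ k x)| <= C * (8^-1 * dd).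
apply: le_trans (normmxM _ _) _; rewrite /C -!mulrA ler_wpM2l// ler_pM//; first exact: boundA.
apply: le_trans (Phi_step k Ux) _; rewrite ler_wpM2l// exprS ler_wpM2l ?invr_ge0//.
by rewrite /dd lerXn2r// ?nnegrE ?invr_ge0// lef_pV2 ?posrE// ler_nat.
have h2 : `|\sum_j (x - x0) 0 j *: mradial x0 1
 (fun y => A j y *m E_ k i y - A i y *m E_ k j y) x| <=
 n%:R * (r * (N%:R * (a * (C * dd)) + N%:R * (a * (C * dd)))).
apply: S_bound => //.
 - by rewrite addr_ge0// !mulr_ge0.
 - by move=> j; apply: smx; apply: smM.
 - move=> j y Uy; apply: le_trans (ler_normB _ _) _.
by apply: lerD; (apply: le_trans (normmxM _ _) _; rewrite ler_wpM2l// ler_pM// ?boundA// IH).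
have e2 : n%:R * (r * (N%:R * (a * (C * dd)) + N%:R * (a * (C * dd)))) =
 2 * (C * dd) * (n%:R * (r * (N%:R * a))) by ring.
rewrite e2 in h2.
have Cd : 0 <= C * dd by rewrite mulr_ge0.
have h3 : 2 * (C * dd) * (n%:R * (r * (N%:R * a))) <= 2 * (C * dd) * 8^-1.
by rewrite ler_wpM2l// mulr_ge0.
apply: le_trans (lerD h1 (le_trans h2 h3)) _.
rewrite exprS -/dd; move: Cd; lra.
Qed.

(** The iterates converge uniformly, and so do their derivatives since the defects tend to 0; the
    limit is C^1 and solves the system, and the system itself then gives smoothness. *)
Lemma frobenius_ball : exists Phi : 'rV[R]_n -> 'M[R]_(N, q),
 [/\ mxsmooth U Phi, Phi x0 = K0
 & forall x i, U x -> dmx Phi i x = A i x *m Phi x].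
have le82 k : (8^-1 : R) ^+ k <= 2^-1 ^+ k.
by rewrite lerXn2r// ?nnegrE ?invr_ge0// lef_pV2 ?posrE// ler_nat.
have lim (t : 'rV[R]_n * 'I_N * 'I_q) : let: (x, u, v) := t in exists l, U x -> forall k,
 `|l - Phi_ k x u v| <= `|K0| * 2^-1 ^+ k.
case: t => [[x u] v]; have [Ux|nUx] := pselect (U x); last by exists 0.
have [k|l Hl] := @geometric_limit R (fun k => Phi_ k x u v) `|K0|; last by exists l.
have := le_trans (normmx_ge _ u v) (Phi_step k Ux); rewrite !mxE => h.
by apply: le_trans h _; rewrite ler_wpM2l.
have lim' (t : 'rV[R]_n * 'I_N * 'I_q) : exists l, U t.1.1 -> forall k,
 `|l - Phi_ k t.1.1 t.1.2 t.2| <= `|K0| * 2^-1 ^+ k.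
by case: t => [[x u] v]; exact: lim (x, u, v).
have [Ph HPh] := boolp.choice lim'.

pose Phi x : 'M[R]_(N, q) := \matrix_(u, v) Ph (x, u, v).
have PhE k x : U x -> `|Phi x - Phi_ k x| <= `|K0| * 2^-1 ^+ k.
move=> Ux; apply: normmx_le => [|u v]; first by rewrite mulr_ge0// exprn_ge0// invr_ge0.
by rewrite !mxE; exact: (HPh (x, u, v)).
have cPhi u v x : U x -> {for x, continuous (fun y => Phi y u v)}.
apply: (@uniform_continuous_limit _ _ _ (fun k y => Phi_ k y u v) _ `|K0| oU).
move=> k y Uy; apply: le_trans _ (PhE k y Uy).
by have := normmx_ge (Phi y - Phi_ k y) u v; rewrite !mxE.
by move=> k; exact: (C0 (Phi_smooth k)).
have cPhi0 : mxCk 0 U Phi by move=> u v; split=> // x; exact: cPhi.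
have cAPhi i : mxCk 0 U (fun y => A i y *m Phi y).
by apply: (mxCkM oU) => //; exact: C0.
(* One constant for all the errors: the two outer terms bound the defect of the iterate and the
   effect of [A] on the distance to the limit, the middle one that distance. *)
set D := N%:R * (a * `|K0|) + `|K0| + N%:R * (a * `|K0|).
have KD : `|K0| <= D
by have p : 0 <= N%:R * (a * `|K0|); [rewrite !mulr_ge0|rewrite /D; move: p; lra].
have dPhi i u v x : U x -> derivable (fun y => Phi y u v) x (delta_mx 0 i) /\
 partial (fun y => Phi y u v) i x = (A i x *m Phi x) u v.
apply: (@uniform_derive_limit R n U (fun k y => Phi_ k y u v) (fun y => Phi y u v) D
 oU _ i (fun y => (A i y *m Phi y) u v)).
 - move=> k y Uy; apply: (@le_trans _ _ (`|K0| * 2^-1 ^+ k)).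
apply: le_trans _ (PhE k y Uy).
by have := normmx_ge (Phi y - Phi_ k y) u v; rewrite !mxE.
by rewrite ler_wpM2r// exprn_ge0// invr_ge0.
 - by move=> k; exact: (C1 (Phi_smooth k)).
 - by move=> y Uy; exact: Ck_cont (cAPhi i u v) y Uy.
 - move=> k y Uy; rewrite -(dmxE _ _ _ oU (C1 (Phi_smooth k)) Uy).
have -> : dmx (Phi_ k) i y u v - (A i y *m Phi y) u v =
 (E_ k i y - A i y *m (Phi y - Phi_ k y)) u v.
by rewrite /E_ mulmxBr [RHS]mxE [in RHS]mxE !mxE; ring.
apply: le_trans (normmx_ge _ _ _) _; apply: le_trans (ler_normB _ _) _.
apply: le_trans (lerD (E_bound k i Uy) (normmxM _ _)) _.
have h : N%:R * (`|A i y| * `|Phi y - Phi_ k y|) <= N%:R * (a * (`|K0| * 2^-1 ^+ k)).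
by rewrite ler_wpM2l// ler_pM// ?boundA// PhE.
apply: le_trans (lerD (lexx _) h) _.
rewrite /D; set dd := 2^-1 ^+ k.
have dd0 : 0 <= dd by rewrite exprn_ge0// invr_ge0.
have := mulr_ge0 (normr_ge0 K0) dd0.
rewrite !mulrDl !mulrA; lra.
have Phi1 : mxCk 1 U Phi.
move=> u v; split; first exact: cPhi.
move=> i; split=> [x Ux|]; first exact: (dPhi i u v x Ux).1.
by apply: (Ck_ext oU _ (cAPhi i u v)) => x Ux; rewrite (dPhi i u v x Ux).2.
have dPhiE x i : U x -> dmx Phi i x = A i x *m Phi x.
move=> Ux; apply/matrixP => u v; rewrite (dmxE _ _ _ oU Phi1 Ux).
exact: (dPhi i u v x Ux).2.
exists Phi; split=> //.
- apply: (mxsmooth_bootstrap oU Phi1) => k Phk i.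
apply: (mxCk_ext oU (F := fun y => A i y *m Phi y)); first by move=> x Ux; rewrite dPhiE.
by apply: (mxCkM oU) => //; exact: smooth_Ck.
- have U0 : U x0 by rewrite /U/= subrr normr0.
have Phi_0 k : Phi_ k x0 = K0.
case: k => //= k; rewrite /S big1 ?addr0// => j _.
by rewrite subrr mxE scale0r.
apply/matrixP => u v; apply/eqP; rewrite -subr_eq0 -normr_le0.
apply: (@le_geometric _ _ _ `|K0|) => k; rewrite add0r.
have := PhE k x0 U0; rewrite Phi_0; apply: le_trans.
by have := normmx_ge (Phi x0 - K0) u v; rewrite !mxE.
Qed.
End Frobenius.

Lemma frobenius (R : realType) (n N q : nat) (O : set 'rV[R]_n) (x0 : 'rV[R]_n)
 (A : 'I_n -> 'rV[R]_n -> 'M[R]_N) (K0 : 'M[R]_(N, q)) :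
 open O -> O x0 -> (forall i, mxsmooth O (A i)) ->
 (forall x i j, O x ->
 dmx (A j) i x + A j x *m A i x = dmx (A i) j x + A i x *m A j x) ->
 exists2 r, 0 < r & [set x | `|x - x0| < r] `<=` O /\
exists Phi : 'rV[R]_n -> 'M[R]_(N, q),
 [/\ mxsmooth [set x | `|x - x0| < r] Phi, Phi x0 = K0
 & forall x i, `|x - x0| < r -> dmx Phi i x = A i x *m Phi x].
move=> oO Ox0 sA flatA.
have : \forall y \near x0, O y by exact: open_nbhs_nbhs.
case/nbhs_normP => d /= d0 xd.
have inO x : `|x - x0| <= d / 2 -> O x.
move=> xr; apply: xd; rewrite /ball_/= distrC; apply: le_lt_trans xr _; lra.
have bA i : exists K, 0 <= K /\ forall x, `|x - x0| <= d / 2 -> `|A i x| <= K.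
have [x xr|K K0' HK] := @bounded_cball R n x0 (d / 2) (fun x => `|A i x|).
have c : {for x, continuous (A i)}.
by apply: (@mxCk_cont _ _ _ _ O _ 0); [move=> u v; exact: sA|exact: inO].
exact: cvg_norm c.
by exists K; split=> // x /HK; rewrite normr_id.
have [Kf HKf] := boolp.choice bA.
pose a := \sum_i Kf i.
have a0 : 0 <= a by apply: sumr_ge0 => i _; exact: (HKf i).1.
have boundA x i : `|x - x0| <= d / 2 -> `|A i x| <= a.
move=> xr; apply: le_trans ((HKf i).2 x xr) _; rewrite /a (bigD1 i)//= lerDl.
by apply: sumr_ge0 => l _; exact: (HKf l).1.
(* The second bound is the smallness condition of [frobenius_ball]; the summand 1 keeps the
   denominator positive when the coefficients vanish. *)
pose r := Num.min (d / 2) (8^-1 / (n%:R * (N%:R * a) + 1)).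
have c0 : 0 < n%:R * (N%:R * a) + 1 by rewrite ltr_wpDl// !mulr_ge0.
have r0 : 0 < r by rewrite lt_min !divr_gt0 ?invr_gt0.
have rd : r <= d / 2 by rewrite ge_min lexx.
have inO' x : `|x - x0| < r -> O x by move=> xr; apply: inO; exact: le_trans (ltW xr) rd.
exists r => //; split=> //.
have := @frobenius_ball R n N q x0 r A K0 _ _ a a0 _ _ r0; apply.
- by move=> i; exact: mxsmooth_sub inO' (sA i).
- by move=> x i j xr; apply: flatA; exact: inO'.
- by move=> x i xr; apply: boundA; exact: le_trans (ltW xr) rd.
- rewrite mulrCA.
have : r <= 8^-1 / (n%:R * (N%:R * a) + 1) by rewrite ge_min lexx orbT.
rewrite ler_pdivlMr//; apply: le_trans; rewrite ler_wpM2l ?ltW// ltrDl.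
exact: ltr01.
Qed.

Lemma near_ball (R : realType) (V : normedModType R) (x : V) (P : V -> Prop) :
 (\forall y \near x, P y) -> exists2 d, 0 < d & forall y, `|x - y| < d -> P y.
by move=> /nbhs_normP[d d0 H]; exists d. Qed.

(** * The Poincaré lemma for closed 2-forms on a ball *)

Section Poincare.
Variables (R : realType) (n : nat) (x0 : 'rV[R]_n) (r : R) (om : 'I_n -> 'I_n -> 'rV[R]_n -> R).
Let U := [set x : 'rV[R]_n | `|x - x0| < r].
Let oU : open U. exact: open_ball_norm. Qed.
Hypotheses (som : forall i j, smooth U (om i j)) (om_anti : forall i j x, U x -> om j i x = - om i j x).
Hypothesis om_closed : forall i j k x, U x ->
 partial (om i j) k x + partial (om j k) i x + partial (om k i) j x = 0.
(** The cone formula: contraction of the 2-form with the radial vector, averaged with weight [t]. *)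
Let th i x := \sum_j (x - x0) 0 j * radial x0 1 (om j i) x.

Lemma coordB_smooth j : smooth U (fun x => (x - x0) 0 j).
move=> k; apply: (Ck_ext oU _ (CkD oU (Ck_coord k U j) (Ck_cst k U (- x0 0 j)))).
by move=> x _; rewrite !mxE.
Qed.

Lemma partial_coordB i j x : partial (fun y => (y - x0) 0 j) i x = (i == j)%:R.
have oT := @openT 'rV[R]_n.
rewrite -[LHS](dmxE (U := setT) (F := fun y => y - x0) i 0 j oT _ I); last first.
move=> b c; rewrite ord1; apply: (Ck_ext oT _ (CkD oT (Ck_coord 1 _ c) (Ck_cst 1 _ (- x0 0 c)))).
by move=> y _; rewrite !mxE.
rewrite dmx_def deriveB; [|exact: derivable_id|exact: derivable_cst].
by rewrite derive_id derive_cst subr0 mxE eqxx eq_sym.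
Qed.

Lemma partialM (W : set 'rV[R]_n) f g i x : Ck 1 W f -> Ck 1 W g -> W x ->
 partial (fun y => f y * g y) i x = partial f i x * g x + f x * partial g i x.
move=> f1 g1 Wx; rewrite !partial_def.
exact: (derivable_mr (Ck_derivable f1 Wx) (Ck_derivable g1 Wx)).2.
Qed.

Lemma partial_sum (W : set 'rV[R]_n) m (f : 'I_m -> 'rV[R]_n -> R) i x :
 (forall j, Ck 1 W (f j)) -> W x ->
 partial (fun y => \sum_j f j y) i x = \sum_j partial (f j) i x.
move=> f1 Wx; rewrite partial_def (_ : (fun y => _) = \sum_j f j).
by rewrite derive_sum// => j; exact: Ck_derivable (f1 j) _ Wx.
by apply/funext => y; rewrite fct_sumE.
Qed.

(** Antisymmetry makes the two undifferentiated terms add up to twice a radial average. Closedness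
    turns the other two into the radial derivative of [om k i], and [radial_parts] with p = 1 has
    precisely the factor 2. *)
Lemma poincare : exists th : 'I_n -> 'rV[R]_n -> R,
 (forall i, smooth U (th i)) /\
 forall x i k, U x -> partial (th i) k x - partial (th k) i x = om k i x.
have c1 j : Ck 1 U (fun x => (x - x0) 0 j) by exact: coordB_smooth.
have r1 j i : Ck 1 U (radial x0 1 (om j i)) by exact: smooth_radial.
exists th; split.
move=> i k; rewrite /th; apply: Ck_sum => // j _; apply: (CkM oU); first exact: coordB_smooth.
exact: smooth_radial.
move=> x i k Ux.
have dth i' k' : partial (th i') k' x = radial x0 1 (om k' i') x +
 \sum_j (x - x0) 0 j * radial x0 2 (partial (om j i') k') x.
rewrite /th (partial_sum _ (fun j => CkM oU (c1 j) (r1 j i')) Ux).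
under eq_bigr => j _.
rewrite (partialM _ (c1 j) (r1 j i') Ux) partial_coordB.
rewrite (radial_derive 1 k' (som j i' 1) Ux).2; over.
rewrite big_split/=; congr (_ + _).
rewrite (bigD1 k')//= eqxx mul1r big1 ?addr0// => j jk.
by rewrite eq_sym (negbTE jk) mul0r.
rewrite !dth [RHS](radial_parts 1 (som k i 1) Ux).
have -> : radial x0 1 (om i k) x = - radial x0 1 (om k i) x.
rewrite -mulN1r -(@radialZ R n x0 r 1 (-1) (om k i) x (Ck_S (som k i 1)) Ux).
by apply: (@eq_radial _ _ _ r) => // y Uy; rewrite mulN1r (om_anti k i Uy).
have E : \sum_j (x - x0) 0 j * radial x0 2 (partial (om k i) j) x =
 \sum_j (x - x0) 0 j * radial x0 2 (partial (om j i) k) x -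
 \sum_j (x - x0) 0 j * radial x0 2 (partial (om j k) i) x.
rewrite -sumrB; apply: eq_bigr => j _; rewrite -mulrBr; congr (_ * _).
rewrite -[X in _ - X]mul1r -mulNr.
have ca a b l : Ck 0 U (partial (om a b) l) by exact: Ck_partial (som a b 1).
rewrite -(@radialZ R n x0 r 2 (-1) _ x (ca j k i) Ux).
have cm : Ck 0 U (fun y => -1 * partial (om j k) i y).
by apply: (CkM oU); [exact: Ck_cst|exact: ca].
rewrite -(@radialD R n x0 r 2 _ _ x (ca j i k) cm Ux).
apply: (@eq_radial _ _ _ r) => // y Uy; rewrite mulN1r.
have := om_closed j i k Uy.
have -> : partial (om i k) j y = - partial (om k i) j y.
rewrite (@partial_near _ _ _ (fun y => -1 * om k i y)); last first.
by apply: (open_near oU Uy) => z Uz; rewrite mulN1r (om_anti k i Uz).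
rewrite (partialM _ (Ck_cst 1 U (-1)) (som k i 1) Uy).
by rewrite [partial (cst _) _ _]partial_def derive_cst mul0r add0r mulN1r.
have -> : partial (om k j) i y = - partial (om j k) i y.
rewrite (@partial_near _ _ _ (fun y => -1 * om j k y)); last first.
by apply: (open_near oU Uy) => z Uz; rewrite mulN1r (om_anti j k Uz).
rewrite (partialM _ (Ck_cst 1 U (-1)) (som j k 1) Uy).
by rewrite [partial (cst _) _ _]partial_def derive_cst mul0r add0r mulN1r.
by move=> h; lra.
have alg (a s1 s2 s3 : R) : s3 = s1 - s2 -> a + s1 - (- a + s2) = 2 * a + s3.
by move=> ->; ring.
exact: (alg _ _ _ _ E).
Qed.
End Poincare.

(** * The inverse function theorem *)

Section InverseFunction.
Variables (R : realType) (n : nat).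

Lemma contraction_fixpoint (T : 'rV[R]_n -> 'rV[R]_n) x1 s :
 0 <= s -> (forall x, `|x - x1| <= s -> `|T x - x1| <= s) ->
 (forall x x', `|x - x1| <= s -> `|x' - x1| <= s ->
 `|T x - T x'| <= 2^-1 * `|x - x'|) ->
 exists2 x, `|x - x1| <= s & T x = x.
move=> s0 Ts cT; pose u k := iter k T x1.
have us k : `|u k - x1| <= s.
by elim: k => [|k IH] /=; [rewrite subrr normr0|exact: Ts].
have h20 k : 0 <= (2^-1 : R) ^+ k by rewrite exprn_ge0// invr_ge0.
have step k : `|u k.+1 - u k| <= s * 2^-1 ^+ k.
elim: k => [|k IH]; first by rewrite expr0 mulr1; exact: us 1%N.
apply: le_trans (cT _ _ (us k.+1) (us k)) _.
by rewrite exprS mulrCA ler_wpM2l// invr_ge0.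
have lim j : exists l, forall k, `|l - u k 0 j| <= s * 2 * 2^-1 ^+ k.
apply: geometric_limit => k; have := le_trans (normmx_ge _ 0 j) (step k).
rewrite !mxE => h; apply: le_trans h _; rewrite exprS -!mulrA ler_wpM2l//.
by rewrite mulrA divff ?mul1r.
have [l0 Hl] := boolp.choice lim; pose l : 'rV[R]_n := \row_j l0 j.
have lu k : `|l - u k| <= s * 2 * 2^-1 ^+ k.
by apply: normmx_le => [|i j]; [rewrite !mulr_ge0|rewrite ord1 !mxE; exact: Hl].
have ls : `|l - x1| <= s.
apply: (@le_geometric _ _ _ (s * 2)) => k.
have -> : l - x1 = (u k - x1) + (l - u k) by mxlin.
by apply: le_trans (ler_normD _ _) _; exact: lerD (us k) (lu k).
exists l => //; apply/eqP; rewrite -subr_eq0 -normr_le0.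
apply: (@le_geometric _ _ _ (s * 2)) => k; rewrite add0r.
have -> : T l - l = (T l - T (u k)) + (u k.+1 - l) by rewrite addrA subrK.
apply: le_trans (ler_normD _ _) _; rewrite [`|_ - l|]distrC.
apply: le_trans (lerD (cT _ _ ls (us k)) (lu k.+1)) _.
have := lu k; rewrite exprS; set d := `|l - u k|; set e := 2^-1 ^+ k => de.
have : 0 <= s * e by rewrite mulr_ge0// h20.
lra.
Qed.
Variables (O : set 'rV[R]_n) (g : 'rV[R]_n -> 'rV[R]_n) (x0 : 'rV[R]_n).
Hypotheses (oO : open O) (Ox0 : O x0) (sg : mxsmooth O g) (ug : 'J g x0 \in unitmx).
Let L := 'J g x0.
(** The simplified Newton map, whose differential vanishes at [x0]; solving [g x = y] amounts to
    finding a fixed point of its translate by [y *m invmx L]. *)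
Let k x := x - g x *m invmx L.
Let g1 : mxCk 1 O g. exact: smooth_Ck. Qed.
Let sk : mxsmooth O k.
apply: (mxsmoothB oO); first by move=> i j l; rewrite ord1; exact: Ck_coord.
by apply: (mxsmoothM oO) => //; exact: mxsmooth_cst.
Qed.
(** The factor [n] of [lipschitz_segment] times this bound is less than 1/2, so that [k] is a
    contraction of ratio 1/2 near [x0]. *)
Let k_small : exists2 r, 0 < r & forall x, `|x - x0| < r ->
 [/\ O x, 'J g x \in unitmx & forall i j,
 `|partial (fun y => k y 0 j) i x| <= (2 * n.+1%:R)^-1].
have k1 : mxCk 1 O k by exact: smooth_Ck.
have H1 : \forall x \near x0, O x by exact: open_nbhs_nbhs.
have H2 : \forall x \near x0, 'J g x \in unitmx.
have cd : {for x0, continuous (fun x => \det ('J g x))}.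
apply: (@Ck_cont _ _ 0 O) => //; apply: Ck_det => //.
by apply: mxCk_jac => //; exact: smooth_Ck.
have d0 : \det ('J g x0) != 0 by rewrite -unitfE -unitmxE.
have d1 : 0 < `|\det ('J g x0)| by rewrite normr_gt0.
have /cvgrPdist_lt/(_ _ d1) := cd; apply: filterS => x.
rewrite unitmxE unitfE => h.
have nz (a b : R) : `|a - b| < `|a| -> b != 0.
by move=> ab; apply/eqP => b0; move: ab; rewrite b0 subr0 ltxx.
exact: nz h.
have kz i j : partial (fun y => k y 0 j) i x0 = 0.
rewrite -(dmxE _ _ _ oO k1 Ox0) (dmxD i oO _ _ Ox0).
 - rewrite dmx_coord (dmxN i oO) //; last first.
by apply: (mxCkM oO) => //; exact: mxCk_cst.
rewrite (dmxM i oO g1 (mxCk_cst _ _ _) Ox0) dmx_cst mulmx0 addr0.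
by rewrite -(jac_row i oO g1 Ox0) -row_mul mulmxV// row1 subrr mxE.
 - by move=> a b; rewrite ord1; exact: Ck_coord.
 - by apply: (mxCkN oO); apply: (mxCkM oO) => //; exact: mxCk_cst.
have H3 : \forall x \near x0, forall ij : 'I_n * 'I_n,
 `|partial (fun y => k y 0 ij.2) ij.1 x| <= (2 * n.+1%:R)^-1.
apply: near_forall => -[i j] /=.
have cp : {for x0, continuous (partial (fun y => k y 0 j) i)}.
by apply: (@Ck_cont _ _ 0 O) => //; exact: Ck_partial (k1 0 j).
have e0 : 0 < (2 * n.+1%:R : R)^-1 by rewrite invr_gt0 mulr_gt0.
have /cvgrPdist_le/(_ _ e0) := cp; apply: filterS => x.
by rewrite kz sub0r normrN.
have [r r0 Hr] := near_ball (filterI H1 (filterI H2 H3)).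
exists r; first exact: r0.
move=> x xr; have xr' : `|x0 - x| < r by rewrite distrC.
have [h1 [h2 H]] := Hr x xr'.
by split=> // i j; exact: (H (i, j)).
Qed.

(** [V] is the image of a ball, open by the contraction principle. The contraction also makes [g]
    injective with Lipschitz inverse; the first-order expansion of [g] then differentiates the
    inverse, and the formula for its derivative bootstraps to smoothness. *)
Lemma inverse_function : exists U V h,
 [/\ [/\ open U, U x0, U `<=` O & forall x, U x -> 'J g x \in unitmx],
 open V, forall x, U x -> V (g x) /\ h (g x) = x,
 forall y, V y -> U (h y) /\ g (h y) = y & mxsmooth V h].
have [r r0 Hr] := k_small.
pose U := [set x : 'rV[R]_n | `|x - x0| < r].
have oU : open U by exact: open_ball_norm.
have lip x x' : U x -> U x' -> `|k x - k x'| <= 2^-1 * `|x - x'|.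
move=> Ux Ux'; apply: normmx_le => [|i j]; first by rewrite mulr_ge0// invr_ge0.
have seg (t : R) : 0 <= t <= 1 -> U (x' + t *: (x - x')).
move=> /andP[t0 t1]; rewrite /U/=.
have -> : x' + t *: (x - x') - x0 = (1 - t) *: (x' - x0) + t *: (x - x0).
by apply/rowP => a; rewrite !mxE; ring.
apply: le_lt_trans (ler_normD _ _) _; rewrite !normrZ !ger0_norm ?subr_ge0//.
have [t1'|t1'] := eqVneq t 1; first by rewrite t1' subrr mul0r add0r mul1r.
have -> : r = (1 - t) * r + t * r by ring.
apply: ltr_leD; last by rewrite ler_wpM2l// ltW.
by rewrite ltr_pM2l// subr_gt0 lt_neqAle t1'.
have := @lipschitz_segment R n U (fun y => k y 0 j) x' x (2 * n.+1%:R)^-1 oU _ seg _.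
rewrite ord1 !mxE => h; apply: le_trans (h _ _) _.
 - by move=> //; apply: Ck_sub (smooth_Ck 1 sk 0 j) => z /Hr[].
 - by move=> t l t01; have [_ _] := Hr _ (seg t t01); apply.
 - rewrite ler_wpM2r// ler_pdivrMr ?mulr_gt0// mulrA mulVf// mul1r ler_nat.
exact: leqnSn.
have inv_lip x x' : U x -> U x' -> `|x - x'| <= 2 * `|(g x - g x') *m invmx L|.
move=> Ux Ux'.
have : x - x' = (k x - k x') + (g x - g x') *m invmx L.
by rewrite /k mulmxBl; mxlin.
move=> E; have := lip x x' Ux Ux'.
have : `|x - x'| <= `|k x - k x'| + `|(g x - g x') *m invmx L|.
by rewrite [in leLHS]E; exact: ler_normD.
 lra.
pose V := [set y | exists2 x, U x & g x = y].
have cL (A : 'rV[R]_n) : A *m invmx L *m L = A by rewrite -mulmxA mulVmx// mulmx1.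
have oV : open V.
rewrite openE => _ [x1 Ux1 <-].
have /nbhs_normP[d /= d0 Hd] : \forall x \near x1, U x by exact: open_nbhs_nbhs.
pose s := d / 2; have s0 : 0 < s by rewrite divr_gt0.
have sU x : `|x - x1| <= s -> U x.
move=> xs; apply: Hd; rewrite /ball_/= distrC; apply: le_lt_trans xs _.
rewrite /s; lra.
pose c := n%:R * `|invmx L| + 1.
have c0 : 0 < c by rewrite ltr_wpDl// mulr_ge0.
suff : nbhs (g x1) V by [].
have sc : 0 < s / 2 / c by rewrite !divr_gt0.
apply: filterS (near_norm (g x1) sc) => y; rewrite ltr_pdivlMr// => yc.
have small : `|(y - g x1) *m invmx L| <= s / 2.
apply: le_trans (normmxM _ _) _; apply: ltW; apply: le_lt_trans yc.
rewrite distrC mulrCA ler_wpM2l// /c lerDl//.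
(* [T x = x] is equivalent to [g x = y], because [L] is invertible. *)
pose T x := k x + y *m invmx L.
have [||x xs xT] := @contraction_fixpoint T x1 s (ltW s0).
 - move=> x xs; have -> : T x - x1 = (k x - k x1) + (y - g x1) *m invmx L.
by rewrite /T /k mulmxBl; mxlin.
apply: le_trans (ler_normD _ _) _; apply: le_trans (lerD (lip _ _ (sU x xs) Ux1) small) _.
 lra.
 - move=> x x' xs x's; have -> : T x - T x' = k x - k x' by rewrite /T; mxlin.
by apply: lip; exact: sU.
exists x; first exact: sU.
have : y *m invmx L = g x *m invmx L.
apply/eqP; rewrite -subr_eq0 (_ : _ - _ = T x - x); first by rewrite xT subrr.
by rewrite /T /k; mxlin.
by move/(congr1 (fun A => A *m L)); rewrite !cL.
have exh y : exists x, V y -> U x /\ g x = y.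
have [[x Ux e]|nV] := pselect (V y); first by exists x.
by exists 0.
have [h Hh] := boolp.choice exh.
have inj x x' : U x -> U x' -> g x = g x' -> x = x'.
move=> Ux Ux' e; apply/eqP; rewrite -subr_eq0 -normr_le0.
by apply: le_trans (inv_lip _ _ Ux Ux') _; rewrite e subrr mul0mx normr0 mulr0.
have hg x : U x -> V (g x) /\ h (g x) = x.
move=> Ux; have Vx : V (g x) by exists x.
by split=> //; have [? ?] := Hh _ Vx; exact: inj.
pose C := 2 * (n%:R * `|invmx L|).
have C0 : 0 <= C by rewrite !mulr_ge0.
have hlip y y' : V y -> V y' -> `|h y - h y'| <= C * `|y - y'|.
move=> /Hh[Uh gh] /Hh[Uh' gh']; apply: le_trans (inv_lip _ _ Uh Uh') _.
rewrite gh gh' /C -mulrA ler_wpM2l// -mulrA [`|invmx L| * _]mulrC.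
exact: normmxM.
have ch y : V y -> {for y, continuous h}.
move=> Vy; apply: continuous_eps => e e0.
have c1 : 0 < e / (C + 1) by rewrite divr_gt0// ltr_wpDl.
have H1 : \forall z \near y, V z by exact: open_nbhs_nbhs.
apply: filterS (filterI H1 (near_norm y c1)) => z [Vz yz].
apply: le_trans (hlip _ _ Vy Vz) _; move: yz; rewrite ltr_pdivlMr ?ltr_wpDl// => yz.
by apply: le_trans (ltW yz); rewrite mulrC ler_wpM2l// lerDl.
have dh y i : V y -> derivable h y (delta_mx 0 i) /\
 'D_(delta_mx 0 i) h y = row i (invmx ('J g (h y))).
move=> Vy; have [Uh gh] := Hh _ Vy.
have [Oh uh _] := Hr _ Uh.
set Jx := 'J g (h y) in uh *.
suff H : (fun t : R => t^-1 *: ((h \o shift y) (t *: (delta_mx 0 i : 'rV[R]_n)) - h y))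
 @ 0^' --> row i (invmx Jx).
by split; [apply/cvg_ex; exists (row i (invmx Jx))|exact: cvg_lim H].
apply/cvgrPdist_le => e e0.
pose c := n%:R * C * `|invmx Jx| + 1.
have c0 : 0 < c by rewrite ltr_wpDl// !mulr_ge0.
have ec : 0 < e / c by rewrite divr_gt0.
have H0 : \forall z \near (0 : 'rV[R]_n), forall j,
 `|g (h y + z) 0 j - g (h y) 0 j - \sum_l z 0 l * partial (fun x => g x 0 j) l (h y)|
 <= e / c * `|z|.
apply: near_forall => j; have [d d0 Hd] := C1_approx oO (g1 0 j) Oh ec.
apply/nbhs_normP; exists d => // z; rewrite /ball_/= sub0r normrN; exact: Hd.
case/nbhs_normP : H0 => d /= d0 Hd.
have : \forall z \near y, V z by exact: open_nbhs_nbhs.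
case/nbhs_normP => d' /= d'0 Hd'.
have dl1 : `|delta_mx 0 i : 'rV[R]_n| <= 1.
apply: normmx_le => // a b; rewrite mxE ord1/=.
by case: eqP => _; rewrite ?normr1 ?normr0.
have m0 : 0 < Num.min d' (d / (C + 1)) by rewrite lt_min d'0 divr_gt0// ltr_wpDl.
near=> t.
have t0 : t != 0 by near: t; exact: nbhs_dnbhs_neq.
have : `|t| < Num.min d' (d / (C + 1)) by near: t; exact: dnbhs0_lt.
rewrite lt_min => /andP[td' td].
have tl : `|t *: (delta_mx 0 i : 'rV[R]_n)| <= `|t|.
by rewrite normrZ -[leRHS]mulr1 ler_wpM2l.
rewrite /= [_ + y]addrC; set y' := y + t *: _.
have Vy' : V y'.
by apply: Hd'; rewrite /ball_/= /y' opprD addrA subrr sub0r normrN; exact: le_lt_trans td'.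
have [Uh' gh'] := Hh _ Vy'.
pose z := h y' - h y.
have zC : `|z| <= C * `|t|.
apply: le_trans (hlip _ _ Vy' Vy) _; rewrite ler_wpM2l//.
by rewrite /y' addrAC subrr add0r.
have zd : `|z| < d.
apply: le_lt_trans zC _; move: td; rewrite ltr_pdivlMr ?ltr_wpDl// => td.
by apply: le_lt_trans td; rewrite mulrC ler_wpM2l// lerDl.
(* The expansion of [g] at [h y] along [z], whose image under [g] is known to be the displacement
   from [y] to [y']; by [zC] the error is o(t). *)
have key : `|t *: delta_mx 0 i - z *m Jx| <= e / c * `|z|.
apply: normmx_le => [|a j]; first by rewrite mulr_ge0// ltW.
have := Hd z; rewrite /ball_/= sub0r normrN => /(_ zd j).
have -> : h y + z = h y' by rewrite /z addrC subrK.
rewrite gh gh' ord1; congr (`|_| <= _).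
have [_ JE _] := row_mulE 0 oO Oh (g1 0).
rewrite /Jx JE /y' !mxE; congr (_ - _); first by rewrite addrAC subrr add0r.
by apply: eq_bigr => l _; rewrite !mxE.
have -> : row i (invmx Jx) - t^-1 *: (h y' - h y) =
 t^-1 *: ((t *: delta_mx 0 i - z *m Jx) *m invmx Jx).
have e1 : (t *: delta_mx 0 i - z *m Jx) *m invmx Jx = t *: row i (invmx Jx) - z.
by rewrite mulmxBl -mulmxA mulmxV// mulmx1 -scalemxAl -rowE.
by rewrite e1 [RHS]scalerBr scalerA mulVf// scale1r.
rewrite normrZ normfV mulrC ler_pdivrMr ?normr_gt0//.
apply: le_trans (normmxM _ _) _.
have h1 : n%:R * (`|t *: delta_mx 0 i - z *m Jx| * `|invmx Jx|) <=
 n%:R * (e / c * (C * `|t|) * `|invmx Jx|).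
rewrite ler_wpM2l// ler_wpM2r//; apply: le_trans key _; rewrite ler_wpM2l// ltW//.
apply: le_trans h1 _.
have -> : n%:R * (e / c * (C * `|t|) * `|invmx Jx|) =
 (n%:R * C * `|invmx Jx|) / c * (e * `|t|) by field; rewrite gt_eqF.
by rewrite ler_piMl ?mulr_ge0// ?ltW// ltr_pdivrMr// mul1r /c ltrDl.
have h1 : mxCk 1 V h.
move=> a j; split=> [y Vy|i].
apply: (@continuous_comp _ _ _ h (fun x : 'rV[R]_n => x a j)); first exact: ch.
exact: coord_continuous.
split=> [y Vy|]; first exact: (derivable_mxP _ _ _).1 (dh y i Vy).1 a j.
apply: (@Ck_ext _ _ _ _ (fun y => invmx ('J g (h y)) i j)) => //.
move=> y Vy; rewrite partial_def (derivable_comp1 _ _ (dh y i Vy).1).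
by rewrite (dh y i Vy).2 ord1 mxE.
split=> // y Vy; have [Uh gh] := Hh _ Vy.
have cV : {for h y, continuous (fun x => invmx ('J g x) i j)}.
have iC : mxCk 0 U (fun x => invmx ('J g x)).
apply: (mxCkV oU); first by move=> x /Hr[].
apply: mxCk_sub (mxCk_jac oO (smooth_Ck 1 sg)); by move=> x /Hr[].
exact: Ck_cont (iC i j) _ Uh.
by apply: (@continuous_comp _ _ _ h (fun x => invmx ('J g x) i j)); [exact: ch|].
exists U, V, h; split; [|exact: oV|exact: hg|exact: Hh|].
- split; first exact: oU.
 + by rewrite /U/= subrr normr0.
 + by move=> x xr; have [] := Hr x xr.
 + by move=> x xr; have [] := Hr x xr.
- apply: (mxsmooth_bootstrap oV h1) => l hl i.
apply: (mxCk_ext oV (F := fun y => row i (invmx ('J g (h y))))).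
by move=> y Vy; rewrite dmx_def (dh y i Vy).2.
have HC : mxCk l V (fun y => invmx ('J g (h y))).
have UJ : mxCk l U (fun x => invmx ('J g x)).
apply: (mxCkV oU); first by move=> x xr; have [] := Hr x xr.
apply: mxCk_sub (mxCk_jac oO (smooth_Ck l.+1 sg)); by move=> x xr; have [] := Hr x xr.
by apply: (mxCk_comp oV oU _ hl UJ) => y /Hh[].
by move=> a j; apply: Ck_ext (HC i j) => // y _; rewrite mxE.
Unshelve. all: by end_near. Qed.
End InverseFunction.

(** * The Levi-Civita connection, its curvature and the Kähler identities *)

Section LinearRules.
Variables (R : pzRingType) (p q : nat).
Implicit Types A B : 'M[R]_(p, q).

Lemma rowD i A B : row i (A + B) = row i A + row i B. exact: linearD. Qed.
Lemma rowN i A : row i (- A) = - row i A. exact: linearN. Qed.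
Lemma trmxD A B : (A + B)^T = A^T + B^T. exact: linearD. Qed.
Lemma trmxN A : (- A)^T = - A^T. exact: linearN. Qed.
Lemma trmxZ a A : (a *: A)^T = a *: A^T. exact: linearZ. Qed.
End LinearRules.

(* Row [j] of [conn c i x] gives the components of nabla_{d_i} d_j. *)
HB.lock Definition conn (R : realType) n (M : riemData R n) (c : chart M)
 (i : 'I_n) (x : 'rV[R]_n) : 'M[R]_n := \matrix_(j, l) christoffel c l i j x.

(* The entry (l, p) of [curvmx c i j x] is the component along d_p of
 R(d_i, d_j) d_l. *)
HB.lock Definition curvmx (R : realType) n (M : riemData R n) (c : chart M)
 (i j : 'I_n) (x : 'rV[R]_n) : 'M[R]_n :=
 dmx (conn c j) i x - dmx (conn c i) j x +
 (conn c j x *m conn c i x - conn c i x *m conn c j x).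

Section LeviCivita.
Variables (R : realType) (n : nat) (M : riemData R n).
Hypotheses (RM : riemannian M).
Implicit Types (c : chart M) (x : 'rV[R]_n).

Lemma open_cimg c : open (cimg c). exact: riem_open_img RM c. Qed.
Lemma metric_smooth c : mxsmooth (cimg c) (metric c).
by move=> i j; exact: (riem_metric_smooth RM). Qed.
Lemma metric_sym c x : cimg c x -> (metric c x)^T = metric c x.
exact: riem_metric_sym. Qed.
Lemma metric_unit c x : cimg c x -> metric c x \in unitmx.
move=> cx; rewrite -row_free_unit -kermx_eq0; apply/eqP/row_matrixP => i.
rewrite row0; apply/eqP; apply: contraT => v0.
have := riem_metric_pos RM cx v0.
by rewrite -row_mul mulmx_ker row0 mul0mx mxE ltxx.
Qed.

Lemma smooth_entry c i j : smooth (cimg c) (fun x => metric c x i j).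
exact: (riem_metric_smooth RM). Qed.
Lemma connE c i x j l : conn c i x j l = christoffel c l i j x.
by rewrite conn.unlock mxE. Qed.
Lemma conn_smooth c i : mxsmooth (cimg c) (conn c i).
move=> j l k; have oU := @open_cimg c.
apply: (Ck_ext oU (f := christoffel c l i j)); first by move=> x _; rewrite connE.
apply: (CkM oU); first exact: Ck_cst.
have sP a b d : Ck k (cimg c) (partial (fun y => metric c y a b) d).
exact: (smooth_partial d (@smooth_entry c a b)).
apply: Ck_sum => // a _; apply: (CkM oU).
exact: (mxsmoothV oU (@metric_unit c) (@metric_smooth c)).
apply: (CkD oU (f := fun x => _ + _)); first exact: (CkD oU).
by apply: (Ck_ext oU _ (CkM oU (Ck_cst k _ (-1)) (sP i j a))) => x _; exact: mulN1r.
Qed.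

Lemma partial_metric_sym c x i j k : cimg c x ->
 partial (fun y => metric c y i j) k x = partial (fun y => metric c y j i) k x.
move=> cx; apply: partial_near; apply: (open_near (@open_cimg c) cx) => y cy.
by rewrite -{1}(metric_sym cy) mxE.
Qed.

(** Lowering the upper index cancels the inverse metric and leaves the Koszul formula. *)
Lemma conn_metric_entry c x i j k : cimg c x ->
 (conn c i x *m metric c x) j k = 2^-1 *
 (partial (fun y => metric c y j k) i x + partial (fun y => metric c y i k) j x -
 partial (fun y => metric c y i j) k x).
move=> cx.
pose w : 'rV[R]_n := \row_l (partial (fun y => metric c y j l) i x +
 partial (fun y => metric c y i l) j x - partial (fun y => metric c y i j) l x).
have -> : (conn c i x *m metric c x) j k = (2^-1 *: w *m invmx (metric c x) *m metric c x) 0 k.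
rewrite [LHS]mxE [RHS]mxE; apply: eq_bigr => l _; congr (_ * _).
rewrite connE /christoffel -scalemxAl [RHS]mxE; congr (_ * _).
rewrite [RHS]mxE; apply: eq_bigr => a _; rewrite [in RHS]mxE mulrC; congr (_ * _).
have -> : invmx (metric c x) a l = (invmx (metric c x))^T l a by rewrite mxE.
by rewrite trmx_inv (metric_sym cx).
by rewrite -mulmxA mulVmx ?mulmx1 ?metric_unit// !mxE.
Qed.

Lemma conn_torsion c x i j l : cimg c x -> conn c i x j l = conn c j x i l.
move=> cx; rewrite !connE /christoffel; congr (_ * _); apply: eq_bigr => a _.
congr (_ * _); rewrite (partial_metric_sym i j a cx); congr (_ - _).
exact: addrC.
Qed.

Lemma conn_torsion_row c x i j : cimg c x -> row j (conn c i x) = row i (conn c j x).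
by move=> cx; apply/rowP => l; rewrite [LHS]mxE [RHS]mxE; exact: conn_torsion. Qed.
Lemma metric_C1 c : mxCk 1 (cimg c) (metric c).
exact: smooth_Ck (@metric_smooth c). Qed.
Lemma conn_C1 c i : mxCk 1 (cimg c) (conn c i).
exact: smooth_Ck (@conn_smooth c i). Qed.
Lemma conn_metric c x i : cimg c x ->
 dmx (metric c) i x = conn c i x *m metric c x + metric c x *m (conn c i x)^T.
move=> cx; apply/matrixP => j k.
rewrite (dmxE _ _ _ (@open_cimg c) (@metric_C1 c) cx) addmxE.
have -> : (metric c x *m (conn c i x)^T) j k = (conn c i x *m metric c x) k j.
by rewrite -{1}(metric_sym cx) -trmx_mul mxE.
rewrite !conn_metric_entry// (partial_metric_sym k j i cx).
by field.
Qed.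

(* The Koszul argument: a tensor symmetric in its first two arguments and
 antisymmetric in its last two vanishes. *)
Lemma conn_unique c x (G : 'I_n -> 'M[R]_n) : cimg c x ->
 (forall i j, row j (G i) = row i (G j)) ->
 (forall i, dmx (metric c) i x = G i *m metric c x + metric c x *m (G i)^T) ->
 forall i, G i = conn c i x.
move=> cx tG mG i0.
pose B i j k := ((G i - conn c i x) *m metric c x) j k.
have B1 i j k : B i j k = B j i k.
have h : row j (G i - conn c i x) = row i (G j - conn c j x).
by rewrite !rowD !rowN tG (conn_torsion_row _ _ cx).
have := congr1 (fun v => (v *m metric c x) 0 k) h.
by rewrite -!row_mul [LHS]mxE [RHS]mxE.
have B2 i j k : B i j k = - B i k j.
have e : (G i - conn c i x) *m metric c x +
 ((G i - conn c i x) *m metric c x)^T = 0.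
rewrite trmx_mul (metric_sym cx) mulmxBl trmxD trmxN mulmxBr.
have := mG i; rewrite (conn_metric i cx) => e.
rewrite addrACA -opprD -e; exact: subrr.
have := congr1 (fun A : 'M[R]_n => A j k) e; rewrite addmxE zeromxE.
have -> : ((G i - conn c i x) *m metric c x)^T j k = B i k j by rewrite mxE.
by move/eqP; rewrite addr_eq0 => /eqP.
have B0 i j k : B i j k = 0.
have e : B i j k = - B i j k.
by rewrite {1}B2 B1 B2 opprK B1 B2 B1.
by move: e; lra.
have : (G i0 - conn c i0 x) *m metric c x = 0 by apply/matrixP => j k; rewrite [RHS]mxE; exact: B0.
move/(congr1 (fun A => A *m invmx (metric c x))).
by rewrite mul0mx mulmxK ?metric_unit// => /subr0_eq.
Qed.

Lemma curvmx_def c i j x : curvmx c i j x =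
 dmx (conn c j) i x - dmx (conn c i) j x +
 (conn c j x *m conn c i x - conn c i x *m conn c j x).
by rewrite curvmx.unlock. Qed.
Lemma curvmxE c i j x l p : cimg c x -> curvmx c i j x l p = curv c p l i j x.
move=> cx; rewrite curvmx_def /curv !(addmxE, oppmxE).
rewrite !(dmxE _ _ _ (@open_cimg c) (@conn_C1 c _) cx) [X in _ + (X - _)]mxE.
rewrite [X in _ + (_ - X)]mxE -sumrB.
have E a b d : partial (fun y => conn c a y b d) = partial (christoffel c d a b).
by congr partial; apply/funext => y; rewrite connE.
rewrite !E; congr (_ + _); apply: eq_bigr => q _; rewrite !connE.
by rewrite mulrC; congr (_ - _); exact: mulrC.
Qed.

Lemma riemE c i j k l x : cimg c x ->
 riem c i j k l x = (curvmx c i j x *m metric c x) l k.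
move=> cx; rewrite mxE; apply: eq_bigr => p _; rewrite curvmxE// mulrC.
by congr (_ * _); rewrite -[in LHS](metric_sym cx) mxE.
Qed.

Lemma curvmx_anti c i j x : curvmx c j i x = - curvmx c i j x.
by rewrite !curvmx_def; mxlin. Qed.
Lemma dmx_conn_tors c x i l k : cimg c x ->
 row l (dmx (conn c i) k x) = row i (dmx (conn c l) k x).
move=> cx; apply/rowP => p; rewrite [LHS]mxE [RHS]mxE.
rewrite !(dmxE _ _ _ (@open_cimg c) (@conn_C1 c _) cx).
by apply: partial_near; apply: (open_near (@open_cimg c) cx) => y cy; exact: conn_torsion.
Qed.

(** Torsion-freeness exchanges the row index with the index of the connection matrix, also after
    differentiation; the cyclic sum then cancels term by term. *)
Lemma bianchi1 c x i j l : cimg c x ->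
 row l (curvmx c i j x) + row i (curvmx c j l x) + row j (curvmx c l i x) = 0.
move=> cx; rewrite !curvmx_def !(rowD, rowN) !row_mul.
rewrite (dmx_conn_tors i l j cx) (dmx_conn_tors l j i cx) (dmx_conn_tors i j l cx).
rewrite (conn_torsion_row i l cx) (conn_torsion_row j l cx) (conn_torsion_row i j cx).
by mxlin.
Qed.

(** Differentiate the compatibility of the metric with the connection once more: the second
    derivatives of the metric commute, and the commutator is this expression. *)
Lemma curvmx_skew c x i j : cimg c x ->
 curvmx c i j x *m metric c x + metric c x *m (curvmx c i j x)^T = 0.
move=> cx; have oU := @open_cimg c.
have g1 := @metric_C1 c.
have dd a b : dmx (dmx (metric c) a) b x =
 dmx (conn c a) b x *m metric c x + conn c a x *m dmx (metric c) b x +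
 (dmx (metric c) b x *m (conn c a x)^T + metric c x *m (dmx (conn c a) b x)^T).
rewrite (dmx_open _ oU (G := fun y => conn c a y *m metric c y + metric c y *m (conn c a y)^T))//.
rewrite (dmxD b oU _ _ cx).
 - rewrite (dmxM b oU (@conn_C1 c a) g1 cx) (dmxM b oU g1 _ cx).
by rewrite (dmx_tr b oU (@conn_C1 c a) cx).
exact: mxCk_tr (@conn_C1 c a).
 - exact: mxCkM (@conn_C1 c a) g1.
 - by apply: (mxCkM oU g1); exact: mxCk_tr (@conn_C1 c a).
by move=> y cy; exact: conn_metric.
have := dmx_Schwarz i j oU (smooth_Ck 2 (@metric_smooth c)) cx.
rewrite !dd (conn_metric i cx) (conn_metric j cx) !curvmx_def !(trmxD, trmxN) !trmx_mul.
rewrite !(mulmxDl, mulmxDr, mulNmx, mulmxN, mulmxA) => e.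
move/eqP: e; rewrite -subr_eq0 => /eqP e; rewrite -[RHS]oppr0 -[in RHS]e.
by clear e; mxlin.
Qed.

Lemma dmx_curvmx c x i j k : cimg c x -> dmx (curvmx c i j) k x =
 dmx (dmx (conn c j) i) k x - dmx (dmx (conn c i) j) k x +
 (dmx (conn c j) k x *m conn c i x + conn c j x *m dmx (conn c i) k x -
 (dmx (conn c i) k x *m conn c j x + conn c i x *m dmx (conn c j) k x)).
move=> cx; have oU := @open_cimg c.
have s a := @conn_smooth c a.
have sd a b : mxsmooth (cimg c) (dmx (conn c a) b) by exact: (mxsmooth_dmx oU).
have sM a b : mxsmooth (cimg c) (fun y => conn c a y *m conn c b y) by exact: (mxsmoothM oU).
rewrite curvmx.unlock (dmxD k oU _ _ cx).
- rewrite (dmxD k oU _ _ cx).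
 + rewrite (dmxN k oU _ cx); last exact/smooth_Ck/sd.
rewrite (dmxD k oU _ _ cx).
 * rewrite (dmxN k oU _ cx); last exact/smooth_Ck/sM.
by rewrite !(dmxM k oU (@conn_C1 c _) (@conn_C1 c _) cx).
 * exact/smooth_Ck/sM.
 * by apply: smooth_Ck; exact: (mxsmoothN oU).
 + exact/smooth_Ck/sd.
 + by apply: smooth_Ck; exact: (mxsmoothN oU).
- by apply: smooth_Ck; exact: (mxsmoothB oU).
- by apply: smooth_Ck; exact: (mxsmoothB oU).
Qed.

(** The covariant derivative of the curvature as an endomorphism: the Christoffel terms acting on
    the form indices [i] and [j] are left out, as they cancel in cyclic sums. *)
Definition covcurv c i j k x := dmx (curvmx c i j) k x +
 (curvmx c i j x *m conn c k x - conn c k x *m curvmx c i j x).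

Lemma bianchi2 c x i j k : cimg c x ->
 covcurv c i j k x + covcurv c j k i x + covcurv c k i j x = 0.
move=> cx; have oU := @open_cimg c; rewrite /covcurv !(dmx_curvmx _ _ _ cx).
have sch a b d := dmx_Schwarz b d oU (smooth_Ck 2 (@conn_smooth c a)) cx.
rewrite (sch j i k) (sch k j i) (sch i k j) !curvmx_def.
rewrite !(mulmxDl, mulmxDr, mulNmx, mulmxN, mulmxA).
by mxlin.
Qed.

Section Kahler.
Variables (J : chart M -> 'rV[R]_n -> 'M[R]_n).
Hypotheses (KJ : kahler J).

Lemma J_smooth c : mxsmooth (cimg c) (J c).
by move=> i j; exact: (kahler_smooth KJ). Qed.
Lemma J_C1 c : mxCk 1 (cimg c) (J c).
exact: smooth_Ck (@J_smooth c). Qed.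
Lemma J_sq c x : cimg c x -> J c x *m J c x = - 1%:M.
exact: kahler_square. Qed.
Lemma J_herm c x : cimg c x -> J c x *m metric c x *m (J c x)^T = metric c x.
exact: kahler_hermitian. Qed.
Lemma dJ c x k : cimg c x ->
 dmx (J c) k x = conn c k x *m J c x - J c x *m conn c k x.
move=> cx; apply/matrixP => i j.
rewrite (dmxE _ _ _ (@open_cimg c) (@J_C1 c) cx) addmxE oppmxE [in RHS]mxE [in X in - X]mxE.
have := kahler_parallel KJ cx k i j; rewrite sumrB => /eqP.
rewrite addr_eq0 opprB => /eqP ->.
by congr (_ - _); apply: eq_bigr => l _; rewrite connE.
Qed.

(** The same argument as for the metric: the second derivatives of the parallel tensor [J]
    commute. *)
Lemma curvmxJ c x i j : cimg c x -> curvmx c i j x *m J c x = J c x *m curvmx c i j x.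
move=> cx; have oU := @open_cimg c.
have J1 := @J_C1 c.
have dd a b : dmx (dmx (J c) a) b x =
 dmx (conn c a) b x *m J c x + conn c a x *m dmx (J c) b x -
 (dmx (J c) b x *m conn c a x + J c x *m dmx (conn c a) b x).
rewrite (dmx_open _ oU (G := fun y => conn c a y *m J c y + - (J c y *m conn c a y)))//.
rewrite (dmxD b oU _ _ cx).
 - rewrite (dmxN b oU _ cx); last exact: mxCkM J1 (@conn_C1 c a).
by rewrite (dmxM b oU (@conn_C1 c a) J1 cx) (dmxM b oU J1 (@conn_C1 c a) cx).
 - exact: mxCkM (@conn_C1 c a) J1.
 - by apply: (mxCkN oU); exact: mxCkM J1 (@conn_C1 c a).
by move=> y cy; exact: dJ.
have := dmx_Schwarz i j oU (smooth_Ck 2 (@J_smooth c)) cx.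
rewrite !dd !(dJ _ cx) !curvmx_def.
rewrite !(mulmxDl, mulmxDr, mulNmx, mulmxN, mulmxA) => e.
apply/eqP; rewrite -subr_eq0; apply/eqP.
move/eqP: e; rewrite -subr_eq0 => /eqP e; rewrite -[RHS]oppr0 -[in RHS]e.
by clear e; mxlin.
Qed.

(** The Kähler form, (u, v) |-> g(J u, v). *)
Definition kform c x : 'M[R]_n := J c x *m metric c x.

Lemma metricJT c x : cimg c x -> metric c x *m (J c x)^T = - kform c x.
move=> cx; rewrite -[in LHS](J_herm cx) -!mulmxA -trmx_mul J_sq//.
by rewrite linearN/= trmx1 !mulmxN mulmx1.
Qed.

Lemma kform_anti c x : cimg c x -> (kform c x)^T = - kform c x.
by move=> cx; rewrite /kform trmx_mul (metric_sym cx) metricJT. Qed.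
Lemma kform_smooth c : mxsmooth (cimg c) (kform c).
by apply: (mxsmoothM (@open_cimg c)); [exact: J_smooth|exact: metric_smooth]. Qed.
Lemma kform_unit c x : cimg c x -> kform c x \in unitmx.
move=> cx; rewrite unitmx_mul metric_unit// andbT.
by apply: (mulmx1_unit (B := - J c x) _).1; rewrite mulmxN J_sq// opprK.
Qed.

Lemma dkform c x k : cimg c x ->
 dmx (kform c) k x = conn c k x *m kform c x + kform c x *m (conn c k x)^T.
move=> cx; rewrite (dmxM k (@open_cimg c) (@J_C1 c) (@metric_C1 c) cx).
rewrite (dJ _ cx) (conn_metric _ cx) /kform !(mulmxDl, mulmxDr, mulNmx, mulmxN, mulmxA).
by mxlin.
Qed.

(** A parallel 2-form of a torsion-free connection is closed: the six Christoffel terms cancel in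
    pairs. *)
Lemma kform_closed c x i j k : cimg c x ->
 dmx (kform c) k x i j + dmx (kform c) i x j k + dmx (kform c) j x k i = 0.
move=> cx; rewrite !(dkform _ cx) !addmxE.
have E a b d : (kform c x *m (conn c a x)^T) b d = - (conn c a x *m kform c x) d b.
by rewrite -[kform c x in LHS]trmxK (kform_anti cx) trmxN mulNmx -trmx_mul oppmxE mxE.
rewrite !E; have T a b d : (conn c a x *m kform c x) b d = (conn c b x *m kform c x) a d.
have := congr1 (fun v => (v *m kform c x) 0 d) (conn_torsion_row a b cx).
by rewrite -!row_mul [LHS]mxE [RHS]mxE.
rewrite (T k i j) (T i j k) (T j k i); ring.
Qed.

(** The trace is a multiple of the Ricci form. Since [J] is parallel its derivative is that of
    [covcurv] traced against [J], and the second Bianchi identity applies. *)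
Lemma trace_curvmx_closed c x i j k : cimg c x ->
 partial (fun y => \tr (curvmx c i j y *m J c y)) k x +
 partial (fun y => \tr (curvmx c j k y *m J c y)) i x +
 partial (fun y => \tr (curvmx c k i y *m J c y)) j x = 0.
move=> cx; have oU := @open_cimg c.
have s a := @conn_smooth c a.
have sF a b : mxsmooth (cimg c) (curvmx c a b).
rewrite curvmx.unlock; apply: (mxsmoothD oU); first by apply: (mxsmoothB oU); exact: (mxsmooth_dmx oU).
by apply: (mxsmoothB oU); exact: (mxsmoothM oU).
have sFJ a b : mxsmooth (cimg c) (fun y => curvmx c a b y *m J c y).
by apply: (mxsmoothM oU) => //; exact: J_smooth.
have E a b d : partial (fun y => \tr (curvmx c a b y *m J c y)) d x =
 \tr (covcurv c a b d x *m J c x).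
rewrite (partial_sum _ (fun l => sFJ a b l l 1) cx).
under eq_bigr do rewrite -(dmxE _ _ _ oU (smooth_Ck 1 (sFJ a b)) cx).
rewrite -/(\tr _) (dmxM d oU (smooth_Ck 1 (sF a b)) (@J_C1 c) cx) dJ//.
rewrite /covcurv !mulmxDl !mulmxBr mulNmx !mxtraceD !raddfN/= !mulmxA.
congr (_ + (_ - _)).
by rewrite mxtrace_mulC mulmxA.
by rewrite !E -!linearD/= -!mulmxDl bianchi2// mul0mx linear0.
Qed.
End Kahler.
End LeviCivita.

(** * Algebraic Kähler curvature tensors and the model tensor *)

Section CurvatureLike.
Variables (R : realType) (n : nat) (J : 'M[R]_n).
Hypotheses (JJ : J *m J = - 1%:M).
Implicit Types (D : 'rV[R]_n -> 'rV[R]_n -> 'rV[R]_n -> 'rV[R]_n -> R) (u v w z : 'rV[R]_n).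

Record curvlike D : Prop := Curvlike {
 cl_add : forall u u' v w z, D (u + u') v w z = D u v w z + D u' v w z;
 cl_scale : forall a u v w z, D (a *: u) v w z = a * D u v w z;
 cl_12 : forall u v w z, D v u w z = - D u v w z;
 cl_34 : forall u v w z, D u v z w = - D u v w z;
 cl_bianchi : forall u v w z, D u v w z + D v w u z + D w u v z = 0;
 cl_J : forall u v w z, D u v (w *m J) (z *m J) = D u v w z
}.
Variables (D : 'rV[R]_n -> 'rV[R]_n -> 'rV[R]_n -> 'rV[R]_n -> R).
Hypotheses (HD : curvlike D).

Lemma cl_pair u v w z : D u v w z = D w z u v.
have a := cl_12 HD; have s := cl_34 HD; have b := cl_bianchi HD.
have := b u v w z; have := b v w z u; have := b w z u v; have := b z u v w.
have := a u w v z; have := s v w u z; have := s w z u v; have := a v z w u.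
have := s v z u w; have := a u z w v; have := s u z v w; have := s u w v z.
have := a u z v w; have := s u v w z.
lra.
Qed.

Lemma cl_add2 u v v' w z : D u (v + v') w z = D u v w z + D u v' w z.
by rewrite (cl_12 HD) (cl_add HD) opprD -!(cl_12 HD). Qed.
Lemma cl_add3 u v w w' z : D u v (w + w') z = D u v w z + D u v w' z.
by rewrite cl_pair (cl_add HD) -!(cl_pair u v). Qed.
Lemma cl_add4 u v w z z' : D u v w (z + z') = D u v w z + D u v w z'.
by rewrite cl_pair cl_add2 -!(cl_pair u v). Qed.
Lemma cl_opp1 u v w z : D (- u) v w z = - D u v w z.
by rewrite -scaleN1r (cl_scale HD) mulN1r. Qed.
Lemma cl_opp2 u v w z : D u (- v) w z = - D u v w z.
by rewrite (cl_12 HD) cl_opp1 -(cl_12 HD). Qed.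
Lemma cl_opp3 u v w z : D u v (- w) z = - D u v w z.
by rewrite cl_pair cl_opp1 -cl_pair. Qed.
Lemma cl_opp4 u v w z : D u v w (- z) = - D u v w z.
by rewrite cl_pair cl_opp2 -cl_pair. Qed.
Definition cl_lin := (cl_add HD, cl_add2, cl_add3, cl_add4, cl_opp1, cl_opp2, cl_opp3, cl_opp4).

Lemma cl_J12 u v w z : D (u *m J) (v *m J) w z = D u v w z.
by rewrite cl_pair (cl_J HD) -cl_pair. Qed.
Lemma mulJJ u : u *m J *m J = - u.
by rewrite -mulmxA JJ mulmxN mulmx1. Qed.

(* Polarization: the holomorphic sectional curvature determines the tensor. *)
Lemma curvlike_hol0 : (forall u, D u (u *m J) u (u *m J) = 0) ->
 forall u v w z, D u v w z = 0.
move=> hol.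
have a := cl_12 HD; have s := cl_34 HD.
have JL u v w z : D (u *m J) v w z = - D u (v *m J) w z.
by rewrite -cl_J12 mulJJ cl_opp1.
have JR u v w z : D u v (w *m J) z = - D u v w (z *m J).
by rewrite -(cl_J HD) mulJJ cl_opp3.
(* The part of degree two in [u] and in [v] of the polarized holomorphic sectional curvature,
   isolated by adding the values at [u + v] and [u - v]. *)
have key u v : D u v u v + 3 * D u (v *m J) u (v *m J) = 0.
have := hol (u + v); have := hol (u - v); have := hol u; have := hol v.
rewrite !mulmxDl !mulNmx !cl_lin !opprK => e1 e2 e3 e4.
have q1 : D v (v *m J) u (u *m J) = D u (u *m J) v (v *m J) by exact: cl_pair.
have q2 : D u (v *m J) v (u *m J) = D u (v *m J) u (v *m J).
by rewrite (s _ _ (u *m J)) JR opprK.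
have q3 : D v (u *m J) u (v *m J) = D u (v *m J) u (v *m J).
by rewrite (a (u *m J)) JL opprK.
have q4 : D v (u *m J) v (u *m J) = D u (v *m J) u (v *m J).
by rewrite (a (u *m J)) JL opprK q2.
have b := cl_bianchi HD u (u *m J) v (v *m J).
have b1 : D (u *m J) v u (v *m J) = - D u (v *m J) u (v *m J) by rewrite JL.
have b2 : D v u (u *m J) (v *m J) = - D u v u v by rewrite (cl_J HD) a.
move: e1 e2 e3 e4 b; rewrite q1 q2 q3 q4 b1 b2; lra.
(* With a = D u v u v and b its value at [v *m J], the relation reads a + 3b = 0, and for [v *m J]
   in place of [v] it reads b + 3a = 0. *)
have p0 u v : D u v u v = 0.
have := key u v; have := key u (v *m J); rewrite mulJJ !cl_lin opprK; lra.
have p1 u v w : D u v w v = 0.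
have := p0 (u + w) v; rewrite !cl_lin !p0 (cl_pair w); lra.
(* From here on the tensor is alternating in all four arguments, and the Bianchi identity says that
   three times it is 0. *)
have p2 u v w z : D u v w z = - D u z w v.
have := p1 u (v + z) w; rewrite !cl_lin !p1; lra.
move=> u v w z; have := cl_bianchi HD u v w z.
have := p2 u v w z; have := a z u w v; have := cl_pair z u w v; have := a v w z u.
have := s v w u z; have := p2 v w u z; have := cl_pair v z u w; have := a u w v z.
lra.
Qed.
End CurvatureLike.

Section ModelTensor.
Variables (R : realType) (n : nat) (J g : 'M[R]_n).
Hypotheses (JJ : J *m J = - 1%:M) (gT : g^T = g) (Jg : J *m g *m J^T = g).
Implicit Types u v w z : 'rV[R]_n.

Definition gip u v : R := (u *m g *m v^T) 0 0.

Lemma gipC u v : gip u v = gip v u.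
by rewrite /gip -[u *m g *m v^T]trmxK [LHS]mxE !trmx_mul trmxK gT mulmxA. Qed.
Lemma gipDl u u' v : gip (u + u') v = gip u v + gip u' v.
by rewrite /gip !mulmxDl mxE. Qed.
Lemma gipZl a u v : gip (a *: u) v = a * gip u v.
by rewrite /gip -!scalemxAl mxE. Qed.
Lemma gipJJ u v : gip (u *m J) (v *m J) = gip u v.
by rewrite /gip trmx_mul !mulmxA -[in RHS]Jg !mulmxA. Qed.
Lemma gipJ u v : gip (u *m J) v = - gip u (v *m J).
by rewrite -gipJJ -mulmxA JJ mulmxN mulmx1 -scaleN1r gipZl mulN1r.
Qed.

(** The curvature tensor of constant holomorphic sectional curvature 4, as [model_hol] confirms. *)
Definition model_tensor u v w z : R :=
 - (2 * gip (u *m J) v * gip (z *m J) w)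
 + gip z v * gip u w + gip z (v *m J) * gip (u *m J) w
 - gip z u * gip v w - gip z (u *m J) * gip (v *m J) w.

Lemma model_curvlike : curvlike J model_tensor.
have C := gipC; have mJ := @mulJJ R n J JJ.
have gN u v : gip u (- v) = - gip u v by rewrite C -scaleN1r gipZl mulN1r C.
split.
- move=> u u' v w z; rewrite /model_tensor !mulmxDl !gipDl.
by rewrite !(C z) !gipDl; ring.
- move=> a u v w z; rewrite /model_tensor -!scalemxAl !gipZl !(C z) !gipZl; ring.
- move=> u v w z; rewrite /model_tensor (gipJ v u) (C v); ring.
- move=> u v w z; rewrite /model_tensor (gipJ w z) (C w (z *m J)).
rewrite (C w v) (C w u) (C z v) (C z u) (C w (v *m J)) (C w (u *m J)).
by rewrite (C z (v *m J)) (C z (u *m J)); ring.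
- move=> u v w z; rewrite /model_tensor.
have -> : gip z (v *m J) = - gip (z *m J) v by rewrite gipJ opprK.
have -> : gip z (u *m J) = - gip (z *m J) u by rewrite gipJ opprK.
have -> : gip z (w *m J) = - gip (z *m J) w by rewrite gipJ opprK.
have -> : gip (v *m J) u = - gip (u *m J) v by rewrite gipJ C.
have -> : gip (w *m J) v = - gip (v *m J) w by rewrite gipJ C.
have -> : gip (w *m J) u = - gip (u *m J) w by rewrite gipJ C.
by rewrite (C v u) (C w v) (C w u); ring.
- move=> u v w z; rewrite /model_tensor !gipJJ.
have e2 : gip (z *m J) v = - gip z (v *m J) by rewrite gipJ.
have e3 : gip (z *m J) u = - gip z (u *m J) by rewrite gipJ.
have e4 : gip u (w *m J) = - gip (u *m J) w by rewrite gipJ opprK.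
have e5 : gip v (w *m J) = - gip (v *m J) w by rewrite gipJ opprK.
by rewrite e2 e3 e4 e5; ring.
Qed.

Lemma model_hol u : model_tensor u (u *m J) u (u *m J) = 4 * gip u u ^+ 2.
rewrite /model_tensor !gipJJ (mulJJ JJ).
have e1 : gip (- u) u = - gip u u by rewrite -scaleN1r gipZl mulN1r.
have e2 : gip u (u *m J) = 0.
by have := gipJ u u; rewrite (gipC (u *m J)); lra.
have e3 : gip (u *m J) u = 0 by rewrite gipC.
by rewrite e1 e2 e3; ring.
Qed.

(** The difference of the two tensors is again an algebraic Kähler curvature tensor, now with zero
    holomorphic sectional curvature. *)
Lemma curvlike_model D l : curvlike J D ->
 (forall u, D u (u *m J) u (u *m J) = 4 * l * gip u u ^+ 2) ->
 forall u v w z, D u v w z = l * model_tensor u v w z.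
move=> HD hol u v w z; apply/eqP; rewrite -subr_eq0; apply/eqP.
have [m1 m2 m3 m4 m5 m6] := model_curvlike.
apply: (@curvlike_hol0 R n J JJ (fun u v w z => D u v w z - l * model_tensor u v w z)).
split.
 - by move=> *; rewrite (cl_add HD) m1; ring.
 - by move=> *; rewrite (cl_scale HD) m2; ring.
 - by move=> *; rewrite (cl_12 HD) m3; ring.
 - by move=> *; rewrite (cl_34 HD) m4; ring.
 - move=> u1 v1 w1 z1; have := cl_bianchi HD u1 v1 w1 z1; have := m5 u1 v1 w1 z1.
move=> e1 e2; rewrite -[RHS](subrr (0 : R)) -{1}e2 -(mulr0 l) -e1; ring.
 - by move=> *; rewrite (cl_J HD) m6.
by move=> u1; rewrite hol model_hol; ring.
Qed.
End ModelTensor.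

(** * Orthonormal bases of symmetric tensors and traces of the curvature operator *)

Section OrthonormalSequences.
Variables (R : realType) (n : nat).
Implicit Types (A B : 'M[R]_n) (X : {vspace 'M[R]_n}) (s : seq 'M[R]_n).

Definition mip A B : R := \tr (A^T *m B).

Lemma mipC A B : mip A B = mip B A.
by rewrite /mip -mxtrace_tr trmx_mul trmxK. Qed.
Lemma mipDr A B C : mip A (B + C) = mip A B + mip A C.
by rewrite /mip mulmxDr mxtraceD. Qed.
Lemma mipZr a A B : mip A (a *: B) = a * mip A B.
by rewrite /mip -scalemxAr mxtraceZ. Qed.
Lemma mipDl A B C : mip (B + C) A = mip B A + mip C A.
by rewrite mipC mipDr !(mipC A). Qed.
Lemma mipZl a A B : mip (a *: B) A = a * mip B A.
by rewrite mipC mipZr mipC. Qed.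
Lemma mip0r A : mip A 0 = 0. by rewrite /mip mulmx0 mxtrace0. Qed.
Lemma mipNr A B : mip A (- B) = - mip A B.
by rewrite -scaleN1r mipZr mulN1r. Qed.
Lemma mip_sumr A (I : Type) (r : seq I) (F : I -> 'M[R]_n) :
 mip A (\sum_(i <- r) F i) = \sum_(i <- r) mip A (F i).
by elim/big_rec2: _ => [|i x y _ <-]; rewrite ?mip0r ?mipDr.
Qed.
Lemma mipE A B : mip A B = \sum_i \sum_j A i j * B i j.
rewrite /mip /mxtrace exchange_big/=; apply: eq_bigr => j _; rewrite mxE.
by apply: eq_bigr => i _; rewrite mxE.
Qed.
Lemma mip_ge0 A : 0 <= mip A A.
by rewrite mipE; apply: sumr_ge0 => i _; apply: sumr_ge0 => j _; exact: sqr_ge0. Qed.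
Lemma mip_eq0 A : mip A A = 0 -> A = 0.
rewrite mipE => /eqP; rewrite psumr_eq0; last first.
by move=> i _; apply: sumr_ge0 => j _; exact: sqr_ge0.
move=> /allP H; apply/matrixP => i j; rewrite mxE.
have := H i (mem_index_enum _); rewrite psumr_eq0; last by move=> k _; exact: sqr_ge0.
by move=> /allP/(_ j (mem_index_enum _)); rewrite -expr2 sqrf_eq0 => /eqP.
Qed.

Definition orthonormal s := forall i j, (i < size s)%N -> (j < size s)%N ->
 mip s`_i s`_j = (i == j)%:R.

Lemma orthonormal_free s : orthonormal s -> free s.
move=> os; apply/(@freeP _ _ _ (in_tuple s)) => k e i.
have := congr1 (mip s`_i) e; rewrite mip0r mip_sumr (bigD1 i)//= mipZr os// eqxx mulr1.
rewrite big1 ?addr0// => j ji; rewrite mipZr os// eq_sym (_ : _ == _ = false) ?mulr0//.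
exact: negbTE ji.
Qed.

Lemma orthonormal_rcons s u : orthonormal s ->
 (forall i, (i < size s)%N -> mip s`_i u = 0) -> mip u u = 1 ->
 orthonormal (rcons s u).
move=> os su uu i j; rewrite size_rcons !ltnS !nth_rcons => i_s js.
move: i_s; rewrite leq_eqVlt => /orP[/eqP->|i_s];
move: js; rewrite leq_eqVlt => /orP[/eqP->|js]; rewrite ?ltnn ?eqxx ?i_s ?js//.
- by rewrite mipC su// eq_sym (ltn_eqF js).
- by rewrite su// (ltn_eqF i_s).
- exact: os.
Qed.

(** Gram-Schmidt, by induction on the number of vectors still missing. *)
Lemma orthonormal_extend X s : orthonormal s -> {subset s <= X} ->
exists t, orthonormal (s ++ t) /\ basis_of X (s ++ t).
move: {2}(\dim X - size s)%N (leqnn (\dim X - size s)) => k.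
elim: k s => [|k IH] s.
rewrite leqn0 subn_eq0 => Xs os sX; exists [::]; rewrite cats0; split=> //.
have fs := orthonormal_free os.
have sub : (<< s >> <= X)%VS by apply/span_subvP.
rewrite /basis_of fs andbT eqEdim sub/=.
by move: fs; rewrite /free => /eqP ->.
move=> Xs os sX; have fs := orthonormal_free os.
have sub : (<< s >> <= X)%VS by apply/span_subvP.
have [Xsub|nsub] := boolP (X <= << s >>)%VS.
exists [::]; rewrite cats0; split=> //; rewrite /basis_of fs andbT eqEsubv sub//.
have [v vX vs] : exists2 v, v \in X & v \notin << s >>%VS.
by move/subvPn: nsub.
pose w := \sum_(i < size s) mip s`_i v *: s`_i.
have wS : w \in << s >>%VS.
by apply: memv_suml => i _; apply: memvZ; apply: memv_span; exact: mem_nth.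
pose u0 := v - w.
have u0X : u0 \in X by rewrite memvB// (subvP sub).
have u00 : u0 != 0 by rewrite subr_eq0; apply: contraNneq vs => ->.
have nn : 0 < mip u0 u0.
rewrite lt_neqAle mip_ge0 andbT eq_sym; apply: contra_neq u00; exact: mip_eq0.
have ou0 i : (i < size s)%N -> mip s`_i u0 = 0.
move=> i_s; rewrite /u0 mipDr mipNr /w mip_sumr (bigD1 (Ordinal i_s))//= mipZr os// eqxx mulr1.
rewrite big1 ?addr0 ?subrr// => j ji; rewrite mipZr os//.
rewrite (_ : (i == j :> nat) = false) ?mulr0//; apply/negbTE; move: ji.
by apply: contra => /eqP ij; apply/eqP/val_inj.
pose u := (Num.sqrt (mip u0 u0))^-1 *: u0.
have uu : mip u u = 1.
rewrite /u mipZr mipZl mulrA -invfM -expr2 sqr_sqrtr ?ltW// mulVf//.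
by rewrite gt_eqF.
have [|||t [ot bt]] := IH (rcons s u).
- by rewrite size_rcons subnS -ltnS; case: (_ - _)%N Xs.
- by apply: orthonormal_rcons => // i i_s; rewrite /u mipZr ou0// mulr0.
- by move=> x; rewrite mem_rcons inE => /orP[/eqP ->|/sX//]; exact: memvZ.
by exists (u :: t); rewrite -cat_rcons.
Qed.

Lemma parseval X s P A : basis_of X s -> orthonormal s ->
 P \in X -> (forall B, B \in X -> mip (A - P) B = 0) ->
 \sum_(k < size s) mip s`_k A *: s`_k = P.
move=> bs os PX orth.
have -> : P = \sum_(k < size s) mip s`_k P *: s`_k.
have Ps : P \in << in_tuple s >>%VS by move: bs => /andP[/eqP -> _].
have E := coord_span Ps; rewrite [in RHS]E [LHS]E.
apply: eq_bigr => k _; congr (_ *: _).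
rewrite mip_sumr (bigD1 k)//= mipZr os// eqxx mulr1 big1 ?addr0// => j jk.
rewrite mipZr os// (_ : (k == j :> nat) = false) ?mulr0//; apply/negbTE; move: jk.
by apply: contra => /eqP ij; apply/eqP/val_inj.
apply: eq_bigr => k _; congr (_ *: _).
have sX : s`_k \in X by apply: basis_mem bs _; exact: mem_nth.
have := orth _ sX; rewrite mipC mipDr mipNr => /eqP; rewrite subr_eq0 => /eqP.
by [].
Qed.
End OrthonormalSequences.

Section FourFoldSums.
Variables (R : realType) (n : nat).
Implicit Type f : 'I_n -> 'I_n -> 'I_n -> 'I_n -> R.

Definition sum4 f := \sum_i \sum_j \sum_k \sum_l f i j k l.

Lemma eq_sum4 f g : (forall i j k l, f i j k l = g i j k l) -> sum4 f = sum4 g.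
by move=> fg; apply: eq_bigr => i _; apply: eq_bigr => j _; apply: eq_bigr => k _;
apply: eq_bigr => l _.
Qed.

Lemma sum4D f g : sum4 (fun i j k l => f i j k l + g i j k l) = sum4 f + sum4 g.
rewrite /sum4 -big_split; apply: eq_bigr => i _; rewrite -big_split.
apply: eq_bigr => j _; rewrite -big_split; apply: eq_bigr => k _.
by rewrite -big_split.
Qed.

Lemma sum4Z a f : sum4 (fun i j k l => a * f i j k l) = a * sum4 f.
rewrite /sum4 mulr_sumr; apply: eq_bigr => i _; rewrite mulr_sumr.
by apply: eq_bigr => j _; rewrite mulr_sumr; apply: eq_bigr => k _; rewrite mulr_sumr.
Qed.

Lemma sum4_swap12 f : sum4 (fun i j => f j i) = sum4 f.
by rewrite /sum4 exchange_big. Qed.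
Lemma sum4_swap23 f : sum4 (fun i j k => f i k j) = sum4 f.
by apply: eq_bigr => i _; rewrite exchange_big. Qed.
Lemma sum4_swap34 f : sum4 (fun i j k l => f i j l k) = sum4 f.
by apply: eq_bigr => i _; apply: eq_bigr => j _; rewrite exchange_big. Qed.
Lemma sum4_rot f : sum4 (fun i j k l => f j k i l) = sum4 f.
by rewrite -[RHS]sum4_swap23 -[RHS]sum4_swap12. Qed.
Lemma sum4_rot' f : sum4 (fun i j k l => f k i j l) = sum4 f.
by rewrite -[RHS]sum4_swap12 -[RHS]sum4_swap23. Qed.
Lemma sum2_delta (f : 'I_n -> 'I_n -> R) a b :
 \sum_k \sum_l f k l * ((l == b) && (k == a))%:R = f a b.
rewrite (bigD1 a)//= (bigD1 b)//= !eqxx mulr1 big1 ?addr0; last first.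
by move=> l lb; rewrite (negbTE lb) mulr0.
rewrite big1 ?addr0// => k ka; rewrite big1// => l _.
by rewrite (negbTE ka) andbF mulr0.
Qed.
End FourFoldSums.

Section PointwiseTraces.
Variables (R : realType) (n : nat) (J : 'M[R]_n).
Hypotheses (JJ : J *m J = - 1%:M) (JT : J^T = - J).
Variables (D : 'rV[R]_n -> 'rV[R]_n -> 'rV[R]_n -> 'rV[R]_n -> R).
Hypotheses (HD : curvlike J D).
Notation e i := (delta_mx 0 i : 'rV[R]_n).
Notation t i j k l := (D (e i) (e j) (e k) (e l)).

Definition op2 (phi psi : 'M[R]_n) : R :=
 sum4 (fun i j k l => t i j k l * phi i l * psi j k).
Let scal := \sum_i \sum_j t i j i j.
Let JA i j : J j i = - J i j.
by have := congr1 (fun A : 'M[R]_n => A i j) JT; rewrite !mxE. Qed.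
Lemma cl_sum3 u v w (I : finType) (a : I -> R) (z : I -> 'rV[R]_n) :
 D u v (\sum_i a i *: z i) w = \sum_i a i * D u v (z i) w.
elim/big_rec2: _ => [|i x y _ <-].
by rewrite (cl_pair HD) -(scale0r (0 : 'rV[R]_n)) (cl_scale HD) mul0r.
by rewrite (cl_add3 HD) (cl_pair HD) (cl_scale HD) -(cl_pair HD).
Qed.

Lemma cl_sum4 u v w (I : finType) (a : I -> R) (z : I -> 'rV[R]_n) :
 D u v w (\sum_i a i *: z i) = \sum_i a i * D u v w (z i).
rewrite (cl_34 HD) cl_sum3 -sumrN; apply: eq_bigr => i _.
by rewrite (cl_34 HD) mulrN opprK.
Qed.

(** Invariance of the last pair of arguments under [J], expanded in the basis. *)
Lemma contract_J : sum4 (fun i j k l => t i j k l * J i k * J j l) = scal.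
apply: eq_bigr => i _; apply: eq_bigr => j _.
rewrite -(cl_J HD (e i) (e j) (e i) (e j)) -!rowE.
rewrite (row_sum_delta (row i J)) (row_sum_delta (row j J)) cl_sum3; apply: eq_bigr => k _.
rewrite cl_sum4 mulr_sumr; apply: eq_bigr => l _.
by rewrite ![row _ _ _ _]mxE; ring.
Qed.

(** The Bianchi identity replaces the tensor by two rotated ones; after renaming the indices each is
    the contraction of [contract_J], up to sign. *)
Lemma contract_bianchi : sum4 (fun i j k l => t i j k l * J j i * J l k) = 2 * scal.
have -> : sum4 (fun i j k l => t i j k l * J j i * J l k) =
 sum4 (fun i j k l => (-1) * (t j k i l * J j i * J l k)) +
 sum4 (fun i j k l => (-1) * (t k i j l * J j i * J l k)).
rewrite -sum4D; apply: eq_sum4 => i j k l.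
have := cl_bianchi HD (e i) (e j) (e k) (e l) => b.
have -> : t i j k l = - t j k i l - t k i j l by move: b; lra.
by ring.
rewrite !sum4Z.
rewrite (sum4_rot (fun a b c d => t a b c d * J a c * J d b)).
rewrite (sum4_rot' (fun a b c d => t a b c d * J c b * J d a)).
have -> : sum4 (fun a b c d => t a b c d * J a c * J d b) = - scal.
rewrite -contract_J -mulN1r -sum4Z; apply: eq_sum4 => a b c d.
by rewrite (JA b d); ring.
have -> : sum4 (fun a b c d => t a b c d * J c b * J d a) = - scal.
rewrite -contract_J -mulN1r -sum4Z -[RHS]sum4_swap34; apply: eq_sum4 => a b c d.
by rewrite (JA b c) (JA a d) (cl_34 HD); ring.
ring.
Qed.

(** For S symmetric, S + J S J anticommutes with J and S - J S J commutes with it. The factor 1/4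
    combines this halving with the symmetrization; [projH] also removes the trace. *)
Definition projW (A : 'M[R]_n) : 'M[R]_n := 4^-1 *: (A + A^T + J *m (A + A^T) *m J).
Definition projH (A : 'M[R]_n) : 'M[R]_n :=
 4^-1 *: (A + A^T - J *m (A + A^T) *m J) - (n%:R^-1 * \tr A)%:M.

Definition antiJ : {vspace 'M[R]_n} :=
 (S20 R n :&: lker (linfun (mulmx J \+ mulmxr J)))%VS.
Definition commJ : {vspace 'M[R]_n} :=
 (S20 R n :&: lker (linfun (mulmx J \- mulmxr J)))%VS.

Lemma antiJP A : reflect [/\ A^T = A, \tr A = 0 & J *m A = - (A *m J)] (A \in antiJ).
rewrite memv_cap S20P memv_ker lfunE/= addr_eq0.
by apply: (iffP idP) => [/andP[/andP[/eqP ? /eqP ?] /eqP ?]|[-> -> ->]]; rewrite ?eqxx.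
Qed.

Lemma commJP A : reflect [/\ A^T = A, \tr A = 0 & J *m A = A *m J] (A \in commJ).
rewrite memv_cap S20P memv_ker lfunE/= subr_eq0.
by apply: (iffP idP) => [/andP[/andP[/eqP ? /eqP ?] /eqP ?]|[-> -> ->]]; rewrite ?eqxx.
Qed.
Let trJ : \tr J = 0.
by have := mxtrace_tr J; rewrite JT raddfN/=; lra. Qed.
Let JSJ_T (A : 'M[R]_n) : A^T = A -> (J *m A *m J)^T = J *m A *m J.
by move=> AT; rewrite !trmx_mul JT AT !mulNmx !mulmxN opprK mulmxA. Qed.
Let sym (A : 'M[R]_n) : (A + A^T)^T = A + A^T.
by rewrite trmxD trmxK addrC. Qed.
Let JJA q (A : 'M[R]_(n, q)) : J *m (J *m A) = - A.
by rewrite mulmxA JJ mulNmx mul1mx. Qed.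
Let AJJ q (A : 'M[R]_(q, n)) : A *m J *m J = - A.
by rewrite -mulmxA JJ mulmxN mulmx1. Qed.
Let tr_JSJ (A : 'M[R]_n) : \tr (J *m A *m J) = - \tr A.
by rewrite mxtrace_mulC JJA raddfN. Qed.
Lemma projW_in A : projW A \in antiJ.
apply/antiJP; split.
- by rewrite /projW trmxZ trmxD sym JSJ_T ?sym.
- by rewrite /projW mxtraceZ mxtraceD tr_JSJ subrr mulr0.
- rewrite /projW -scalemxAr -scalemxAl -scalerN; congr (_ *: _).
set S := A + A^T; rewrite mulmxDr mulmxDl AJJ (mulmxA J (J *m S)) JJA mulNmx.
by rewrite opprD opprK addrC.
Qed.

Lemma projH_in A : (0 < n)%N -> projH A \in commJ.
move=> n0; have n0' : n%:R != 0 :> R by rewrite pnatr_eq0 -lt0n.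
apply/commJP; split.
- by rewrite /projH trmxD trmxN trmxZ trmxD trmxN sym JSJ_T ?sym// tr_scalar_mx.
- rewrite /projH mxtraceD raddfN/= mxtraceZ mxtraceD raddfN/= tr_JSJ mxtraceD mxtrace_tr.
by rewrite raddfN/= mxtrace_scalar -mulr_natl; field.
- rewrite /projH mulmxBr mulmxBl -scalemxAr -scalemxAl; congr (_ *: _ - _); last first.
by rewrite scalar_mxC.
set S := A + A^T; rewrite mulmxBr mulmxBl AJJ (mulmxA J (J *m S)) JJA mulNmx.
by rewrite !opprK addrC.
Qed.
Let mip_sym (A B : 'M[R]_n) : B^T = B -> mip (A^T) B = mip A B.
by move=> BT; rewrite /mip trmxK -[in RHS]mxtrace_tr trmx_mul trmxK BT mxtrace_mulC. Qed.
Let mip_JSJ (A B : 'M[R]_n) : mip (J *m A *m J) B = mip A (J *m B *m J).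
by rewrite /mip !trmx_mul JT !(mulNmx,mulmxN) opprK -!mulmxA mxtrace_mulC -!mulmxA.
Qed.
Let mipZl' a (A B : 'M[R]_n) : mip (a *: A) B = a * mip A B. exact: mipZl. Qed.
Let mipDl' (A A' B : 'M[R]_n) : mip (A + A') B = mip A B + mip A' B. exact: mipDl. Qed.
Let mipNl' (A B : 'M[R]_n) : mip (- A) B = - mip A B. by rewrite -scaleN1r mipZl' mulN1r. Qed.
Lemma projW_orth A B : B \in antiJ -> mip (A - projW A) B = 0.
move=> /antiJP[BT Btr BJ]; rewrite mipDl' mipNl' /projW mipZl' !mipDl' mip_JSJ.
by rewrite BJ mulNmx AJJ opprK mipDl' mip_sym//; field.
Qed.

Lemma projH_orth A B : B \in commJ -> mip (A - projH A) B = 0.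
move=> /commJP[BT Btr BJ]; rewrite mipDl' mipNl' /projH !mipDl' !mipNl' mipZl' !mipDl' mipNl' mip_JSJ.
rewrite BJ AJJ mipNr mipDl' mip_sym//.
have -> : mip (n%:R^-1 * \tr A)%:M B = 0.
by rewrite /mip tr_scalar_mx mul_scalar_mx mxtraceZ Btr mulr0.
by field.
Qed.

Lemma antiJ_commJ_orth A B : A \in antiJ -> B \in commJ -> mip A B = 0.
move=> /antiJP[AT _ AJ] /commJP[BT _ BJ].
have : mip A B = - mip A B; last lra.
rewrite -{1}[B]opprK -(AJJ B) -BJ mipNr -mip_JSJ AJ mulNmx AJJ opprK.
by [].
Qed.

Lemma proj_sum A : A \in S20 R n -> A = projW A + projH A.
rewrite S20P => /andP[/eqP AT /eqP Atr]; rewrite /projW /projH AT Atr mulr0 raddf0 subr0.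
by apply/matrixP=> i j; rewrite !mxE; field.
Qed.

(* Contracting with an orthonormal basis amounts to contracting with the
 orthogonal projection. *)
Lemma trace_onb X s P : basis_of X s -> orthonormal s ->
 (forall A, P A \in X) -> (forall A B, B \in X -> mip (A - P A) B = 0) ->
 (\sum_(x <- s) op2 x x = sum4 (fun i j k l => t i j k l * P (delta_mx i l) j k)) /\
 (size s)%:R = \sum_i \sum_l P (delta_mx i l) i l.
move=> bs os PX PO.
have mipd (B : 'M[R]_n) i l : mip B (delta_mx i l) = B i l.
rewrite mipE (bigD1 i)//= (bigD1 l)//= !mxE !eqxx mulr1 big1 ?addr0; last first.
by move=> b bl; rewrite mxE (negbTE bl) andbF mulr0.
rewrite big1 ?addr0// => b bi; rewrite big1// => c _.
by rewrite mxE (negbTE bi) mulr0.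
have PE i l j k : P (delta_mx i l) j k = \sum_(x <- s) x i l * x j k.
rewrite -(parseval bs os (PX _) (PO _)) summxE (big_nth 0) big_mkord.
by apply: eq_bigr => b _; rewrite mxE mipd.
split.
rewrite [RHS](eq_sum4 (g := fun i j k l => \sum_(x <- s) t i j k l * x i l * x j k)).
rewrite /op2 /sum4 exchange_big/=; apply: eq_bigr => i _.
rewrite exchange_big/=; apply: eq_bigr => j _.
by rewrite exchange_big/=; apply: eq_bigr => k _; rewrite exchange_big.
by move=> i j k l; rewrite PE mulr_sumr; apply: eq_bigr => x _; rewrite mulrA.
under eq_bigr do under eq_bigr do rewrite PE.
under eq_bigr do rewrite exchange_big/=; rewrite exchange_big/=.
rewrite (big_nth 0) big_mkord -[in LHS](card_ord (size s)) -sum1_card natr_sum.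
by apply: eq_bigr => b _; rewrite -mipE os// eqxx.
Qed.
Let JdJ i l j k : (J *m delta_mx i l *m J) j k = J j i * J l k.
rewrite mxE (bigD1 l)//= big1 ?addr0; last first.
move=> b bl; rewrite mxE (bigD1 i)//= big1 ?addr0 ?mxE ?(negbTE bl) ?andbF ?mulr0 ?mul0r//.
by move=> c _; rewrite mxE (negbTE bl) andbF mulr0.
rewrite mxE (bigD1 i)//= big1 ?addr0 ?mxE ?eqxx ?mulr1// => b bi.
by rewrite mxE (negbTE bi) mulr0.
Qed.
Let projWE i l j k : projW (delta_mx i l) j k = 4^-1 *
 (((l == k) && (j == i))%:R + ((j == l) && (k == i))%:R + (J j i * J l k + J j l * J i k)).
rewrite /projW scalemxE !addmxE trmx_delta mulmxDr mulmxDl addmxE !JdJ !mxE.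
by rewrite [in (k == l)]eq_sym [(j == i) && _]andbC.
Qed.
Let s1 : sum4 (fun i j k l => t i j k l * ((l == k) && (j == i))%:R) = 0.
rewrite /sum4 big1// => i _; rewrite big1// => j _; rewrite big1// => k _; rewrite big1// => l _.
have [->|ji] := eqVneq j i; last by rewrite andbF mulr0.
have -> : t i i k l = 0 by have := cl_12 HD (e i) (e i) (e k) (e l); lra.
by rewrite mul0r.
Qed.
Let s2 : sum4 (fun i j k l => t i j k l * ((j == l) && (k == i))%:R) = scal.
apply: eq_bigr => i _; apply: eq_bigr => j _.
rewrite -(sum2_delta (fun k l => t i j k l) i j); apply: eq_bigr => k _.
by apply: eq_bigr => l _; rewrite (eq_sym j l).
Qed.
Let sumdelta (i : 'I_n) : \sum_(l < n) (((i == l) && (l == i))%:R : R) = 1.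
by rewrite (bigD1 i)//= !eqxx big1 ?addr0// => l li; rewrite (negbTE li) andbF. Qed.
Let sumJJ i : \sum_(l < n) (J i i * J l l + J i l * J i l) = J i i * \tr J + 1.
rewrite big_split/= -mulr_sumr; congr (_ + _).
have := congr1 (fun A : 'M[R]_n => A i i) JJ; rewrite !mxE eqxx => e1.
have -> : \sum_(l < n) J i l * J i l = - \sum_(l < n) J i l * J l i.
by rewrite -sumrN; apply: eq_bigr => l _; rewrite (JA i l) mulrN opprK.
by rewrite e1 opprK.
Qed.

(** The four terms of [projW] contribute 0 (antisymmetry), [scal], 2 [scal] (Bianchi) and [scal]
    (invariance under J), with the common factor 1/4. For n = 2m the dimension is m^2 + m. *)
Lemma trace_antiJ s : basis_of antiJ s -> orthonormal s ->
 \sum_(x <- s) op2 x x = scal /\ (size s)%:R = 4^-1 * (n%:R ^+ 2 + 2 * n%:R) :> R.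
move=> bs os; have [-> ->] := trace_onb bs os projW_in projW_orth; split.
rewrite (eq_sum4 (g := fun i j k l => 4^-1 * (t i j k l * ((l == k) && (j == i))%:R +
 t i j k l * ((j == l) && (k == i))%:R + (t i j k l * J j i * J l k + t i j k l * J i k * J j l)))).
by rewrite sum4Z !sum4D s1 s2 contract_J contract_bianchi; field.
by move=> i j k l; rewrite projWE; ring.
under eq_bigr do under eq_bigr do rewrite projWE.
have -> : \sum_i \sum_l 4^-1 * (((l == l) && (i == i))%:R + ((i == l) && (l == i))%:R +
 (J i i * J l l + J i l * J i l)) =
 4^-1 * (\sum_(i < n) \sum_(l < n) (1 + ((i == l) && (l == i))%:R + (J i i * J l l + J i l * J i l))).
rewrite mulr_sumr; apply: eq_bigr => i _; rewrite mulr_sumr; apply: eq_bigr => l _.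
by rewrite !eqxx.
congr (_ * _); have -> : \sum_(i < n) \sum_(l < n) (1 + ((i == l) && (l == i))%:R + (J i i * J l l + J i l * J i l)) =
 \sum_(i < n) (n%:R + 1 + (J i i * \tr J + 1)).
apply: eq_bigr => i _; rewrite big_split/= sumJJ big_split/= sumdelta.
by rewrite sumr_const card_ord.
rewrite !big_split/= -mulr_suml trJ mulr0 add0r !sumr_const !card_ord.
by rewrite -[n%:R *+ n]mulr_natl; ring.
Qed.

(** The J-terms now have the opposite sign, which gives (1 - 3)/4 = -1/2, and the removal of the
    trace adds 1/n. For n = 2m this is -(m - 1)/(2m), and the dimension is m^2 - 1. *)
Lemma trace_commJ s : (0 < n)%N -> basis_of commJ s -> orthonormal s ->
 \sum_(x <- s) op2 x x = - 2^-1 * scal + n%:R^-1 * scal /\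
 (size s)%:R = 4^-1 * n%:R ^+ 2 - 1 :> R.
move=> n0 bs os; have n0' : n%:R != 0 :> R by rewrite pnatr_eq0 -lt0n.
have [-> ->] := trace_onb bs os (fun A => projH_in A n0) projH_orth.
have projHE i l j k : projH (delta_mx i l) j k = 4^-1 *
 (((l == k) && (j == i))%:R + ((j == l) && (k == i))%:R - (J j i * J l k + J j l * J i k))
 - n%:R^-1 * ((l == i) && (k == j))%:R.
rewrite /projH addmxE oppmxE scalemxE !addmxE oppmxE trmx_delta mulmxDr mulmxDl addmxE !JdJ.
have -> : \tr (delta_mx i l : 'M[R]_n) = (l == i)%:R.
rewrite /mxtrace (bigD1 i)//= big1 ?addr0 ?mxE ?eqxx//= 1?eq_sym// => b bi.
by rewrite mxE (negbTE bi).
rewrite !mxE [in (k == l)]eq_sym [(j == i) && _]andbC [in X in _ - X]mulr_natr mulrb.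
rewrite [j == k]eq_sym; case: (l == i); case: (k == j); rewrite ?mulr1 ?mulr0 ?mulr1n ?mulr0n//.
have s3 : sum4 (fun i j k l => t i j k l * ((l == i) && (k == j))%:R) = - scal.
rewrite /sum4 /scal -sumrN; apply: eq_bigr => i _; rewrite -sumrN; apply: eq_bigr => j _.
by rewrite sum2_delta (cl_34 HD).
split.
rewrite (eq_sum4 (g := fun i j k l => 4^-1 * (t i j k l * ((l == k) && (j == i))%:R +
 t i j k l * ((j == l) && (k == i))%:R + (-1) * (t i j k l * J j i * J l k + t i j k l * J i k * J j l))
 + (- n%:R^-1) * (t i j k l * ((l == i) && (k == j))%:R))).
rewrite sum4D !sum4Z !sum4D sum4Z sum4D s1 s2 s3 contract_J contract_bianchi; field.
by rewrite n0'.
by move=> i j k l; rewrite projHE; ring.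
under eq_bigr do under eq_bigr do rewrite projHE.
have -> : \sum_i \sum_l (4^-1 * (((l == l) && (i == i))%:R + ((i == l) && (l == i))%:R -
 (J i i * J l l + J i l * J i l)) - n%:R^-1 * ((l == i) && (l == i))%:R) =
 \sum_(i < n) (4^-1 * (n%:R + 1 - (J i i * \tr J + 1)) - n%:R^-1).
apply: eq_bigr => i _; rewrite big_split/= -mulr_sumr; congr (_ * _ + _).
rewrite sumrB sumJJ big_split/= sumdelta; congr (_ + _ - _).
by under eq_bigr do rewrite !eqxx; rewrite sumr_const card_ord.
rewrite sumrN; congr (- _); rewrite -mulr_sumr (bigD1 i)//= eqxx big1 ?addr0 ?mulr1// => l li.
by rewrite (negbTE li).
rewrite !big_split/= -mulr_sumr sumrN big_split/= !big_split/= sumrN big_split/= -mulr_suml trJ mulr0 add0r !sumr_const !card_ord.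
rewrite -[n%:R *+ n]mulr_natl -[n%:R^-1 *+ n]mulr_natl mulfV//.
by ring.
Qed.
End PointwiseTraces.

(** * From the condition on partial sums to constant holomorphic sectional curvature at a point *)

Section PartialSums.
Variables (R : realType).
Implicit Types A B : seq R.

(** The weighted sum of [alpha_sum], for an index with integer part [k] and fractional part [f]. *)
Definition psum k f B : R := \sum_(i < k) B`_i + f * B`_k.

Lemma psum_cat k f A B : psum (size A + k) f (A ++ B) = \sum_(x <- A) x + psum k f B.
rewrite /psum big_split_ord/= addrA (big_nth 0) big_mkord; congr (_ + _ + _).
- by apply: eq_bigr => i _; rewrite nth_cat ltn_ord.
- by apply: eq_bigr => i _; rewrite nth_cat ltnNge leq_addr/= addKn.
- by rewrite nth_cat ltnNge leq_addr/= addKn.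
Qed.

(** One more rotation shifts the position by one, so the total does not depend on [i]; at position 0
    the rotations run through [B]. *)
Lemma sum_rot_nth B i : (i < size B)%N ->
 \sum_(r < size B) (rot r B)`_i = \sum_(x <- B) x.
elim: i => [|i IH] iB.
rewrite [RHS](big_nth 0) big_mkord; apply: eq_bigr => r _.
by rewrite /rot nth_cat size_drop subn_gt0 ltn_ord nth_drop addn0.
rewrite -(IH (ltnW iB)).
have rotE r : (r < size B)%N -> (rot r B)`_i.+1 = (rot r.+1 B)`_i.
move=> rB; rewrite (rotS rB).
have : size (rot r B) = size B by rewrite size_rot.
case: (rot r B) => [|x s]/= ss; first by rewrite -ss in iB.
by rewrite rot1_cons nth_rcons; case: ltnP => //; rewrite leqNgt -ltnS ss iB.
under eq_bigr => r _ do rewrite rotE ?ltn_ord//.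
case: (size B) iB (rot_size B) => // d _ rd.
by rewrite big_ord_recr [RHS]big_ord_recl rd rot0 addrC.
Qed.

Lemma sum_rot_psum k f B : (k < size B)%N ->
 \sum_(r < size B) psum k f (rot r B) = (k%:R + f) * \sum_(x <- B) x.
move=> kB; rewrite big_split/= exchange_big/= -mulr_sumr sum_rot_nth// mulrDl; congr (_ + _).
rewrite (eq_bigr (fun=> \sum_(x <- B) x)) ?sumr_const ?card_ord ?mulr_natl// => i _.
by apply: sum_rot_nth; apply: ltn_trans kB.
Qed.

Lemma psum_const k f B l : (k < size B)%N -> (forall x, x \in B -> x = l) ->
 psum k f B = (k%:R + f) * l.
move=> kB Bl; rewrite /psum [B`_k]Bl ?mem_nth// mulrDl (eq_bigr (fun=> l)).
by rewrite sumr_const card_ord mulr_natl.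
by move=> i _; apply: Bl; rewrite mem_nth// (ltn_trans (ltn_ord i) kB).
Qed.
End PartialSums.

Section OrthonormalPermutations.
Variables (R : realType) (n : nat).
Implicit Type s t : seq 'M[R]_n.

Lemma orthonormalP s : orthonormal s <->
 uniq s /\ forall x y, x \in s -> y \in s -> mip x y = (x == y)%:R.
split=> [os|[us sxy] i j si sj]; last by rewrite sxy ?mem_nth// nth_uniq.
have us : uniq s by apply/free_uniq/orthonormal_free.
split=> // x y xs ys; rewrite -(nth_index 0 xs) -(nth_index 0 ys) os ?index_mem//.
by rewrite nth_uniq ?index_mem.
Qed.

Lemma orthonormal_perm s t : perm_eq s t -> orthonormal s -> orthonormal t.
move=> st /orthonormalP[us sxy]; apply/orthonormalP; split; first by rewrite -(perm_uniq st).
by move=> x y; rewrite -!(perm_mem st); apply: sxy.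
Qed.

Lemma orthonormal_cat s t : orthonormal s -> orthonormal t ->
 (forall x y, x \in s -> y \in t -> mip x y = 0) -> orthonormal (s ++ t).
move=> /orthonormalP[us sxy] /orthonormalP[ut txy] st; apply/orthonormalP; split.
rewrite cat_uniq us ut andbT/=; apply/hasPn => x xt; apply/negP => xs.
by have := st x x xs xt; rewrite sxy// eqxx => /eqP; rewrite oner_eq0.
have neq x y : x \in s -> y \in t -> (x == y) = false.
move=> xs yt; apply/eqP => xy; have := st _ _ xs yt.
by rewrite -xy sxy// eqxx => /eqP; rewrite oner_eq0.
move=> x y; rewrite !mem_cat => /orP[xs|xt] /orP[ys|yt].
- exact: sxy.
- by rewrite st// neq.
- by rewrite mipC st// eq_sym neq.
- exact: txy.
Qed.
End OrthonormalPermutations.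

Section AlphaArgument.
Variables (R : realType) (n m : nat) (Q : 'M[R]_n -> R) (H W : {vspace 'M[R]_n}) (T : R).
Hypotheses (m2 : (2 <= m)%N) (HW_orth : forall x y, x \in H -> y \in W -> mip x y = 0)
 (HW_sum : (H + W)%VS = S20 R n) (QZ : forall a x, Q (a *: x) = a ^+ 2 * Q x)
 (sizeH : forall s, basis_of H s -> orthonormal s -> (size s)%:R = m%:R ^+ 2 - 1 :> R)
 (sizeW : forall s, basis_of W s -> orthonormal s -> (size s)%:R = m%:R ^+ 2 + m%:R :> R).
Hypothesis sumH : forall s, basis_of H s -> orthonormal s ->
 \sum_(x <- s) Q x = - (m%:R - 1) / (2 * m%:R) * T.
Hypotheses (sumW : forall s, basis_of W s -> orthonormal s -> \sum_(x <- s) Q x = T).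
Let al : R := 3 / 2 * (m%:R ^+ 2 - 1).
Hypothesis alpha : forall phi, orthonormal_basis phi ->
 0 <= \sum_(i < Num.truncn al) Q phi`_i + (al - (Num.truncn al)%:R) * Q phi`_(Num.truncn al).
Let Q0 : Q 0 = 0. by rewrite -(scale0r 0) QZ expr0n mul0r. Qed.
Let c : R := 2^-1 * (m%:R ^+ 2 - 1).
Let k := Num.truncn c.
Let f := c - k%:R.
Let m2' : 2 <= m%:R :> R. by rewrite ler_nat. Qed.
Let c1 : 1 <= c. by rewrite /c; move: m2'; nra. Qed.
Let k1 : (0 < k)%N. by rewrite truncn_gt0. Qed.
Let kc : k%:R <= c. by rewrite truncn_le; apply: le_trans c1. Qed.
Let sizeW_nat s : basis_of W s -> orthonormal s -> (k.+1 < size s)%N.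
move=> bs os; rewrite -(ltr_nat R) sizeW// -natr1; move: kc m2'; rewrite /c; nra.
Qed.
Let truncn_al s : basis_of H s -> orthonormal s -> Num.truncn al = (size s + k)%N.
move=> bs os; apply: truncn_def; rewrite -natr1 natrD sizeH// /al.
have := truncn_itv (le_trans ler01 c1); rewrite -/k -natr1 => /andP[h1 h2].
by apply/andP; split; move: h1 h2; rewrite /c; lra.
Qed.
Let onb hs ws phi : basis_of H hs -> orthonormal hs -> basis_of W ws -> orthonormal ws ->
 perm_eq (hs ++ ws) phi -> orthonormal_basis phi.
move=> bh oh bw ow p.
have o : orthonormal (hs ++ ws).
by apply: orthonormal_cat => // x y xh yw; apply: HW_orth; rewrite (basis_mem bh, basis_mem bw).
split; last by have := orthonormal_perm p o.
rewrite -(perm_basis _ p) basisEfree orthonormal_free//=.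
have e : <<hs ++ ws>>%VS = S20 R n by rewrite span_cat (span_basis bh) (span_basis bw).
by have := orthonormal_free o; rewrite /free e => /eqP <-; rewrite subvv leqnn.
Qed.
Let alpha_psum phi hs : basis_of H hs -> orthonormal hs -> orthonormal_basis phi ->
 0 <= psum (size hs + k) f (map Q phi).
move=> bh oh /alpha; rewrite (truncn_al bh oh); set a := (size hs + k)%N.
have nthQ i : (map Q phi)`_i = Q phi`_i.
have [iphi|phii] := ltnP i (size phi); first by rewrite (nth_map 0).
by rewrite !nth_default ?size_map.
rewrite /psum nthQ; under eq_bigr do rewrite -nthQ.
suff -> : al - a%:R = f by [].
by rewrite /a natrD sizeH// /f /al /c; field.
Qed.
Let psumW hs ws : basis_of H hs -> orthonormal hs -> basis_of W ws -> orthonormal ws ->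
 0 <= \sum_(x <- hs) Q x + psum k f (map Q ws).
move=> bh oh bw ow; rewrite -(big_map Q xpredT id)/= -psum_cat size_map -map_cat.
by apply: alpha_psum => //; apply: onb bh oh bw ow _.
Qed.
Let rot_onb r s : basis_of W s -> orthonormal s -> basis_of W (rot r s) /\ orthonormal (rot r s).
move=> bs os; have p : perm_eq s (rot r s) by rewrite perm_sym perm_rot.
by split; [rewrite -(perm_basis _ p)|apply: orthonormal_perm p os].
Qed.
(** Add the inequality over all rotations of [ws]. By the values of the two traces the total is 0,
    precisely because c T / (m^2 + m) = (m - 1)/(2m) T; nonnegative terms with zero sum all
    vanish. *)
Let psumW_eq hs ws : basis_of H hs -> orthonormal hs -> basis_of W ws -> orthonormal ws ->
 psum k f (map Q ws) = - \sum_(x <- hs) Q x.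
move=> bh oh bw ow.
have sz : (k < size (map Q ws))%N by rewrite size_map ltnW// sizeW_nat.
have S0 : \sum_(r < size (map Q ws)) (\sum_(x <- hs) Q x + psum k f (rot r (map Q ws))) = 0.
rewrite big_split sum_rot_psum// big_map [\sum_(x <- ws) _]sumW// sumr_const card_ord sumH//.
rewrite /= -[_ *+ size _]mulr_natr size_map sizeW// /f /c; field.
by rewrite pnatr_eq0; case: m m2.
have pos (r : 'I_(size (map Q ws))) : 0 <= \sum_(x <- hs) Q x + psum k f (rot r (map Q ws)).
by rewrite -map_rot; have [] := rot_onb r bw ow; apply: psumW.
have/eqP := S0; rewrite psumr_eq0// => /allP/(_ (Ordinal (leq_ltn_trans (leq0n k) sz))).
by rewrite mem_index_enum => /(_ isT)/eqP; rewrite rot0; lra.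
Qed.
(** Put [x] first and [y] last, then exchange them. The first place has full weight since [k] is
    positive, the last one has weight 0 since the basis is longer than [k.+1], and both partial sums
    have the same value. *)
Let swap_eq hs x y rest : basis_of H hs -> orthonormal hs -> basis_of W (x :: rest) ->
 orthonormal (x :: rest) -> y \in rest -> Q y = Q x.
move=> bh oh bw ow /splitPr yr; case: yr bw ow => r1 r2 bw ow.
have p1 : perm_eq (x :: r1 ++ y :: r2) (x :: rcons (r1 ++ r2) y).
by apply/permP=> a; rewrite /= -!cats1 !count_cat/=; ring.
have p2 : perm_eq (x :: r1 ++ y :: r2) (y :: rcons (r1 ++ r2) x).
by apply/permP=> a; rewrite /= -!cats1 !count_cat/=; ring.
have eqP s : perm_eq (x :: r1 ++ y :: r2) s -> psum k f (map Q s) = - \sum_(z <- hs) Q z.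
by move=> p; apply: psumW_eq => //; [rewrite -(perm_basis _ p)|apply: orthonormal_perm p ow].
have sz : (k < (size (r1 ++ r2)).+1)%N.
by have := sizeW_nat bw ow; rewrite (perm_size p1)/= size_rcons.
have psE a b : psum k f (map Q (a :: rcons (r1 ++ r2) b)) =
 Q a + psum k.-1 f (map Q (r1 ++ r2)).
rewrite map_cons map_rcons; case: k k1 sz => // k' _ sz.
rewrite /psum big_ord_recl/= -addrA; congr (_ + (_ + _ * _)); last first.
by rewrite nth_rcons size_map -ltnS sz.
apply: eq_bigr => i _; rewrite nth_rcons size_map ifT//.
by apply: ltn_trans (ltn_ord i) _.
by have := eqP _ p1; rewrite -(eqP _ p2) !psE => /addIr ->.
Qed.

(** Any unit vector of [W] begins an orthonormal basis on which [Q] is constant by [swap_eq], so its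
    value there is the average [l]. The sign of [l] needs other bases, in which one element of [H]
    leaves the partial sum. *)
Lemma alpha_constW : exists2 l, 0 <= l & (T = l * (m%:R ^+ 2 + m%:R) /\
 forall x, x \in W -> Q x = l * mip x x).
have [hs [oh bh]] : exists hs, orthonormal hs /\ basis_of H hs.
by apply: (@orthonormal_extend _ _ H [::]).
have d0 : m%:R ^+ 2 + m%:R != 0 :> R by rewrite gt_eqF//; move: m2'; nra.
pose l := T / (m%:R ^+ 2 + m%:R).
have lW x : x \in W -> mip x x = 1 -> Q x = l.
move=> xW x1; have [||rest [ow bw]] := @orthonormal_extend _ _ W [:: x].
 - by move=> [|//] [|//] _ _.
 - by move=> z; rewrite inE => /eqP ->.
have : \sum_(z <- x :: rest) Q z = T by exact: sumW.
have e z : z \in x :: rest -> Q z = Q x.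
by rewrite inE => /orP[/eqP -> //|]; exact: swap_eq bh oh bw ow.
rewrite big_seq (eq_bigr (fun=> Q x))// -big_seq big_const_seq count_predT -Monoid.iteropE.
rewrite -[iterop _ _ _ _]/(Q x *+ size (x :: rest)) -mulr_natr (sizeW bw ow) /l => <-.
by rewrite mulfK.
exists l; last first.
split; first by rewrite /l divfK.
move=> x xW; have [x0|x0] := eqVneq (mip x x) 0.
by rewrite (mip_eq0 x0) Q0 mip0r mulr0.
have xx : 0 < mip x x by rewrite lt_neqAle eq_sym x0 mip_ge0.
pose r := Num.sqrt (mip x x); have r0 : r != 0 by rewrite sqrtr_eq0 -ltNge.
have r2 : r ^+ 2 = mip x x by rewrite sqr_sqrtr ?mip_ge0.
rewrite -{1}[x](scalerKV r0) QZ r2 lW ?memvZ//; first by rewrite mulrC.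
by rewrite mipZl mipZr -r2; field.
have [ws [ow bw]] : exists ws, orthonormal ws /\ basis_of W ws.
by apply: (@orthonormal_extend _ _ W [::]).
have Qws z : z \in map Q ws -> z = l.
move=> /mapP[x xws ->]; apply: lW; first exact: (basis_mem bw).
by have [_ ->] := (orthonormalP ws).1 ow; rewrite ?eqxx.
have Th : \sum_(x <- hs) Q x = - c * l.
by rewrite sumH// /l /c; field; rewrite d0 pnatr_eq0; case: m m2.
(* Move [h] behind the basis of [W]. The partial sum loses [Q h] and gains one more element of [W];
   as the sum over [hs] is -c l, what remains is l - Q h. *)
have step h : h \in hs -> 0 <= l - Q h.
move=> hh; have p : perm_eq hs (h :: rem h hs) by apply: perm_to_rem.
have ob : orthonormal_basis (rem h hs ++ rcons ws h).
apply: (onb bh oh bw ow); rewrite -cats1 catA perm_sym perm_catC catA perm_cat2r/=.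
by rewrite perm_sym.
have := alpha_psum bh oh ob.
have -> : (size hs + k)%N = (size (map Q (rem h hs)) + k.+1)%N.
by rewrite size_map (perm_size p)/= addnS addSn.
rewrite map_cat psum_cat map_rcons.
have sz := sizeW_nat bw ow.
have -> : psum k.+1 f (rcons (map Q ws) (Q h)) = psum k.+1 f (map Q ws).
rewrite /psum nth_rcons size_map sz; congr (_ + _); apply: eq_bigr => i _.
by rewrite nth_rcons size_map ifT// (ltn_trans (ltn_ord i)).
rewrite (@psum_const _ _ _ _ l) ?size_map// big_map.
move: Th; rewrite (perm_big _ p) big_cons /f -natr1/=; lra.
have : 0 <= \sum_(h <- hs) (l - Q h).
by rewrite big_seq; apply: sumr_ge0 => h; exact: step.
rewrite sumrB Th big_const_seq count_predT -Monoid.iteropE.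
rewrite -[iterop _ _ _ _]/(l *+ size hs) -mulr_natr (sizeH bh oh) /c.
have pos : 0 < m%:R ^+ 2 - 1 :> R by move: m2'; nra.
have -> : l * (m%:R ^+ 2 - 1) - - (2^-1 * (m%:R ^+ 2 - 1)) * l = (3 / 2 * (m%:R ^+ 2 - 1)) * l by field.
by rewrite pmulr_rge0 ?mulr_gt0.
Qed.
End AlphaArgument.

Section PointwiseRigidity.
Variables (R : realType) (m : nat).
Let n := (m + m)%N.
Variables (J : 'M[R]_n) (D : 'rV[R]_n -> 'rV[R]_n -> 'rV[R]_n -> 'rV[R]_n -> R).
Hypotheses (m2 : (2 <= m)%N) (JJ : J *m J = - 1%:M) (JT : J^T = - J) (HD : curvlike J D).
Let n0 : (0 < n)%N. by rewrite /n; case: m m2. Qed.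
Lemma row_sumE (u : 'rV[R]_n) : u = \sum_i u 0 i *: delta_mx 0 i.
exact: row_sum_delta. Qed.
Lemma op2_rank1 (a b c d : 'rV[R]_n) : op2 D (a^T *m b) (c^T *m d) = D a c d b.
have colrow (u v : 'rV[R]_n) i j : (u^T *m v) i j = u 0 i * v 0 j.
by rewrite mxE big_ord1 mxE.
rewrite [in RHS](row_sumE a) (cl_pair HD) (cl_sum3 HD); apply: eq_bigr => i _.
rewrite -(cl_pair HD) [in RHS](row_sumE c) (cl_pair HD) (cl_sum4 HD) mulr_sumr; apply: eq_bigr => j _.
rewrite -(cl_pair HD) [in RHS](row_sumE d) (cl_sum3 HD) !mulr_sumr; apply: eq_bigr => k _.
rewrite [in RHS](row_sumE b) (cl_sum4 HD) !mulr_sumr; apply: eq_bigr => l _.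
by rewrite !colrow; ring.
Qed.

Lemma mip_rank1 (a b c d : 'rV[R]_n) :
 mip (a^T *m b) (c^T *m d) = (a *m c^T) 0 0 * (b *m d^T) 0 0.
rewrite mipE ![(_ *m _^T) 0 0]mxE mulr_suml; apply: eq_bigr => i _; rewrite mulr_sumr.
by apply: eq_bigr => j _; rewrite !mxE !big_ord1 !mxE; ring.
Qed.

Lemma op2Zr a x y : op2 D x (a *: y) = a * op2 D x y.
by rewrite /op2 -sum4Z; apply: eq_sum4 => i j k l; rewrite mxE; ring. Qed.
Lemma op2Zl a x y : op2 D (a *: x) y = a * op2 D x y.
by rewrite /op2 -sum4Z; apply: eq_sum4 => i j k l; rewrite mxE; ring. Qed.
Lemma op2Dl x x' y : op2 D (x + x') y = op2 D x y + op2 D x' y.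
by rewrite /op2 -sum4D; apply: eq_sum4 => i j k l; rewrite mxE; ring. Qed.
Lemma op2Dr x y y' : op2 D x (y + y') = op2 D x y + op2 D x y'.
by rewrite /op2 -sum4D; apply: eq_sum4 => i j k l; rewrite mxE; ring. Qed.
(** The sign [s] treats both inequalities. The test tensor is phi = u u - (uJ)(uJ), which
    anticommutes with J: its square norm is twice the fourth power of the norm of [u], and the
    operator gives 2 D(u, uJ, u, uJ). The factor 1/4 in the witness reflects the normalization of
    the model to curvature 4. *)
Lemma alpha_model (s : R) : s ^+ 2 = 1 ->
 let al := 3 / 2 * (m%:R ^+ 2 - 1) in
 (forall phi, orthonormal_basis phi ->
 0 <= s * (\sum_(i < Num.truncn al) op2 D phi`_i phi`_i +
 (al - (Num.truncn al)%:R) * op2 D phi`_(Num.truncn al) phi`_(Num.truncn al))) ->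
 exists2 l, 0 <= s * l & forall u v w z, D u v w z = l * model_tensor J 1%:M u v w z.
move=> s2 al Hal.
have m0 : m%:R != 0 :> R by rewrite pnatr_eq0; case: m m2.
have nE : n%:R = 2 * m%:R :> R by rewrite /n natrD; ring.
pose Q x := s * op2 D x x.
pose T := s * \sum_i \sum_j D (delta_mx 0 i) (delta_mx 0 j) (delta_mx 0 i) (delta_mx 0 j).
have [||||||||l l0 [_ Ql]] := @alpha_constW R n m Q (commJ J) (antiJ J) T m2.
- by move=> x y xH yW; rewrite mipC; apply: (antiJ_commJ_orth JJ JT yW xH).
- apply/eqP; rewrite eqEsubv; apply/andP; split.
by rewrite subv_add /commJ /antiJ !capvSl.
apply/subvP => A AS; rewrite (proj_sum J AS) addrC.
by rewrite memv_add ?(projH_in JJ JT)// (projW_in JJ JT).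
- by move=> a x; rewrite /Q op2Zl op2Zr; ring.
- move=> t bt ot; have [_ ->] := trace_commJ JJ JT HD n0 bt ot.
by rewrite nE; field.
- move=> t bt ot; have [_ ->] := trace_antiJ JJ JT HD bt ot.
by rewrite nE; field.
- move=> t bt ot; have [e _] := trace_commJ JJ JT HD n0 bt ot.
by rewrite -mulr_sumr e nE /T; field.
- move=> t bt ot; have [e _] := trace_antiJ JJ JT HD bt ot.
by rewrite -mulr_sumr e.
- move=> phi ophi; have := Hal phi ophi.
by rewrite mulrDr mulr_sumr mulrCA.
have Jg : J *m 1%:M *m J^T = 1%:M by rewrite mulmx1 JT mulmxN JJ opprK.
exists (4^-1 * (s * l)).
by rewrite mulrCA mulr_ge0// mulrA -expr2 s2 mul1r.
apply: (curvlike_model JJ (trmx1 _ _) Jg HD) => u.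
pose v := u *m J; pose phi := u^T *m u - v^T *m v.
have JuJ : J *m (u^T *m u) *m J = - (v^T *m v).
by rewrite /v trmx_mul JT !mulNmx opprK !mulmxA.
have vv : (v *m v^T) = u *m u^T.
by rewrite /v trmx_mul JT -mulmxA (mulmxA J) mulmxN JJ opprK mul1mx.
have phiW : phi \in antiJ J.
apply/(antiJP); split.
 - by rewrite /phi trmxD trmxN !trmx_mul !trmxK.
 - by rewrite /phi mxtraceD raddfN/= (mxtrace_mulC u^T) (mxtrace_mulC v^T) vv subrr.
 - rewrite /phi -JuJ; set S := u^T *m u; rewrite mulmxDr mulmxDl.
rewrite -[_ *m J *m J]mulmxA JJ -[J *m S *m J]mulmxA [J *m (J *m _)]mulmxA JJ.
by rewrite !(mulNmx, mulmxN) mul1mx mulmx1 opprD opprK addrC.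
have := Ql phi phiW; rewrite /Q.
have -> : phi = u^T *m u + (-1) *: (v^T *m v) by rewrite scaleN1r.
rewrite !(op2Dl, op2Dr, op2Zl, op2Zr, mipDr, mipDl, mipZr, mipZl) !op2_rank1 !mip_rank1.
rewrite -/v; have D0 a b c : D a a b c = 0 by have := cl_12 HD a a b c; lra.
rewrite !D0 (cl_34 HD u v u v) (cl_12 HD u v u v).
have vvE : (v *m v^T) 0 0 = gip 1%:M u u by rewrite vv /gip mulmx1.
have dotC (a b : 'rV[R]_n) : (a *m b^T) 0 0 = (b *m a^T) 0 0.
by have := gipC (trmx1 R n) a b; rewrite /gip !mulmx1.
have uvE : (u *m v^T) 0 0 = 0.
have := gipJ JJ Jg u u; rewrite /gip !mulmx1 -/v => e.
by have := dotC u v; lra.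
have vuE : (v *m u^T) 0 0 = 0 by rewrite dotC.
rewrite vvE uvE vuE -[(u *m u^T) 0 0]/((u *m u^T) 0 0).
have -> : (u *m u^T) 0 0 = gip 1%:M u u by rewrite /gip mulmx1.
move=> e.
have e' : s * D u v u v = l * gip 1%:M u u ^+ 2 by move: e; lra.
have -> : 4 * (4^-1 * (s * l)) * gip 1%:M u u ^+ 2 = s * (l * gip 1%:M u u ^+ 2) by field.
by rewrite -e' mulrA -expr2 s2 mul1r.
Qed.
End PointwiseRigidity.

(** * Unitary frames and the constancy of the holomorphic sectional curvature *)

Definition J0 (R : pzRingType) m : 'M[R]_(m + m) := block_mx 0 1%:M (- 1%:M) 0.

Section UnitaryFrames.
Variables (R : realType) (m : nat).
Notation n := (m + m)%N.

Lemma J0_sq : J0 R m *m J0 R m = - 1%:M.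
rewrite /J0 mulmx_block !mulmx0 !mul0mx !mulmx1 !mul1mx !add0r !addr0.
by rewrite [in RHS]scalar_mx_block opp_block_mx oppr0.
Qed.

Lemma J0_tr : (J0 R m)^T = - J0 R m.
by rewrite /J0 tr_block_mx opp_block_mx !trmx0 linearN/= trmx1 opprK oppr0. Qed.
Lemma mul_iE (v : 'rV[R]_n) : mul_i v = v *m J0 R m.
rewrite -[v in RHS]hsubmxK /J0 mul_row_block !mulmx0 mulmxN !mulmx1 add0r addr0.
by [].
Qed.
Variables (J g : 'M[R]_n).
Hypotheses (JJ : J *m J = - 1%:M) (gT : g^T = g)
 (gpos : forall v : 'rV[R]_n, v != 0 -> 0 < (v *m g *m v^T) 0 0) (Jg : J *m g *m J^T = g).

(** Complex Gram-Schmidt: while k < m, the rows of [B] and [B *m J] impose 2k < 2m linear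
    conditions, so that a nonzero vector orthogonal to all of them exists. *)
Lemma unitary_frame : exists E : 'M[R]_n, E *m g *m E^T = 1%:M /\ E *m J = J0 R m *m E.
have gJT : g *m J^T = - (J *m g) by rewrite -[in LHS]Jg -!mulmxA -trmx_mul JJ linearN/= trmx1 !mulmxN mulmx1.
have trg p q (A : 'M[R]_(p, n)) (B : 'M[R]_(q, n)) : (A *m g *m B^T)^T = B *m g *m A^T.
by rewrite !trmx_mul trmxK gT mulmxA.
have build k : (k <= m)%N -> exists B : 'M[R]_(k, n),
 B *m g *m B^T = 1%:M /\ B *m J *m g *m B^T = 0.
elim: k => [|k IH] km.
by exists 0; split; apply/matrixP => -[].
have [B [B1 B2]] := IH (ltnW km).
pose C := g *m row_mx B^T (B *m J)^T.
have [v vC v0] : exists2 v : 'rV[R]_n, v *m C = 0 & v != 0.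
have rC : (\rank C < n)%N.
by apply: leq_ltn_trans (rank_leq_col _) _; rewrite -addnS leq_add// ltnW.
have := kermx_eq0 C; rewrite /row_free (ltn_eqF rC) => kC.
have /rowV0Pn[v vk v0] : kermx C != 0 by rewrite kC.
by exists v => //; apply/sub_kermxP.
move: vC; rewrite mulmxA mul_mx_row => /eqP.
rewrite -[0]row_mx0 => /eqP/eq_row_mx[vB vBJ].
pose s := Num.sqrt ((v *m g *m v^T) 0 0).
have s0 : s != 0 by rewrite sqrtr_eq0 -ltNge gpos.
have s2 : s ^+ 2 = (v *m g *m v^T) 0 0 by rewrite sqr_sqrtr// ltW// gpos.
pose w := s^-1 *: v.
have wg : w *m g *m w^T = 1%:M.
apply/matrixP => i j; rewrite !ord1 /w linearZ/= -scalemxAr -!scalemxAl !scalemxE -s2 mxE eqxx/=.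
by field.
have wB : w *m g *m B^T = 0 by rewrite /w -!scalemxAl vB scaler0.
have wBJ : w *m g *m (B *m J)^T = 0 by rewrite /w -!scalemxAl vBJ scaler0.
have wJw : w *m J *m g *m w^T = 0.
have e : (w *m J *m g *m w^T)^T = - (w *m J *m g *m w^T).
by rewrite !trmx_mul trmxK gT (mulmxA g) gJT mulNmx mulmxN !mulmxA.
apply/matrixP => i j; rewrite !ord1 zeromxE.
by have := congr1 (fun A : 'M[R]_1 => A 0 0) e; rewrite mxE oppmxE; lra.
have BJw : B *m J *m g *m w^T = 0.
by rewrite -[LHS]trmxK trg wBJ trmx0.
have Bw : B *m g *m w^T = 0.
by rewrite -[LHS]trmxK trg wB trmx0.
have wJB : w *m J *m g *m B^T = 0.
rewrite -(mulmxA w J g) -[J *m g]opprK -gJT mulmxN mulNmx -!mulmxA -trmx_mul !mulmxA.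
by rewrite wBJ oppr0.
rewrite -addn1; exists (col_mx B w); rewrite !mul_col_mx tr_col_mx !mul_mx_row.
rewrite B1 B2 wg wB Bw wJw BJw wJB; split; first by rewrite [RHS]scalar_mx_block.
by rewrite !row_mx0 col_mx0.
have [B [B1 B2]] := build m (leqnn m).
have BJ2 : B *m J *m J = - B by rewrite -mulmxA JJ mulmxN mulmx1.
exists (col_mx B (B *m J)); split; last first.
rewrite mul_col_mx /J0 mul_block_col !mul0mx mul1mx mulNmx mul1mx add0r addr0 BJ2.
by [].
rewrite !mul_col_mx tr_col_mx !mul_mx_row B1.
have -> : B *m g *m (B *m J)^T = 0.
by rewrite trmx_mul mulmxA -(mulmxA B g) gJT mulmxN mulNmx !mulmxA B2 oppr0.
have -> : B *m J *m g *m (B *m J)^T = 1%:M.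
by rewrite trmx_mul mulmxA -(mulmxA B J g) -(mulmxA B) Jg B1.
by rewrite B2 [RHS]scalar_mx_block.
Qed.
End UnitaryFrames.

Lemma cyclic_cancel (F : fieldType) (k h a1 a2 a3 b1 b2 b3 : F) : k != 0 ->
 b1 + b2 + b3 = 0 -> k * (a1 + h * b1) + k * (a2 + h * b2) + k * (a3 + h * b3) = 0 ->
 a1 + a2 + a3 = 0.
move=> k0 b0 e; apply: (mulfI k0); rewrite mulr0 -[RHS]e.
by rewrite -[LHS]addr0 -(mulr0 (k * h)) -b0; ring.
Qed.

(** The cyclic hypothesis says that the wedge product of the 1-form [mu] with the 2-form [Om] is 0.
    Contracting with the inverse of [Om], the term [mu k] appears n times and the two others remove
    it once each. *)
Lemma closed_contract (F : fieldType) n (Om P : 'M[F]_n) (mu : 'I_n -> F) :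
 Om *m P = 1%:M -> Om^T = - Om ->
 (forall a b d, mu d * Om a b + mu a * Om b d + mu b * Om d a = 0) ->
 forall k, (n%:R - 2) * mu k = 0.
move=> OP OT closed k.
have OO a b : \sum_l Om a l * P l b = (a == b)%:R.
by have := congr1 (fun A : 'M[F]_n => A a b) OP; rewrite !mxE.
have Oa a b : Om a b = - Om b a.
by have := congr1 (fun A : 'M[F]_n => A b a) OT; rewrite mxE oppmxE.
have Pa a b : P a b = - P b a.
have [uO _] := mulmx1_unit OP.
have : P^T = - P.
apply: (can_inj (mulKmx uO)); rewrite mulmxN OP.
rewrite -[X in X *m _]opprK -OT mulNmx -trmx_mul (mulmx1C OP) trmx1.
by [].
by move=> /(congr1 (fun A : 'M[F]_n => A b a)); rewrite mxE oppmxE.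
pose nu d := \sum_b mu b * P b d.
have one a : mu k - mu a * (k == a)%:R + Om k a * nu a = 0.
have : \sum_b (mu k * Om a b + mu a * Om b k + mu b * Om k a) * P b a = 0.
by rewrite big1// => b _; rewrite closed mul0r.
rewrite (eq_bigr (fun b => mu k * (Om a b * P b a) - mu a * (Om k b * P b a)
 + Om k a * (mu b * P b a))); last by move=> b _; rewrite (Oa b k); ring.
by rewrite big_split sumrB -!mulr_sumr !OO eqxx mulr1.
have : \sum_a (mu k - mu a * (k == a)%:R + Om k a * nu a) = 0 by rewrite big1.
rewrite big_split sumrB sumr_const card_ord.
have -> : \sum_a mu a * (k == a)%:R = mu k.
by rewrite (bigD1 k)//= eqxx mulr1 big1 ?addr0// => a ak; rewrite eq_sym (negbTE ak) mulr0.
have -> : \sum_a Om k a * nu a = - mu k.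
under eq_bigr do rewrite mulr_sumr.
rewrite exchange_big (bigD1 k)//= [X in _ + X]big1 ?addr0; last first.
move=> b bk; have := OO k b; rewrite eq_sym (negbTE bk) => e.
rewrite (eq_bigr (fun a => - mu b * (Om k a * P a b))).
by rewrite -mulr_sumr e mulr0.
by move=> a _; rewrite (Pa b a); ring.
rewrite (eq_bigr (fun a => - mu k * (Om k a * P a k))).
by rewrite -mulr_sumr OO eqxx mulr1.
by move=> a _; rewrite (Pa k a); ring.
by rewrite /= -mulr_natl => e; rewrite -[RHS]e; ring.
Qed.

Section HolomorphicCurvature.
Variables (R : realType) (m : nat) (M : riemData R (m + m)).
Notation n := (m + m)%N.
Hypotheses (RM : riemannian M).
Variables (J : chart M -> 'rV[R]_n -> 'M[R]_n).
Hypotheses (KJ : kahler J).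
Implicit Types (c : chart M) (x : 'rV[R]_n).
Notation kfm := (kform J).
Notation dl i := (delta_mx 0 i : 'rV[R]_n).

Definition curvform c x (u v w z : 'rV[R]_n) : R :=
 \sum_i \sum_j u 0 i * v 0 j * (z *m curvmx c i j x *m metric c x *m w^T) 0 0.

Lemma curvform_entry c x i j k l : cimg c x ->
 curvform c x (delta_mx 0 i) (delta_mx 0 j) (delta_mx 0 k) (delta_mx 0 l) = riem c i j k l x.
move=> cx; rewrite /curvform (bigD1 i)//= (bigD1 j)//= big1 ?addr0; last first.
by move=> b bj; rewrite [X in _ * X * _]mxE (negbTE bj) andbF mulr0 mul0r.
rewrite big1 ?addr0; last first.
move=> a ai; rewrite big1// => b _.
by rewrite [X in X * _ * _]mxE (negbTE ai) andbF !mul0r.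
have d1 a : (delta_mx 0 a : 'rV[R]_n) 0 a = 1 by rewrite mxE !eqxx.
rewrite !d1 !mul1r riemE// trmx_delta.
by rewrite -!mulmxA (mulmxA (curvmx _ _ _ _)) -colE -rowE mxE [LHS]mxE.
Qed.

Lemma curvlike_curvform c x : cimg c x -> curvlike (J c x) (curvform c x).
move=> cx; have sk i j := curvmx_skew RM i j cx.
have gF i j : metric c x *m (curvmx c i j x)^T = - (curvmx c i j x *m metric c x).
by apply/eqP; rewrite -addr_eq0 addrC sk.
have sk' i j (w z : 'rV[R]_n) : (w *m curvmx c i j x *m metric c x *m z^T) 0 0 =
 - (z *m curvmx c i j x *m metric c x *m w^T) 0 0.
rewrite -[w *m _ *m _ *m _]trmxK [LHS]mxE !trmx_mul trmxK (metric_sym RM cx).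
by rewrite (mulmxA (metric c x)) gF mulNmx mulmxN oppmxE !mulmxA.
split.
- move=> u u' v w z; rewrite -big_split; apply: eq_bigr => i _; rewrite -big_split.
by apply: eq_bigr => j _; rewrite /= addmxE; ring.
- move=> a u v w z; rewrite /curvform mulr_sumr; apply: eq_bigr => i _; rewrite mulr_sumr.
by apply: eq_bigr => j _; rewrite scalemxE; ring.
- move=> u v w z; rewrite /curvform exchange_big -sumrN; apply: eq_bigr => i _.
rewrite -sumrN; apply: eq_bigr => j _.
by rewrite [curvmx c j i x]curvmx_anti mulmxN !mulNmx oppmxE; ring.
- move=> u v w z; rewrite /curvform -sumrN; apply: eq_bigr => i _; rewrite -sumrN.
by apply: eq_bigr => j _; rewrite sk'; ring.
- move=> u v w z.
pose T i j l : R := (row l (curvmx c i j x) *m metric c x *m z^T) 0 0.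
have E (a b d : 'rV[R]_n) : curvform c x a b d z =
 \sum_i \sum_j \sum_l - (a 0 i * b 0 j * d 0 l * T i j l).
apply: eq_bigr => i _; apply: eq_bigr => j _.
rewrite sk' mulrN [in LHS](row_sum_delta d) !mulmx_suml summxE mulr_sumr -sumrN.
by apply: eq_bigr => l _; rewrite -!scalemxAl -rowE scalemxE mulrA.
rewrite !E [X in _ + X + _](eq_bigr (fun i => \sum_l \sum_j - (v 0 i * w 0 j * u 0 l * T i j l))).
rewrite [X in _ + X + _]exchange_big/=.
rewrite [X in _ + _ + X]exchange_big/=.
rewrite [X in _ + _ + X](eq_bigr (fun j => \sum_l \sum_i - (w 0 i * u 0 j * v 0 l * T i j l))).
rewrite -!big_split big1// => i _; rewrite -!big_split big1// => j _.
rewrite -!big_split big1// => l _; have := bianchi1 RM i j l cx.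
move=> /(congr1 (fun r => (r *m metric c x *m z^T) 0 0)).
rewrite !mulmxDl !mul0mx !addmxE zeromxE -/(T i j l) -/(T j l i) -/(T l i j) => e.
have -> : T i j l = - T j l i - T l i j by move: e; lra.
by rewrite /=; ring.
by move=> j _; rewrite exchange_big.
by move=> i _; rewrite exchange_big.
- move=> u v w z; apply: eq_bigr => i _; apply: eq_bigr => j _; congr (_ * _).
rewrite trmx_mul -(mulmxA z) -(curvmxJ RM KJ i j cx) !mulmxA.
by rewrite -(mulmxA _ (J c x)) -(mulmxA _ (_ *m _)) (J_herm KJ cx).
Qed.

Lemma cl_expand (I : 'M[R]_n) D (E : 'M[R]_n) i j k l : curvlike I D ->
 D (row i E) (row j E) (row k E) (row l E) =
 \sum_a \sum_b \sum_d \sum_e E i a * E j b * E k d * E l e *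
 D (delta_mx 0 a) (delta_mx 0 b) (delta_mx 0 d) (delta_mx 0 e).
move=> HD; have rE a : row a E = \sum_b E a b *: delta_mx 0 b.
by rewrite [LHS]row_sumE; apply: eq_bigr => b _; rewrite mxE.
rewrite (rE i) (cl_pair HD) (cl_sum3 HD); apply: eq_bigr => a _.
rewrite -(cl_pair HD) (rE j) (cl_pair HD) (cl_sum4 HD) mulr_sumr; apply: eq_bigr => b _.
rewrite -(cl_pair HD) (rE k) (cl_sum3 HD) !mulr_sumr; apply: eq_bigr => d _.
by rewrite (rE l) (cl_sum4 HD) !mulr_sumr; apply: eq_bigr => e _; ring.
Qed.

(** In a unitary frame the metric is the identity and J is [J0], so the algebraic result applies;
    both sides are then transported back by the frame. *)
Lemma alpha_curvform (s : R) c x : (2 <= m)%N -> s ^+ 2 = 1 -> cimg c x ->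
 (forall E phi, frame c x E -> orthonormal_basis phi ->
 0 <= s * alpha_sum c x E (3 / 2 * (m%:R ^+ 2 - 1)) phi) ->
 exists2 l, 0 <= s * l & forall u v w z,
 curvform c x u v w z = l * model_tensor (J c x) (metric c x) u v w z.
move=> m2 s2 cx Hal.
have [E [E1 EJ]] := unitary_frame (J_sq KJ cx) (metric_sym RM cx)
 (fun v => riem_metric_pos RM cx (v := v)) (J_herm KJ cx).
have HD := curvlike_curvform cx.
pose D (u v w z : 'rV[R]_n) := curvform c x (u *m E) (v *m E) (w *m E) (z *m E).
have HDE : curvlike (J0 R m) D.
split; rewrite /D.
 - by move=> *; rewrite mulmxDl (cl_add HD).
 - by move=> *; rewrite -scalemxAl (cl_scale HD).
 - by move=> *; rewrite (cl_12 HD).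
 - by move=> *; rewrite (cl_34 HD).
 - by move=> *; rewrite (cl_bianchi HD).
 - by move=> u v w z; rewrite -!(mulmxA _ (J0 R m)) -EJ !mulmxA (cl_J HD).
have op2E phi psi : curv_op2 c x E phi psi = op2 D phi psi.
apply: eq_sum4 => i j k l; congr (_ * _ * _).
rewrite /D -!rowE (cl_expand _ _ _ _ _ HD); apply: eq_sum4 => a b d e.
by rewrite curvform_entry.
have [|l sl Dl] := @alpha_model R m (J0 R m) D m2 (J0_sq R m) (J0_tr R m) HDE s s2.
move=> phi ophi; have := Hal E phi E1 ophi; rewrite /alpha_sum op2E.
by under eq_bigr do rewrite op2E.
exists l => // u v w z.
have uE : E \in unitmx by apply: (mulmx1_unit (B := metric c x *m E^T) _).1; rewrite mulmxA.
have gipE a b : gip (metric c x) (a *m E) (b *m E) = gip 1%:M a b.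
by rewrite /gip trmx_mul !mulmxA -(mulmxA a) -(mulmxA a) E1.
have key a b d e : curvform c x (a *m E) (b *m E) (d *m E) (e *m E) =
 l * model_tensor (J c x) (metric c x) (a *m E) (b *m E) (d *m E) (e *m E).
rewrite -[LHS]/(D a b d e) Dl /model_tensor.
by rewrite -!(mulmxA _ E) EJ !mulmxA !gipE.
by have := key (u *m invmx E) (v *m invmx E) (w *m invmx E) (z *m invmx E); rewrite !mulmxKV.
Qed.

(* The rows are d_i and J d_i. *)
Definition holrows c i x : 'M[R]_(1 + 1, n) :=
 col_mx (delta_mx 0 i) (delta_mx 0 i *m J c x).

(** The matrix of the curvature R(d_i, d_j) of [model_tensor], written with the pairs of rows d_i, J
    d_i because these are also the off-diagonal blocks of the developing connection. *)
Definition holmx c i j x : 'M[R]_n :=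
 - (2 * kfm c x i j) *: J c x + metric c x *m
 ((holrows c j x)^T *m holrows c i x - (holrows c i x)^T *m holrows c j x).

Lemma holrows_mul c i j x : (holrows c j x)^T *m holrows c i x =
 (dl j)^T *m (dl i) +
 ((dl j) *m J c x)^T *m ((dl i) *m J c x).
by rewrite /holrows tr_col_mx mul_row_col. Qed.
Lemma kform_entry c i j x : ((delta_mx 0 i : 'rV[R]_n) *m J c x *m metric c x *m
 (delta_mx 0 j : 'rV[R]_n)^T) 0 0 = kfm c x i j.
by rewrite -(mulmxA _ (J c x)) -rowE trmx_delta -colE !mxE. Qed.
Lemma curvmx_model c x l : cimg c x ->
 (forall u v w z, curvform c x u v w z = l * model_tensor (J c x) (metric c x) u v w z) ->
 forall i j, curvmx c i j x = l *: holmx c i j x.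
move=> cx H i j.
suff e : curvmx c i j x *m metric c x = l *: holmx c i j x *m metric c x.
by rewrite -[LHS](mulmxK (metric_unit RM cx)) e mulmxK// (metric_unit RM cx).
apply/matrixP => a b; rewrite -riemE// -curvform_entry// H.
rewrite -!scalemxAl scalemxE; congr (_ * _).
have ent (A : 'M[R]_n) k q : (A : 'M[R]_n) k q = ((dl k) *m A *m (dl q)^T) 0 0.
by rewrite -rowE trmx_delta -colE !mxE.
have gipE (u v w z : 'rV[R]_n) : (u *m (metric c x *m (v^T *m w) *m metric c x) *m z^T) 0 0 =
 gip (metric c x) u v * gip (metric c x) w z.
have -> : u *m (metric c x *m (v^T *m w) *m metric c x) *m z^T =
 (u *m metric c x *m v^T) *m (w *m metric c x *m z^T) by rewrite !mulmxA.
by rewrite mxE big_ord1.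
have kE k q : kfm c x k q = gip (metric c x) ((dl k) *m J c x) (dl q).
by rewrite -kform_entry.
rewrite ent /holmx !holrows_mul !(mulmxBr, mulmxDr, mulmxBl, mulmxDl, mulmxN, mulNmx).
rewrite -!scalemxAl -!scalemxAr -!scalemxAl !(addmxE, oppmxE, scalemxE) !gipE kE /model_tensor.
rewrite (mulmxA (dl a) (J c x)) -/(gip (metric c x) (dl a *m J c x) (dl b)).
ring.
Qed.

Lemma trace_holmx c i j x : cimg c x ->
 \tr (holmx c i j x *m J c x) = (2 * n%:R + 4) * kfm c x i j.
move=> cx; have tE (u w : 'rV[R]_n) : \tr (metric c x *m (u^T *m w) *m J c x) =
 (w *m J c x *m metric c x *m u^T) 0 0.
by rewrite mulmxA -mulmxA mxtrace_mulC mulmxA /mxtrace big_ord1.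
have tJ k q : \tr (metric c x *m ((dl k *m J c x)^T *m (dl q *m J c x)) *m J c x) =
 kfm c x q k.
rewrite tE -(mulmxA (dl q)) (J_sq KJ cx) mulmxN mulmx1 trmx_mul mulmxA.
rewrite !mulNmx -(mulmxA (dl q)) (metricJT KJ cx) mulmxN mulNmx opprK.
by rewrite -rowE trmx_delta -colE !mxE.
have te k q : \tr (metric c x *m ((dl k)^T *m dl q) *m J c x) = kfm c x q k.
by rewrite tE kform_entry.
rewrite /holmx !holrows_mul !(mulmxDr, mulmxDl, mulmxN, mulNmx, opprD) -scalemxAl (J_sq KJ cx).
have trN (A : 'M[R]_n) : \tr (- A) = - \tr A by rewrite raddfN.
rewrite !mxtraceD !trN mxtraceZ trN mxtrace1 !tJ !te.
have := congr1 (fun A : 'M[R]_n => A i j) (kform_anti RM KJ cx); rewrite mxE oppmxE => ->.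
ring.
Qed.

(** Contraction of a multiple of the Ricci form with the inverse of the Kähler form, normalized
    through [trace_holmx]. This recovers the constant [l] of each point by a formula that is visibly
    smooth. *)
Definition hol c x : R := (n%:R * (2 * n%:R + 4))^-1 *
 \sum_i \sum_j invmx (kfm c x) j i * \tr (curvmx c i j x *m J c x).
Hypotheses (m2 : (2 <= m)%N).
Hypothesis Hmodel : forall c x, cimg c x -> exists l, forall i j,
 curvmx c i j x = l *: holmx c i j x.
Let n4 : 4 <= n%:R :> R. by rewrite ler_nat (leq_add m2 m2). Qed.
Let n2 : n%:R - 2 != 0 :> R. by rewrite gt_eqF//; move: n4; lra. Qed.
Lemma kformV c x : cimg c x -> kfm c x *m invmx (kfm c x) = 1%:M.
by move=> cx; rewrite mulmxV// (kform_unit RM KJ). Qed.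
Lemma curvmx_hol c i j x : cimg c x -> curvmx c i j x = hol c x *: holmx c i j x.
move=> cx; have [l Hl] := Hmodel cx; suff -> : hol c x = l by [].
have E : \sum_i \sum_j invmx (kfm c x) j i * \tr (curvmx c i j x *m J c x) =
 l * (2 * n%:R + 4) * \tr (kfm c x *m invmx (kfm c x)).
rewrite /mxtrace mulr_sumr; apply: eq_bigr => a _.
rewrite [in RHS]mxE mulr_sumr; apply: eq_bigr => b _.
by rewrite Hl -scalemxAl -/(mxtrace _) mxtraceZ trace_holmx//; ring.
rewrite /hol E kformV// mxtrace1; field.
by apply/andP; split; rewrite gt_eqF//; move: n4; lra.
Qed.

Lemma hol_smooth c : smooth (cimg c) (hol c).
have oU := @open_cimg R n M RM c; move=> k.
apply: (CkM oU); first exact: Ck_cst.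
apply: Ck_sum => // i _; apply: Ck_sum => // j _; apply: (CkM oU).
exact: (mxsmoothV oU (@kform_unit R n M RM J KJ c) (@kform_smooth R n M RM J KJ c)).
apply: Ck_sum => // l _.
apply: (mxsmoothM oU _ (@J_smooth R n M J KJ c)).
apply: (mxsmooth_ext oU (F := fun x => dmx (conn c j) i x - dmx (conn c i) j x +
 (conn c j x *m conn c i x - conn c i x *m conn c j x))).
by move=> x _; rewrite curvmx_def.
have sc a := @conn_smooth R n M RM c a.
apply: (mxsmoothD oU); apply: (mxsmoothB oU).
- exact: (mxsmooth_dmx oU).
- exact: (mxsmooth_dmx oU).
- exact: (mxsmoothM oU).
- exact: (mxsmoothM oU).
Qed.

(** The traced curvature is (2n + 4) [hol] times the Kähler form, and both forms are closed. Hence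
    the wedge of d [hol] with the Kähler form vanishes, and [closed_contract] concludes as n is not
    2. *)
Lemma schur c k x : cimg c x -> partial (hol c) k x = 0.
move=> cx; have oU := @open_cimg R n M RM c.
pose Om := kfm c x; pose mu i := partial (hol c) i x.
have part a b d : partial (fun y => \tr (curvmx c a b y *m J c y)) d x =
 (2 * n%:R + 4) * (mu d * Om a b + hol c x * dmx (kfm c) d x a b).
have ko : Ck 1 (cimg c) (fun y => kfm c y a b) by apply: (kform_smooth RM KJ).
have h1 : Ck 1 (cimg c) (hol c) by apply: hol_smooth.
rewrite (@partial_near _ _ _ (fun y => (2 * n%:R + 4) * (hol c y * kfm c y a b))).
rewrite (@partialM _ _ (cimg c) (fun=> 2 * n%:R + 4) (fun y => hol c y * kfm c y a b) d x).
 - rewrite (@partialM _ _ (cimg c) (hol c) (fun y => kfm c y a b) d x h1 ko cx).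
rewrite (dmxE _ _ _ oU _ cx); last by move=> i j; apply: (kform_smooth RM KJ).
by rewrite partial_def derive_cst mul0r add0r.
 - exact: Ck_cst.
 - exact: (CkM oU).
 - exact: cx.
apply: (open_near oU cx) => y cy.
by rewrite curvmx_hol// -scalemxAl mxtraceZ trace_holmx//; ring.
have closed a b d : mu d * Om a b + mu a * Om b d + mu b * Om d a = 0.
have := trace_curvmx_closed RM KJ a b d cx; rewrite !part.
have e := kform_closed RM KJ a b d cx.
have c0 : 2 * n%:R + 4 != 0 :> R by rewrite gt_eqF//; move: n4; lra.
by move=> e2; exact: cyclic_cancel c0 e e2.
have uO : Om \in unitmx by exact: (kform_unit RM KJ cx).
have OT : Om^T = - Om by exact: (kform_anti RM KJ cx).
have e := closed_contract (mulmxV uO) OT closed k.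
by apply: (mulfI n2); rewrite mulr0; exact: e.
Qed.
End HolomorphicCurvature.

Lemma connected_near (T : topologicalType) (P : T -> Prop) (x0 : T) :
 connected [set: T] -> (forall x, \forall y \near x, P y <-> P x) -> P x0 -> forall x, P x.
move=> cT Pn Px0 x.
suff -> : P = [set: T] :> set T by [].
apply: cT; first by exists x0.
exists P; last by rewrite setTI.
by rewrite openE => y Py; apply: filterS (Pn y) => z [_ /(_ Py)].
exists P; last by rewrite setTI.
rewrite -openC openE => y nPy; apply: filterS (Pn y) => z [zy _] /zy.
exact: nPy.
Qed.

Lemma partial0_near (R : realType) n (U : set 'rV[R]_n) (f : 'rV[R]_n -> R) x :
 open U -> Ck 1 U f -> (forall y i, U y -> partial f i y = 0) -> U x ->
 \forall y \near x, f y = f x.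
move=> oU f1 f0 Ux; have [d d0 xU] := near_ball (open_near oU Ux (fun y Uy => Uy)).
apply: filterS (near_norm x d0) => y xy.
have seg t : 0 <= t <= 1 -> U (x + t *: (y - x)).
move=> /andP[t0 t1]; apply: xU; rewrite opprD addrA subrr add0r normrN normrZ ger0_norm//.
by rewrite distrC; apply: le_lt_trans xy; rewrite ler_piMl.
have := @lipschitz_segment R n U f x y 0 oU f1 seg.
rewrite mulr0 mul0r => H; apply/eqP; rewrite -subr_eq0 -normr_le0; apply: H => t i t01.
by rewrite f0 ?normr0//; exact: seg.
Qed.

(** * Changes of charts, and the global constant *)

Section ChartChange.
Variables (R : realType) (n : nat) (M : riemData R n).
Hypotheses (RM : riemannian M).
Implicit Types (c d : chart M) (x : 'rV[R]_n) (p : M).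

Definition trans c d : 'rV[R]_n -> 'rV[R]_n := @local_rep R n M M id c d.
Definition overlap c d : set 'rV[R]_n := @local_dom R n M M id c d.

Lemma overlapE c d x : overlap c d x <-> cimg c x /\ cdom d (param c x).
split=> [[p [cp dp] <-]|[[p cp <-]]].
by split; [exists p|rewrite (riem_coordK RM)].
by rewrite (riem_coordK RM cp) => dp; exists p.
Qed.

Lemma cimg_param c x : cimg c x -> cdom c (param c x) /\ coord c (param c x) = x.
by move=> [p cp <-]; rewrite (riem_coordK RM). Qed.
Lemma cimg_coord c p : cdom c p -> cimg c (coord c p).
by exists p. Qed.
Lemma param_cont c x : cimg c x -> {for x, continuous (param c)}.
move=> cx; have := riem_param_cts RM (c := c).
rewrite (continuous_open_subspace _ (@open_cimg R n M RM c)) => H.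
by apply: H; apply/mem_set.
Qed.

Lemma coord_cont c p : cdom c p -> {for p, continuous (coord c)}.
move=> cp; have := riem_coord_cts RM (c := c).
rewrite (continuous_open_subspace _ (riem_open_dom RM c)) => H.
by apply: H; apply/mem_set.
Qed.

Lemma open_overlap c d : open (overlap c d).
rewrite openE => x /overlapE[cx dx].
have nd : nbhs (param c x) (cdom d) by apply: open_nbhs_nbhs; split=> //; exact: riem_open_dom.
have := param_cont cx nd; have := open_nbhs_nbhs (conj (@open_cimg R n M RM c) cx).
by apply: filterS2 => y cy dy; apply/overlapE.
Qed.

Lemma trans_smooth c d : mxsmooth (overlap c d) (trans c d).
by move=> i j; rewrite (ord1 i); have [_] := riem_smooth RM; apply. Qed.
Lemma trans_img c d x : overlap c d x -> cimg d (trans c d x).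
by move=> /overlapE[cx dx]; exists (param c x). Qed.
Lemma metric_trans c d x : overlap c d x ->
 metric c x = 'J (trans c d) x *m metric d (trans c d x) *m ('J (trans c d) x)^T.
exact: riem_metric_trans. Qed.
Lemma overlap_cimg c d x : overlap c d x -> cimg c x.
by move=> /overlapE[]. Qed.
Lemma jac_trans_unit c d x : overlap c d x -> 'J (trans c d) x \in unitmx.
move=> ox; have := metric_unit RM (overlap_cimg ox); rewrite (metric_trans ox).
by rewrite !unitmx_mul => /andP[/andP[]].
Qed.
Notation A c d := (fun x => 'J (trans c d) x).

Lemma jac_trans_smooth c d : mxsmooth (overlap c d) (A c d).
apply/mxsmoothP => k; apply: (mxCk_jac (@open_overlap c d)).
exact: (smooth_Ck _ (@trans_smooth c d)).
Qed.

Lemma dmx_jac_trans_sym c d i j x : overlap c d x ->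
 row j (dmx (A c d) i x) = row i (dmx (A c d) j x).
move=> ox; have oU := @open_overlap c d.
have A1 := smooth_Ck 1 (@jac_trans_smooth c d).
have t1 : mxCk 1 (overlap c d) (trans c d) by exact: (smooth_Ck _ (@trans_smooth c d)).
have t2 : mxCk 2 (overlap c d) (trans c d) by exact: (smooth_Ck _ (@trans_smooth c d)).
have dA k l : row l (dmx (A c d) k x) = dmx (dmx (trans c d) l) k x.
rewrite -(dmx_open k oU (F := fun y => row l ('J (trans c d) y)) _ ox); last first.
by move=> y oy; exact: (jac_row l oU t1 oy).
have -> : (fun y => row l ('J (trans c d) y)) = (fun y => delta_mx 0 l *m 'J (trans c d) y).
by apply/funext => y; rewrite rowE.
by rewrite (dmxM k oU (mxCk_cst _ _ _) A1 ox) dmx_cst mul0mx add0r rowE.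
by rewrite !dA; exact: (dmx_Schwarz j i oU t2 ox).
Qed.

Definition pullconn c d i x : 'M[R]_n :=
 \sum_k 'J (trans c d) x i k *: conn d k (trans c d x).

(* The transformation law of the Christoffel symbols. *)
Lemma dmx_jac_trans c d i x : overlap c d x ->
 dmx (A c d) i x = conn c i x *m 'J (trans c d) x - 'J (trans c d) x *m pullconn c d i x.
move=> ox; have oU := @open_overlap c d; have cx := overlap_cimg ox.
have sA := @jac_trans_smooth c d; have A1 := smooth_Ck 1 sA.
have dV := @open_cimg R n M RM d; have dx := trans_img ox.
have t1 : mxCk 1 (overlap c d) (trans c d) by exact: (smooth_Ck _ (@trans_smooth c d)).
have t2 : mxCk 2 (overlap c d) (trans c d) by exact: (smooth_Ck _ (@trans_smooth c d)).
have rA j y : overlap c d y -> row j ('J (trans c d) y) = dmx (trans c d) j y.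
by move=> oy; exact: (jac_row j oU t1 oy).
set J := 'J (trans c d) x; pose H i := pullconn c d i x.
have uJ : J \in unitmx by exact: jac_trans_unit.
(* The connection of [d] pulled back to [c]. It is torsion-free and metric, so uniqueness identifies
   it with the connection of [c]. *)
pose G i := (dmx (A c d) i x + J *m H i) *m invmx J.
suff GE : G i = conn c i x by rewrite -GE /G mulmxKV// addrK.
apply: (conn_unique RM cx) => [{}i j|{}i].
rewrite /G !row_mul !rowD; congr (_ *m _); congr (_ + _).
exact: dmx_jac_trans_sym.
rewrite !row_mul /H /pullconn !mulmx_sumr.
have rr a b : \sum_k row a J *m (J b k *: conn d k (trans c d x)) =
 \sum_k \sum_l (J b k * J a l) *: row l (conn d k (trans c d x)).
apply: eq_bigr => k _; rewrite -scalemxAr (row_sum_delta (row a J)) mulmx_suml scaler_sumr.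
by apply: eq_bigr => l _; rewrite -scalemxAl -rowE scalerA [row a J 0 l]mxE.
rewrite !rr exchange_big; apply: eq_bigr => k _; apply: eq_bigr => l _.
by rewrite (conn_torsion_row RM _ _ dx) mulrC.
have gE : dmx (metric c) i x = dmx (fun y => 'J (trans c d) y *m (metric d \o trans c d) y *m ('J (trans c d) y)^T) i x.
by apply: (dmx_open i oU) ox => y oy; exact: metric_trans.
have md1 : mxCk 1 (overlap c d) (metric d \o trans c d).
by apply: (mxCk_comp oU dV _ t1 (@metric_C1 R n M RM d)) => y; exact: trans_img.
rewrite gE (dmxM i oU (mxCkM oU A1 md1) (mxCk_tr oU A1) ox) (dmxM i oU A1 md1 ox).
rewrite (dmx_tr i oU A1 ox).
rewrite (dmx_comp i oU dV (fun y => @trans_img c d y) t1 (@metric_C1 R n M RM d) ox) -/J.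
rewrite (metric_trans ox) -/J /G /=; set g := metric d (trans c d x).
have -> : \sum_j J i j *: dmx (metric d) j (trans c d x) = H i *m g + g *m (H i)^T.
rewrite /H /pullconn linear_sum/= mulmx_suml mulmx_sumr -big_split; apply: eq_bigr => k _.
by rewrite (conn_metric RM k dx) scalerDr -scalemxAl linearZ/= -scalemxAr.
set dA := dmx _ i x.
have JTV : J^T *m (invmx J)^T = 1%:M by rewrite -trmx_mul mulVmx// trmx1.
rewrite !trmx_mul !(trmxD, trmx_mul) !(mulmxDl, mulmxDr) !mulmxA.
rewrite !(mulmxKV uJ) -!(mulmxA _ J^T (invmx J)^T) JTV !mulmx1.
by mxlin.
Qed.

(** Differentiate the transformation law of the Christoffel symbols once more and use that the
    second derivatives of the Jacobian commute. *)
Lemma curvmx_trans c d i j x : overlap c d x ->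
 curvmx c i j x *m 'J (trans c d) x = 'J (trans c d) x *m
 \sum_k \sum_l ('J (trans c d) x i k * 'J (trans c d) x j l) *: curvmx d k l (trans c d x).
move=> ox; have oU := @open_overlap c d; have cx := overlap_cimg ox.
have A1 := smooth_Ck 1 (@jac_trans_smooth c d).
have A2 := smooth_Ck 2 (@jac_trans_smooth c d).
have dV := @open_cimg R n M RM d; have dx := trans_img ox.
have t1 : mxCk 1 (overlap c d) (trans c d) by exact: (smooth_Ck _ (@trans_smooth c d)).
have G1 k : mxCk 1 (overlap c d) (conn c k).
by apply: (mxCk_sub _ (@conn_C1 R n M RM c k)) => y; exact: overlap_cimg.
have G'1 k : mxCk 1 (overlap c d) (conn d k \o trans c d).
by apply: (mxCk_comp oU dV _ t1 (@conn_C1 R n M RM d k)) => y; exact: trans_img.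
have Ak k l : Ck 1 (overlap c d) (fun y => 'J (trans c d) y k l) by apply: A1.
have AG k l : mxCk 1 (overlap c d) (fun y => 'J (trans c d) y k l *: (conn d l \o trans c d) y).
exact: (mxCkZ oU (Ak k l) (G'1 l)).
have H1 k : mxCk 1 (overlap c d) (pullconn c d k).
exact: (@mxCk_sum _ _ _ _ _ _ _ _ (fun l y => 'J (trans c d) y k l *: (conn d l \o trans c d) y) oU (AG k)).
have AM k : mxCk 1 (overlap c d) (fun y => conn c k y *m 'J (trans c d) y) by exact: (mxCkM oU (G1 k) A1).
have AH k : mxCk 1 (overlap c d) (fun y => 'J (trans c d) y *m pullconn c d k y) by exact: (mxCkM oU A1 (H1 k)).
have AH' k : mxCk 1 (overlap c d) (fun y => - ('J (trans c d) y *m pullconn c d k y)) by exact: (mxCkN oU (AH k)).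
have dd k l : dmx (dmx (A c d) l) k x =
 dmx (conn c l) k x *m 'J (trans c d) x + conn c l x *m dmx (A c d) k x
 - (dmx (A c d) k x *m pullconn c d l x + 'J (trans c d) x *m dmx (pullconn c d l) k x).
rewrite (dmx_open k oU (G := fun y => conn c l y *m 'J (trans c d) y -
 'J (trans c d) y *m pullconn c d l y) _ ox); last by move=> y oy; exact: dmx_jac_trans.
rewrite (dmxD k oU (AM l) (AH' l) ox) (dmxN k oU (AH l) ox).
by rewrite (dmxM k oU (G1 l) A1 ox) (dmxM k oU A1 (H1 l) ox).
have dH k l : dmx (pullconn c d l) k x =
 \sum_a dmx (A c d) k x l a *: conn d a (trans c d x) +
 \sum_a \sum_b ('J (trans c d) x k a * 'J (trans c d) x l b) *: dmx (conn d b) a (trans c d x).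
rewrite (dmx_sum k oU (AG l) ox) exchange_big -big_split; apply: eq_bigr => a _.
rewrite (dmxZ k oU (Ak l a) (G'1 a) ox) (dmxE _ _ _ oU A1 ox); congr (_ + _).
rewrite (dmx_comp k oU dV (fun y => @trans_img c d y) t1 (@conn_C1 R n M RM d a) ox).
by rewrite scaler_sumr; apply: eq_bigr => b _; rewrite scalerA mulrC.
have HH k l : pullconn c d k x *m pullconn c d l x =
 \sum_a \sum_b ('J (trans c d) x k a * 'J (trans c d) x l b) *:
 (conn d a (trans c d x) *m conn d b (trans c d x)).
rewrite /pullconn mulmx_suml; apply: eq_bigr => a _; rewrite mulmx_sumr; apply: eq_bigr => b _.
by rewrite -scalemxAl -scalemxAr scalerA.
have sym := dmx_Schwarz i j oU A2 ox; move: sym; rewrite !dd !dmx_jac_trans//.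
have dsym a : dmx (A c d) i x j a = dmx (A c d) j x i a.
by have := congr1 (fun r : 'rV_n => r 0 a) (dmx_jac_trans_sym i j ox); rewrite !mxE.
have -> : \sum_k \sum_l ('J (trans c d) x i k * 'J (trans c d) x j l) *: curvmx d k l (trans c d x) =
 dmx (pullconn c d j) i x - dmx (pullconn c d i) j x +
 (pullconn c d j x *m pullconn c d i x - pullconn c d i x *m pullconn c d j x).
rewrite !dH !HH (eq_bigr _ (fun a _ => congr1 (fun z => z *: _) (dsym a))).
rewrite [X in _ - (_ + X)]exchange_big [X in _ + (X - _)]exchange_big.
rewrite opprD [X in X + _]addrACA subrr add0r -!sumrN -!big_split; apply: eq_bigr => a _.
rewrite -!sumrN -!big_split; apply: eq_bigr => b _.
rewrite curvmx_def /= [_ * 'J _ x i a]mulrC -!scalerBr -scalerDr.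
by [].
rewrite curvmx_def; set G_i := conn c i x; set G_j := conn c j x; set J := 'J _ x.
set Hi := pullconn c d i x; set Hj := pullconn c d j x.
move=> /eqP; rewrite -subr_eq0 => /eqP sym.
apply/eqP; rewrite -subr_eq0; apply/eqP; rewrite -[RHS]oppr0 -sym.
by rewrite !(mulmxDl, mulmxDr, mulNmx, mulmxN, mulmxA); mxlin.
Qed.
End ChartChange.

Section HolChange.
Variables (R : realType) (m : nat) (M : riemData R (m + m)).
Notation n := (m + m)%N.
Hypotheses (RM : riemannian M).
Variables (J : chart M -> 'rV[R]_n -> 'M[R]_n).
Hypotheses (KJ : kahler J) (m2 : (2 <= m)%N).
Hypothesis Hmodel : forall c x, cimg c x -> exists l, forall i j,
 curvmx c i j x = l *: holmx J c i j x.
Implicit Types (c d : chart M) (x : 'rV[R]_n).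

Lemma J_trans c d x : overlap c d x ->
 J c x *m 'J (trans c d) x = 'J (trans c d) x *m J d (trans c d x).
exact: kahler_trans. Qed.
(** Both sides multiply the same tensor: the traced curvature and the Kähler form transform by the
    same law, and the Kähler form is not 0. *)
Lemma hol_trans c d x : overlap c d x -> hol J c x = hol J d (trans c d x).
move=> ox; have cx := overlap_cimg RM ox; have dx := trans_img RM ox.
set A := 'J (trans c d) x; have uA : A \in unitmx by exact: jac_trans_unit.
have kE : kform J c x = A *m kform J d (trans c d x) *m A^T.
by rewrite /kform (metric_trans RM ox) !mulmxA -(J_trans ox).
have n0 : 2 * n%:R + 4 != 0 :> R by rewrite gt_eqF// ltr_wpDl// mulr_ge0.
have tr i j : hol J c x * kform J c x i j = hol J d (trans c d x) * kform J c x i j.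
have L : (2 * n%:R + 4) * (hol J c x * kform J c x i j) = \tr (curvmx c i j x *m J c x).
by rewrite (curvmx_hol RM KJ m2 Hmodel _ _ cx) -scalemxAl mxtraceZ (trace_holmx RM KJ _ _ cx) mulrCA.
apply: (mulfI n0); rewrite L.
have -> : curvmx c i j x = A *m (\sum_k \sum_l (A i k * A j l) *: curvmx d k l (trans c d x)) *m invmx A.
by rewrite -(curvmx_trans RM _ _ ox) mulmxK.
have -> (X : 'M[R]_n) : \tr (A *m X *m invmx A *m J c x) = \tr (X *m J d (trans c d x)).
have -> : J c x = A *m J d (trans c d x) *m invmx A by rewrite -(J_trans ox) mulmxK.
rewrite !mulmxA mulmxKV// mxtrace_mulC !mulmxA mulVmx// mul1mx.
by [].
have -> : kform J c x i j = \sum_k \sum_l (A i k * A j l) * kform J d (trans c d x) k l.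
rewrite kE mxE exchange_big; apply: eq_bigr => l _; rewrite [(_ *m _) _ _]mxE mulr_suml.
by apply: eq_bigr => k _; rewrite [A^T _ _]mxE; ring.
rewrite mulmx_suml raddf_sum mulrA mulr_sumr; apply: eq_bigr => k _.
rewrite mulmx_suml raddf_sum mulr_sumr; apply: eq_bigr => l _.
rewrite /= -scalemxAl mxtraceZ (curvmx_hol RM KJ m2 Hmodel _ _ dx) -scalemxAl mxtraceZ.
by rewrite (trace_holmx RM KJ _ _ dx); ring.
apply/eqP; rewrite -subr_eq0; apply: contraT => ne.
have k0 : kform J c x = 0.
apply/matrixP => i j; rewrite zeromxE; apply: (mulfI ne).
by rewrite mulr0 mulrBl tr subrr.
have i0 : 'I_n by exists 0%N; rewrite addn_gt0; case: m m2.
have := congr1 (fun B : 'M[R]_n => B i0 i0) (kformV RM KJ cx).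
by rewrite k0 mul0mx !mxE eqxx => /eqP; rewrite eq_sym oner_eq0.
Qed.

Lemma hol_const : connected [set: M] -> exists l, forall c x, cimg c x -> hol J c x = l.
move=> cM.
have [[p0 _]|M0] := pselect (exists p : M, True); last first.
by exists 0 => c x [p _ _]; case: M0; exists p.
have [c0 cp0] := riem_cover RM p0.
have ind c d p : cdom c p -> cdom d p -> hol J d (coord d p) = hol J c (coord c p).
move=> cp dp; rewrite (hol_trans (c := c) (d := d)); last by exists p.
by rewrite /trans /local_rep (riem_coordK RM cp).
pose P p := exists2 c, cdom c p & hol J c (coord c p) = hol J c0 (coord c0 p0).
exists (hol J c0 (coord c0 p0)) => c x cx.
have [cp xE] := cimg_param RM cx.
suff [d dp <-] : P (param c x) by rewrite -{1}xE; exact: ind.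
apply: (connected_near cM (x0 := p0)); last by exists c0.
move=> p; have [d dp] := riem_cover RM p.
have dx := cimg_coord dp.
have n1 : \forall q \near p, hol J d (coord d q) = hol J d (coord d p).
have h : \forall y \near coord d p, hol J d y = hol J d (coord d p).
apply: (partial0_near (U := cimg d) _ _ _ dx).
 - exact: open_cimg.
 - exact: (@hol_smooth R m M RM J KJ d 1).
 - by move=> y i dy; exact: (schur RM KJ m2 Hmodel).
exact: (coord_cont RM dp h).
have n2 : \forall q \near p, cdom d q.
by apply: open_nbhs_nbhs; split=> //; exact: riem_open_dom RM d.
apply: filterS (filterI n1 n2) => q [hq dq]; split=> -[e ep he].
by exists d => //; rewrite -he -hq; exact: ind.
by exists d => //; rewrite -he hq; exact: ind.
Qed.
End HolChange.

(** The condition at each point gives the weak sign of [s * l]; if [s * l] were not positive then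
    [M] would be flat. *)
Lemma constant_holomorphic_curvature (R : realType) m (M : riemData R (m + m)) J (s : R) :
 riemannian M -> @kahler R (m + m) M J -> (2 <= m)%N -> connected [set: M] -> ~ flat M ->
 s ^+ 2 = 1 ->
 (forall (c : chart M) x E phi, cimg c x -> frame c x E -> orthonormal_basis phi ->
 0 <= s * alpha_sum c x E (3 / 2 * (m%:R ^+ 2 - 1)) phi) ->
 exists2 l, 0 < s * l & forall (c : chart M) x i j, cimg c x ->
 curvmx c i j x = l *: holmx J c i j x.
move=> RM KJ m2 cM nf s2 Hal.
have Hm c x : cimg c x -> exists l, 0 <= s * l /\ forall i j, curvmx c i j x = l *: holmx J c i j x.
move=> cx; have [l sl Hl] := alpha_curvform RM KJ m2 s2 cx (fun E phi => @Hal c x E phi cx).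
by exists l; split=> //; exact: (curvmx_model RM cx Hl).
have Hm' c x : cimg c x -> exists l, forall i j, curvmx c i j x = l *: holmx J c i j x.
by move=> cx; have [l [_ Hl]] := Hm c x cx; exists l.
have [l Hl] := hol_const RM KJ m2 Hm' cM.
have cl c x i j : cimg c x -> curvmx c i j x = l *: holmx J c i j x.
by move=> cx; rewrite (curvmx_hol RM KJ m2 Hm' _ _ cx) (Hl c x cx).
exists l; last by move=> c x i j cx; exact: cl.
apply: contrapT => /negP sl; apply: nf => c x cx i j k q.
have [l' [sl' Hl']] := Hm c x cx.
rewrite riemE// cl//.
have [->|l0] := eqVneq l 0; first by rewrite scale0r mul0mx mxE.
have s0 : s != 0 by apply: contraTneq (ltr01 : (0 : R) < 1) => s0; rewrite -s2 s0 expr0n ltxx.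
(* The constant [l'] of this point has the right weak sign. If it equals [l], then [s * l] is both
   nonnegative and nonpositive, which is excluded as neither factor is 0; so they differ, and the
   model matrix vanishes. *)
have -> : holmx J c i j x = 0.
have := Hl' i j; rewrite cl// => /eqP; rewrite -subr_eq0 -scalerBl scaler_eq0 subr_eq0.
move=> /orP[/eqP ll|/eqP //].
by move: sl sl'; rewrite -leNgt -ll => h1 h2; have/eqP := le_anti (introT andP (conj h1 h2)); rewrite mulf_eq0 (negbTE s0) (negbTE l0).
by rewrite scaler0 mul0mx mxE.
Qed.

(** The sizes [1 + 1 + n] and [m.+1 + m.+1] are equal but not convertible, so the equation is
    carried as a hypothesis. *)
Lemma mulmx1C_size (R : comUnitRingType) p q (A : 'M[R]_(p, q)) (B : 'M[R]_(q, p)) :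
 p = q -> A *m B = 1%:M -> B *m A = 1%:M.
by move=> e; case: q / e A B => A B; exact: mulmx1C. Qed.

(** * The hermitian space C^(m+1) of the model and its affine coordinates *)

Section ModelSpace.
Variables (R : realType) (m : nat) (eps : R).
Notation n := (m + m)%N.
Notation N := (m.+1 + m.+1)%N.
Notation JJ := (J0 R m.+1).
Variables (eta : 'M[R]_N).
Hypotheses (eps2 : eps ^+ 2 = 1) (etaT : eta^T = eta) (etaJ : JJ *m eta = eta *m JJ).
Implicit Types (u v y z e : 'rV[R]_N) (L : 'M[R]_(n, N)) (w : 'rV[R]_n).
Let JJ2 : JJ *m JJ = - 1%:M. exact: J0_sq. Qed.
Lemma etaJJ : JJ *m eta *m JJ^T = eta.
by rewrite etaJ J0_tr mulmxN -mulmxA JJ2 mulmxN mulmx1 opprK. Qed.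
Notation S := (gip eta).
Let SC := gipC etaT.
Let SJJ := gipJJ etaJJ.
Let SJ := gipJ JJ2 etaJJ.

Lemma gipDr u v y : S y (u + v) = S y u + S y v.
by rewrite SC gipDl !(SC y). Qed.
Lemma gipZr a u v : S u (a *: v) = a * S u v.
by rewrite SC gipZl SC. Qed.
Lemma gip_self_J u : S (u *m JJ) u = 0.
by have := SJ u u; rewrite [in X in _ = - X]SC; lra. Qed.
Lemma etatr p q (A : 'M[R]_(p, N)) (B : 'M[R]_(q, N)) :
 (A *m eta *m B^T)^T = B *m eta *m A^T.
by rewrite !trmx_mul trmxK etaT mulmxA. Qed.

(* The product by the complex number a + i b. *)
Definition cmul (a b : R) z : 'rV[R]_N := a *: z + b *: (z *m JJ).

Lemma cmulJ a b z : cmul a b z *m JJ = cmul a b (z *m JJ).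
by rewrite /cmul mulmxDl -!scalemxAl. Qed.
Lemma cmulA a b c d z : cmul a b (cmul c d z) = cmul (a * c - b * d) (a * d + b * c) z.
rewrite /cmul mulmxDl -!scalemxAl -(mulmxA z) JJ2 mulmxN mulmx1.
by mxlin.
Qed.

Lemma cmul10 z : cmul 1 0 z = z. by rewrite /cmul scale1r scale0r addr0. Qed.
Lemma cmulZ a z : cmul a 0 z = a *: z. by rewrite /cmul scale0r addr0. Qed.
Lemma cmulD a b y z : cmul a b (y + z) = cmul a b y + cmul a b z.
by rewrite /cmul mulmxDl !scalerDr addrACA. Qed.
Lemma cmul_mulmx a b z (g : 'M[R]_N) : g *m JJ = JJ *m g -> cmul a b z *m g = cmul a b (z *m g).
by move=> gJ; rewrite /cmul mulmxDl -!scalemxAl -!mulmxA gJ. Qed.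
Lemma gip_cmul a b y z : S (cmul a b y) (cmul a b z) = (a ^+ 2 + b ^+ 2) * S y z.
rewrite /cmul !(gipDl, gipDr, gipZl, gipZr) SJJ SJ (SC y (z *m JJ)) SJ; ring.
Qed.

(** Proportionality by a nonzero complex number, hence equality of complex lines for nonzero
    vectors, kept in real coordinates. *)
Definition csim y z := exists ab : R * R, ab.1 ^+ 2 + ab.2 ^+ 2 != 0 /\ y = cmul ab.1 ab.2 z.

Lemma csim_refl z : csim z z.
by exists (1, 0); rewrite /= expr1n expr0n addr0 oner_neq0 cmul10. Qed.
Lemma csim_cmul a b z : a ^+ 2 + b ^+ 2 != 0 -> csim (cmul a b z) z.
by move=> ab; exists (a, b). Qed.
Lemma csim_sym y z : csim y z -> csim z y.
move=> [[a b]/= [ab ->]]; exists (a / (a ^+ 2 + b ^+ 2), - b / (a ^+ 2 + b ^+ 2)); split=> /=.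
suff -> : (a / (a ^+ 2 + b ^+ 2)) ^+ 2 + (- b / (a ^+ 2 + b ^+ 2)) ^+ 2 = (a ^+ 2 + b ^+ 2)^-1.
by rewrite invr_eq0.
by field.
rewrite cmulA -[LHS]cmul10; congr (cmul _ _ _); by field.
Qed.

Lemma csim_trans x y z : csim x y -> csim y z -> csim x z.
move=> [[a b]/= [ab ->]] [[c d]/= [cd ->]]; rewrite cmulA; apply: csim_cmul.
suff -> : (a * c - b * d) ^+ 2 + (a * d + b * c) ^+ 2 = (a ^+ 2 + b ^+ 2) * (c ^+ 2 + d ^+ 2).
by rewrite mulf_neq0.
by ring.
Qed.

Lemma csim_mulmx y z (g : 'M[R]_N) : g *m JJ = JJ *m g -> csim y z -> csim (y *m g) (z *m g).
by move=> gJ [[a b]/= [ab ->]]; rewrite cmul_mulmx//; exact: csim_cmul. Qed.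
Lemma csim_pos y z : csim y z -> 0 < S z z -> 0 < S y y.
move=> [[a b]/= [ab ->]] z0; rewrite gip_cmul mulr_gt0// lt_neqAle eq_sym ab/=.
by rewrite addr_ge0 ?sqr_ge0.
Qed.

(* The unitary group of the hermitian form with real part [eta]. *)
Definition unitary (g : 'M[R]_N) := g *m eta *m g^T = eta /\ g *m JJ = JJ *m g.

Lemma unitary_gip g y z : unitary g -> S (y *m g) (z *m g) = S y z.
by move=> [gg _]; rewrite /gip trmx_mul !mulmxA -(mulmxA y) -(mulmxA y) gg. Qed.

(** Data of an affine chart of the model: a unit vector [e], and a unitary basis [L] of its
    hermitian complement, on which the form is [eps] times the standard one. *)
Record aframe e L : Prop := Aframe {
 af_ee : e *m eta *m e^T = 1%:M;
 af_LL : L *m eta *m L^T = eps%:M;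
 af_eL : e *m eta *m L^T = 0;
 af_LJ : L *m JJ = J0 R m *m L
}.

Section AffineCoordinates.
Variables (e : 'rV[R]_N) (L : 'M[R]_(n, N)).
Hypotheses (F : aframe e L).

Lemma af_eJL : e *m JJ *m eta *m L^T = 0.
rewrite -(mulmxA e) etaJ mulmxA -mulmxA -[JJ]opprK -J0_tr -[_ *m L^T]trmxK trmx_mul.
rewrite trmxK linearN/= trmxK mulmxN (af_LJ F) -mulNmx trmx_mul mulmxA (af_eL F).
by rewrite mul0mx.
Qed.

Definition re z := S z e.
Definition im z := S z (e *m JJ).

(** The rows e, i e and [L] form a matrix [Fr] whose right inverse [G] is read off the Gram matrix.
    Both are square, so [G] is also a left inverse. *)
Lemma af_decomp z : z = cmul (re z) (im z) e + eps *: (z *m eta *m L^T *m L).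
pose Fr : 'M[R]_(1 + 1 + n, N) := col_mx (col_mx e (e *m JJ)) L.
pose G : 'M[R]_(N, 1 + 1 + n) := row_mx (row_mx (eta *m e^T) (eta *m (e *m JJ)^T)) (eps *: (eta *m L^T)).
have Lte p q (A : 'M[R]_(p, N)) (B : 'M[R]_(q, N)) : A *m eta *m B^T = 0 -> B *m eta *m A^T = 0.
by move=> AB; rewrite -(etatr A B) AB trmx0.
have eeJ : e *m eta *m (e *m JJ)^T = 0.
by apply/matrixP => i j; rewrite !ord1 zeromxE -[LHS]/(S e (e *m JJ)) SC gip_self_J.
have FG : Fr *m G = 1%:M.
rewrite /Fr /G mul_col_row !mul_col_mx !mul_mx_row -!scalemxAr !mulmxA.
rewrite (af_ee F) eeJ (Lte _ _ _ _ eeJ) (af_eL F) (Lte _ _ _ _ (af_eL F)).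
rewrite af_eJL (Lte _ _ _ _ af_eJL) (af_LL F) !scaler0 row_mx0 col_mx0.
have -> : e *m JJ *m eta *m (e *m JJ)^T = 1%:M.
by rewrite trmx_mul !mulmxA -(mulmxA e) -(mulmxA e) etaJJ (af_ee F).
rewrite scale_scalar_mx -expr2 eps2 [RHS]scalar_mx_block.
by rewrite [X in _ = block_mx X _ _ _]scalar_mx_block.
have GF : G *m Fr = 1%:M.
by apply: mulmx1C_size FG; rewrite [in RHS]addSn [in RHS]addnS.
rewrite -[LHS]mulmx1 -GF mulmxA /G /Fr !mul_mx_row !mul_row_col /cmul.
have sc (y v : 'rV[R]_N) : z *m (eta *m y^T) *m v = S z y *: v.
by rewrite mulmxA [z *m eta *m y^T]mx11_scalar mul_scalar_mx.
by rewrite !sc -scalemxAr -scalemxAl !mulmxA.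
Qed.

Lemma re_cmul a b z : re (cmul a b z) = a * re z - b * im z.
by rewrite /re /im /cmul gipDl !gipZl SJ; ring. Qed.
Lemma im_cmul a b z : im (cmul a b z) = a * im z + b * re z.
by rewrite /re /im /cmul gipDl !gipZl SJJ. Qed.

Definition den z := re z ^+ 2 + im z ^+ 2.

Lemma den_cmul a b z : den (cmul a b z) = (a ^+ 2 + b ^+ 2) * den z.
by rewrite /den re_cmul im_cmul; ring. Qed.

(** Divide [z] by its hermitian product with [e], whose square modulus is [den z], and take the
    components along [L]. On the hyperplane at infinity the division by 0 makes the value 0. *)
Definition aff z : 'rV[R]_n :=
 (eps / den z) *: (cmul (re z) (- im z) z *m eta *m L^T).

Lemma aff_csim y z : csim y z -> aff y = aff z.
move=> [[a b]/= [ab ->]]; rewrite /aff den_cmul re_cmul im_cmul cmulA.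
have -> : cmul ((a * re z - b * im z) * a - - (a * im z + b * re z) * b)
 ((a * re z - b * im z) * b + - (a * im z + b * re z) * a) z =
 (a ^+ 2 + b ^+ 2) *: cmul (re z) (- im z) z.
by rewrite -cmulZ cmulA; congr (cmul _ _ _); ring.
have [d0|d0] := eqVneq (den z) 0; first by rewrite d0 !mulr0 invr0 !mulr0 !scale0r.
by rewrite -!scalemxAl scalerA; congr (_ *: _); field; rewrite ?ab ?d0.
Qed.

Definition lift_aff w : 'rV[R]_N := e + w *m L.

Lemma re_lift w : re (lift_aff w) = 1.
rewrite /re /lift_aff gipDl /gip (af_ee F) mxE eqxx -!mulmxA (mulmxA L).
have -> : L *m eta *m e^T = 0 by rewrite -(etatr e L) (af_eL F) trmx0.
by rewrite mulmx0 mxE addr0.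
Qed.

Lemma im_lift w : im (lift_aff w) = 0.
rewrite /im /lift_aff gipDl SC gip_self_J add0r /gip -!mulmxA (mulmxA L).
have -> : L *m eta *m (e *m JJ)^T = 0.
by rewrite -(etatr (e *m JJ) L) af_eJL trmx0.
by rewrite mulmx0 mxE.
Qed.

Lemma den_lift w : den (lift_aff w) = 1.
by rewrite /den re_lift im_lift expr1n expr0n addr0. Qed.
Lemma aff_lift w : aff (lift_aff w) = w.
rewrite /aff den_lift re_lift im_lift oppr0 cmul10 invr1 mulr1 /lift_aff mulmxDl mulmxDl (af_eL F).
by rewrite add0r -!mulmxA (mulmxA L) (af_LL F) mul_mx_scalar scalerA -expr2 eps2 scale1r.
Qed.

Lemma lift_affE z : den z != 0 -> lift_aff (aff z) = cmul (re z / den z) (- im z / den z) z.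
move=> d0; set u := cmul (re z / den z) (- im z / den z) z.
have uE : u = (den z)^-1 *: cmul (re z) (- im z) z.
by rewrite -cmulZ cmulA; congr (cmul _ _ _); field.
have ru : re u = 1 by rewrite /u re_cmul /den; field.
have iu : im u = 0 by rewrite /u im_cmul /den; field.
rewrite [RHS]af_decomp ru iu cmul10 /lift_aff /aff uE -!scalemxAl scalerA.
by [].
Qed.

Lemma lift_aff_csim z : den z != 0 -> csim (lift_aff (aff z)) z.
move=> d0; rewrite lift_affE//; apply: csim_cmul.
have -> : (re z / den z) ^+ 2 + (- im z / den z) ^+ 2 = (re z ^+ 2 + im z ^+ 2) / den z ^+ 2.
by field.
by rewrite -/(den z) expr2 invfM mulrA mulfV// mul1r invr_eq0.
Qed.

Lemma gip_lift w : S (lift_aff w) (lift_aff w) = 1 + eps * sqnorm w.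
have L0 : S (w *m L) e = 0.
have see : S e e = 1 by rewrite /gip (af_ee F) mxE eqxx.
by have := re_lift w; rewrite /re /lift_aff gipDl see; lra.
rewrite /lift_aff gipDl !gipDr (SC e (w *m L)) L0 add0r addr0 /gip (af_ee F) mxE eqxx.
congr (_ + _); rewrite trmx_mul -!mulmxA (mulmxA L) (mulmxA _ _ w^T) (af_LL F).
by rewrite mul_scalar_mx -scalemxAr scalemxE.
Qed.
End AffineCoordinates.
End ModelSpace.

Lemma partial_cst (R : realType) n (k : R) i (x : 'rV[R]_n) : partial (cst k) i x = 0.
by rewrite partial_def derive_cst. Qed.
Lemma delta_form (R : pzRingType) p q (A : 'M[R]_(p, q)) i j :
 (delta_mx 0 i : 'rV_p) *m (A *m (delta_mx 0 j : 'rV_q)^T) = (A i j)%:M.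
by apply/matrixP => k l; rewrite !ord1 mulmxA -rowE trmx_delta -colE !mxE eqxx.
Qed.

Lemma eq_block (R : Type) p1 p2 q1 q2 (A A' : 'M[R]_(p1, q1)) (B B' : 'M[R]_(p1, q2))
 (C C' : 'M[R]_(p2, q1)) (D D' : 'M[R]_(p2, q2)) :
 A = A' -> B = B' -> C = C' -> D = D' -> block_mx A B C D = block_mx A' B' C' D'.
by move=> -> -> -> ->. Qed.

(** * Developing frames: parallel frames of the flat bundle R^2 + TM *)

Section GaugeLemmas.
Variables (R : realType) (n N : nat) (U : set 'rV[R]_n).
Hypotheses (oU : open U).

Lemma dmx0_near p q (F : 'rV[R]_n -> 'M[R]_(p, q)) x : mxCk 1 U F ->
 (forall y i, U y -> dmx F i y = 0) -> U x -> \forall y \near x, F y = F x.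
move=> F1 F0 Ux.
have H : \forall y \near x, forall ij : 'I_p * 'I_q, F y ij.1 ij.2 = F x ij.1 ij.2.
apply: near_forall => -[i j]/=; apply: (@partial0_near R n U (fun y => F y i j) x oU (F1 i j) _ Ux).
by move=> y k Uy; rewrite -(dmxE k i j oU F1 Uy) F0// mxE.
by apply: filterS H => y Fy; apply/matrixP => i j; exact: (Fy (i, j)).
Qed.

Lemma dmxV (F : 'rV[R]_n -> 'M[R]_N) i x : (forall y, U y -> F y \in unitmx) ->
 mxCk 1 U F -> U x ->
 dmx (fun y => invmx (F y)) i x = - (invmx (F x) *m dmx F i x *m invmx (F x)).
move=> uF F1 Ux; have V1 := mxCkV oU uF F1.
have := dmxM i oU V1 F1 Ux.
rewrite (dmx_open i oU (G := fun=> 1%:M) _ Ux) ?dmx_cst; last by move=> y Uy; rewrite mulVmx ?uF.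
move=> /eqP; rewrite eq_sym addr_eq0 => /eqP e.
by rewrite -[LHS](mulmxK (uF x Ux)) e mulNmx.
Qed.
Variables (A : 'I_n -> 'rV[R]_n -> 'M[R]_N) (Phi : 'rV[R]_n -> 'M[R]_N).
Hypotheses (Phi1 : mxCk 1 U Phi) (uPhi : forall y, U y -> Phi y \in unitmx)
 (dPhi : forall y i, U y -> dmx Phi i y = A i y *m Phi y).

Lemma dmx_gaugeV y i : U y -> dmx (fun y => invmx (Phi y)) i y = - (invmx (Phi y) *m A i y).
by move=> Uy; rewrite (dmxV i uPhi Phi1 Uy) dPhi// !mulmxA mulmxK ?uPhi. Qed.
(** A parallel endomorphism has constant matrix in a parallel frame; [gauge_form] is the analogue
    for bilinear forms. *)
Lemma gauge_endo (B : 'rV[R]_n -> 'M[R]_N) x : mxCk 1 U B -> U x ->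
 (forall y i, U y -> dmx B i y = A i y *m B y - B y *m A i y) ->
 \forall y \near x, invmx (Phi y) *m B y *m Phi y = invmx (Phi x) *m B x *m Phi x.
move=> B1 Ux dB; have V1 := mxCkV oU uPhi Phi1; have VB1 := mxCkM oU V1 B1.
apply: (dmx0_near (mxCkM oU VB1 Phi1) _ Ux) => y i Uy.
rewrite (dmxM i oU VB1 Phi1 Uy) (dmxM i oU V1 B1 Uy) dmx_gaugeV// dB// dPhi//.
by rewrite !(mulmxDl, mulmxDr, mulmxN, mulNmx, mulmxA); mxlin.
Qed.

Lemma gauge_form (B : 'rV[R]_n -> 'M[R]_N) x : mxCk 1 U B -> U x ->
 (forall y i, U y -> dmx B i y = A i y *m B y + B y *m (A i y)^T) ->
 \forall y \near x, invmx (Phi y) *m B y *m (invmx (Phi y))^T =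
 invmx (Phi x) *m B x *m (invmx (Phi x))^T.
move=> B1 Ux dB; have V1 := mxCkV oU uPhi Phi1; have VB1 := mxCkM oU V1 B1.
have T1 := mxCk_tr oU V1.
apply: (dmx0_near (mxCkM oU VB1 T1) _ Ux) => y i Uy.
rewrite (dmxM i oU VB1 T1 Uy) (dmx_tr i oU V1 Uy) (dmxM i oU V1 B1 Uy) dmx_gaugeV// dB//.
by rewrite trmxN trmx_mul !(mulmxDl, mulmxDr, mulmxN, mulNmx, mulmxA); mxlin.
Qed.
End GaugeLemmas.

Section BlockDerivatives.
Variables (R : realType) (n : nat) (U : set 'rV[R]_n).
Hypotheses (oU : open U).
Variables (p1 p2 q1 q2 : nat) (A : 'rV[R]_n -> 'M[R]_(p1, q1)) (B : 'rV[R]_n -> 'M[R]_(p1, q2))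
 (C : 'rV[R]_n -> 'M[R]_(p2, q1)) (D : 'rV[R]_n -> 'M[R]_(p2, q2)).
Notation bm := (fun x => block_mx (A x) (B x) (C x) (D x)).
Let block_entry (P : ('rV[R]_n -> R) -> Prop) :
 (forall i j, P (fun x => A x i j)) -> (forall i j, P (fun x => B x i j)) ->
 (forall i j, P (fun x => C x i j)) -> (forall i j, P (fun x => D x i j)) ->
 forall i j, P (fun x => bm x i j).
move=> PA PB PC PD i j.
case: (split_ordP i) => i' ->; case: (split_ordP j) => j' ->.
- by rewrite (_ : (fun x => _) = fun x => A x i' j')//; apply/funext => x; rewrite block_mxEul.
- by rewrite (_ : (fun x => _) = fun x => B x i' j')//; apply/funext => x; rewrite block_mxEur.
- by rewrite (_ : (fun x => _) = fun x => C x i' j')//; apply/funext => x; rewrite block_mxEdl.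
- by rewrite (_ : (fun x => _) = fun x => D x i' j')//; apply/funext => x; rewrite block_mxEdr.
Qed.

Lemma mxCk_block k : mxCk k U A -> mxCk k U B -> mxCk k U C -> mxCk k U D -> mxCk k U bm.
by move=> hA hB hC hD; exact: block_entry. Qed.
Lemma mxsmooth_block : mxsmooth U A -> mxsmooth U B -> mxsmooth U C -> mxsmooth U D ->
 mxsmooth U bm.
by move=> hA hB hC hD; exact: block_entry. Qed.
Lemma dmx_block i x : mxCk 1 U A -> mxCk 1 U B -> mxCk 1 U C -> mxCk 1 U D -> U x ->
 dmx bm i x = block_mx (dmx A i x) (dmx B i x) (dmx C i x) (dmx D i x).
move=> hA hB hC hD Ux; have hb := mxCk_block hA hB hC hD.
apply/matrixP => k l; rewrite (dmxE i k l oU hb Ux).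
case: (split_ordP k) => k' ->; case: (split_ordP l) => l' ->.
- rewrite block_mxEul (dmxE i k' l' oU hA Ux).
by congr (partial _ i x); apply/funext => y; rewrite block_mxEul.
- rewrite block_mxEur (dmxE i k' l' oU hB Ux).
by congr (partial _ i x); apply/funext => y; rewrite block_mxEur.
- rewrite block_mxEdl (dmxE i k' l' oU hC Ux).
by congr (partial _ i x); apply/funext => y; rewrite block_mxEdl.
- rewrite block_mxEdr (dmxE i k' l' oU hD Ux).
by congr (partial _ i x); apply/funext => y; rewrite block_mxEdr.
Qed.
End BlockDerivatives.

Section DevelopingFrames.
Variables (R : realType) (m : nat) (eps : R) (M : riemData R (m + m)).
Notation n := (m + m)%N.
Notation N := (m.+1 + m.+1)%N.
Notation JJ := (J0 R m.+1).
Hypotheses (RM : riemannian M).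
Variables (J : chart M -> 'rV[R]_n -> 'M[R]_n).
Hypotheses (KJ : kahler J) (eps2 : eps ^+ 2 = 1)
 (curvM : forall c x i j, cimg c x -> curvmx c i j x = eps *: holmx J c i j x).
Implicit Types (c d : chart M) (x : 'rV[R]_n) (th : 'I_n -> 'rV[R]_n -> R).
Notation jj := (J0 R 1).
Notation a c i x := (holrows J c i x).

(* The connection of the bundle R^2 + TM whose curvature is the difference of
 the curvature and of that of the model; th is a potential of 2 eps omega. *)
Definition devconn c th i x : 'M[R]_(1 + 1 + n) :=
 block_mx (th i x *: jj) (a c i x)
 (- eps *: (metric c x *m (a c i x)^T)) (conn c i x + th i x *: J c x).

(** The complex structure and the metric of R^2 + TM, both parallel for [devconn]. The sign [eps] on
    TM is the one that the form [eta] of the model has on the complement of a positive line. *)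
Definition devJ c x : 'M[R]_(1 + 1 + n) := block_mx jj 0 0 (J c x).
Definition devform c x : 'M[R]_(1 + 1 + n) := block_mx 1%:M 0 0 (eps *: metric c x).

Lemma jj_holrows c i x : cimg c x -> jj *m a c i x = a c i x *m J c x.
move=> cx; rewrite /holrows /J0 mul_block_col !mul0mx mul1mx mulNmx mul1mx add0r addr0.
by rewrite mul_col_mx -mulmxA (J_sq KJ cx) mulmxN mulmx1.
Qed.

Lemma metric_holrows_jj c i x : cimg c x ->
 metric c x *m (a c i x)^T *m jj = J c x *m (metric c x *m (a c i x)^T).
move=> cx; have := congr1 trmx (jj_holrows i cx); rewrite !trmx_mul J0_tr mulmxN => e.
rewrite -mulmxA -[(a c i x)^T *m jj]opprK e mulmxN (mulmxA (metric c x)) (metricJT KJ cx).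
by rewrite mulNmx opprK /kform mulmxA.
Qed.
Let oC c : open (cimg c). exact: open_cimg. Qed.
Let g1 c : mxCk 1 (cimg c) (metric c). exact: metric_C1. Qed.
Let J1 c : mxCk 1 (cimg c) (J c). exact: J_C1. Qed.
Notation c1 A := (@mxCk_cst R n _ _ _ 1 A).

Lemma holrowsE c i x : a c i x =
 col_mx (delta_mx 0 i) 0 + col_mx 0 (delta_mx 0 i) *m J c x.
by rewrite mul_col_mx mul0mx add_col_mx addr0 add0r. Qed.
Lemma holrows_smooth c i : mxsmooth (cimg c) (holrows J c i).
have oU := @oC c; apply: (mxsmooth_ext oU (fun x _ => esym (holrowsE c i x))).
apply: (mxsmoothD oU (mxsmooth_cst _ _)); apply: (mxsmoothM oU (mxsmooth_cst _ _)).
exact: (@J_smooth R n M J KJ c).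
Qed.
Let a1 c i : mxCk 1 (cimg c) (holrows J c i). exact: (smooth_Ck _ (@holrows_smooth c i)). Qed.
Lemma dmx_holrows c i j x : cimg c x ->
 dmx (holrows J c j) i x = col_mx 0 (delta_mx 0 j *m (conn c i x *m J c x - J c x *m conn c i x)).
move=> cx; rewrite (dmx_open i (@oC c) (fun x _ => holrowsE c j x) cx).
rewrite (dmxD i (@oC c) (c1 _) (mxCkM (@oC c) (c1 _) (@J1 c)) cx) dmx_cst add0r.
rewrite (dmxM i (@oC c) (c1 _) (@J1 c) cx) dmx_cst mul0mx add0r (dJ RM KJ i cx).
by rewrite mul_col_mx mul0mx.
Qed.

Lemma devJ_devconn c th i x : cimg c x ->
 dmx (devJ c) i x = devconn c th i x *m devJ c x - devJ c x *m devconn c th i x.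
move=> cx.
have -> : dmx (devJ c) i x = block_mx 0 0 0 (dmx (J c) i x).
by rewrite (dmx_block (@oC c) i (c1 _) (c1 _) (c1 _) (@J1 c) cx) !dmx_cst.
rewrite /devconn /devJ !mulmx_block !mulmx0 !mul0mx !addr0 !add0r.
rewrite opp_block_mx add_block_mx (jj_holrows _ cx) -!scalemxAl -!scalemxAr.
rewrite (metric_holrows_jj _ cx) !subrr mulmxDl mulmxDr -!scalemxAl -!scalemxAr (dJ RM KJ i cx).
by congr block_mx; mxlin.
Qed.

Lemma devform_devconn c th i x : cimg c x ->
 dmx (devform c) i x = devconn c th i x *m devform c x + devform c x *m (devconn c th i x)^T.
move=> cx; have gT := metric_sym RM cx.
have -> : dmx (devform c) i x = block_mx 0 0 0 (eps *: dmx (metric c) i x).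
rewrite (dmx_block (@oC c) i (c1 _) (c1 _) (c1 _) (mxCkZ (@oC c) (@Ck_cst _ _ _ _ eps) (@g1 c)) cx) !dmx_cst.
by rewrite (dmxZ i (@oC c) (@Ck_cst _ _ _ _ eps) (@g1 c) cx) partial_cst scale0r add0r.
rewrite /devconn /devform tr_block_mx !mulmx_block !mulmx0 !mul0mx !addr0 !add0r.
rewrite add_block_mx !mul1mx !mulmx1 (conn_metric RM i cx) !trmxZ trmxD trmxZ J0_tr.
rewrite trmx_mul trmxK gT -!scalemxAr; congr block_mx.
- by rewrite scalerN addrN.
- by rewrite scaleNr subrr.
- by rewrite scaleNr -scalemxAl addNr.
rewrite mulmxDl mulmxDr -!scalemxAl -!scalemxAr (metricJT KJ cx) /kform.
by mxlin.
Qed.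

Lemma devconn_smooth c th (U : set 'rV[R]_n) i : open U -> U `<=` cimg c ->
 (forall i, smooth U (th i)) -> mxsmooth U (devconn c th i).
move=> oU Uc sth; have sub p q (F : 'rV[R]_n -> 'M[R]_(p, q)) := @mxsmooth_sub R n U p q _ F Uc.
have sa := sub _ _ _ (@holrows_smooth c i).
have sg := sub _ _ _ (@metric_smooth R n M RM c).
apply: mxsmooth_block => //.
- exact: (mxsmoothZ oU (sth i) (mxsmooth_cst _ _)).
- apply: (mxsmoothZ oU (f := fun=> - eps)); first by move=> k; exact: Ck_cst.
exact: (mxsmoothM oU sg (mxsmooth_tr oU sa)).
- apply: (mxsmoothD oU); first exact: (sub _ _ _ (@conn_smooth R n M RM c i)).
exact: (mxsmoothZ oU (sth i) (sub _ _ _ (@J_smooth R n M J KJ c))).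
Qed.

Lemma holrows_gram c i j x : cimg c x ->
 a c j x *m (metric c x *m (a c i x)^T) = (metric c x i j)%:M + kform J c x i j *: jj.
move=> cx; have gT := metric_sym RM cx; have OT := kform_anti RM KJ cx.
have gji : metric c x j i = metric c x i j by rewrite -[in LHS]gT mxE.
have Oji : kform J c x j i = - kform J c x i j.
by have := congr1 (fun A : 'M[R]_n => A i j) OT; rewrite mxE oppmxE.
have b1 : (delta_mx 0 j : 'rV_n) *m (metric c x *m ((delta_mx 0 i : 'rV_n) *m J c x)^T) = (kform J c x i j)%:M.
by rewrite trmx_mul (mulmxA (metric c x)) (metricJT KJ cx) mulNmx mulmxN delta_form Oji raddfN/= opprK.
have b2 : (delta_mx 0 j : 'rV_n) *m J c x *m (metric c x *m (delta_mx 0 i : 'rV_n)^T) = (- kform J c x i j)%:M.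
by rewrite -mulmxA (mulmxA (J c x)) -/(kform J c x) delta_form Oji.
have b3 : (delta_mx 0 j : 'rV_n) *m J c x *m (metric c x *m ((delta_mx 0 i : 'rV_n) *m J c x)^T) = (metric c x i j)%:M.
rewrite trmx_mul (mulmxA (metric c x)) -mulmxA (mulmxA (J c x)) (mulmxA (J c x)) (J_herm KJ cx).
by rewrite delta_form gji.
rewrite /holrows tr_col_mx mul_mx_row mul_col_row delta_form gji b1 b2 b3.
rewrite /J0 scale_block_mx !scaler0 [(metric c x i j)%:M in RHS]scalar_mx_block add_block_mx.
by rewrite !add0r !addr0 scalerN !scalemx1 raddfN.
Qed.

(** Block by block. The upper left one is d th = 2 [eps] omega, through [holrows_gram]; the
    off-diagonal ones express torsion-freeness and the parallelism of g and J. In the last, the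
    curvature of [M] cancels the products of off-diagonal blocks, and d th times J cancels the term
    of [holmx] in J. *)
Lemma devconn_flat c th x i j (U : set 'rV[R]_n) : open U -> U `<=` cimg c ->
 (forall i, smooth U (th i)) -> U x ->
 partial (th j) i x - partial (th i) j x = 2 * eps * kform J c x i j ->
 dmx (devconn c th j) i x + devconn c th j x *m devconn c th i x =
 dmx (devconn c th i) j x + devconn c th i x *m devconn c th j x.
move=> oU Uc sth Ux dth; have cx := Uc x Ux.
have sub p q (F : 'rV[R]_n -> 'M[R]_(p, q)) := @mxCk_sub R n p q U _ F 1 Uc.
have th1 k : Ck 1 U (th k) by exact: sth.
have JU := sub _ _ _ (@J1 c); have gU := sub _ _ _ (@g1 c).
have aU k := sub _ _ _ (@a1 c k); have GU k := sub _ _ _ (@conn_C1 R n M RM c k).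
have gaU k := mxCkM oU gU (mxCk_tr oU (aU k)).
have e1 := @Ck_cst R n 1 U (- eps).
have j1 := @mxCk_cst R n _ _ U 1 jj.
have dA k l : dmx (devconn c th l) k x = block_mx (partial (th l) k x *: jj) (dmx (holrows J c l) k x)
 (- eps *: (dmx (metric c) k x *m (a c l x)^T + metric c x *m (dmx (holrows J c l) k x)^T))
 (dmx (conn c l) k x + (partial (th l) k x *: J c x + th l x *: dmx (J c) k x)).
rewrite (dmx_block oU k (mxCkZ oU (th1 l) j1) (aU l) (mxCkZ oU e1 (gaU l))
 (mxCkD oU (GU l) (mxCkZ oU (th1 l) JU)) Ux).
rewrite (dmxZ k oU (th1 l) j1 Ux) dmx_cst scaler0 addr0.
rewrite (dmxZ k oU e1 (gaU l) Ux) partial_cst scale0r add0r.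
rewrite (dmxM k oU gU (mxCk_tr oU (aU l)) Ux) (dmx_tr k oU (aU l) Ux).
by rewrite (dmxD k oU (GU l) (mxCkZ oU (th1 l) JU) Ux) (dmxZ k oU (th1 l) JU Ux).
rewrite !dA /devconn !mulmx_block !add_block_mx.
set g := metric c x; set Jx := J c x; set Gi := conn c i x; set Gj := conn c j x.
set ai := a c i x; set aj := a c j x.
have torsion (k l : 'I_n) : dmx (holrows J c l) k x + a c l x *m conn c k x =
 col_mx (delta_mx 0 l *m conn c k x) (delta_mx 0 l *m conn c k x *m Jx).
rewrite (dmx_holrows _ _ cx) /holrows mul_col_mx add_col_mx add0r mulmxBr !mulmxA subrK.
by [].
have tors k l : dmx (holrows J c l) k x + a c l x *m conn c k x =
 dmx (holrows J c k) l x + a c k x *m conn c l x.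
by rewrite !torsion -!rowE (conn_torsion_row RM k l cx).
have dthE : partial (th j) i x = partial (th i) j x + 2 * eps * kform J c x i j.
by rewrite -dth addrC subrK.
have Oji : kform J c x j i = - kform J c x i j.
by have := congr1 (fun A : 'M[R]_n => A i j) (kform_anti RM KJ cx); rewrite mxE oppmxE.
have gji : metric c x j i = metric c x i j by rewrite -[in LHS](metric_sym RM cx) mxE.
have tE k l : dmx (holrows J c l) k x = dmx (holrows J c k) l x + a c k x *m conn c l x - a c l x *m conn c k x.
by rewrite -tors addrK.
apply: eq_block.
- rewrite -!scalemxAr -!scalemxAl !(holrows_gram _ _ cx) Oji gji dthE.
by mxlin.
- rewrite !mulmxDr -!scalemxAl -!scalemxAr !(jj_holrows _ cx) (tE i j).
by rewrite -/ai -/aj -/Gi -/Gj; mxlin.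
- rewrite !mulmxDl !(conn_metric RM _ cx) (tE i j) /g /ai /aj -!scalemxAr -!scalemxAl !(metric_holrows_jj _ cx).
rewrite !(trmxD, trmxN, trmx_mul) -/ai -/aj -/Gi -/Gj -/g -/Jx.
by rewrite !(mulmxDl, mulmxDr, mulmxN, mulNmx, mulmxA); mxlin.
have := curvM i j cx; rewrite curvmx_def -/Gi -/Gj /holmx -/g -/Jx -/ai -/aj => F.
have FE : dmx (conn c j) i x = dmx (conn c i) j x - (Gj *m Gi - Gi *m Gj) +
 eps *: (- (2 * kform J c x i j) *: Jx + g *m (aj^T *m ai - ai^T *m aj)).
by rewrite -F; mxlin.
rewrite FE dthE !(dJ RM KJ _ cx) -/Gi -/Gj -/Jx.
rewrite !(mulmxDl, mulmxDr, mulmxN, mulNmx) -!scalemxAr -!scalemxAl !mulmxA.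
by mxlin.
Qed.
Variables (eta : 'M[R]_N).
Hypotheses (etaT : eta^T = eta) (etaJ : JJ *m eta = eta *m JJ).

(** [P] identifies the flat bundle over [U] with a fixed hermitian space. It depends on the
    potential [th], hence carries a phase that varies with the choice. *)
Record devframe c (U : set 'rV[R]_n) th (P : 'rV[R]_n -> 'M[R]_(1 + 1 + n, N)) : Prop :=
 Devframe {
 df_open : open U;
 df_sub : U `<=` cimg c;
 df_th : forall i, smooth U (th i);
 df_smooth : mxsmooth U P;
 df_eq : forall x i, U x -> dmx P i x = devconn c th i x *m P x;
 df_J : forall x, U x -> devJ c x *m P x = P x *m JJ;
 df_form : forall x, U x -> P x *m eta *m (P x)^T = devform c x
}.

Lemma devframe_sub c U V th P : open V -> V `<=` U -> devframe c U th P -> devframe c V th P.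
move=> oV VU [oU Uc sth sP dP PJ Pf]; split=> //.
- by move=> x Vx; apply: Uc; exact: VU.
- by move=> i k; apply: (Ck_sub VU); exact: sth.
- exact: mxsmooth_sub VU sP.
- by move=> x i Vx; apply: dP; exact: VU.
- by move=> x Vx; apply: PJ; exact: VU.
- by move=> x Vx; apply: Pf; exact: VU.
Qed.

Lemma devframe_unitary c U th P g : unitary eta g -> devframe c U th P ->
 devframe c U th (fun x => P x *m g).
move=> [gg gJ] [oU Uc sth sP dP PJ Pf]; split=> //.
- exact: (mxsmoothM oU sP (mxsmooth_cst _ _)).
- move=> x i Ux; rewrite (dmxM i oU (smooth_Ck 1 sP) (mxCk_cst _ _ _) Ux) dmx_cst mulmx0 addr0.
by rewrite dP// mulmxA.
- by move=> x Ux; rewrite mulmxA PJ// -!mulmxA gJ.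
- by move=> x Ux; rewrite trmx_mul !mulmxA -(mulmxA (P x)) -(mulmxA (P x)) gg Pf.
Qed.

Lemma devJ_smooth c : mxsmooth (cimg c) (devJ c).
apply: mxsmooth_block; [exact: mxsmooth_cst|exact: mxsmooth_cst|exact: mxsmooth_cst|].
exact: (@J_smooth R n M J KJ c).
Qed.

Lemma devform_smooth c : mxsmooth (cimg c) (devform c).
apply: mxsmooth_block; [exact: mxsmooth_cst|exact: mxsmooth_cst|exact: mxsmooth_cst|].
apply: (mxsmoothZ (@oC c) (f := fun=> eps)); first by move=> k; exact: Ck_cst.
exact: (@metric_smooth R n M RM c).
Qed.

Lemma devform_unit c x : cimg c x -> devform c x \in unitmx.
move=> cx; have gu := metric_unit RM cx.
have : devform c x *m block_mx 1%:M 0 0 (eps *: invmx (metric c x)) = 1%:M.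
rewrite mulmx_block !mulmx0 !mul0mx !addr0 !add0r mulmx1 -scalemxAl -scalemxAr mulmxV//.
by rewrite scalerA -expr2 eps2 scale1r -scalar_mx_block.
by move=> /mulmx1_unit[].
Qed.

(** Potential by Poincaré, fundamental solution [Phi] by Frobenius from the identity. Compatibility
    with J and with the form holds at [x0] and persists by the gauge lemmas; each step shrinks the
    ball. *)
Lemma devframe_exists c x0 (K0 : 'M[R]_(1 + 1 + n, N)) : cimg c x0 ->
 devJ c x0 *m K0 = K0 *m JJ -> K0 *m eta *m K0^T = devform c x0 ->
exists U th P, [/\ devframe c U th P, U x0 & P x0 = K0].
move=> cx0 K0J K0f.
have [r r0 rc] := near_ball (open_near (@oC c) cx0 (fun y h => h)).
pose B := [set x : 'rV[R]_n | `|x - x0| < r].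
have oB : open B by exact: open_ball_norm.
have Bc : B `<=` cimg c by move=> x Bx; apply: rc; rewrite distrC.
pose om i k x := 2 * eps * kform J c x i k.
have k1 : mxCk 1 B (kform J c).
by apply: (mxCk_sub Bc); exact: (smooth_Ck 1 (@kform_smooth R n M RM J KJ c)).
have som i j : smooth B (om i j).
move=> k; apply: (CkM oB); first exact: Ck_cst.
by apply: (Ck_sub Bc); exact: (@kform_smooth R n M RM J KJ c).
have pom i j k x : B x -> partial (om i j) k x = 2 * eps * dmx (kform J c) k x i j.
move=> Bx; rewrite (@partialM _ _ B (fun=> 2 * eps) (fun y => kform J c y i j) k x _ _ Bx).
 - by rewrite partial_cst mul0r add0r (dmxE k i j oB k1 Bx).
 - exact: Ck_cst.
 - exact: k1.
have [||th [sth dth]] := @poincare R n x0 r om som.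
- move=> i j x Bx; rewrite /om; have cx := Bc x Bx.
have := congr1 (fun A : 'M[R]_n => A i j) (kform_anti RM KJ cx).
by rewrite mxE oppmxE => ->; rewrite mulrN.
- move=> i j k x Bx; rewrite !pom// -!mulrDr (kform_closed RM KJ i j k (Bc x Bx)).
by rewrite mulr0.
have sA i := @devconn_smooth c th B i oB Bc sth.
have flat x i j (Bx : B x) := devconn_flat oB Bc sth Bx (dth x j i Bx).
have Bx0 : B x0 by rewrite /B /= subrr normr0.
have [s s0 [sB [Phi [sPhi Phi0 dPhi]]]] := @frobenius R n _ _ B x0 (devconn c th) 1%:M oB Bx0 sA flat.
pose V := [set x : 'rV[R]_n | `|x - x0| < s].
have oV : open V by exact: open_ball_norm.
have Vx0 : V x0 by rewrite /V /= subrr normr0.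
have Phi1 := smooth_Ck 1 sPhi.
have nu : \forall x \near x0, Phi x \in unitmx.
have dc : {for x0, continuous (fun x => \det (Phi x))}.
exact: (Ck_cont (Ck_det oV Phi1) Vx0).
have d1 : \det (Phi x0) = 1 by rewrite Phi0 det1.
have H : \forall x \near x0, `|\det (Phi x0) - \det (Phi x)| < 1.
exact: (dc _ (near_norm (\det (Phi x0)) (ltr01 : 0 < 1 :> R))).
apply: filterS H => x; rewrite /= d1 unitmxE unitfE => h.
by apply: contraTneq h => ->; rewrite subr0 normr1 ltxx.
have [s' s'0 us] := near_ball nu.
pose V1 := [set x : 'rV[R]_n | `|x - x0| < Num.min s s'].
have oV1 : open V1 by exact: open_ball_norm.
have V1V : V1 `<=` V by move=> x; rewrite /V1 /V /= lt_min => /andP[].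
have V1x0 : V1 x0 by rewrite /V1 /= subrr normr0 lt_min s0.
have uPhi x : V1 x -> Phi x \in unitmx.
by rewrite /V1 /= lt_min => /andP[_ h]; apply: us; rewrite distrC.
have dPhi1 x i (Vx : V1 x) := dPhi x i (V1V x Vx).
have V1c : V1 `<=` cimg c by move=> x Vx; apply/Bc/sB; exact: V1V.
have Phi11 := mxCk_sub V1V Phi1.
have nJ := gauge_endo oV1 Phi11 uPhi dPhi1 (mxCk_sub V1c (smooth_Ck 1 (@devJ_smooth c))) V1x0
 (fun y i Vy => devJ_devconn th i (V1c y Vy)).
have nF := gauge_form oV1 Phi11 uPhi dPhi1 (mxCk_sub V1c (smooth_Ck 1 (@devform_smooth c))) V1x0
 (fun y i Vy => devform_devconn th i (V1c y Vy)).
have [t t0 Ht] := near_ball (filterI nJ nF).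
pose V2 := [set x : 'rV[R]_n | `|x - x0| < Num.min (Num.min s s') t].
have oV2 : open V2 by exact: open_ball_norm.
have V21 : V2 `<=` V1 by move=> x; rewrite /V2 /V1 /= lt_min => /andP[].
have V2V x (Vx : V2 x) := V1V x (V21 x Vx).
have H2 x : V2 x -> devJ c x *m Phi x = Phi x *m devJ c x0 /\
 Phi x *m devform c x0 *m (Phi x)^T = devform c x.
move=> Vx; have := Vx; rewrite /V2 /= lt_min => /andP[_ xt].
have ux := uPhi x (V21 x Vx).
have := Ht x; rewrite distrC Phi0 invmx1 trmx1 !mul1mx !mulmx1 => /(_ xt)[<- <-]; split.
by rewrite !mulmxA mulmxV// mul1mx.
by rewrite !mulmxA mulmxV// mul1mx -mulmxA -trmx_mul mulmxV// trmx1 mulmx1.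
exists V2, th, (fun x => Phi x *m K0); split; last by rewrite Phi0 mul1mx.
split=> //.
 - by move=> x Vx; apply: V1c; exact: V21.
 - by move=> i k; apply: (@Ck_sub R n k V2 B); [move=> x Vx; apply/sB/V2V|exact: sth].
 - apply: (mxsmoothM oV2 _ (mxsmooth_cst _ _)); exact: (mxsmooth_sub V2V sPhi).
 - move=> x i Vx; rewrite (dmxM i oV (Phi1) (mxCk_cst _ _ _) (V2V x Vx)) dmx_cst mulmx0 addr0.
by rewrite dPhi ?mulmxA//; exact: V2V.
 - by move=> x Vx; have [h _] := H2 x Vx; rewrite mulmxA h -!mulmxA K0J.
 - move=> x Vx; have [_ <-] := H2 x Vx; rewrite -K0f trmx_mul !mulmxA.
by [].
by rewrite /V2 /= subrr normr0 !lt_min s0 s'0.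
Qed.
Let sizeN : (1 + 1 + n = N)%N. by rewrite [in RHS]addSn [in RHS]addnS. Qed.

(** The inverse of the frame, given by the forms alone because [P] is an isometry. *)
Definition devinv c P x : 'M[R]_(N, 1 + 1 + n) := eta *m (P x)^T *m invmx (devform c x).

Lemma devinvP c U th P x : devframe c U th P -> U x ->
 P x *m devinv c P x = 1%:M /\ devinv c P x *m P x = 1%:M.
move=> dP Ux; have e : P x *m devinv c P x = 1%:M.
by rewrite /devinv !mulmxA (df_form dP Ux) mulmxV// (devform_unit (df_sub dP Ux)).
by split=> //; exact: mulmx1C_size e.
Qed.

(** Homogeneous coordinates of the developing map, the image of the first basis vector of R^2. The
    equation of the frame makes [trows] its differential up to multiples of i [zrow]. *)
Definition zrow P (x : 'rV[R]_n) : 'rV[R]_N := usubmx (usubmx (P x : 'M[R]_(1 + 1 + n, N))).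
Definition trows P (x : 'rV[R]_n) : 'M[R]_(n, N) := dsubmx (P x : 'M[R]_(1 + 1 + n, N)).

Lemma jj_col q (A B : 'M[R]_(1, q)) : jj *m col_mx A B = col_mx B (- A).
by rewrite /J0 mul_block_col !mul0mx mul1mx mulNmx mul1mx add0r addr0. Qed.
Lemma devframeE c U th P x : devframe c U th P -> U x ->
 P x = col_mx (col_mx (zrow P x) (zrow P x *m JJ)) (trows P x) /\
 J c x *m trows P x = trows P x *m JJ.
move=> dP Ux; have := df_J dP Ux.
have PE : P x = col_mx (col_mx (zrow P x) (dsubmx (usubmx (P x : 'M[R]_(1 + 1 + n, N))))) (trows P x).
by rewrite !vsubmxK.
rewrite {1 2}PE /devJ mul_block_col !mul0mx addr0 add0r jj_col !mul_col_mx.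
move=> /eq_col_mx[/eq_col_mx[e1 _] e2].
by split=> //; rewrite {1}PE e1.
Qed.

Lemma devframe_gram c U th P x : devframe c U th P -> U x ->
 [/\ zrow P x *m eta *m (zrow P x)^T = 1%:M,
 zrow P x *m eta *m (trows P x)^T = 0,
 zrow P x *m JJ *m eta *m (trows P x)^T = 0
 & trows P x *m eta *m (trows P x)^T = eps *: metric c x].
move=> dP Ux; have [PE _] := devframeE dP Ux; have := df_form dP Ux.
rewrite {1 2}PE !tr_col_mx !mul_col_mx !mul_mx_row /devform scalar_mx_block.
have E : row_mx (block_mx 1%:M 0 0 1%:M : 'M[R]_(1 + 1)) (0 : 'M[R]_(1 + 1, n)) =
 col_mx (row_mx (row_mx 1%:M 0) 0) (row_mx (row_mx 0 1%:M) 0).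
by rewrite -[RHS]/(block_mx _ _ _ _) [RHS]block_mxEh col_mx0.
rewrite -[X in col_mx _ X = _]/(row_mx _ _) => /eq_col_mx[e12 /eq_row_mx[_ e4]].
move: e12; rewrite E => /eq_col_mx[/eq_row_mx[/eq_row_mx[e1 _] e2] /eq_row_mx[_ e3]].
by split.
Qed.
End DevelopingFrames.

Lemma sum_block (R : pzRingType) I (r : seq I) p1 p2 q1 q2 (A : I -> 'M[R]_(p1, q1))
 (B : I -> 'M[R]_(p1, q2)) (C : I -> 'M[R]_(p2, q1)) (D : I -> 'M[R]_(p2, q2)) :
 \sum_(i <- r) block_mx (A i) (B i) (C i) (D i) =
 block_mx (\sum_(i <- r) A i) (\sum_(i <- r) B i) (\sum_(i <- r) C i) (\sum_(i <- r) D i).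
by elim: r => [|i r IH]; rewrite ?big_nil ?block_mx0// !big_cons IH add_block_mx.
Qed.
Local Notation hol_curv l M J := (forall (c : chart M) x i j, cimg c x -> curvmx c i j x = l *: holmx J c i j x).

(** * Developments as germs of maps on the manifold, and their uniqueness *)

Section Development.
Variables (R : realType) (m : nat) (eps : R) (M : riemData R (m + m)).
Notation n := (m + m)%N.
Notation N := (m.+1 + m.+1)%N.
Notation JJ := (J0 R m.+1).
Hypotheses (RM : riemannian M).
Variables (J : chart M -> 'rV[R]_n -> 'M[R]_n).
Hypotheses (KJ : kahler J) (eps2 : eps ^+ 2 = 1)
 (curvM : hol_curv eps M J).
Variables (eta : 'M[R]_N).
Hypotheses (etaT : eta^T = eta) (etaJ : JJ *m eta = eta *m JJ).
Implicit Types (c d : chart M) (x : 'rV[R]_n) (th : 'I_n -> 'rV[R]_n -> R) (p q : M).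
Implicit Types (P : 'rV[R]_n -> 'M[R]_(1 + 1 + n, N)) (U : set 'rV[R]_n).
Notation devframe := (devframe eps J eta).
Notation S := (gip eta).

(** The transition matrix [Nm] is unitary, and its derivative is (th' - th) times i [Nm], as the two
    connections differ by the difference of the potentials times the complex structure. So it is
    constant up to a phase. *)
Lemma devframe_unique c U th P U' th' P' x0 : devframe c U th P -> devframe c U' th' P' ->
 U x0 -> U' x0 -> exists2 g, unitary eta g &
 \forall x \near x0, csim (zrow P' x) (zrow P x *m g).
move=> dP dP' Ux0 U'x0; pose V := U `&` U'.
have oV : open V by apply: openI; [exact: df_open dP|exact: df_open dP'].
have Vx0 : V x0 by [].
have {}dP : devframe c V th P by apply: devframe_sub oV _ dP => x [].
have {}dP' : devframe c V th' P' by apply: devframe_sub oV _ dP' => x [].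
have Vc := df_sub dP.
pose Nm x := devinv eps eta c P x *m P' x.
have PN x : V x -> P x *m Nm x = P' x.
by move=> Vx; rewrite /Nm mulmxA (devinvP RM eps2 dP Vx).1 mul1mx.
have QJ x : V x -> devinv eps eta c P x *m devJ J c x = JJ *m devinv eps eta c P x.
move=> Vx; have [e1 e2] := devinvP RM eps2 dP Vx.
rewrite -[LHS]mulmx1 -e1 mulmxA -(mulmxA _ (devJ J c x)) (df_J dP Vx) mulmxA e2 mul1mx.
by [].
have NJ x : V x -> Nm x *m JJ = JJ *m Nm x.
by move=> Vx; rewrite /Nm -(mulmxA _ (P' x)) -(df_J dP' Vx) mulmxA QJ// -mulmxA.
have Nu x : V x -> unitary eta (Nm x).
move=> Vx; split; last exact: NJ.
have [e1 e2] := devinvP RM eps2 dP Vx.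
rewrite /Nm trmx_mul !mulmxA -(mulmxA _ (P' x)) -(mulmxA _ (P' x *m _)) (df_form dP' Vx).
rewrite -(df_form dP Vx) !mulmxA e2 mul1mx -!mulmxA -trmx_mul e2 trmx1 mulmx1.
by [].
have sQ : mxsmooth V (devinv eps eta c P).
apply: (mxsmoothM oV (F := fun x => eta *m (P x)^T)).
exact: (mxsmoothM oV (mxsmooth_cst _ _) (mxsmooth_tr oV (df_smooth dP))).
apply: (mxsmoothV oV); first by move=> x Vx; exact: (devform_unit RM eps2 (Vc x Vx)).
exact: (mxsmooth_sub Vc (@devform_smooth R m eps M RM c)).
have N1 : mxCk 1 V Nm by exact: (smooth_Ck 1 (mxsmoothM oV sQ (df_smooth dP'))).
have Q1 := smooth_Ck 1 sQ; have P'1 := smooth_Ck 1 (df_smooth dP').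
have P1 := smooth_Ck 1 (df_smooth dP).
pose dl i x := th' i x - th i x.
have AA i x : devconn eps J c th' i x - devconn eps J c th i x = dl i x *: devJ J c x.
rewrite /devconn /devJ opp_block_mx add_block_mx !subrr opprD addrACA subrr add0r.
rewrite [RHS]scale_block_mx ?scaler0 /dl.
by apply: eq_block; rewrite ?scalerBl.
have dN i x : V x -> dmx Nm i x = dl i x *: (Nm x *m JJ).
move=> Vx; have [e1 e2] := devinvP RM eps2 dP Vx.
have dQ : dmx (devinv eps eta c P) i x = - (devinv eps eta c P x *m devconn eps J c th i x).
have := dmxM i oV Q1 P1 Vx.
rewrite (dmx_open i oV (G := fun=> 1%:M) _ Vx) ?dmx_cst; last first.
by move=> y Vy; rewrite (devinvP RM eps2 dP Vy).2.
move=> /eqP; rewrite eq_sym addr_eq0 => /eqP e.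
rewrite -[LHS]mulmx1 -e1 mulmxA e (df_eq dP i Vx) mulmxA mulNmx -[_ *m P x *m _]mulmxA e1 mulmx1.
by [].
rewrite (dmxM i oV Q1 P'1 Vx) dQ (df_eq dP' i Vx) mulNmx addrC mulmxA -mulmxBl -mulmxBr AA.
by rewrite -scalemxAr -scalemxAl (QJ x Vx) (NJ x Vx) /Nm [in RHS]mulmxA.
have uN0 : Nm x0 \in unitmx.
have [e1 e2] := devinvP RM eps2 dP Vx0; have [f1 f2] := devinvP RM eps2 dP' Vx0.
have : Nm x0 *m (devinv eps eta c P' x0 *m P x0) = 1%:M.
by rewrite /Nm -mulmxA (mulmxA (P' x0)) f1 mul1mx e2.
by move=> /mulmx1_unit[].
pose Mm x := Nm x *m invmx (Nm x0).
have uJ : invmx (Nm x0) *m JJ = JJ *m invmx (Nm x0).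
by rewrite -[LHS]mulmx1 -(mulmxV uN0) -mulmxA (mulmxA JJ) -NJ// -mulmxA (mulmxA (invmx _)) mulVmx// mul1mx.
have M1 : mxCk 1 V Mm by apply: (mxCkM oV N1 (mxCk_cst _ _ _)).
have dM i x : V x -> dmx Mm i x = dl i x *: (Mm x *m JJ).
move=> Vx; rewrite (dmxM i oV N1 (mxCk_cst _ _ _) Vx) dmx_cst mulmx0 addr0 dN//.
by rewrite -scalemxAl /Mm -!mulmxA uJ.
pose k0 : 'I_N := lshift m.+1 ord0; pose k1 : 'I_N := rshift m.+1 ord0.
have JJe (A : 'M[R]_N) : (A *m JJ) k0 k0 = - A k0 k1 /\ (A *m JJ) k0 k1 = A k0 k0.
rewrite -[A]submxK /J0 mulmx_block !mulmx0 !mulmxN !mulmx1 !add0r !addr0 /k0 /k1.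
by rewrite !block_mxEul !block_mxEur oppmxE.
have ca : Ck 1 V (fun x => Mm x k0 k0) by [].
have cb : Ck 1 V (fun x => Mm x k0 k1) by [].
(* If [Mm] is a complex number a + i b, then a and b are its entries at (k0, k0) and (k0, k1), so
   [K] is [Mm] times the conjugate number. Its derivative vanishes identically, which shows [Mm] to
   be scalar without an integration of the phase. *)
pose K x := Mm x k0 k0 *: Mm x - Mm x k0 k1 *: (Mm x *m JJ).
have MJ1 := mxCkM oV M1 (@mxCk_cst R n _ _ V 1 JJ).
have K1a := mxCkZ oV ca M1; have K1b := mxCkZ oV cb MJ1.
have nK : \forall x \near x0, K x = K x0.
apply: (dmx0_near oV (mxCkD oV K1a (mxCkN oV K1b)) _ Vx0) => x i Vx.
rewrite (dmxD i oV K1a (mxCkN oV K1b) Vx) (dmxN i oV K1b Vx).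
rewrite (dmxZ i oV ca M1 Vx) (dmxZ i oV cb MJ1 Vx) -!(dmxE i _ _ oV M1 Vx).
rewrite (dmxM i oV M1 (mxCk_cst _ _ _) Vx) dmx_cst mulmx0 addr0 !dM//.
rewrite !scalemxE (JJe (Mm x)).1 (JJe (Mm x)).2 -scalemxAl -(mulmxA (Mm x)) J0_sq mulmxN mulmx1.
by mxlin.
have M0 : Mm x0 = 1%:M by rewrite /Mm mulmxV.
have K0 : K x0 = 1%:M by rewrite /K M0 !mxE eqxx (_ : (k0 == k1) = false)// scale1r scale0r subr0.
exists (Nm x0); first exact: Nu.
have nV : \forall x \near x0, V x by apply: open_nbhs_nbhs.
apply: filterS (filterI nK nV) => x [Kx Vx].
have zE : zrow P' x = zrow P x *m Nm x.
by rewrite /zrow -(PN x Vx) !mul_usub_mx.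
have NM : Nm x = Mm x *m Nm x0 by rewrite /Mm mulmxKV.
apply: csim_sym; exists (Mm x k0 k0, - Mm x k0 k1); split=> /=.
apply: contraTneq (ltr01 : (0 : R) < 1) => /eqP.
rewrite paddr_eq0 ?sqr_ge0// !sqrf_eq0 oppr_eq0 => /andP[/eqP a0 /eqP b0].
have := congr1 (fun A : 'M[R]_N => A k0 k0) Kx.
by rewrite K0 /K a0 b0 !scale0r subr0 zeromxE mxE eqxx -[true%:R]/(1 : R) => <-; rewrite ltxx.
rewrite /cmul zE NM scaleNr.
have -> : Mm x k0 k0 *: (zrow P x *m (Mm x *m Nm x0)) - Mm x k0 k1 *: (zrow P x *m (Mm x *m Nm x0) *m JJ)
 = zrow P x *m K x *m Nm x0.
have h : zrow P x *m (Mm x *m Nm x0) *m JJ = zrow P x *m (Mm x *m JJ) *m Nm x0.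
move: (NJ x0 Vx0); clearbody Mm; set N0 := Nm x0; clearbody N0 => hN.
by rewrite -!mulmxA hN.
rewrite h /K mulmxBr mulmxBl -!scalemxAr -!scalemxAl; congr (_ *: _ - _).
by move: (Mm x) (Nm x0) => A B; rewrite mulmxA.
by rewrite Kx K0 mulmx1.
Qed.

Lemma holrows_trans c d i x : overlap c d x ->
 holrows J c i x *m 'J (trans c d) x =
 \sum_k 'J (trans c d) x i k *: holrows J d k (trans c d x).
move=> ox; rewrite (_ : \sum_k _ = col_mx ((delta_mx 0 i : 'rV[R]_n) *m 'J (trans c d) x)
 ((delta_mx 0 i : 'rV[R]_n) *m 'J (trans c d) x *m J d (trans c d x))).
by rewrite /holrows mul_col_mx -mulmxA (J_trans KJ ox) mulmxA.
have e : (delta_mx 0 i : 'rV[R]_n) *m 'J (trans c d) x = \sum_k 'J (trans c d) x i k *: (delta_mx 0 k : 'rV[R]_n).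
by rewrite -rowE [LHS]row_sum_delta; apply: eq_bigr => k _; rewrite mxE.
rewrite e mulmx_suml; elim/big_rec3: _ => [|k u v w _ ->]; first by rewrite col_mx0.
by rewrite -scalemxAl /holrows scale_col_mx add_col_mx.
Qed.

(** [th] pulls back as a 1-form and the tangent rows by the Jacobian, while the part R^2, hence
    [zrow], does not change. *)
Lemma devframe_trans c d U th P : devframe d U th P ->
 devframe c (overlap c d `&` trans c d @^-1` U)
 (fun i x => \sum_k 'J (trans c d) x i k * th k (trans c d x))
 (fun x => block_mx 1%:M 0 0 ('J (trans c d) x) *m P (trans c d x)).
move=> dP; have oO := open_overlap RM (c := c) (d := d).
have st := @trans_smooth R n M RM c d; have sA := @jac_trans_smooth R n M RM c d.
set V := _ `&` _.
have oV : open V.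
rewrite openE => x [ox Ux].
have tc : {for x, continuous (trans c d)} by exact: (mxCk_cont (smooth_Ck 0 st) ox).
have h1 : \forall y \near x, U (trans c d y).
by apply: tc; apply: open_nbhs_nbhs; split=> //; exact: df_open dP.
have h2 : \forall y \near x, overlap c d y by apply: open_nbhs_nbhs.
by apply: filterS (filterI h1 h2) => y [].
have VO : V `<=` overlap c d by move=> x [].
have VU x : V x -> U (trans c d x) by case.
have t1 : mxCk 1 V (trans c d) by exact: (smooth_Ck 1 (mxsmooth_sub VO st)).
have sAV := mxsmooth_sub VO sA; have A1 := smooth_Ck 1 sAV.
have oU := df_open dP.
have sc a b (F : 'rV[R]_n -> 'M[R]_(a, b)) : mxsmooth U F -> mxsmooth V (F \o trans c d).
move=> sF; apply/mxsmoothP => k.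
exact: (mxCk_comp oV oU VU (smooth_Ck k (mxsmooth_sub VO st)) (smooth_Ck k sF)).
pose T x : 'M[R]_(1 + 1 + n) := block_mx 1%:M 0 0 ('J (trans c d) x).
have sT : mxsmooth V T.
by apply: mxsmooth_block => //; exact: mxsmooth_cst.
split=> //.
- by move=> x /VO; exact: overlap_cimg.
- move=> i k; apply: (@Ck_sum _ _ _ _ _ _ _ (fun l x => 'J (trans c d) x i l * th l (trans c d x)) oV) => l _.
apply: (CkM oV (f := fun x => 'J (trans c d) x i l)); first exact: sAV.
apply: (@Ck_comp R n n k V U (trans c d) (th l) oV oU VU); last exact: (df_th dP).
by move=> j; exact: (smooth_Ck k (mxsmooth_sub VO st)).
- exact: (mxsmoothM oV sT (sc _ _ _ (df_smooth dP))).
- move=> x i Vx; have ox := VO x Vx; have cx := overlap_cimg RM ox; have dx := trans_img RM ox.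
rewrite (dmxM i oV (smooth_Ck 1 sT) (smooth_Ck 1 (sc _ _ _ (df_smooth dP))) Vx).
rewrite (dmx_comp i oV oU VU t1 (smooth_Ck 1 (df_smooth dP)) Vx).
have -> : \sum_j 'J (trans c d) x i j *: dmx P j (trans c d x) =
 (\sum_j 'J (trans c d) x i j *: devconn eps J d th j (trans c d x)) *m P (trans c d x).
rewrite mulmx_suml; apply: eq_bigr => j _.
by rewrite (df_eq dP j (VU x Vx)) scalemxAl.
rewrite !mulmxA -mulmxDl; congr (_ *m _).
have -> : dmx T i x = block_mx 0 0 0 (dmx (fun y => 'J (trans c d) y) i x).
by rewrite (dmx_block oV i (mxCk_cst _ _ _) (mxCk_cst _ _ _) (mxCk_cst _ _ _) A1 Vx) !dmx_cst.
pose A := 'J (trans c d) x; pose y := trans c d x; pose t := \sum_k A i k * th k y.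
have -> : \sum_j 'J (trans c d) x i j *: devconn eps J d th j (trans c d x) =
 block_mx (t *: J0 R 1) (holrows J c i x *m A) (- eps *: (metric d y *m (holrows J c i x *m A)^T))
 (pullconn c d i x + t *: J d y).
rewrite (holrows_trans i ox) /t /pullconn -/A -/y linear_sum/= mulmx_sumr scaler_sumr.
rewrite !scaler_suml -big_split/= -sum_block; apply: eq_bigr => k _.
rewrite /devconn scale_block_mx scalerDr !scalerA linearZ/= -scalemxAr !scalerA.
by rewrite (mulrC _ (- eps)).
rewrite /T !mulmx_block !mulmx0 !mul0mx !addr0 !add0r !mul1mx !mulmx1 add_block_mx !add0r.
apply: eq_block => //.
 - rewrite -scalemxAr trmx_mul (metric_trans RM ox) -/A -/y !mulmxA.
by [].
rewrite (dmx_jac_trans RM i ox) mulmxDr mulmxDl -!scalemxAr -!scalemxAl (J_trans KJ ox) -/A -/y -/t.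
by mxlin.
- move=> x Vx; have ox := VO x Vx.
rewrite -mulmxA -(df_J dP (VU x Vx)) !mulmxA; congr (_ *m _).
rewrite /devJ !mulmx_block !mulmx0 !mul0mx !addr0 !add0r !mul1mx !mulmx1 (J_trans KJ ox).
by [].
- move=> x Vx; have ox := VO x Vx.
rewrite trmx_mul !mulmxA -(mulmxA _ (P _)) -(mulmxA _ (P _ *m _)) (df_form dP (VU x Vx)).
rewrite /devform tr_block_mx !mulmx_block !trmx0 trmx1 !mulmx0 !mul0mx !addr0 !add0r !mul1mx.
by rewrite !mul0mx (metric_trans RM ox) -scalemxAr -scalemxAl.
Qed.

Lemma zrow_trans c d P x :
 zrow (fun x => block_mx 1%:M 0 0 ('J (trans c d) x) *m P (trans c d x) : 'M[R]_(1 + 1 + n, N)) x =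
 zrow P (trans c d x).
rewrite /zrow -[P (trans c d x) in LHS]vsubmxK mul_block_col !mul0mx mul1mx addr0 col_mxKu.
by [].
Qed.

Definition isdev p (Z : M -> 'rV[R]_N) := exists c U th P,
 [/\ devframe c U th P, cdom c p, U (coord c p) & Z = fun q => zrow P (coord c q)].

Lemma isdev_near p Z : isdev p Z -> \forall q \near p, isdev q Z.
move=> [c [U [th [P [dP cp Up ->]]]]].
have h1 : \forall q \near p, U (coord c q).
by apply: (coord_cont RM cp); apply: open_nbhs_nbhs; split=> //; exact: df_open dP.
have h2 : \forall q \near p, cdom c q.
by apply: open_nbhs_nbhs; split=> //; exact: riem_open_dom.
by apply: filterS (filterI h1 h2) => q [Uq cq]; exists c, U, th, P.
Qed.

Lemma isdev_cont p Z : isdev p Z -> {for p, continuous Z}.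
move=> [c [U [th [P [dP cp Up ->]]]]].
have sz : mxsmooth U (zrow P).
move=> i j; have := df_smooth dP (lshift n (lshift 1 i)) j.
by congr (smooth U); apply/funext => x; rewrite /zrow !mxE.
apply: continuous_comp; first exact: coord_cont RM _ _ cp.
exact: (mxCk_cont (smooth_Ck 0 sz) Up).
Qed.

Lemma isdev_chart p Z c : isdev p Z -> cdom c p -> exists U th P,
 [/\ devframe c U th P, U (coord c p) & \forall q \near p, Z q = zrow P (coord c q)].
move=> [d [U [th [P [dP dp Up ->]]]]] cp.
have tE q : cdom c q -> trans c d (coord c q) = coord d q.
by move=> cq; rewrite /trans /local_rep (riem_coordK RM cq).
have dP' := devframe_trans c dP.
eexists _, _, _; split; first exact: dP'.
- split; first by exists p.
by rewrite /= tE.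
- have h2 : \forall q \near p, cdom c q.
by apply: open_nbhs_nbhs; split=> //; exact: riem_open_dom.
by apply: filterS h2 => q cq; rewrite zrow_trans tE.
Qed.

Lemma isdev_unitary p Z g : unitary eta g -> isdev p Z -> isdev p (fun q => Z q *m g).
move=> ug [c [U [th [P [dP cp Up ->]]]]].
exists c, U, th, (fun x => P x *m g); split=> //; first exact: devframe_unitary.
apply/funext => q; rewrite /zrow -[P _ in RHS]vsubmxK mul_col_mx col_mxKu.
by rewrite -[usubmx (P _) in RHS]vsubmxK mul_col_mx col_mxKu.
Qed.

Lemma isdev_unique p Z Z' : isdev p Z -> isdev p Z' -> exists2 g, unitary eta g &
 \forall q \near p, csim (Z' q) (Z q *m g).
move=> [c [U [th [P [dP cp Up ->]]]]] dZ'.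
have [U' [th' [P' [dP' U'p Z'E]]]] := isdev_chart dZ' cp.
have [g ug ng] := devframe_unique dP dP' Up U'p; exists g => //.
have ng' : \forall q \near p, csim (zrow P' (coord c q)) (zrow P (coord c q) *m g).
exact: (coord_cont RM cp ng).
by apply: filterS (filterI ng' Z'E) => q [h ->].
Qed.

Lemma isdev_gip p Z : isdev p Z -> S (Z p) (Z p) = 1.
move=> [c [U [th [P [dP cp Up ->]]]]].
by have [e _ _ _] := devframe_gram dP Up; rewrite /gip e mxE eqxx.
Qed.
End Development.

Lemma jac_near_C1 (R : realType) n p (U V : set 'rV[R]_n) (f g : 'rV[R]_n -> 'rV[R]_p) x :
 open U -> mxCk 1 U f -> U x -> open V -> mxCk 1 V g -> V x ->
 (\near x, f x = g x) -> 'J f x = 'J g x.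
move=> oU f1 Ux oV g1 Vx fg; apply/row_matrixP => i.
exact: (etrans (jac_row i oU f1 Ux) (etrans (dmx_near i fg) (esym (jac_row i oV g1 Vx)))).
Qed.

(** * The model metric and developments as local isometries *)

Section ModelMetric.
Variables (R : realType) (m : nat) (eps : R).
Notation n := (m + m)%N.
Notation N := (m.+1 + m.+1)%N.
Notation JJ := (J0 R m.+1).
Variables (eta : 'M[R]_N).
Hypotheses (eps2 : eps ^+ 2 = 1) (etaT : eta^T = eta) (etaJ : JJ *m eta = eta *m JJ).
Notation S := (gip eta).

(** The Fubini-Study metric for eps = 1 and the metric of the complex ball for eps = -1. *)
Definition model_metric (w : 'rV[R]_n) : 'M[R]_n :=
 (1 + eps * sqnorm w) ^- 2 *: ((1 + eps * sqnorm w)%:M -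
 eps *: (w^T *m w + (w *m J0 R m)^T *m (w *m J0 R m))).

Lemma model_metric_form (u v w : 'rV[R]_n) : (u *m model_metric w *m v^T) 0 0 =
 (1 + eps * sqnorm w) ^- 2 * ((1 + eps * sqnorm w) * (u *m v^T) 0 0 -
 eps * ((u *m w^T) 0 0 * (v *m w^T) 0 0 +
 (u *m (w *m J0 R m)^T) 0 0 * (v *m (w *m J0 R m)^T) 0 0)).
have rk (a : 'rV[R]_n) : (u *m (a^T *m a) *m v^T) 0 0 = (u *m a^T) 0 0 * (v *m a^T) 0 0.
have -> : u *m (a^T *m a) *m v^T = (u *m a^T) *m (a *m v^T) by rewrite !mulmxA.
rewrite mxE big_ord1; congr (_ * _).
by rewrite -[a *m v^T]trmxK [LHS]mxE trmx_mul trmxK.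
rewrite /model_metric -scalemxAr -scalemxAl scalemxE mulmxBr mulmxBl addmxE oppmxE.
rewrite mul_mx_scalar -scalemxAl scalemxE -scalemxAr -scalemxAl scalemxE mulmxDr mulmxDl addmxE !rk.
by [].
Qed.
Variables (e : 'rV[R]_N) (L : 'M[R]_(n, N)).
Hypotheses (F : aframe eps eta e L).
Notation lift := (lift_aff e L).

Lemma gip_L (u v : 'rV[R]_n) : S (u *m L) (v *m L) = eps * (u *m v^T) 0 0.
rewrite /gip trmx_mul !mulmxA -(mulmxA u) -(mulmxA u) (af_LL F) mul_mx_scalar -scalemxAl scalemxE.
by [].
Qed.

Lemma gip_L_e (u : 'rV[R]_n) : S (u *m L) e = 0 /\ S (u *m L) (e *m JJ) = 0.
have h (y : 'rV[R]_N) : y *m eta *m L^T = 0 -> S (u *m L) y = 0.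
by move=> h; rewrite (gipC etaT) /gip trmx_mul mulmxA h mul0mx mxE.
by split; apply: h; [exact: af_eL F|exact: (af_eJL etaJ F)].
Qed.

(** [D] is the Jacobian in affine coordinates, [a] and [b] the factor that normalizes [z]. The
    metric of the model measures the part of a derivative that is orthogonal to the complex line of
    [z]; the part along that line drops out. *)
Lemma pullback_algebra (z : 'rV[R]_N) (tau : 'M[R]_(n, N)) (g D : 'M[R]_n) a b w :
 z *m eta *m z^T = 1%:M -> z *m eta *m tau^T = 0 -> z *m JJ *m eta *m tau^T = 0 ->
 tau *m eta *m tau^T = eps *: g -> lift w = cmul a b z -> a ^+ 2 + b ^+ 2 != 0 ->
 (forall i, exists al be, row i D *m L = cmul a b (row i tau) + cmul al be z) ->
 g = D *m model_metric w *m D^T.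
move=> zz zt zJt tt wz ab HD; set y := lift w.
have szz : S z z = 1 by rewrite /gip zz mxE eqxx.
have sE : a ^+ 2 + b ^+ 2 = 1 + eps * sqnorm w.
by rewrite -(gip_lift etaT F) wz gip_cmul// szz mulr1.
set s := a ^+ 2 + b ^+ 2 in ab sE.
have syy : S y y = s by rewrite /y (gip_lift etaT F) sE.
have yJy : S (y *m JJ) y = 0 := gip_self_J etaT etaJ y.
have zE al be : exists p q, cmul al be z = cmul p q y.
exists ((al * a + be * b) / s), ((be * a - al * b) / s).
by rewrite /y wz cmulA; congr (cmul _ _ _); rewrite /s; field.
have rtau i (v : 'rV[R]_N) : v *m eta *m tau^T = 0 -> S (row i tau) v = 0.
by move=> h; rewrite (gipC etaT) /gip tr_row colE mulmxA h mul0mx mxE.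
have ty i : S (cmul a b (row i tau)) y = 0 /\ S (cmul a b (row i tau)) (y *m JJ) = 0.
rewrite /y wz cmulJ !gip_cmul// !rtau ?mulr0//.
have tij i j : S (cmul a b (row i tau)) (cmul a b (row j tau)) = s * eps * g i j.
rewrite gip_cmul// -mulrA; congr (_ * _).
have := congr1 (fun A : 'M[R]_n => A i j) tt; rewrite scalemxE => <-.
by rewrite /gip tr_row colE -row_mul mulmxA -row_mul -colE [LHS]mxE [LHS]mxE.
have dec i : exists p q, row i D *m L = cmul a b (row i tau) + cmul p q y.
by have [al [be ->]] := HD i; have [p [q ->]] := zE al be; exists p, q.
apply/matrixP => i j.
have -> : (D *m model_metric w *m D^T) i j = (row i D *m model_metric w *m (row j D)^T) 0 0.
by rewrite -row_mul tr_row colE mulmxA -row_mul -colE [RHS]mxE [RHS]mxE.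
rewrite model_metric_form -sE.
have [p [q Di]] := dec i; have [p' [q' Dj]] := dec j.
have yL (u : 'rV[R]_n) : S (u *m L) y = eps * (u *m w^T) 0 0.
by rewrite /y /lift_aff gipDr// (gip_L_e u).1 add0r gip_L.
have yJL (u : 'rV[R]_n) : S (u *m L) (y *m JJ) = eps * (u *m (w *m J0 R m)^T) 0 0.
rewrite /y /lift_aff mulmxDl gipDr// (gip_L_e u).2 add0r.
by rewrite -(mulmxA w) (af_LJ F) mulmxA gip_L.
have ps p0 q0 k : row k D *m L = cmul a b (row k tau) + cmul p0 q0 y ->
 S (row k D *m L) y = p0 * s /\ S (row k D *m L) (y *m JJ) = q0 * s.
move=> ->; rewrite !(gipDl eta (cmul a b (row k tau))) (ty k).1 (ty k).2 !add0r /cmul !gipDl !gipZl.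
by rewrite (gipC etaT y) yJy (gipJJ (etaJJ etaJ)) syy; split; ring.
have [pi qi] := ps _ _ _ Di; have [pj qj] := ps _ _ _ Dj.
have ij : S (row i D *m L) (row j D *m L) = s * eps * g i j + (p * p' + q * q') * s.
rewrite {1}Di {1}Dj (gipDl eta (cmul a b (row i tau))) !(gipDr etaT (cmul a b (row j tau))) tij.
rewrite (gipC etaT (cmul p q y) (cmul a b _)).
have h k x1 x2 : S (cmul a b (row k tau)) (cmul x1 x2 y) = 0.
by rewrite /cmul gipDr// !gipZr// (ty k).1 (ty k).2 !mulr0 addr0.
rewrite !h addr0 add0r /cmul gipDl !gipDr// !gipZl !gipZr//.
by rewrite (gipC etaT y (y *m JJ)) yJy (gipJJ (etaJJ etaJ)) syy; ring.
move: ij pi qi pj qj; rewrite !gip_L !yL !yJL.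
set dd := (row i D *m (row j D)^T) 0 0; set u1 := (row i D *m w^T) 0 0.
set u2 := (row i D *m (w *m _)^T) 0 0; set v1 := (row j D *m w^T) 0 0.
set v2 := (row j D *m (w *m _)^T) 0 0 => ij pi qi pj qj.
have e0 : eps != 0.
by apply/eqP => e0; move: eps2; rewrite e0 expr0n => /eqP; rewrite eq_sym oner_eq0.
have epsV : eps^-1 = eps by apply: (mulfI e0); rewrite mulfV// -expr2 eps2.
have solve (X Y : R) : eps * X = Y -> X = eps * Y.
by move=> <-; rewrite mulrA -expr2 eps2 mul1r.
rewrite (solve _ _ ij) (solve _ _ pi) (solve _ _ qi) (solve _ _ pj) (solve _ _ qj).
have -> : s ^- 2 * (s * (eps * (s * eps * g i j + (p * p' + q * q') * s)) -
 eps * (eps * (p * s) * (eps * (p' * s)) + eps * (q * s) * (eps * (q' * s)))) =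
 eps ^+ 2 * g i j + (1 - eps ^+ 2) * eps * (p * p' + q * q') by field.
by rewrite eps2 mul1r subrr !mul0r addr0.
Qed.

Section AffineSmooth.
Variables (p : nat) (U : set 'rV[R]_p) (z : 'rV[R]_p -> 'rV[R]_N).
Hypotheses (oU : open U) (sz : mxsmooth U z).
Let sre y : smooth U (fun x => S (z x) y).
have := mxsmoothM oU (mxsmoothM oU sz (mxsmooth_cst U eta)) (mxsmooth_cst U y^T).
by move=> h; exact: h.
Qed.

Lemma den_smooth : smooth U (fun x => den eta e (z x)).
by move=> k; apply: (CkD oU); apply: (CkM oU); exact: sre. Qed.
Lemma den_near x : U x -> den eta e (z x) != 0 -> \forall y \near x, den eta e (z y) != 0.
move=> Ux d0; have dc := Ck_cont (den_smooth 0%N) Ux.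
have d1 : 0 < `|den eta e (z x)| by rewrite normr_gt0.
have H : \forall y \near x, `|den eta e (z x) - den eta e (z y)| < `|den eta e (z x)|.
exact: (dc _ (near_norm (den eta e (z x)) d1)).
by apply: filterS H => y; apply: contraTneq => ->; rewrite subr0 ltxx.
Qed.
Hypotheses (d0 : forall x, U x -> den eta e (z x) != 0).
Notation a x := (re eta e (z x) / den eta e (z x)).
Notation b x := (- im eta e (z x) / den eta e (z x)).

Lemma unphase_smooth :
 [/\ smooth U (fun x => a x), smooth U (fun x => b x) & mxsmooth U (fun x => cmul (a x) (b x) (z x))].
have sdV : smooth U (fun x => (den eta e (z x))^-1).
by move=> k; apply: (CkV oU d0); exact: den_smooth.
have sneg f : smooth U f -> smooth U (fun x => - f x).
move=> sf k; apply: (Ck_ext oU (f := fun x => (-1) * f x)); first by move=> x _; rewrite mulN1r.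
by apply: (CkM oU (f := fun=> -1)); [exact: Ck_cst|exact: sf].
have sa : smooth U (fun x => a x) by move=> k; apply: (CkM oU); [exact: sre|exact: sdV].
have sb : smooth U (fun x => b x) by move=> k; apply: (CkM oU); [exact: (sneg _ (sre _))|exact: sdV].
have szJ := mxsmoothM oU sz (mxsmooth_cst U JJ).
by split=> //; exact: (mxsmoothD oU (mxsmoothZ oU sa sz) (mxsmoothZ oU sb szJ)).
Qed.

Lemma aff_smooth : mxsmooth U (fun x => aff eps eta e L (z x)).
have [_ _ sy] := unphase_smooth.
have h : forall x, U x -> eps *: (cmul (a x) (b x) (z x) *m (eta *m L^T)) = aff eps eta e L (z x).
move=> x Ux; rewrite -(lift_affE eps2 etaT etaJ F (d0 Ux)) /lift_aff mulmxDl !mulmxA (af_eL F) add0r.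
by rewrite -!mulmxA (mulmxA L) (af_LL F) mul_mx_scalar scalerA -expr2 eps2 scale1r.
apply: (mxsmooth_ext oU h); apply: (mxsmoothZ oU (f := fun=> eps)); first by move=> k; exact: Ck_cst.
exact: (mxsmoothM oU sy (mxsmooth_cst _ _)).
Qed.
End AffineSmooth.
End ModelMetric.

Section LocalDevelopment.
Variables (R : realType) (m : nat) (eps : R) (M : riemData R (m + m)).
Notation n := (m + m)%N.
Notation N := (m.+1 + m.+1)%N.
Notation JJ := (J0 R m.+1).
Hypotheses (RM : riemannian M).
Variables (J : chart M -> 'rV[R]_n -> 'M[R]_n).
Hypotheses (KJ : kahler J) (eps2 : eps ^+ 2 = 1)
 (curvM : hol_curv eps M J).
Variables (eta : 'M[R]_N).
Hypotheses (etaT : eta^T = eta) (etaJ : JJ *m eta = eta *m JJ).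
Implicit Types (c d : chart M) (x w : 'rV[R]_n) (p q : M) (Z : M -> 'rV[R]_N).
Notation S := (gip eta).
Notation isdev := (isdev eps J eta).
Notation aframe := (aframe eps eta).
Notation aff := (aff eps eta).
Notation den := (den eta).
Let dE x (E : 'M[R]_n) c : cimg c x -> E *m metric c x *m E^T = 1%:M -> E \in unitmx.
by move=> cx E1; apply: (mulmx1_unit (B := metric c x *m E^T) _).1; rewrite mulmxA.
Qed.

(** A unitary frame at [p] is matched with the rows of [L], which gives an admissible initial value
    with first row [e]. *)
Lemma isdev_exists p e L : aframe e L -> exists Z, isdev p Z /\ Z p = e.
move=> F; have [c cp] := riem_cover RM p; have cx := cimg_coord cp.
have [E [E1 EJ]] := unitary_frame (J_sq KJ cx) (metric_sym RM cx)
 (fun v => riem_metric_pos RM cx (v := v)) (J_herm KJ cx).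
have uE := dE cx E1; pose B := invmx E.
have BB : B *m B^T = metric c (coord c p).
have h : metric c (coord c p) *m E^T = B by rewrite -[LHS](mulKmx uE) (mulmxA E) E1 mulmx1.
by rewrite -{1}h -mulmxA -trmx_mul mulVmx// trmx1 mulmx1.
have JB : J c (coord c p) *m B = B *m J0 R m.
by rewrite -[LHS](mulKmx uE) !mulmxA -(mulmxA B) EJ -!mulmxA mulmxV// mulmx1.
have [||U [th [P [dP Up P0]]]] := @devframe_exists R m eps M RM J KJ curvM eta c (coord c p)
 (col_mx (col_mx e (e *m JJ)) (B *m L)) cx.
- rewrite /devJ mul_block_col !mul0mx addr0 add0r jj_col !mul_col_mx -(mulmxA e) J0_sq mulmxN mulmx1.
by rewrite mulmxA JB -!mulmxA (af_LJ F).
- rewrite !tr_col_mx !mul_col_mx !mul_mx_row /devform.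
have eeJ : e *m eta *m (e *m JJ)^T = 0.
by apply/matrixP => i k; rewrite !ord1 zeromxE -[LHS]/(S e (e *m JJ)) gipC// gip_self_J.
have tz a (A : 'M[R]_(a, N)) (v : 'rV[R]_N) : v *m eta *m A^T = 0 -> A *m eta *m v^T = 0.
by move=> h; rewrite -(etatr etaT v A) h trmx0.
have eL : e *m eta *m (B *m L)^T = 0 by rewrite trmx_mul mulmxA (af_eL F) mul0mx.
have eJL : e *m JJ *m eta *m (B *m L)^T = 0.
by rewrite trmx_mul mulmxA (af_eJL etaJ F) mul0mx.
have eJeJ : e *m JJ *m eta *m (e *m JJ)^T = 1%:M.
by rewrite trmx_mul !mulmxA -(mulmxA e) -(mulmxA e) etaJJ// (af_ee F).
have BLBL : B *m L *m eta *m (B *m L)^T = eps *: metric c (coord c p).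
by rewrite trmx_mul !mulmxA -(mulmxA B) -(mulmxA B) (af_LL F) mul_mx_scalar -scalemxAl BB.
rewrite (af_ee F) eeJ (tz _ _ _ eeJ) eJeJ eL eJL (tz _ _ _ eL) (tz _ _ _ eJL) BLBL.
have E' : row_mx (block_mx 1%:M 0 0 1%:M : 'M[R]_(1 + 1)) (0 : 'M[R]_(1 + 1, n)) =
 col_mx (row_mx (row_mx 1%:M 0) 0) (row_mx (row_mx 0 1%:M) 0).
by rewrite -[RHS]/(block_mx _ _ _ _) [RHS]block_mxEh col_mx0.
by rewrite -E' row_mx0 [X in _ = block_mx X _ _ _]scalar_mx_block.
exists (fun q => zrow P (coord c q)); split; first by exists c, U, th, P.
by rewrite /zrow P0 !col_mxKu.
Qed.

Lemma isdev_frame p Z : isdev p Z -> exists L, aframe (Z p) L.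
move=> [c [U [th [P [dP cp Up ->]]]]]; have cx := cimg_coord cp.
have [E [E1 EJ]] := unitary_frame (J_sq KJ cx) (metric_sym RM cx)
 (fun v => riem_metric_pos RM cx (v := v)) (J_herm KJ cx).
have [zz zt zJt tt] := devframe_gram dP Up; have [_ Jt] := devframeE dP Up.
exists (E *m trows P (coord c p)); split=> //.
- rewrite trmx_mul !mulmxA -(mulmxA E) -(mulmxA E) tt -scalemxAr -scalemxAl E1.
by rewrite scale_scalar_mx mulr1.
- by rewrite trmx_mul mulmxA zt mul0mx.
- by rewrite -mulmxA -Jt mulmxA EJ mulmxA.
Qed.

(* A development followed by an affine coordinate is a local isometry to the
 model, hence a local diffeomorphism. *)
Lemma isdev_local p Z c e L : isdev p Z -> cdom c p -> aframe e L -> den e (Z p) != 0 ->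
exists U V h, [/\ [/\ open U, U (coord c p), U `<=` cimg c & open V],
 forall x, U x -> [/\ isdev (param c x) Z, den e (Z (param c x)) != 0,
 V (aff e L (Z (param c x))) & h (aff e L (Z (param c x))) = x],
 forall w, V w -> U (h w) /\ aff e L (Z (param c (h w))) = w,
 mxsmooth U (fun x => aff e L (Z (param c x))) /\ mxsmooth V h
 & forall x, U x -> metric c x = 'J (fun x => aff e L (Z (param c x))) x *m
 model_metric eps (aff e L (Z (param c x))) *m
 ('J (fun x => aff e L (Z (param c x))) x)^T].
move=> dZ cp F dp; have [U [th [P [dP Up ZE]]]] := isdev_chart RM KJ dZ cp.
have cx := cimg_coord cp.
have pc : {for coord c p, continuous (param c)} := param_cont RM cx.
have near_p (Q : M -> Prop) : (\forall q \near p, Q q) -> \forall x \near coord c p, Q (param c x).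
by move=> h; apply: pc; rewrite (riem_coordK RM cp).
have n1 := near_p _ (isdev_near RM dZ).
have cK x : cimg c x -> coord c (param c x) = x by move=> /(cimg_param RM)[].
have nU : \forall x \near coord c p, U x by apply: open_nbhs_nbhs; split=> //; exact: df_open dP.
have ZE' : \forall x \near coord c p, Z (param c x) = zrow P x.
by apply: filterS (filterI nU (near_p _ ZE)) => x [Ux ->]; rewrite cK//; exact: (df_sub dP).
have Z0 : zrow P (coord c p) = Z p by have := nbhs_singleton ZE'; rewrite (riem_coordK RM cp) => ->.
have sz : mxsmooth U (zrow P).
move=> i j; have := df_smooth dP (lshift n (lshift 1 i)) j.
by congr (smooth U); apply/funext => x; rewrite /zrow !mxE.
have oU := df_open dP.
have nd : \forall x \near coord c p, den e (zrow P x) != 0.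
by apply: (den_near oU sz Up); rewrite Z0.
have [r r0 Hr] := near_ball (filterI (filterI nU nd) (filterI n1 ZE')).
pose B := [set x : 'rV[R]_n | `|x - coord c p| < r].
have oB : open B by exact: open_ball_norm.
have Bp : B (coord c p) by rewrite /B /= subrr normr0.
have HB x : B x -> [/\ U x, den e (zrow P x) != 0, isdev (param c x) Z & Z (param c x) = zrow P x].
by rewrite /B /= distrC => /Hr[[? ?] [? ?]].
have BU : B `<=` U by move=> x /HB[].
pose W x := aff e L (zrow P x).
have WE x : B x -> aff e L (Z (param c x)) = W x by move=> /HB[_ _ _ ->].
have szB := mxsmooth_sub BU sz.
have dB x : B x -> den e (zrow P x) != 0 by move=> /HB[].
have [sa sb sy] := unphase_smooth oB szB dB.
have yE x : B x -> lift_aff e L (W x) = cmul (re eta e (zrow P x) / den e (zrow P x)) (- im eta e (zrow P x) / den e (zrow P x)) (zrow P x).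
by move=> /HB[_ d0 _ _]; rewrite lift_affE.
have sW : mxsmooth B W := aff_smooth eps2 etaT etaJ F oB szB dB.
have pull x : B x -> metric c x = 'J W x *m model_metric eps (W x) *m ('J W x)^T.
move=> Bx; have [Ux d0 _ _] := HB x Bx.
have [zz zt zJt tt] := devframe_gram dP Ux; have [PE _] := devframeE dP Ux.
apply: (pullback_algebra eps2 etaT etaJ F zz zt zJt tt (yE x Bx)).
have -> : (re eta e (zrow P x) / den e (zrow P x)) ^+ 2 + (- im eta e (zrow P x) / den e (zrow P x)) ^+ 2
 = (re eta e (zrow P x) ^+ 2 + im eta e (zrow P x) ^+ 2) / den e (zrow P x) ^+ 2 by field.
by rewrite -/(den e (zrow P x)) expr2 invfM mulrA mulfV// mul1r invr_eq0.
move=> i; rewrite (jac_row i oB (smooth_Ck 1 sW) Bx).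
have zi : dmx (zrow P) i x = cmul 0 (th i x) (zrow P x) + row i (trows P x).
have -> : dmx (zrow P) i x = usubmx (usubmx (dmx P i x)).
have P1 := smooth_Ck 1 (df_smooth dP).
apply/matrixP => k l; rewrite (dmxE i k l oU (smooth_Ck 1 sz) Ux) !mxE (dmxE i _ _ oU P1 Ux).
by congr (partial _ i x); apply/funext => y; rewrite /zrow !mxE.
rewrite (df_eq dP i Ux) {1}PE /devconn mul_block_col -scalemxAl jj_col scale_col_mx.
rewrite /holrows mul_col_mx add_col_mx !col_mxKu /cmul scale0r add0r -rowE.
by [].
pose a x := re eta e (zrow P x) / den e (zrow P x); pose b x := - im eta e (zrow P x) / den e (zrow P x).
have e1 : dmx W i x *m L = dmx (fun x => cmul (a x) (b x) (zrow P x)) i x.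
rewrite -(dmx_open i oB yE Bx) /lift_aff.
rewrite (dmxD i oB (mxCk_cst _ _ _) (mxCkM oB (smooth_Ck 1 sW) (mxCk_cst _ _ _)) Bx).
by rewrite (dmxM i oB (smooth_Ck 1 sW) (mxCk_cst _ _ _) Bx) !dmx_cst mulmx0 addr0 add0r.
have z1 := smooth_Ck 1 szB; have zJ1 := smooth_Ck 1 (mxsmoothM oB szB (mxsmooth_cst B JJ)).
rewrite e1 /cmul (dmxD i oB (mxCkZ oB (sa 1%N) z1) (mxCkZ oB (sb 1%N) zJ1) Bx).
rewrite (dmxZ i oB (sa 1%N) z1 Bx) (dmxZ i oB (sb 1%N) zJ1 Bx).
rewrite (dmxM i oB z1 (mxCk_cst _ _ _) Bx) dmx_cst mulmx0 addr0 zi -/(a x) -/(b x).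
set pa := partial _ i x; set pb := partial _ i x.
exists (pa - b x * th i x), (pb + a x * th i x).
rewrite /cmul scale0r add0r mulmxDl -scalemxAl -(mulmxA (zrow P x)) J0_sq mulmxN mulmx1.
by mxlin.
have uJ : 'J W (coord c p) \in unitmx.
have := metric_unit RM cx; rewrite (pull _ Bp) !unitmx_mul => /andP[/andP[]].
by [].
have [U1 [V [h [[oU1 U1p U1B _] oV HU HV sh]]]] := inverse_function oB Bp sW uJ.
have Wnear x : U1 x -> \forall y \near x, W y = aff e L (Z (param c y)).
by move=> Ux; apply: (open_near oU1 Ux) => y Uy; rewrite WE//; exact: U1B.
have sW1 : mxsmooth U1 (fun x => aff e L (Z (param c x))).
apply: (mxsmooth_ext oU1 _ (mxsmooth_sub U1B sW)) => y Uy; rewrite WE//; exact: U1B.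
exists U1, V, h; split=> //.
- by split=> // x /U1B /BU; exact: (df_sub dP).
- move=> x Ux; have Bx := U1B x Ux; have [_ d0 dx zx] := HB x Bx; have [? ?] := HU x Ux.
by rewrite !WE// zx; split.
- by move=> w Vw; have [Uh hw] := HV w Vw; split=> //; rewrite WE//; exact: U1B.
- move=> x Ux; have Bx := U1B x Ux.
rewrite (_ : 'J (fun x => aff e L (Z (param c x))) x = 'J W x); first by rewrite WE// pull.
apply: (jac_near_C1 oU1 (smooth_Ck 1 sW1) Ux oB (smooth_Ck 1 sW) Bx).
by apply: filterS (Wnear x Ux) => y ->.
Qed.
End LocalDevelopment.

(** * Continuation along paths and the uniqueness of lifts *)

Section ContinuousInduction.
Variables (R : realType).

(** The supremum of the initial segments on which [P] holds: the third hypothesis reaches it, the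
    second passes beyond it. *)
Lemma segment_induction (P : R -> Prop) : P 0 ->
 (forall s, 0 <= s <= 1 -> P s -> \forall t \near s, P t) ->
 (forall s, 0 < s <= 1 -> (forall t, 0 <= t < s -> P t) -> P s) ->
 forall s, 0 <= s <= 1 -> P s.
move=> P0 Po Pc s /andP[s0 s1].
pose E := [set t : R | 0 <= t <= 1 /\ forall u, 0 <= u <= t -> P u].
have E0 : E 0.
by split=> [|u]; rewrite ?lexx ?ler01// => /andP[u0 u0']; rewrite (le_anti (introT andP (conj u0' u0))).
have ub : ubound E 1 by move=> t [/andP[]].
have hub : has_ubound E by exists 1.
pose b := sup E.
have b0 : 0 <= b by apply: ub_le_sup.
have b1 : b <= 1 by apply: ge_sup => //; exists 0.
have Plt u : 0 <= u < b -> P u.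
move=> /andP[u0 ub']; have [t [_ Et] ut] := sup_gt (ex_intro _ 0 E0) ub'.
by apply: Et; rewrite u0 ltW.
have Pb : P b.
have [->//|bn0] := eqVneq b 0; apply: Pc => //.
by rewrite lt_neqAle eq_sym bn0 b0 b1.
have [bs|sb] := ltP s b; first by apply: Plt; rewrite s0.
have [bE|bn1] := eqVneq b 1.
by rewrite (_ : s = b)//; apply/eqP; rewrite eq_le sb bE s1.
have blt : b < 1 by rewrite lt_neqAle bn1.
have [d d0 Hd] := near_ball (Po b (introT andP (conj b0 b1)) Pb).
pose t := Num.min (b + d / 2) 1.
have bt : b < t by rewrite lt_min blt andbT ltrDl divr_gt0.
have td : t <= b + d / 2 by rewrite ge_min lexx.
have Et : E t.
split; first by rewrite (le_trans b0 (ltW bt)) ge_min lexx orbT.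
move=> u /andP[u0 ut]; have [ub'|bu] := ltP u b; first by apply: Plt; rewrite u0.
apply: Hd; rewrite distrC ger0_norm ?subr_ge0//.
rewrite ltrBlDl; apply: (le_lt_trans (le_trans ut td)).
by rewrite ltrD2l ltr_pdivrMr// ltr_pMr// ltr1n.
by have := ub_le_sup hub Et; rewrite leNgt bt.
Qed.
End ContinuousInduction.

Lemma cont_near (X Y : topologicalType) (f : X -> Y) a (P : set Y) :
 {for a, continuous f} -> nbhs (f a) P -> \forall b \near a, P (f b).
by move=> fc; exact: fc. Qed.
Lemma denE (R : realType) m (eta : 'M[R]_(m.+1 + m.+1)) e z :
 den eta e z = re eta e z ^+ 2 + im eta e z ^+ 2.
by []. Qed.

Section Lifts.
Variables (R : realType) (m : nat) (eps : R) (M : riemData R (m + m)).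
Notation n := (m + m)%N.
Notation N := (m.+1 + m.+1)%N.
Notation JJ := (J0 R m.+1).
Hypotheses (RM : riemannian M).
Variables (J : chart M -> 'rV[R]_n -> 'M[R]_n).
Hypotheses (KJ : kahler J) (eps2 : eps ^+ 2 = 1)
 (curvM : hol_curv eps M J).
Variables (eta : 'M[R]_N).
Hypotheses (etaT : eta^T = eta) (etaJ : JJ *m eta = eta *m JJ).
Implicit Types (c d : chart M) (x w : 'rV[R]_n) (p q : M) (Z : M -> 'rV[R]_N).
Notation S := (gip eta).
Notation isdev := (isdev eps J eta).
Notation aframe := (aframe eps eta).
Notation aff := (aff eps eta).
Notation den := (den eta).
Notation lift := lift_aff.

Lemma den_csim e y z : csim y z -> den e z != 0 -> den e y != 0.
by move=> [[a b]/= [ab ->]] d; rewrite den_cmul// mulf_neq0. Qed.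
Lemma near_coord c p (Q : 'rV[R]_n -> Prop) : cdom c p ->
 (\forall x \near coord c p, Q x) -> \forall q \near p, Q (coord c q).
by move=> cp h; exact: (coord_cont RM cp h). Qed.
(** [psi] is the local section of the developing map: from affine coordinates in a ball back to [M].
    It is the form in which the local diffeomorphism is used from here on. *)
Lemma isdev_inverse p Z e L : isdev p Z -> aframe e L -> den e (Z p) != 0 ->
exists r psi, [/\ 0 < r, psi (aff e L (Z p)) = p & forall w, `|aff e L (Z p) - w| < r ->
 [/\ isdev (psi w) Z, csim (Z (psi w)) (lift e L w), {for w, continuous psi} &
 \forall q \near psi w, [/\ psi (aff e L (Z q)) = q, `|aff e L (Z p) - aff e L (Z q)| < r
 & den e (Z q) != 0]]].
move=> dZ F d0; have [c cp] := riem_cover RM p.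
have [U [V [h [[oU Up Uc oV] HU HV [sW sh] _]]]] := isdev_local RM KJ eps2 etaT etaJ dZ cp F d0.
have [_ _ Vp hp] := HU _ Up; rewrite (riem_coordK RM cp) in Vp hp.
have [r r0 rV] := near_ball (open_near oV Vp (fun y h => h)).
exists r, (fun w => param c (h w)); split=> //; first by rewrite hp (riem_coordK RM cp).
move=> w wr.
have Vw := rV w wr; have [Uh hw] := HV w Vw.
have [dh dn0 _ _] := HU _ Uh.
have ch := Uc _ Uh; have [cph cK] := cimg_param RM ch.
split=> //.
- by apply: csim_sym; rewrite -{1}hw; apply: lift_aff_csim.
- apply: continuous_comp; first exact: (mxCk_cont (smooth_Ck 0 sh) Vw).
exact: param_cont RM _ _ ch.
have h1 : \forall q \near param c (h w), U (coord c q).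
by apply: (near_coord cph); rewrite cK; apply: open_nbhs_nbhs.
have h2 : \forall q \near param c (h w), cdom c q.
by apply: open_nbhs_nbhs; split=> //; exact: riem_open_dom.
have h3 : \forall q \near param c (h w), `|aff e L (Z p) - aff e L (Z (param c (coord c q)))| < r.
apply: (near_coord cph (Q := fun x => `|aff e L (Z p) - aff e L (Z (param c x))| < r)); rewrite cK.
have Wc := mxCk_cont (smooth_Ck 0 sW) Uh.
have pos : 0 < r - `|aff e L (Z p) - w| by rewrite subr_gt0.
have H : \forall y \near h w, `|aff e L (Z (param c (h w))) - aff e L (Z (param c y))| < r - `|aff e L (Z p) - w|.
apply: (cont_near (P := fun v : 'rV[R]_n => `|aff e L (Z (param c (h w))) - v| < r - `|aff e L (Z p) - w|) Wc).
have := @near_norm R 'rV[R]_n (aff e L (Z (param c (h w)))) _ pos.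
exact.
apply: filterS H => y /=; rewrite hw => hy.
by rewrite -(subrK w (aff e L (Z p))) -addrA; apply: le_lt_trans (ler_normD _ _) _; rewrite -ltrBrDl.
apply: filterS (filterI (filterI h1 h2) h3) => q [[Uq cq] q3].
have [_ dq _ hq] := HU _ Uq; move: q3 hq dq; rewrite (riem_coordK RM cq) => q3 hq dq.
by split=> //; rewrite hq (riem_coordK RM cq).
Qed.

(** In the affine chart centred at [Z p] the local section recovers a point from its developed
    line. *)
Lemma isdev_injective p Z : isdev p Z ->
 exists2 O : set M, nbhs p O & forall a b, O a -> O b -> csim (Z a) (Z b) -> a = b.
move=> dZ; have [L F] := isdev_frame RM KJ dZ.
have d0 : den (Z p) (Z p) != 0.
by rewrite denE /re (isdev_gip dZ) expr1n gt_eqF// ltr_pwDl// sqr_ge0.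
have [r [psi [r0 psip H]]] := isdev_inverse dZ F d0.
have h0 : `|aff (Z p) L (Z p) - aff (Z p) L (Z p)| < r by rewrite subrr normr0.
have [_ _ _ nq] := H _ h0; rewrite psip in nq.
exists [set q | psi (aff (Z p) L (Z q)) = q]; first by apply: filterS nq => q [].
by move=> a b aO bO /(aff_csim eps etaJ (Z p) L) ab; rewrite -aO -bO ab.
Qed.
Hypotheses (eta2 : eta *m eta = 1%:M).

(** As [eta] is an involution, the inverse of [g] is [eta *m g^T *m eta]. *)
Lemma unitaryV g : unitary eta g -> exists g', [/\ unitary eta g', g *m g' = 1%:M & g' *m g = 1%:M].
move=> [gg gJ]; pose g' := eta *m g^T *m eta.
have e1 : g *m g' = 1%:M by rewrite /g' !mulmxA gg eta2.
have e2 := mulmx1C e1; exists g'; split=> //; split.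
- have e3 : g^T *m eta *m g = eta.
by rewrite -[LHS]mul1mx -eta2 -!mulmxA (mulmxA eta g^T) (mulmxA (eta *m g^T)) -/g' e2 mulmx1.
by rewrite /g' !trmx_mul trmxK etaT -!mulmxA (mulmxA eta eta) eta2 mul1mx (mulmxA g^T) (mulmxA (_ *m _) g) e3 eta2 mulmx1.
- by rewrite -[LHS]mulmx1 -e1 (mulmxA (g' *m JJ)) -(mulmxA g' JJ) -gJ mulmxA e2 mul1mx.
Qed.

Lemma csim_unitary g y z : unitary eta g -> csim (y *m g) (z *m g) -> csim y z.
move=> /unitaryV[g' [[_ g'J] gg' _]] /(csim_mulmx g'J).
by rewrite -!mulmxA gg' !mulmx1.
Qed.

Section Uniqueness.
Variables (X : topologicalType) (sig : X -> 'rV[R]_N).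

Implicit Types (f : X -> M) (a b : X).

(** The identity principle for the family of lines [sig], in place of analyticity: a unitary matrix
    that fixes the lines near one parameter fixes all of them. *)
Definition rigid := forall a g, unitary eta g ->
 (\forall b \near a, csim (sig b *m g) (sig b)) -> forall b, csim (sig b *m g) (sig b).

(* [f] is locally a section of a development over [sig]. *)
Definition lifts f a := {for a, continuous f} /\
 exists2 Z, isdev (f a) Z & \forall b \near a, csim (Z (f b)) (sig b).

(** The last hypothesis asks for agreement near points arbitrarily close to [a]. It gives f a = f' a
    as [M] is Hausdorff, and the matrix relating the two developments fixes some lines, hence all by
    rigidity; local injectivity ends the argument. *)
Lemma lifts_agree f f' a : rigid -> lifts f a -> lifts f' a ->
 (forall A, nbhs a A -> exists2 a1, A a1 & \forall b \near a1, f b = f' b) ->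
 \forall b \near a, f b = f' b.
move=> rig [fc [Z dZ nZ]] [f'c [Z' dZ' nZ']] freq.
have ff' : f a = f' a.
apply: (riem_hausdorff RM) => A B /fc fA /f'c fB.
have [a1 [Ax Bx] n1] := freq _ (filterI (fA : nbhs a (f @^-1` A)) (fB : nbhs a (f' @^-1` B))).
by exists (f a1); split=> //; rewrite (nbhs_singleton n1).
rewrite -ff' in dZ'.
have [g ug ng] := isdev_unique RM KJ eps2 dZ dZ'.
have [B nO injO] := isdev_injective dZ.
have ng' : \forall b \near a, csim (Z' (f' b)) (Z (f' b) *m g).
by apply: (cont_near f'c (P := fun p => csim (Z' p) (Z p *m g))); rewrite -ff'.
have nO' : \forall b \near a, B (f' b) by apply: (cont_near f'c); rewrite -ff'.
have nO1 : \forall b \near a, B (f b) := cont_near fc nO.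
have [a1 nx1 e1] := freq _ (nbhs_interior (filterI (filterI nZ nZ') ng')).
have sg : forall y, csim (sig y *m g) (sig y).
apply: (rig a1 g ug); apply: filterS (filterI nx1 e1) => y [[[h1 h2] h3] h4].
have h5 := csim_mulmx ug.2 h1; rewrite h4 in h5.
exact: csim_trans (csim_sym h5) (csim_trans (csim_sym h3) h2).
apply: filterS (filterI (filterI (filterI nZ nZ') ng') (filterI nO1 nO')) => y [[[h1 h2] h3] [h4 h5]].
apply: injO => //; apply: csim_trans h1 _; apply: csim_sym.
apply: (csim_unitary ug); apply: csim_trans (csim_sym h3) _.
exact: csim_trans h2 (csim_sym (sg y)).
Qed.

Lemma lifts_path f f' (c : R -> X) : rigid ->
 (forall s, 0 <= s <= 1 -> {for s, continuous c}) ->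
 (forall s, 0 <= s <= 1 -> lifts f (c s) /\ lifts f' (c s)) ->
 (\forall a \near c 0, f a = f' a) ->
 forall s, 0 <= s <= 1 -> \forall a \near c s, f a = f' a.
move=> rig cc fl n0; apply: segment_induction => // [s s01 ns|s /andP[s0 s1] H].
exact: (cc s s01 _ (nbhs_interior ns)).
have s01 : 0 <= s <= 1 by rewrite ltW.
have [l1 l2] := fl s s01; apply: (lifts_agree rig l1 l2) => A nA.
have [d d0 Hd] := near_ball (cc s s01 _ nA).
pose t := Num.max 0 (s - d / 2).
have ts : t < s by rewrite gt_max s0 ltrBlDr ltrDl divr_gt0.
have t0 : 0 <= t by rewrite le_max lexx.
exists (c t); last by apply: H; rewrite t0.
apply: Hd; rewrite ger0_norm ?subr_ge0 ?(ltW ts)// ltrBlDr.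
have : s - d / 2 <= t by rewrite le_max lexx orbT.
rewrite lerBlDr => h; apply: (le_lt_trans h); rewrite addrC ltrD2r.
by rewrite ltr_pdivrMr// ltr_pMr// ltr1n.
Qed.
End Uniqueness.

Section AffineRigidity.
Variables (e : 'rV[R]_N) (L : 'M[R]_(n, N)).
Hypotheses (F : aframe e L).

Lemma mulL_eq0 (u : 'rV[R]_n) : u *m L = 0 -> u = 0.
move=> h; have : u *m L *m eta *m L^T = 0 by rewrite h !mul0mx.
rewrite -!mulmxA (mulmxA L) (af_LL F) mul_mx_scalar => /eqP.
rewrite scaler_eq0 => /orP[/eqP e0|/eqP //].
by move: eps2; rewrite e0 expr0n => /eqP; rewrite eq_sym oner_eq0.
Qed.

(** Along the line the factor of proportionality is affine in [s], since it can be read off the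
    hermitian product with [e]. Comparing the powers of [s] shows it to be constant. *)
Lemma line_rigid w u g : g *m JJ = JJ *m g -> u != 0 ->
 (\forall s \near (0 : R), csim (lift e L (w + s *: u) *m g) (lift e L (w + s *: u))) ->
 let a := re eta e (lift e L w *m g) in let b := im eta e (lift e L w *m g) in
 [/\ a ^+ 2 + b ^+ 2 != 0, lift e L w *m g = cmul a b (lift e L w)
 & u *m L *m g = cmul a b (u *m L)].
move=> gJ u0 nh; have [d d0 Hd] := near_ball nh.
pose y := lift e L w; pose v := u *m L.
have yE s : lift e L (w + s *: u) = y + s *: v.
by rewrite /y /lift mulmxDl -scalemxAl addrA.
have K s : `|s| < d -> exists A B, [/\ A ^+ 2 + B ^+ 2 != 0,
 A = re eta e (y *m g) + s * re eta e (v *m g), B = im eta e (y *m g) + s * im eta e (v *m g)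
 & y *m g + s *: (v *m g) = cmul A B (y + s *: v)].
move=> sd; have := Hd s; rewrite sub0r normrN => /(_ sd)[[A B]/= [AB E]].
exists A, B; move: (E); rewrite yE mulmxDl -scalemxAl => E'.
have rE := re_lift etaT F (w + s *: u); have iE := im_lift etaT etaJ F (w + s *: u).
split=> //.
 - have := congr1 (re eta e) E; rewrite re_cmul// rE iE mulr1 mulr0 subr0 => <-.
by rewrite yE mulmxDl -scalemxAl /re gipDl gipZl.
 - have := congr1 (im eta e) E; rewrite im_cmul// rE iE mulr1 mulr0 add0r => <-.
by rewrite yE mulmxDl -scalemxAl /im gipDl gipZl.
have d2 : 0 < d / 2 by rewrite divr_gt0.
have dd : d / 2 < d by rewrite ltr_pdivrMr// ltr_pMr// ltr1n.
set a := re eta e (y *m g); set b := im eta e (y *m g) => /=.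
pose a1 := re eta e (v *m g); pose b1 := im eta e (v *m g).
have K0 : `|0 : R| < d by rewrite normr0.
have [A [B [AB0 A0 B0 E0]]] := K 0 K0.
move: A0 B0 AB0 E0; rewrite !mul0r !addr0 scale0r scale0r !addr0 => -> -> AB0 E0.
split=> //.
have K1 : `|d / 2| < d by rewrite gtr0_norm.
have [A' [B' [_ A1 B1 E1]]] := K _ K1.
have K2 : `|- (d / 2)| < d by rewrite normrN gtr0_norm.
have [A'' [B'' [_ A2 B2 E2]]] := K _ K2.
set t := d / 2 in d2 A1 B1 E1 A2 B2 E2.
(* The coefficient of t^2, isolated by adding the relations at t and -t and subtracting twice the
   one at 0. *)
have q1 : cmul a1 b1 v = 0.
have : (2 * t ^+ 2) *: cmul a1 b1 v = 0.
have H1 : cmul (a + t * a1) (b + t * b1) (y + t *: v) = y *m g + t *: (v *m g) by rewrite E1 A1 B1.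
have H2 : cmul (a + - t * a1) (b + - t * b1) (y + - t *: v) = y *m g + - t *: (v *m g) by rewrite E2 A2 B2.
have -> : (2 * t ^+ 2) *: (a1 *: v + b1 *: (v *m JJ)) =
 (cmul (a + t * a1) (b + t * b1) (y + t *: v) - (a *: y + b *: (y *m JJ) + t *: (v *m g))) +
 (cmul (a + - t * a1) (b + - t * b1) (y + - t *: v) - (a *: y + b *: (y *m JJ) + - t *: (v *m g))).
by rewrite /cmul !mulmxDl -!scalemxAl; mxlin.
by rewrite -/(cmul a b y) -E0 H1 H2 !subrr addr0.
by move=> /eqP; rewrite scaler_eq0 mulf_eq0 pnatr_eq0/= sqrf_eq0 (gt_eqF d2) => /eqP.
have [a10 b10] : a1 = 0 /\ b1 = 0.
have : cmul a1 (- b1) (cmul a1 b1 v) = 0 by rewrite q1 /cmul mul0mx !scaler0 addr0.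
rewrite cmulA (_ : a1 * b1 + - b1 * a1 = 0); last by ring.
rewrite cmulZ => /eqP; rewrite scaler_eq0 => /orP[|/eqP /mulL_eq0 ue]; last by rewrite ue eqxx in u0.
rewrite mulNr opprK -!expr2 paddr_eq0 ?sqr_ge0// !sqrf_eq0 => /andP[/eqP ? /eqP ?].
by [].
move: E1; rewrite A1 B1 -/a1 -/b1 a10 b10 !mulr0 !addr0 cmulD -E0 => /addrI.
have -> : cmul (re eta e (y *m g)) (im eta e (y *m g)) (t *: v) = t *: cmul a b v.
by rewrite /cmul -scalemxAl -/a -/b; mxlin.
move=> E1.
by apply: (scalerI (_ : t != 0)) => //; rewrite gt_eqF.
Qed.

(** All lines through [w1] give the same factor, the one of [w1]; [e] and the rows of [L] therefore
    have it too, and they span the space over the complex numbers. *)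
Lemma rigid_scalar w1 g : g *m JJ = JJ *m g ->
 (\forall w \near w1, csim (lift e L w *m g) (lift e L w)) ->
 (0 < m)%N -> exists2 ab, ab.1 ^+ 2 + ab.2 ^+ 2 != 0 & forall z : 'rV[R]_N, z *m g = cmul ab.1 ab.2 z.
move=> gJ nh m0; pose a := re eta e (lift e L w1 *m g); pose b := im eta e (lift e L w1 *m g).
have nu u : \forall s \near (0 : R), csim (lift e L (w1 + s *: u) *m g) (lift e L (w1 + s *: u)).
have cl : {for (0 : R), continuous (fun s : R => w1 + s *: u)} by exact: cont_line.
apply: (cl (fun w => csim (lift e L w *m g) (lift e L w))); rewrite scale0r addr0.
exact: nh.
have i0 : 'I_n by exists 0%N; rewrite addn_gt0 m0.
have u1 : (delta_mx 0 i0 : 'rV[R]_n) != 0.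
by apply/eqP => /rowP/(_ i0); rewrite !mxE !eqxx => /eqP; rewrite oner_eq0.
have [ab0 yg _] := line_rigid gJ u1 (nu _).
exists (a, b) => //= z.
have vg (u : 'rV[R]_n) : u *m L *m g = cmul a b (u *m L).
have [->|u0] := eqVneq u 0; first by rewrite !mul0mx /cmul mul0mx !scaler0 addr0.
by have [_ _] := line_rigid gJ u0 (nu u).
have eg : e *m g = cmul a b e.
have -> : e = lift e L w1 - w1 *m L by rewrite /lift addrK.
rewrite mulmxBl yg vg /cmul !mulmxBl -/a -/b; mxlin.
rewrite (af_decomp eps2 etaT etaJ F z) mulmxDl cmul_mulmx// eg scalemxAl -!scalemxAl vg.
rewrite cmulD !cmulA; congr (cmul _ _ _ + _); [by ring|by ring|].
by rewrite /cmul -!scalemxAl; mxlin.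
Qed.
End AffineRigidity.
End Lifts.

Lemma near_dist (R : realType) (V : normedModType R) (t0 t : V) (d : R) : `|t - t0| < d -> \forall s \near t, `|s - t0| < d.
rewrite -subr_gt0 => /(near_norm t); apply: filterS => s h.
by rewrite -(subrK t s) -addrA (le_lt_trans (ler_normD _ _))// -ltrBrDr distrC.
Qed.

(** * Developed geodesics *)

Section CurveDerivatives.
Variables (R : realType).
Implicit Types (t : R).

Definition sder (f : R -> R) t (f' : R) := derivable f t 1 /\ 'D_1 f t = f'.

Definition hasder p q (F : R -> 'M[R]_(p, q)) t (F' : 'M[R]_(p, q)) := derivable F t 1 /\ 'D_1 F t = F'.

Lemma sder_is (f : R -> R) t f' : sder f t f' <-> is_derive t 1 f f'.
by split=> -[h1 h2]; [apply: DeriveDef|split]. Qed.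
Lemma hasderP p q (F : R -> 'M[R]_(p, q)) t F' :
 hasder F t F' <-> forall i j, sder (fun s => F s i j) t (F' i j).
split=> [[dF <-] i j|H]; first by split; [exact: (derivable_mxP _ _ _).1|exact: derivable_comp1].
have dF : derivable F t 1 by apply/derivable_mxP => i j; have [] := H i j.
by split=> //; apply/matrixP => i j; rewrite -derivable_comp1//; have [] := H i j.
Qed.

Lemma hd_cst p q (A : 'M[R]_(p, q)) t : hasder (fun=> A) t 0.
by split; [exact: derivable_cst|exact: derive_cst]. Qed.
Lemma hdD p q (F G : R -> 'M[R]_(p, q)) t F' G' : hasder F t F' -> hasder G t G' ->
 hasder (fun s => F s + G s) t (F' + G').
move=> [dF <-] [dG <-]; split; first exact: (derivableD dF dG).
exact: (deriveD dF dG).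
Qed.

Lemma hdM p q r (F : R -> 'M[R]_(p, q)) (G : R -> 'M[R]_(q, r)) t F' G' :
 hasder F t F' -> hasder G t G' -> hasder (fun s => F s *m G s) t (F' *m G t + F t *m G').
by move=> [dF <-] [dG <-]; exact: derivable_mulmx. Qed.
Lemma hdMr p q r (F : R -> 'M[R]_(p, q)) (A : 'M[R]_(q, r)) t F' :
 hasder F t F' -> hasder (fun s => F s *m A) t (F' *m A).
by move=> /hdM/(_ (hd_cst A t)); rewrite mulmx0 addr0. Qed.
Lemma hdZ p q (f : R -> R) (F : R -> 'M[R]_(p, q)) t f' F' :
 sder f t f' -> hasder F t F' -> hasder (fun s => f s *: F s) t (f' *: F t + f t *: F').
by move=> [df <-] [dF <-]; exact: derivable_scalemx. Qed.
Lemma hdT p q (F : R -> 'M[R]_(p, q)) t F' : hasder F t F' -> hasder (fun s => (F s)^T) t F'^T.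
by move=> [dF <-]; exact: derivable_trmx. Qed.
Lemma hd_near p q (F G : R -> 'M[R]_(p, q)) t F' :
 (\forall s \near t, F s = G s) -> hasder F t F' -> hasder G t F'.
move=> FG [dF <-]; split; first exact: (near_eq_derivable FG).
by apply: esym; exact: near_eq_derive.
Qed.

Lemma hd_unique p q (F : R -> 'M[R]_(p, q)) t F' F'' :
 hasder F t F' -> hasder F t F'' -> F' = F''.
by move=> [_ <-] [_ <-]. Qed.
Lemma hd_comp n p q U (F : 'rV[R]_n -> 'M[R]_(p, q)) (x : R -> 'rV[R]_n) t v :
 open U -> mxCk 1 U F -> U (x t) -> hasder x t v ->
 hasder (fun s => F (x s)) t (\sum_k v 0 k *: dmx F k (x t)).
move=> oU F1 Ux /hasderP dx; apply/hasderP => i j.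
have dxk k : derivable (fun s => x s 0 k) t 1 by have [] := dx 0 k.
have [h1 h2] := chain_rule1 dxk oU (F1 i j) Ux.
split; first exact: h1.
rewrite [LHS]h2 summxE; apply: eq_bigr => k _.
by rewrite mxE (dmxE k i j oU F1 Ux); have [_ ->] := dx 0 k.
Qed.

Lemma hd_const p q (F : R -> 'M[R]_(p, q)) t0 d : (forall t, `|t - t0| < d -> hasder F t 0) ->
 forall s t, `|s - t0| < d -> `|t - t0| < d -> F s = F t.
move=> H s t sd td; wlog st : s t sd td / s <= t.
by move=> W; have [|/ltW] := leP s t => h; [exact: W|apply/esym; exact: W].
have I u : s <= u <= t -> `|u - t0| < d.
move=> /andP[su ut]; move: sd td; rewrite !ltr_distl => /andP[s1 _] /andP[_ t1].
by rewrite (lt_le_trans s1 su) (le_lt_trans ut t1).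
apply/matrixP => i j; apply/esym/eqP; rewrite -subr_eq0; apply/eqP.
have K u : s <= u <= t -> is_derive u 1 (fun s => F s i j) 0.
by move=> /I/H/hasderP/(_ i j)/sder_is; rewrite mxE.
have [||u _ ->] := @MVT_segment R (fun s => F s i j) (fun=> 0) s t st; last by rewrite mul0r.
by move=> u; rewrite in_itv/= => /andP[su ut]; apply: K; rewrite !ltW.
apply: derivable_within_continuous => u; rewrite in_itv/= => su.
by have [] := K u su.
Qed.
End CurveDerivatives.

Section ModelGeodesics.
Variables (R : realType) (m : nat) (eps : R).
Notation n := (m + m)%N.
Notation N := (m.+1 + m.+1)%N.
Notation JJ := (J0 R m.+1).
Variables (eta : 'M[R]_N).
Hypotheses (eps2 : eps ^+ 2 = 1) (etaT : eta^T = eta) (etaJ : JJ *m eta = eta *m JJ).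
Implicit Types (u v y z e : 'rV[R]_N) (t : R).
Notation S := (gip eta).
Let JJ2 : JJ *m JJ = - 1%:M. exact: J0_sq. Qed.
Let SC := gipC etaT.
Let SJJ := gipJJ (etaJJ etaJ).
Let SJ := gipJ JJ2 (etaJJ etaJ).
Let SDr := gipDr etaT.
Let SZr := gipZr etaT.

Lemma sd_gip (f g : R -> 'rV[R]_N) t f' g' : hasder f t f' -> hasder g t g' ->
 sder (fun s => S (f s) (g s)) t (S f' (g t) + S (f t) g').
move=> df dg; have /hasderP/(_ 0 0) := hdM (hdMr eta df) (hdT dg).
by rewrite mxE.
Qed.

Lemma hd_cmul (a b : R -> R) (z : R -> 'rV[R]_N) t a' b' z' :
 sder a t a' -> sder b t b' -> hasder z t z' ->
 hasder (fun s => cmul (a s) (b s) (z s)) t (cmul a' b' (z t) + cmul (a t) (b t) z').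
move=> da db dz; have := hdD (hdZ da dz) (hdZ db (hdMr JJ dz)).
by rewrite /cmul addrACA.
Qed.

Lemma gip0r u : S u 0 = 0.
by rewrite SC /gip !mul0mx mxE. Qed.
Lemma cmul_conj a b z : a ^+ 2 + b ^+ 2 = 1 -> cmul a (- b) (cmul a b z) = z.
move=> ab; rewrite cmulA (_ : a * a - - b * b = 1); last by rewrite -ab; ring.
by rewrite (_ : a * b + - b * a = 0) ?cmul10//; ring.
Qed.

Lemma cmul_scale a b k z : cmul a b (k *: z) = k *: cmul a b z.
by rewrite /cmul -scalemxAl; mxlin. Qed.
Lemma gip_cmul_self a b y : S y y = 1 -> S (cmul a b y) y = a /\ S (cmul a b y) (y *m JJ) = b.
move=> y1; have h : S (y *m JJ) y = 0 by exact: gip_self_J.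
rewrite /cmul !gipDl !gipZl h SJJ (SC y) h y1 !mulr0 !mulr1 addr0 add0r.
by [].
Qed.

(* [z] is the first row of a developing frame along a curve, [T] the image of
 the velocity. *)
Lemma geodesic_match (z T l l' : R -> 'rV[R]_N) (th : R) t1 :
 hasder z t1 (th *: (z t1 *m JJ) + T t1) -> hasder l t1 (l' t1) ->
 (forall t, S (l t) (l t) = 1) -> (forall t, S (l' t) (l t) = 0 /\ S (l' t) (l t *m JJ) = 0) ->
 S (z t1) (z t1) = 1 -> S (T t1) (z t1) = 0 -> S (T t1) (z t1 *m JJ) = 0 ->
 (\forall t \near t1, csim (z t) (l t)) ->
exists a b, [/\ a ^+ 2 + b ^+ 2 = 1, z t1 = cmul a b (l t1) & T t1 = cmul a b (l' t1)].
move=> dz dl ll ll' zz Tz TzJ nl.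
pose a t := S (z t) (l t); pose b t := S (z t) (l t *m JJ).
have zE t : csim (z t) (l t) -> z t = cmul (a t) (b t) (l t).
by move=> [[p q]/= [_ E]]; have [h1 h2] := gip_cmul_self p q (ll t); rewrite /a /b E h1 h2.
have z1 := zE _ (nbhs_singleton nl).
have ab : a t1 ^+ 2 + b t1 ^+ 2 = 1 by have := gip_cmul etaT etaJ (a t1) (b t1) (l t1) (l t1); rewrite -z1 zz ll mulr1.
have da := sd_gip dz dl; have db := sd_gip dz (hdMr JJ dl).
have nz : \forall t \near t1, cmul (a t) (b t) (l t) = z t by apply: filterS nl => t /zE.
have := hd_unique dz (hd_near nz (hd_cmul da db dl)).
set a' := (X in cmul X _ (l t1)); set b' := (X in cmul _ X (l t1)) => E.
(* Differentiating z = (a + i b) l leaves a difference in the complex line of [l t1]. Both [T] and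
   the derivative of [l] are orthogonal to that line, so the difference is 0. *)
have E' : T t1 - cmul (a t1) (b t1) (l' t1) = cmul (a' + th * b t1) (b' - th * a t1) (l t1).
have -> : T t1 = cmul a' b' (l t1) + cmul (a t1) (b t1) (l' t1) - th *: (z t1 *m JJ).
by rewrite -E addrC addKr.
by rewrite {1}z1 /cmul mulmxDl -!scalemxAl -mulmxA JJ2 mulmxN mulmx1; mxlin.
have orth u : S u (z t1) = 0 -> S u (z t1 *m JJ) = 0 -> S u (l t1) = 0 /\ S u (l t1 *m JJ) = 0.
move=> h1 h2; have -> : l t1 = cmul (a t1) (- b t1) (z t1).
by rewrite [in RHS]z1 cmul_conj.
have h3 : S u (z t1 *m JJ *m JJ) = 0.
by rewrite -mulmxA JJ2 mulmxN mulmx1 -[- z t1]scaleN1r SZr h1 mulr0.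
by rewrite cmulJ /cmul !SDr !SZr h1 h2 h3 !mulr0 addr0.
have [k1 k2] := orth _ Tz TzJ; have [p1 p2] := ll' t1.
have q1 : S (cmul (a t1) (b t1) (l' t1)) (l t1) = 0.
by rewrite /cmul gipDl !gipZl SJ p1 p2 oppr0 !mulr0 addr0.
have q2 : S (cmul (a t1) (b t1) (l' t1)) (l t1 *m JJ) = 0.
by rewrite /cmul gipDl !gipZl SJJ p1 p2 !mulr0 addr0.
have [r1 r2] := gip_cmul_self (a' + th * b t1) (b' - th * a t1) (ll t1).
exists (a t1), (b t1); split=> //; apply/eqP; rewrite -subr_eq0 E'.
have sub0 w v : S v w = 0 -> S (T t1) w = 0 -> S (T t1 - v) w = 0.
by move=> h1 h2; rewrite gipDl -[- v]scaleN1r gipZl h1 h2 mulr0 addr0.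
rewrite -E' sub0// in r1; rewrite -E' sub0// in r2.
by rewrite -r1 -r2 /cmul !scale0r addr0.
Qed.

(** Cosine and sine for eps = 1, their hyperbolic analogues for eps = -1. *)
Record modeltrig (C Sn : R -> R) : Prop := Modeltrig {
 mt_dC : forall t, sder C t (- eps * Sn t);
 mt_dS : forall t, sder Sn t (C t);
 mt_C0 : C 0 = 1;
 mt_S0 : Sn 0 = 0;
 mt_CS : forall t, C t ^+ 2 + eps * Sn t ^+ 2 = 1;
 mt_CD : forall s t, C (s + t) = C s * C t - eps * (Sn s * Sn t);
 mt_SD : forall s t, Sn (s + t) = Sn s * C t + C s * Sn t
}.
Variables (C Sn : R -> R).
Hypotheses (tr : modeltrig C Sn).
Let dC := mt_dC tr. Let dS := mt_dS tr. Let C0 := mt_C0 tr. Let S0 := mt_S0 tr.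
Let CS := mt_CS tr.

Lemma sder_shift f t t1 f' : sder f (t - t1) f' -> sder (fun s : R => f (s - t1)) t f'.
move=> /sder_is h; apply/sder_is.
have hs : is_derive t 1 (fun s : R => s - t1) 1.
by apply: is_derive_eq; rewrite ?subr0.
have := @is_derive1_comp R f (fun s : R => s - t1) t _ _ h hs.
by rewrite mulr1.
Qed.

Section ODE.
Variables (t0 d : R) (z T : R -> 'rV[R]_N) (th : R -> R).
Hypotheses (dz : forall t, `|t - t0| < d -> hasder z t (th t *: (z t *m JJ) + T t))
 (dT : forall t, `|t - t0| < d -> hasder T t (th t *: (T t *m JJ) - eps *: z t))
 (zz : forall t, `|t - t0| < d -> S (z t) (z t) = 1).

(** [Y1] and [Y2] undo the rotation of the model in the plane of z and T. Both then satisfy dY = th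
    i Y, so they move by one common phase, which the products [al] and [be] with the initial vector
    compute. *)
Lemma geodesic_model t1 : `|t1 - t0| < d -> forall t, `|t - t0| < d ->
 csim (z t) (C (t - t1) *: z t1 + Sn (t - t1) *: T t1).
move=> t1d t td.
have dC1 s := sder_shift (dC (s - t1)); have dS1 s := sder_shift (dS (s - t1)).
pose c s := C (s - t1); pose n s := Sn (s - t1).
have dnN s : sder (fun s => - n s) s (- c s).
by have /sder_is h := dS1 s; apply/sder_is; exact: is_deriveN.
have den s : sder (fun s => eps * n s) s (eps * c s).
by have /sder_is h := dS1 s; apply/sder_is; exact: is_deriveZ.
pose Y1 s := c s *: z s + (- n s) *: T s.
pose Y2 s := (eps * n s) *: z s + c s *: T s.
have dY1 s : `|s - t0| < d -> hasder Y1 s (th s *: (Y1 s *m JJ)).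
move=> sd; have := hdD (hdZ (dC1 s) (dz sd)) (hdZ (dnN s) (dT sd)).
by congr hasder; rewrite /Y1 /n /c mulmxDl -!scalemxAl; mxlin.
have dY2 s : `|s - t0| < d -> hasder Y2 s (th s *: (Y2 s *m JJ)).
move=> sd; have := hdD (hdZ (den s) (dz sd)) (hdZ (dC1 s) (dT sd)).
by congr hasder; rewrite /Y2 /n /c mulmxDl -!scalemxAl; mxlin.
have c1 : c t1 = 1 by rewrite /c subrr.
have n1 : n t1 = 0 by rewrite /n subrr.
have Y1E : Y1 t1 = z t1 by rewrite /Y1 c1 n1 oppr0 scale0r scale1r addr0.
have Y2E : Y2 t1 = T t1 by rewrite /Y2 c1 n1 mulr0 scale0r scale1r add0r.
pose al s := S (Y1 s) (z t1); pose be s := S (Y1 s) (z t1 *m JJ).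
have J0z : S (z t1) (z t1 *m JJ) = 0 by rewrite SC; exact: gip_self_J.
have dal s : `|s - t0| < d -> sder al s (- (th s * be s)).
move=> sd; have := sd_gip (dY1 s sd) (hd_cst (z t1) s).
by rewrite gipZl SJ gip0r addr0 mulrN.
have dbe s : `|s - t0| < d -> sder be s (th s * al s).
move=> sd; have := sd_gip (dY1 s sd) (hd_cst (z t1 *m JJ) s).
by rewrite gipZl SJJ gip0r addr0.
have dNbe s : `|s - t0| < d -> sder (fun s => - be s) s (- (th s * al s)).
by move=> sd; have /sder_is h := dbe s sd; apply/sder_is; exact: is_deriveN.
have al1 : al t1 = 1 by rewrite /al Y1E zz.
have be1 : be t1 = 0 by rewrite /be Y1E.
have W (Y : R -> 'rV[R]_N) : (forall s, `|s - t0| < d -> hasder Y s (th s *: (Y s *m JJ))) ->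
 cmul (al t) (- be t) (Y t) = Y t1.
move=> dY; rewrite -[RHS]cmul10 -al1 -[0]oppr0 -be1.
apply: (hd_const (F := fun s => cmul (al s) (- be s) (Y s)) (d := d) (t0 := t0)) => // s sd.
have := hd_cmul (dal s sd) (dNbe s sd) (dY s sd).
by congr hasder; rewrite /cmul -scalemxAl -mulmxA JJ2 mulmxN mulmx1; mxlin.
have ab : al t ^+ 2 + be t ^+ 2 = 1.
have : S (cmul (al t) (- be t) (Y1 t)) (z t1) = 1 by rewrite (W _ dY1) Y1E zz.
by rewrite /cmul gipDl !gipZl SJ mulrNN !expr2.
have V Y : (forall s, `|s - t0| < d -> hasder Y s (th s *: (Y s *m JJ))) ->
 Y t = cmul (al t) (be t) (Y t1).
move=> /W <-; have := @cmul_conj (al t) (- be t) (Y t).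
by rewrite opprK sqrrN => ->.
exists (al t, be t) => /=; split; first by rewrite ab oner_neq0.
have -> : z t = c t *: Y1 t + n t *: Y2 t.
have -> : c t *: Y1 t + n t *: Y2 t = (c t ^+ 2 + eps * n t ^+ 2) *: z t.
by rewrite /Y1 /Y2; mxlin.
by rewrite CS scale1r.
by rewrite (V _ dY1) (V _ dY2) Y1E Y2E cmulD -[C (t - t1)]/(c t) -[Sn (t - t1)]/(n t) /cmul -!scalemxAl; mxlin.
Qed.
End ODE.

Section ModelLine.
Variables (e u : 'rV[R]_N).
Hypotheses (ee : S e e = 1) (ue : S u e = 0) (ueJ : S u (e *m JJ) = 0) (uu : S u u = eps).

Definition mline t := C t *: e + Sn t *: u.
Definition mline' t := (- eps * Sn t) *: e + C t *: u.

Lemma mline_der t : hasder mline t (mline' t).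
have := hdD (hdZ (dC t) (hd_cst e t)) (hdZ (dS t) (hd_cst u t)).
by rewrite !scaler0 !addr0.
Qed.

Lemma mline_gip t : [/\ S (mline t) (mline t) = 1, S (mline' t) (mline t) = 0,
 S (mline' t) (mline t *m JJ) = 0 & S (mline' t) (mline' t) = eps].
have eu : S e u = 0 by rewrite SC.
have euJ : S e (u *m JJ) = 0 by rewrite SC SJ ueJ oppr0.
have eeJ : S e (e *m JJ) = 0 by rewrite SC; exact: gip_self_J.
have uuJ : S u (u *m JJ) = 0 by rewrite SC; exact: gip_self_J.
have cs := CS t; rewrite /mline /mline' !mulmxDl -!scalemxAl.
split; rewrite !gipDl !gipZl !SDr !SZr ?ee ?uu ?eu ?ue ?eeJ ?euJ ?ueJ ?uuJ.
- rewrite -[RHS]cs; ring.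
- ring.
- ring.
- have -> : - eps * Sn t * (- eps * Sn t * 1 + C t * 0) +
 C t * (- eps * Sn t * 0 + C t * eps) = eps ^+ 2 * Sn t ^+ 2 + eps * C t ^+ 2 by ring.
by rewrite -[RHS]mulr1 -cs; ring.
Qed.

Lemma mline_add s t : C t *: mline s + Sn t *: mline' s = mline (s + t).
by rewrite /mline /mline' (mt_CD tr) (mt_SD tr); mxlin. Qed.
End ModelLine.
End ModelGeodesics.

Section DevelopedGeodesics.
Variables (R : realType) (m : nat) (eps : R) (M : riemData R (m + m)).
Notation n := (m + m)%N.
Notation N := (m.+1 + m.+1)%N.
Notation JJ := (J0 R m.+1).
Hypotheses (RM : riemannian M).
Variables (J : chart M -> 'rV[R]_n -> 'M[R]_n).
Hypotheses (KJ : kahler J) (eps2 : eps ^+ 2 = 1)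
 (curvM : hol_curv eps M J).
Variables (eta : 'M[R]_N).
Hypotheses (etaT : eta^T = eta) (etaJ : JJ *m eta = eta *m JJ).
Implicit Types (c : chart M) (p q : M) (Z : M -> 'rV[R]_N).
Notation S := (gip eta).
Notation isdev := (isdev eps J eta).
Notation devframe := (devframe eps J eta).
Notation aframe := (aframe eps eta).

Definition velocity (g : R -> M) c t : 'rV[R]_n := \row_k derive1 (curve_coord c g k) t.

Lemma geodesic_hasder (g : R -> M) c t : geodesic g -> cdom c (g t) ->
 hasder (fun s => coord c (g s)) t (velocity g c t) /\
 hasder (velocity g c) t
 (- \sum_i velocity g c t 0 i *: (velocity g c t *m conn c i (coord c (g t)))).
move=> [_ G] ct; split; apply/hasderP => i k; rewrite ord1.
have [d1 _ _] := G c t ct k; rewrite mxE; split; first exact: d1.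
by rewrite derive1E.
have [_ d2 E] := G c t ct k.
have -> : (fun s => velocity g c s 0 k) = derive1 (curve_coord c g k).
by apply/funext => s; rewrite mxE.
split; first exact: d2.
rewrite -derive1E; move/eqP: E; rewrite addr_eq0 => /eqP ->; rewrite mxE summxE; congr (- _).
apply: eq_bigr => a _; rewrite !mxE mulr_sumr; apply: eq_bigr => b _.
by rewrite connE !mxE mulrCA mulrA mulrC mulrA mulrAC.
Qed.

Lemma skewJ c x (v : 'rV[R]_n) : cimg c x -> v *m metric c x *m (v *m J c x)^T = 0.
move=> cx; have JgJ := kahler_hermitian KJ cx; have JJ1 := kahler_square KJ cx.
have gT := riem_metric_sym RM cx.
have E : metric c x *m (J c x)^T = - (J c x *m metric c x).
by rewrite -{1}JgJ -mulmxA -trmx_mul JJ1 linearN/= trmx1 mulmxN mulmx1.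
set A := (LHS); have AT : A^T = - A.
rewrite /A !trmx_mul !trmxK gT -!mulmxA (mulmxA (metric c x)) E.
by rewrite mulNmx mulmxN opprK !mulmxA.
apply/matrixP => i j; rewrite !ord1 mxE; apply/eqP.
have /matrixP/(_ 0 0) := AT; rewrite !mxE => /eqP.
by rewrite -addr_eq0 -mulr2n mulrn_eq0.
Qed.

Lemma devconn_velocity c th (x v : 'rV[R]_n) :
 let om := \sum_k v 0 k * th k x in let vJ := v *m J c x in
 \sum_k v 0 k *: devconn eps J c th k x =
 block_mx (om *: J0 R 1) (col_mx v vJ)
 (- eps *: (metric c x *m row_mx v^T vJ^T)) (\sum_k v 0 k *: conn c k x + om *: J c x).
move=> om vJ.
have hE : \sum_k v 0 k *: holrows J c k x = col_mx v vJ.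
rewrite /vJ [in RHS](row_sum_delta v) mulmx_suml.
under eq_bigr => k _ do rewrite /holrows scale_col_mx scalemxAl.
by elim/big_rec3: _ => [|k a b c' _ ->]; rewrite ?col_mx0// add_col_mx.
under eq_bigr => k _ do rewrite /devconn scale_block_mx.
rewrite sum_block; apply: eq_block.
- by rewrite /om scaler_suml; apply: eq_bigr => k _; rewrite scalerA.
- exact: hE.
- rewrite -tr_col_mx -hE raddf_sum/= mulmx_sumr scaler_sumr; apply: eq_bigr => k _.
by rewrite [(_ *: _)^T]linearZ/= -scalemxAr !scalerA mulrC.
- by under eq_bigr => k _ do rewrite scalerDr scalerA; rewrite big_split/= -scaler_suml.
Qed.

(** Along a geodesic the Christoffel terms of the frame cancel those of the velocity, which leaves a
    linear system for z and its tangent T with the constant coefficient S(T, T), [eps] times the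
    square of the speed. *)
Lemma geodesic_dev (g : R -> M) c U th P t0 : geodesic g -> devframe c U th P ->
 cdom c (g t0) -> U (coord c (g t0)) ->
 let z t := zrow P (coord c (g t)) in
 let T t := velocity g c t *m trows P (coord c (g t)) in
exists d om, 0 < d /\ forall t, `|t - t0| < d ->
 [/\ cdom c (g t) /\ U (coord c (g t)), hasder z t (om t *: (z t *m JJ) + T t),
 hasder T t (om t *: (T t *m JJ) - S (T t0) (T t0) *: z t),
 S (z t) (z t) = 1 & [/\ S (T t) (z t) = 0, S (T t) (z t *m JJ) = 0 & S (T t) (T t) = S (T t0) (T t0)]].
move=> G D ct0 Ut0 z T; have gc := G.1.
have n1 : \forall t \near t0, cdom c (g t).
by apply: (cont_near (gc t0)); apply: open_nbhs_nbhs; split=> //; exact: riem_open_dom.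
have n2 : \forall t \near t0, U (coord c (g t)).
apply: (cont_near (P := fun q => U (coord c q)) (gc t0)).
apply: (near_coord RM ct0); apply: open_nbhs_nbhs; split=> //; exact: df_open D.
have [d d0 Hd] := near_ball (filterI n1 n2).
pose v := velocity g c; pose x t := coord c (g t).
pose om t := \sum_i v t 0 i * th i (x t).
have H t : `|t - t0| < d -> cdom c (g t) /\ U (x t) by rewrite distrC => /Hd[].
have gram t : `|t - t0| < d -> [/\ S (z t) (z t) = 1, S (T t) (z t) = 0, S (T t) (z t *m JJ) = 0
 & v t *m metric c (x t) *m (v t)^T = (eps * S (T t) (T t))%:M].
move=> td; have [ct Ut] := H t td; have [g1 g2 g3 g4] := devframe_gram D Ut.
split.
 - by rewrite /gip g1 mxE eqxx.
 - by rewrite gipC// /gip /T trmx_mul mulmxA g2 mul0mx mxE.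
 - by rewrite gipC// /gip /T trmx_mul mulmxA g3 mul0mx mxE.
 - have E : T t *m eta *m (T t)^T = eps *: (v t *m metric c (x t) *m (v t)^T).
rewrite /T trmx_mul -/v -/(x t).
rewrite (_ : _ *m _ = v t *m (trows P (x t) *m eta *m (trows P (x t))^T) *m (v t)^T); last by rewrite !mulmxA.
by rewrite g4 -scalemxAr -scalemxAl.
apply/matrixP => i j; rewrite !ord1 [RHS]mxE eqxx mulr1n /gip E [in RHS]mxE.
by rewrite mulrA -expr2 eps2 mul1r.
have dz t : `|t - t0| < d -> hasder z t (om t *: (z t *m JJ) + T t) /\
 hasder T t (om t *: (T t *m JJ) - S (T t) (T t) *: z t).
move=> td; have [ct Ut] := H t td; have [_ _ _ kap] := gram t td.
have cx := cimg_coord ct; have [dx dv] := geodesic_hasder G ct.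
have dP := hd_comp (df_open D) (smooth_Ck 1 (df_smooth D)) Ut dx.
have [PE JP] := devframeE D Ut.
pose Gv := \sum_i v t 0 i *: conn c i (x t); pose gx := metric c (x t).
pose D' : 'M[R]_(1 + 1 + n, N) := col_mx
 (om t *: col_mx (z t *m JJ) (- z t) + col_mx (T t) (v t *m J c (x t) *m trows P (x t)))
 (- eps *: (gx *m (v t)^T *m z t + gx *m (v t *m J c (x t))^T *m (z t *m JJ)) +
 Gv *m trows P (x t) + om t *: (trows P (x t) *m JJ)).
have DE : \sum_k v t 0 k *: dmx P k (x t) = D'.
under eq_bigr => k _ do rewrite (df_eq D k Ut) scalemxAl.
rewrite -mulmx_suml devconn_velocity PE mul_block_col /D'; congr col_mx.
by rewrite -scalemxAl jj_col mul_col_mx.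
by rewrite -scalemxAl -mulmxA mul_row_col mulmxDl -scalemxAl JP mulmxDr !mulmxA addrA.
rewrite {}DE in dP.
have dz : hasder z t (om t *: (z t *m JJ) + T t).
move/hasderP: dP => dP; apply/hasderP => i j; rewrite ord1.
have := dP (lshift n (lshift 1 0)) j.
rewrite /D' col_mxEu mxE scale_col_mx col_mxEu [X in _ + X]col_mxEu => h.
have -> : (om t *: (z t *m JJ) + T t) 0 j = (om t *: (z t *m JJ)) 0 j + T t 0 j by rewrite mxE.
have -> : (fun s => z s 0 j) = (fun s => P (coord c (g s)) (lshift n (lshift 1 0)) j).
by apply/funext => s; rewrite /z /zrow !mxE.
exact: h.
have dtau : hasder (fun s => trows P (x s)) t (dsubmx D').
move/hasderP: dP => dP; apply/hasderP => i j.
have := dP (rshift (1 + 1) i) j; rewrite [dsubmx D' i j]mxE.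
have -> : (fun s => trows P (x s) i j) = (fun s => P (coord c (g s)) (rshift (1 + 1) i) j).
by apply/funext => s; rewrite /trows mxE.
by [].
split; first exact: dz.
have := hdM dv dtau; congr hasder; rewrite /D' col_mxKd.
have -> : S (T t) (T t) = eps * (v t *m gx *m (v t)^T) 0 0.
by rewrite kap mxE eqxx mulr1n mulrA -expr2 eps2 mul1r.
have k1 : v t *m (gx *m (v t)^T *m z t) = (v t *m gx *m (v t)^T) 0 0 *: z t.
by rewrite !mulmxA [X in X *m z t]mx11_scalar mul_scalar_mx.
have k2 : v t *m (gx *m (v t *m J c (x t))^T *m (z t *m JJ)) = 0.
by rewrite !mulmxA skewJ// !mul0mx.
have k3 : \sum_i v t 0 i *: (v t *m conn c i (x t)) = v t *m Gv.
by rewrite /Gv mulmx_sumr; apply: eq_bigr => i _; rewrite scalemxAr.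
rewrite -/v -/(x t) k3 /T -/v -/(x t) !mulmxDr -!scalemxAr mulmxDr k1 k2 !mulmxA.
rewrite mulNmx; mxlin.
exists d, om; split=> // t td; have [ct Ut] := H t td; have [g1 g2 g3 g4] := gram t td.
have [dz1 dT1] := dz t td.
have kc : S (T t) (T t) = S (T t0) (T t0).
have h0 : `|t0 - t0| < d by rewrite subrr normr0.
have K s : `|s - t0| < d -> hasder (fun s => const_mx (S (T s) (T s)) : 'M[R]_1) s 0.
move=> sd; have [_ h1 h2 _] := gram s sd; have [_ dTs] := dz s sd.
apply/hasderP => i j; rewrite !mxE.
have [e1 e2] := sd_gip eta dTs dTs.
have E : (fun s => (const_mx (S (T s) (T s)) : 'M[R]_1) i j) = (fun s => S (T s) (T s)).
by apply/funext => s'; rewrite mxE.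
rewrite E; split; first exact: e1.
rewrite e2 [X in _ + X](gipC etaT) -mulr2n -scaleN1r scalerA gipDl !gipZl.
have -> : S (T s *m JJ) (T s) = 0 by exact: gip_self_J.
by rewrite [S (z s) _](gipC etaT) h1 !mulr0 addr0 mul0rn.
have := hd_const K td h0.
by move=> /matrixP/(_ 0 0); rewrite !mxE.
by split; rewrite -?kc.
Qed.
Variables (C Sn : R -> R).
Hypotheses (tr : modeltrig eps C Sn).
Notation mline := (mline C Sn).
Notation mline' := (mline' eps C Sn).

Definition develops (g : R -> M) (l : R -> 'rV[R]_N) t :=
 exists2 Z, isdev (g t) Z & \forall s \near t, csim (Z (g s)) (l s).

Lemma isdev_frame_pt c U th P p : devframe c U th P -> cdom c p -> U (coord c p) ->
 isdev p (fun q => zrow P (coord c q)).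
by move=> D cp Up; exists c, U, th, P. Qed.
(** One developing frame around [g t0] serves the whole interval. If a development follows the model
    line near one time of it, a unitary matrix adapts the frame and [geodesic_model] spreads the
    property; the equivalence is the form that connectedness needs. *)
Lemma geodesic_develops_near (g : R -> M) e u e0 L t0 : aframe e0 L -> geodesic g ->
 S e e = 1 -> S u e = 0 -> S u (e *m JJ) = 0 -> S u u = eps ->
 \forall t \near t0, develops g (mline e u) t <-> develops g (mline e u) t0.
move=> F G ee ue ueJ uu; have gc := G.1; have lg := mline_gip etaT etaJ tr ee ue ueJ uu.
have [Z0 [[c [U [th [P [D cp Up _]]]]] _]] := isdev_exists RM KJ curvM etaT etaJ (g t0) F.
have /= [d [om [d0 H]]] := geodesic_dev G D cp Up.
set z := fun t : R => zrow P (coord c (g t)) in H.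
set T := fun t : R => velocity g c t *m trows P (coord c (g t)) in H.
have h0 : `|t0 - t0| < d by rewrite subrr normr0.
have dZ t : `|t - t0| < d -> isdev (g t) (fun q => zrow P (coord c q)).
by move=> td; have [[h1 h2] _ _ _ _] := H t td; exact: isdev_frame_pt D h1 h2.
have K t1 : `|t1 - t0| < d -> develops g (mline e u) t1 ->
 forall t, `|t - t0| < d -> develops g (mline e u) t.
move=> t1d [Z' dZ' nZ'].
have [k uk nk] := isdev_unique RM KJ eps2 (dZ t1 t1d) dZ'.
have nk' : \forall s \near t1, csim (Z' (g s)) (z s *m k) := cont_near (gc t1) nk.
have nl : \forall s \near t1, csim (z s *m k) (mline e u s).
by apply: filterS (filterI nZ' nk') => s [h1 h2]; exact: csim_trans (csim_sym h2) h1.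
have [_ dz dT zz [Tz TzJ kc]] := H t1 t1d.
have dzk : hasder (fun t => z t *m k) t1 (om t1 *: (z t1 *m k *m JJ) + T t1 *m k).
by have := hdMr k dz; rewrite mulmxDl -scalemxAl -!mulmxA uk.2.
have zzk : S (z t1 *m k) (z t1 *m k) = 1 by rewrite (unitary_gip _ _ uk).
have Tzk : S (T t1 *m k) (z t1 *m k) = 0 by rewrite (unitary_gip _ _ uk).
have TzJk : S (T t1 *m k) (z t1 *m k *m JJ) = 0.
by rewrite -mulmxA uk.2 mulmxA (unitary_gip _ _ uk).
have l1 t : S (mline e u t) (mline e u t) = 1 by have [] := lg t.
have l2 t : S (mline' e u t) (mline e u t) = 0 /\ S (mline' e u t) (mline e u t *m JJ) = 0.
by have [] := lg t.
have [a [b [ab zE TE]]] := geodesic_match etaT etaJ (T := fun t => T t *m k) dzk (mline_der tr e u t1) l1 l2 zzk Tzk TzJk nl.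
have kap : S (T t0) (T t0) = eps.
have [_ _ _ l3] := lg t1.
by rewrite -kc -(unitary_gip _ _ uk) TE (gip_cmul etaT etaJ) ab mul1r.
move=> t td; exists (fun q => zrow P (coord c q) *m k); first exact: isdev_unitary uk (dZ t td).
have nd : \forall s \near t, `|s - t0| < d.
exact: near_dist.
apply: filterS nd => s sd.
have dT' r : `|r - t0| < d -> hasder T r (om r *: (T r *m JJ) - eps *: z r).
by move=> rd; have [_ _ h _ _] := H r rd; rewrite -kap.
have dz' r : `|r - t0| < d -> hasder z r (om r *: (z r *m JJ) + T r).
by move=> rd; have [] := H r rd.
have zz' r : `|r - t0| < d -> S (z r) (z r) = 1 by move=> rd; have [] := H r rd.
have := csim_mulmx uk.2 (geodesic_model etaT etaJ tr dz' dT' zz' t1d sd).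
move=> h; apply: csim_trans h _.
rewrite mulmxDl -!scalemxAl zE TE.
have -> : C (s - t1) *: cmul a b (mline e u t1) + Sn (s - t1) *: cmul a b (mline' e u t1) =
 cmul a b (mline e u s).
have sE : t1 + (s - t1) = s by rewrite addrC subrK.
rewrite -[in RHS]sE -(mline_add tr).
by rewrite -!cmul_scale -cmulD.
by apply: csim_cmul; rewrite ab oner_neq0.
apply: filterS (near_norm t0 d0) => t; rewrite distrC => td.
by split=> h; [exact: K t td h t0 h0|exact: K t0 h0 h t td].
Qed.

Lemma geodesic_develops (g : R -> M) e u e0 L : aframe e0 L -> geodesic g ->
 S e e = 1 -> S u e = 0 -> S u (e *m JJ) = 0 -> S u u = eps ->
 develops g (mline e u) 0 -> forall t, develops g (mline e u) t.
move=> F G ee ue ueJ uu h0; apply: (connected_near _ _ h0) => [|t0].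
by apply/connected_intervalP => x y z.
exact: (geodesic_develops_near t0 F G ee ue ueJ uu).
Qed.
Hypotheses (complete : complete_riem M).

(** The initial velocity [v] is the one that the frame at [p] sends to [u0 *m L]: this vector is
    orthogonal to the complex line of [e], so it is a combination of the tangent rows. Completeness
    gives a geodesic for all times. *)
Lemma develop_geodesic p Z e L (u0 : 'rV[R]_n) : isdev p Z -> Z p = e -> aframe e L ->
 sqnorm u0 = 1 -> exists g : R -> M, [/\ continuous g, g 0 = p,
 \forall t \near 0, csim (Z (g t)) (mline e (u0 *m L) t)
 & forall t, develops g (mline e (u0 *m L)) t].
move=> dZ Ze F u01; have [c [U [th [P [D cp Up ZE]]]]] := dZ.
pose x := coord c p; have [PQ QP] := devinvP RM eps2 D Up; have [PE JP] := devframeE D Up.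
have [g1 g2 g3 g4] := devframe_gram D Up.
have zx : zrow P x = e by rewrite -Ze ZE.
have [ue ueJ] := gip_L_e etaT etaJ F u0.
have uu : S (u0 *m L) (u0 *m L) = eps by rewrite (gip_L F) -/(sqnorm u0) u01 mulr1.
have ee : S e e = 1 by rewrite /gip (af_ee F) mxE eqxx.
have [v vE] : exists v : 'rV[R]_n, u0 *m L = v *m trows P x.
pose B := u0 *m L *m devinv eps eta c P x; exists (rsubmx B).
pose a := lsubmx (lsubmx B) 0 0; pose b := rsubmx (lsubmx B) 0 0.
have BE : u0 *m L = a *: e + b *: (e *m JJ) + rsubmx B *m trows P x.
rewrite -[LHS]mulmx1 -QP mulmxA -/x -/B PE -{1}(hsubmxK B) mul_row_col zx; congr (_ + _).
by rewrite -{1}(hsubmxK (lsubmx B)) mul_row_col -!mul_scalar_mx -!mx11_scalar.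
have v1 : S (rsubmx B *m trows P x) e = 0.
by rewrite -zx (gipC etaT) /gip trmx_mul mulmxA g2 mul0mx mxE.
have v2 : S (rsubmx B *m trows P x) (e *m JJ) = 0.
by rewrite -zx (gipC etaT) /gip trmx_mul mulmxA g3 mul0mx mxE.
have eJe : S (e *m JJ) e = 0 by exact: gip_self_J.
have a0 : a = 0.
by move: ue; rewrite BE !gipDl !gipZl ee eJe v1 mulr1 mulr0 !addr0.
have b0 : b = 0.
move: ueJ; rewrite BE !gipDl !gipZl [S e _](gipC etaT) eJe v2 (gipJJ (etaJJ etaJ)) ee.
by rewrite mulr1 mulr0 !addr0 add0r.
by rewrite {1}BE a0 b0 !scale0r !add0r.
have [g [G g0 gv]] := complete v cp.
have cp0 : cdom c (g 0) by rewrite g0.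
have Up0 : U (coord c (g 0)) by rewrite g0.
have /= [d [om [d0 H]]] := geodesic_dev G D cp0 Up0.
have v0 : velocity g c 0 = v by apply/rowP => k; rewrite mxE gv.
have ZgE t : Z (g t) = zrow P (coord c (g t)) by rewrite ZE.
have T0 : velocity g c 0 *m trows P (coord c (g 0)) = u0 *m L by rewrite v0 g0 vE.
rewrite T0 uu in H.
have near0 : \forall t \near 0, csim (Z (g t)) (mline e (u0 *m L) t).
have h0 : `|0 - 0 : R| < d by rewrite subrr normr0.
have := geodesic_model etaT etaJ tr (d := d) (t0 := 0) (z := fun t => zrow P (coord c (g t)))
 (T := fun t => velocity g c t *m trows P (coord c (g t))) (th := om) _ _ _ h0.
rewrite T0 g0 -/x zx => E.
apply: filterS (near_dist h0) => t td; rewrite ZgE -[t in mline _ _ t]subr0.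
by apply: E => // s sd; have [] := H s sd.
exists g; split=> //; first exact: G.1.
apply: (geodesic_develops F G) => //.
by exists Z => //; rewrite g0.
Qed.
End DevelopedGeodesics.

Lemma left_point (R : realType) (s d c : R) : 0 < d -> c < s ->
exists u, [/\ c <= u, u < s & `|s - u| < d].
move=> d0 cs; exists (Num.max (s - d / 2) c).
have us : Num.max (s - d / 2) c < s by rewrite gt_max cs ltrBlDr ltrDl divr_gt0.
split=> //; first by rewrite le_max lexx orbT.
rewrite ger0_norm ?subr_ge0 ?(ltW us)// ltrBlDr -ltrBlDl lt_max; apply/orP; left.
by rewrite ltrD2l ltrN2 ltr_pdivrMr// ltr_pMr// ltr1n.
Qed.

Lemma convex_lt (R : realType) (u a b r : R) : 0 <= u <= 1 -> a < r -> b < r ->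
 (1 - u) * a + u * b < r.
move=> /andP[u0 u1] ar br; have -> : r = (1 - u) * r + u * r by ring.
have [->|un0] := eqVneq u 0; first by rewrite subr0 !mul1r !mul0r !addr0.
apply: ler_ltD; first by rewrite ler_wpM2l ?subr_ge0// ltW.
by rewrite ltr_pM2l// lt_neqAle eq_sym un0.
Qed.

Lemma ball_convex (R : realType) (V : normedModType R) (x y : V) (u r : R) : 0 <= u <= 1 ->
 `|x| < r -> `|y| < r -> `|(1 - u) *: x + u *: y| < r.
move=> u01 xr yr; have /andP[u0 u1] := u01; apply: le_lt_trans (ler_normD _ _) _.
by rewrite !normrZ (ger0_norm u0) ger0_norm ?subr_ge0//; exact: convex_lt.
Qed.

Lemma sqnormE (R : realType) n (w : 'rV[R]_n) : sqnorm w = \sum_i w 0 i ^+ 2.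
by rewrite /sqnorm mxE; apply: eq_bigr => i _; rewrite mxE expr2. Qed.
Lemma sqnormZ (R : realType) n a (w : 'rV[R]_n) : sqnorm (a *: w) = a ^+ 2 * sqnorm w.
by rewrite !sqnormE mulr_sumr; apply: eq_bigr => i _; rewrite mxE exprMn. Qed.
Lemma sqnorm_ge0 (R : realType) n (w : 'rV[R]_n) : 0 <= sqnorm w.
by rewrite sqnormE sumr_ge0// => i _; exact: sqr_ge0. Qed.
Lemma sqnorm_gt0 (R : realType) n (w : 'rV[R]_n) : w != 0 -> 0 < sqnorm w.
move=> w0; rewrite lt_neqAle sqnorm_ge0 andbT eq_sym; apply: contra w0 => /eqP.
rewrite sqnormE => /psumr_eq0P w0; apply/eqP/rowP => i; rewrite mxE.
by apply/eqP; rewrite -sqrf_eq0 w0// => j _; exact: sqr_ge0.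
Qed.

Lemma cont_comp (X Y W : topologicalType) (f : X -> Y) (g : Y -> W) a :
 {for a, continuous f} -> {for f a, continuous g} -> {for a, continuous (fun b => g (f b))}.
exact: continuous_comp. Qed.
Lemma cont_addl (R : realType) (a s : R) : {for s, continuous (fun t : R => a + t)}.
by apply: cvgD; [exact: cvg_cst|exact: cvg_id]. Qed.
Lemma mulmxr_cont (R : realType) p q (A : 'M[R]_(p, q)) (z : 'rV[R]_p) :
 {for z, continuous (fun y : 'rV[R]_p => y *m A)}.
apply: (@mxCk_cont R p 1 q setT _ 0) => //; apply: (mxCkM openT); last exact: mxCk_cst.
by move=> i j; rewrite ord1; exact: Ck_coord.
Qed.

Lemma sqnorm_cont (R : realType) n (w : 'rV[R]_n) : {for w, continuous (@sqnorm R n)}.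
have -> : @sqnorm R n = fun w => \sum_i w 0 i ^+ 2 by apply/funext => x; rewrite sqnormE.
apply: (@Ck_cont R n 0 setT) => //; apply: Ck_sum => [|i _]; first exact: openT.
by apply: (CkM openT); exact: Ck_coord.
Qed.

(* [ang] inverts the quotient [Sn / C]: the arc tangent or its hyperbolic analogue. *)
Record modelangle (R : realType) (eps : R) (C Sn ang : R -> R) : Prop := Modelangle {
 ma_0 : ang 0 = 0;
 ma_C : forall s, 0 < 1 + eps * s ^+ 2 -> C (ang s) != 0;
 ma_S : forall s, 0 < 1 + eps * s ^+ 2 -> Sn (ang s) = s * C (ang s);
 ma_cont : forall s, 0 < 1 + eps * s ^+ 2 -> {for s, continuous ang}
}.

(** * The inverse development, built along rays from a base point *)

Section Exponential.
Variables (R : realType) (m : nat) (eps : R) (M : riemData R (m + m)).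
Notation n := (m + m)%N.
Notation N := (m.+1 + m.+1)%N.
Notation JJ := (J0 R m.+1).
Hypotheses (RM : riemannian M).
Variables (J : chart M -> 'rV[R]_n -> 'M[R]_n).
Hypotheses (KJ : kahler J) (eps2 : eps ^+ 2 = 1)
 (curvM : hol_curv eps M J).
Variables (eta : 'M[R]_N).
Hypotheses (etaT : eta^T = eta) (etaJ : JJ *m eta = eta *m JJ) (eta2 : eta *m eta = 1%:M).
Implicit Types (p : M) (Z : M -> 'rV[R]_N) (w : 'rV[R]_n).
Notation isdev := (isdev eps J eta).
Notation aframe := (aframe eps eta).
Notation aff := (aff eps eta).
Notation den := (den eta).
Notation lift := lift_aff.
Notation lifts := (lifts eps J eta).

Lemma lifts_congr (X : topologicalType) (sig : X -> 'rV[R]_N) f f' (a : X) :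
 (\forall b \near a, f b = f' b) -> lifts sig f a -> lifts sig f' a.
move=> ff' [fc [Z dZ nZ]]; have e := nbhs_singleton ff'; split.
move=> A nA; rewrite -e in nA.
have h : \forall b \near a, A (f' b) by apply: filterS (filterI ff' (cont_near fc nA)) => b [<-].
exact: h.
exists Z; first by rewrite -e.
by apply: filterS (filterI ff' nZ) => b [<-].
Qed.

Lemma den_near_pt e z : den e z != 0 -> \forall y \near z, den e y != 0.
by apply: (den_near (U := setT) (z := id) openT) => // i j k; rewrite ord1; exact: Ck_coord.
Qed.

Lemma den_lift_neq0 e L w : aframe e L -> den e (lift e L w) != 0.
by move=> F; rewrite (den_lift etaT etaJ F) oner_neq0. Qed.

Section Frame.
Variables (e : 'rV[R]_N) (L : 'M[R]_(n, N)).
Hypotheses (F : aframe e L).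

Lemma aff_cont z : den e z != 0 -> {for z, continuous (aff e L)}.
move=> z0; pose U := [set y | den e y != 0].
have oU : open U by rewrite openE => y; exact: den_near_pt.
have sU : mxsmooth U (fun y : 'rV[R]_N => y) by move=> i j k; rewrite ord1; exact: Ck_coord.
exact: (mxCk_cont (smooth_Ck 0 (aff_smooth eps2 etaT etaJ F oU sU (fun y h => h))) (z0 : U z)).
Qed.

Section Sections.
Variables (p : M) (Z : M -> 'rV[R]_N) (r : R) (psi : 'rV[R]_n -> M).
Hypothesis H : forall w, `|aff e L (Z p) - w| < r ->
 [/\ isdev (psi w) Z, csim (Z (psi w)) (lift e L w), {for w, continuous psi} &
 \forall q \near psi w, [/\ psi (aff e L (Z q)) = q, `|aff e L (Z p) - aff e L (Z q)| < r
 & den e (Z q) != 0]].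
Variables (g g' : 'M[R]_N).
Hypotheses (ug : unitary eta g) (ug' : unitary eta g') (gg' : g *m g' = 1%:M) (g'g : g' *m g = 1%:M).
Variables (X : topologicalType) (sig : X -> 'rV[R]_N).

(** A local section of a development transported by [g]: undo [g], pass to affine coordinates, apply
    [psi]. *)
Lemma section_lifts a : {for a, continuous sig} -> den e (sig a *m g') != 0 ->
 `|aff e L (Z p) - aff e L (sig a *m g')| < r ->
 lifts sig (fun b => psi (aff e L (sig b *m g'))) a.
move=> sc d0 ar; have [dZ _ pc _] := H ar.
have ac : {for a, continuous (fun b => aff e L (sig b *m g'))}.
apply: (cont_comp (f := fun b => sig b *m g')); last exact: aff_cont.
 refine (@cont_comp X _ _ sig (fun z => z *m g') a sc (@mulmxr_cont R N N g' (sig a))).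
split; first exact: (cont_comp ac pc).
exists (fun q => Z q *m g); first exact: isdev_unitary.
have n1 : \forall b \near a, `|aff e L (Z p) - aff e L (sig b *m g')| < r.
have ar' : `|aff e L (sig a *m g') - aff e L (Z p)| < r by rewrite distrC.
by apply: filterS (cont_near ac (near_dist (V := 'rV[R]_n) ar')) => b; rewrite distrC.
have n2 : \forall b \near a, den e (sig b *m g') != 0.
apply: (cont_near (f := fun b => sig b *m g') _ (den_near_pt d0)).
 refine (@cont_comp X _ _ sig (fun z => z *m g') a sc (@mulmxr_cont R N N g' (sig a))).
apply: filterS (filterI n1 n2) => b [br bd]; have [_ h _ _] := H br.
have := csim_mulmx ug.2 (csim_trans h (lift_aff_csim eps2 etaT etaJ F bd)).
by rewrite -mulmxA g'g mulmx1.
Qed.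

(** Where [f] is continuous and developed over [sig], it coincides with the local section through
    its value. *)
Lemma section_eq f a w : `|aff e L (Z p) - w| < r -> f a = psi w -> {for a, continuous f} ->
 (\forall b \near a, csim (Z (f b) *m g) (sig b)) ->
 \forall b \near a, psi (aff e L (sig b *m g')) = f b.
move=> wr fa fc nf; have [_ _ _ nq] := H wr; rewrite -fa in nq.
apply: filterS (filterI (cont_near fc nq) nf) => b [[h1 _ _] /(csim_mulmx ug'.2) h2].
by rewrite -(aff_csim eps etaJ e L h2) -mulmxA gg' mulmx1.
Qed.
End Sections.

Lemma rigid_lift : (0 < m)%N -> rigid eta (lift e L).
move=> m0 w1 g [_ gJ] /(rigid_scalar eps2 etaT etaJ F gJ)/(_ m0)[ab ab0 E] w.
by rewrite E; exact: csim_cmul.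
Qed.

Lemma rigid_ray w : w != 0 -> rigid eta (fun t : R => lift e L (t *: w)).
move=> w0 a g [_ gJ] na b.
have na' : \forall s \near (0 : R), csim (lift e L (a *: w + s *: w) *m g) (lift e L (a *: w + s *: w)).
have sc : {for (0 : R), continuous (fun s : R => a + s)}.
exact: cont_addl.
have := cont_near (f := fun s : R => a + s) sc (_ : nbhs (a + 0) _).
rewrite addr0 => /(_ _ na); apply: filterS => s.
by rewrite scalerDl.
have [] := line_rigid eps2 etaT etaJ F gJ w0 na'.
set A := re _ _ _; set B := im _ _ _ => AB e1 e2.
have -> : lift e L (b *: w) = lift e L (a *: w) + (b - a) *: (w *m L).
by rewrite /lift -addrA !scalemxAl -mulmxDl -scalerDl [a + _]addrC subrK.
by rewrite mulmxDl -scalemxAl e1 e2 -cmul_scale -cmulD; exact: csim_cmul.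
Qed.
Variables (C Sn ang : R -> R).
Hypotheses (tr : modeltrig eps C Sn) (an : modelangle eps C Sn ang) (complete : complete_riem M)
 (m0 : (0 < m)%N).
Variables (p0 : M) (Z0 : M -> 'rV[R]_N).
Hypotheses (dZ0 : isdev p0 Z0) (Z0p : Z0 p0 = e).
Notation dom w := (0 < 1 + eps * sqnorm w).

Lemma dom_segment w (t : R) : 0 <= t <= 1 -> dom w -> dom (t *: w).
move=> /andP[t0 t1] dw; rewrite sqnormZ.
have -> : 1 + eps * (t ^+ 2 * sqnorm w) = (1 - t ^+ 2) + t ^+ 2 * (1 + eps * sqnorm w) by ring.
have [->|tn0] := eqVneq t 0; first by rewrite expr0n/= mul0r subr0 addr0 ltr01.
apply: ltr_wpDl; last by rewrite mulr_gt0// exprn_gt0// lt_neqAle eq_sym tn0.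
by rewrite subr_ge0 expr_le1.
Qed.

Lemma dom_near w : dom w -> \forall b \near w, dom b.
move=> dw; have c : {for w, continuous (fun b : 'rV[R]_n => 1 + eps * sqnorm b)}.
apply: (cont_comp (f := fun b => eps * sqnorm b)); last exact: cont_addl.
by apply: (cont_comp (g := fun t => eps * t)); [exact: sqnorm_cont|exact: mulrl_continuous].
apply: (cont_near (P := fun t : R => 0 < t) c); exact: lt_nbhsr.
Qed.
Let nrm w := Num.sqrt (sqnorm w).
Let nrmE w : nrm w ^+ 2 = sqnorm w. by rewrite sqr_sqrtr// sqnorm_ge0. Qed.
Let nrm_gt0 w : w != 0 -> 0 < nrm w. by move=> w0; rewrite sqrtr_gt0 sqnorm_gt0. Qed.

(* The geodesics from [p0], reparametrized so as to follow affine segments in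
 the development. *)
Lemma radial_family : exists G : 'rV[R]_n -> R -> M, forall w, w != 0 ->
 [/\ G w 0 = p0, \forall t \near (0 : R), csim (Z0 (G w t)) (lift e L (t *: w)),
 forall t s : R, 0 < s -> G (s *: w) t = G w (t * s)
 & forall t : R, dom (t *: w) -> lifts (fun s : R => lift e L (s *: w)) (G w) t].
have ex u : exists g : R -> M, sqnorm u = 1 -> [/\ continuous g, g 0 = p0,
 \forall t \near 0, csim (Z0 (g t)) (mline C Sn e (u *m L) t)
 & forall t, develops eps J eta g (mline C Sn e (u *m L)) t].
have [u1|u1] := pselect (sqnorm u = 1); last by exists (fun=> p0).
have [g Hg] := develop_geodesic RM KJ eps2 curvM etaT etaJ tr complete dZ0 Z0p F u1.
by exists g.
have [g Hg] := choice ex.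
exists (fun w t => g ((nrm w)^-1 *: w) (ang (t * nrm w))) => w w0.
have nw := nrm_gt0 w0; set u := _ *: w.
have u1 : sqnorm u = 1.
by rewrite sqnormZ exprVn nrmE mulVf// gt_eqF// sqnorm_gt0.
have [gc g0 gn gd] := Hg u u1.
have domE t : dom (t *: w) -> 0 < 1 + eps * (t * nrm w) ^+ 2 by rewrite sqnormZ exprMn nrmE.
have ac t : dom (t *: w) -> {for t, continuous (fun s : R => ang (s * nrm w))}.
move=> /domE dt; apply: (cont_comp (f := fun s : R => s * nrm w)); last exact: (ma_cont an).
exact: mulrr_continuous.
have lE t : dom (t *: w) -> csim (mline C Sn e (u *m L) (ang (t * nrm w))) (lift e L (t *: w)).
(* At the parameter [ang (t * nrm w)] the quotient [Sn / C] is [t * nrm w], so the point of the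
   model line is [C] times the affine lift of [t *: w]. *)
move=> /domE dt; have -> : mline C Sn e (u *m L) (ang (t * nrm w)) = cmul (C (ang (t * nrm w))) 0 (lift e L (t *: w)).
rewrite /mline (ma_S an dt) cmulZ /lift scalerDr; congr (_ + _).
rewrite mulrC -!scalemxAl !scalerA -mulrA -[t * nrm w / nrm w]mulrA mulfV ?gt_eqF// mulr1.
by [].
by apply: csim_cmul; rewrite expr0n/= addr0 expf_neq0// (ma_C an).
have d00 : dom (0 *: w) by rewrite sqnormZ expr0n mul0r mulr0 addr0 ltr01.
have a0 : ang (0 * nrm w) = 0 by rewrite mul0r (ma_0 an).
have nd t : dom (t *: w) -> \forall s \near t, dom (s *: w).
move=> /dom_near; apply: (cont_near (f := fun s : R => s *: w)).
exact: scalel_continuous.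
split.
- by rewrite a0 g0.
- have := cont_near (ac 0 d00) (_ : nbhs _ _); rewrite a0 => /(_ _ gn) h.
by apply: filterS (filterI h (nd 0 d00)) => t [h1 /lE]; exact: csim_trans.
- move=> t s s0; have sw : nrm (s *: w) = s * nrm w.
by rewrite /nrm sqnormZ sqrtrM ?sqr_ge0// sqrtr_sqr gtr0_norm.
rewrite sw; congr (g _ (ang _)); last by rewrite mulrA.
by rewrite scalerA invfM mulrAC mulVf ?mul1r// gt_eqF.
- move=> t dt; have [Z dZ nZ] := gd (ang (t * nrm w)).
split; first exact: (cont_comp (ac t dt) (gc _)).
exists Z => //; apply: filterS (filterI (cont_near (ac t dt) nZ) (nd t dt)) => s [h1 /lE].
exact: csim_trans.
Qed.

Lemma lifts_comp (X Y : topologicalType) (sig : X -> 'rV[R]_N) (h : Y -> X) f (a : Y) :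
 {for a, continuous h} -> lifts sig f (h a) -> lifts (fun b => sig (h b)) (fun b => f (h b)) a.
move=> hc [fc [Z dZ nZ]]; split; first exact: (cont_comp hc fc).
by exists Z => //; exact: cont_near hc nZ.
Qed.
Let lc w (t : R) : {for t, continuous (fun s : R => s *: w)}.
exact: scalel_continuous. Qed.
Let lc' w : {for w, continuous (lift e L)}.
apply: (@mxCk_cont R n 1 N setT _ 0) => //; apply: (mxCkD openT); first exact: mxCk_cst.
apply: (mxCkM openT); last exact: mxCk_cst.
by move=> i j; rewrite ord1; exact: Ck_coord.
Qed.

Section Family.
Variables (G : 'rV[R]_n -> R -> M) (q : 'rV[R]_n -> M).
Hypothesis lG : forall w, w != 0 -> forall t : R, dom (t *: w) ->
 lifts (fun s : R => lift e L (s *: w)) (G w) t.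
Hypotheses (qE : forall w (t : R), w != 0 -> 0 < t -> q (t *: w) = G w t).
Let lq w (t : R) : w != 0 -> 0 < t -> dom (t *: w) ->
 lifts (fun s : R => lift e L (s *: w)) (fun s : R => q (s *: w)) t.
move=> w0 t0 /(lG w0); apply: lifts_congr; have h : `|t - t| < t by rewrite subrr normr0.
apply: filterS (near_dist h) => s; rewrite ltr_distl subrr => /andP[s0 _].
by rewrite qE.
Qed.

(** Near [s *: w] the map [q] is only controlled along each ray, by the geodesics. It is compared
    with a local section [psig], which is continuous in all directions: first along the ray of [w],
    up to points just before [s], then from there along all neighbouring rays. *)
Lemma exponential_closed w (s : R) : w != 0 -> dom w -> 0 < s <= 1 ->
 (forall t : R, 0 <= t < s -> \forall b \near t *: w, lifts (lift e L) q b) ->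
 \forall b \near s *: w, lifts (lift e L) q b.
move=> w0 dw /andP[s0 s1] Hs.
have ds : dom (s *: w) by apply: dom_segment => //; rewrite s1 ltW.
have [gc [Z dZ nZ]] := lG w0 ds; have csp := nbhs_singleton nZ.
have d0 : den e (Z (G w s)) != 0 := den_csim etaJ csp (den_lift_neq0 _ F).
have ap : aff e L (Z (G w s)) = s *: w.
by rewrite (aff_csim eps etaJ e L csp) (aff_lift eps2 etaT etaJ F).
have [r [psi [r0 psip H]]] := isdev_inverse RM KJ eps2 etaT etaJ dZ F d0.
have H' := H; rewrite ap in psip H'.
have h0 : `|s *: w - s *: w| < r by rewrite subrr normr0.
have [_ _ _ np] := H' _ h0; rewrite psip in np.
have sr : `|s - s| < s by rewrite subrr normr0.
have nr : \forall t \near s, `|t *: w - s *: w| < r.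
exact: cont_near (lc (w := w) (t := s)) (near_dist (V := 'rV[R]_n) h0).
have [d d1 Hd] := near_ball (filterI (filterI (cont_near gc (isdev_near RM dZ)) nZ)
 (filterI (cont_near gc np) (filterI nr (near_dist sr)))).
have [d2 {}Hd] : 0 < d /\ forall t, `|s - t| < d -> [/\ isdev (G w t) Z, csim (Z (G w t)) (lift e L (t *: w)),
 `|s *: w - t *: w| < r, psi (t *: w) = G w t & 0 < t].
split=> // t /Hd[[h1 h2] [[h3 _ _] [h4 h5]]]; split=> //; first by rewrite distrC.
by rewrite -[RHS]h3 (aff_csim eps etaJ e L h2) (aff_lift eps2 etaT etaJ F).
by move: h5; rewrite ltr_distl subrr => /andP[].
(* A time before [s] at which [q] is already a lift and the local section at time [s] is already
   valid. The two developments there differ by a unitary [g]. *)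
have [s2 [s20' s2s s2d]] : exists u, [/\ s / 2 <= u, u < s & `|s - u| < d].
by apply: left_point => //; rewrite ltr_pdivrMr// ltr_pMr// ltr1n.
have s20 : 0 < s2 by rewrite (lt_le_trans _ s20')// divr_gt0.
have [A1 A2 A3 A4 _] := Hd s2 s2d.
have P2 : \forall b \near s2 *: w, lifts (lift e L) q b by apply: Hs; rewrite s2s ltW.
have [qc [Z' dZ' nZ']] := nbhs_singleton P2; rewrite qE// in dZ'.
have [g ug ng] := isdev_unique RM KJ eps2 A1 dZ'.
have [g' [ug' gg' g'g]] := unitaryV etaT eta2 ug.
have nq : \forall b \near s2 *: w, csim (Z' (q b)) (Z (q b) *m g).
by apply: (cont_near (P := fun x => csim (Z' x) (Z x *m g)) qc); rewrite qE.
have nd : \forall t \near s2, `|t - s| < d by apply: near_dist; rewrite distrC.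
(* [g] fixes the lines over the ray near [s2], hence over the whole ray; correcting by [g']
   therefore does not move the ray. *)
have ray t : csim (lift e L (t *: w)) (lift e L (t *: w) *m g').
have h : \forall t \near s2, csim (lift e L (t *: w) *m g) (lift e L (t *: w)).
have lw := lc (w := w) (t := s2).
apply: filterS (filterI (filterI (cont_near lw nZ') (cont_near lw nq)) nd) => u [[h1 h2]].
rewrite distrC => /Hd[_ h3 _ _ u0]; rewrite qE// in h1 h2.
exact: csim_trans (csim_sym (csim_mulmx ug.2 h3)) (csim_trans (csim_sym h2) h1).
have := csim_mulmx ug'.2 (rigid_ray w0 ug h t).
by rewrite -mulmxA gg' mulmx1.
pose psig b := psi (aff e L (lift e L b *m g')).
have affr t : aff e L (lift e L (t *: w) *m g') = t *: w.
by rewrite -(aff_csim eps etaJ e L (ray t)) (aff_lift eps2 etaT etaJ F).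
have denr t : den e (lift e L (t *: w) *m g') != 0.
by apply: (den_csim etaJ (csim_sym (ray t))); exact: den_lift_neq0.
have psigl := section_lifts H ug g'g (sig := lift e L) _.
have lpr t : `|s - t| < d -> lifts (lift e L) psig (t *: w).
by move=> /Hd[_ _ h _ _]; apply: (psigl (t *: w) (lc' (w := _)) (denr t)); rewrite ap affr.
have lc2 b : {for b, continuous (fun b => lift e L b *m g')}.
exact: (@cont_comp _ _ _ (lift e L) (fun z => z *m g') b (lc' (w := b)) (@mulmxr_cont R N N g' (lift e L b))).
have nlp : \forall b \near s *: w, lifts (lift e L) psig b.
have ac : {for s *: w, continuous (fun b => aff e L (lift e L b *m g'))}.
by apply: (cont_comp (lc2 _)); apply: aff_cont.
have ar : `|aff e L (lift e L (s *: w) *m g') - s *: w| < r by rewrite affr.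
apply: filterS (filterI (cont_near (lc2 _) (den_near_pt (denr s))) (cont_near ac (near_dist (V := 'rV[R]_n) ar))).
move=> b [b1 b2]; apply: (psigl b (lc' (w := _)) b1).
by rewrite ap distrC.
have e2 : \forall b \near s2 *: w, psig b = q b.
apply: (section_eq H ug' gg' (w := s2 *: w)) => //; [by rewrite ap|by rewrite qE|].
by apply: filterS (filterI nZ' nq) => b [h1 h2]; exact: csim_trans (csim_sym h2) h1.
have e3 t : s2 <= t < s -> \forall b \near t *: w, psig b = q b.
move=> /andP[t2 ts].
have cE u : 0 <= u <= 1 -> s2 <= s2 + u * (t - s2) < s.
move=> /andP[u0 u1]; rewrite lerDl mulr_ge0 ?subr_ge0//=; apply: le_lt_trans ts.
by rewrite -lerBrDl ler_piMl// subr_ge0.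
have cc (u : R) : {for u, continuous (fun u : R => (s2 + u * (t - s2)) *: w)}.
apply: (@cont_comp _ _ _ (fun u : R => s2 + u * (t - s2)) (fun x : R => x *: w)); last exact: lc.
apply: (@cont_comp _ _ _ (fun u : R => u * (t - s2)) (fun x : R => s2 + x)); last exact: cont_addl.
exact: mulrr_continuous.
have := lifts_path RM KJ eps2 etaT etaJ eta2 (f := psig) (f' := q)
 (c := fun u : R => (s2 + u * (t - s2)) *: w) (rigid_lift m0) (fun u _ => cc u) _ _ (_ : 0 <= 1 <= 1).
rewrite mul0r addr0 mul1r [s2 + _]addrC subrK; apply=> //; last by rewrite ler01 lexx.
move=> u /cE /andP[u2 us]; split.
apply: lpr; move: s2d; rewrite !ger0_norm ?subr_ge0 ?(ltW us) ?(ltW s2s)//.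
by apply: le_lt_trans; rewrite lerD2l lerN2.
by apply: nbhs_singleton; apply: Hs; rewrite us (le_trans (ltW s20) u2).
have w0' : s *: w != 0 by rewrite scaler_eq0 negb_or gt_eqF.
have nn0 : \forall b \near s *: w, b != 0.
have c0 : 0 < `|s *: w| by rewrite normr_gt0.
apply: filterS (near_norm (V := 'rV[R]_n) (s *: w) c0) => b.
by apply: contraTneq => ->; rewrite subr0 ltxx.
have [D D0 HD] := near_ball (filterI nlp (filterI (dom_near ds) nn0)).
have hD : `|s *: w - s *: w| < D by rewrite subrr normr0.
have [d' d'0 Hd'] := near_ball (cont_near (lc (w := w) (t := s)) (near_dist (V := 'rV[R]_n) hD)).
have [t2 [t2s2 t2s t2d]] := left_point d'0 s2s.
(* Scaling by [t3] sends a neighbour [b] of [s *: w] to a neighbour of [t2 *: w], where [psig] and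
   [q] are known to agree; the segment from [t3 *: b] to [b] stays on the ray of [b]. *)
pose t3 := t2 / s.
have t30 : 0 < t3 by rewrite divr_gt0// (lt_le_trans s20).
have t31 : t3 < 1 by rewrite ltr_pdivrMr// mul1r.
have t3c : {for s *: w, continuous (fun b : 'rV[R]_n => t3 *: b)} by exact: scaler_continuous.
have t3E : t3 *: (s *: w) = t2 *: w by rewrite scalerA /t3 divfK// gt_eqF.
pose T (b : 'rV[R]_n) : 'rV[R]_n := t3 *: b.
have m1 : \forall b \near s *: w, nbhs (T b) [set x | psig x = q x].
apply: (cont_near (P := fun x => nbhs x [set x | psig x = q x]) t3c).
by rewrite t3E; apply: nbhs_interior; apply: e3; rewrite t2s2.
have m2 : \forall b \near s *: w, `|t3 *: b - s *: w| < D.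
apply: (cont_near (P := fun b : 'rV[R]_n => `|b - s *: w| < D) t3c); rewrite t3E.
by apply: (near_dist (V := 'rV[R]_n)); exact: Hd'.
have eqn : \forall b \near s *: w, psig b = q b.
apply: filterS (filterI (filterI m1 m2) (near_dist (V := 'rV[R]_n) hD)) => b [[b1 b2] b3].
have cE u : 0 <= u <= 1 -> `|s *: w - (t3 + u * (1 - t3)) *: b| < D.
move=> /andP[u0 u1].
have -> : s *: w - (t3 + u * (1 - t3)) *: b = - ((1 - u) *: (t3 *: b - s *: w) + u *: (b - s *: w)).
by mxlin.
by rewrite normrN; apply: (ball_convex (V := 'rV[R]_n)) b2 b3; rewrite u0.
have cc (u : R) : {for u, continuous (fun u : R => t3 + u * (1 - t3))}.
apply: (@cont_comp _ _ _ (fun u : R => u * (1 - t3)) (fun x : R => t3 + x)); last exact: cont_addl.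
exact: mulrr_continuous.
have b3' : `|s *: w - b| < D by rewrite distrC.
have [_ [db bn0]] := HD b b3'.
have := lifts_path RM KJ eps2 etaT etaJ eta2 (f := fun x : R => psig (x *: b)) (f' := fun x : R => q (x *: b))
 (c := fun u : R => t3 + u * (1 - t3)) (rigid_ray bn0) (fun u _ => cc u) _ _ (_ : 0 <= 1 <= 1).
rewrite mul0r addr0 mul1r [t3 + _]addrC subrK => K.
suff : \forall a \near (1 : R), psig (a *: b) = q (a *: b) by move=> /nbhs_singleton; rewrite scale1r.
apply: K; last by rewrite ler01 lexx.
move=> u u01; have [h1 [h2 h3]] := HD _ (cE u u01); split.
exact: (lifts_comp (h := fun x : R => x *: b) (lc (w := b) (t := _)) h1).
move: u01 => /andP[u0 _]; apply: (lq bn0 _ h2).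
by rewrite ltr_wpDr// mulr_ge0// subr_ge0 ltW.
exact: (cont_near (f := fun x : R => x *: b) (lc (w := b) (t := t3)) b1).
apply: filterS (filterI nlp (nbhs_interior eqn)) => b [h1 h2].
exact: lifts_congr h2 h1.
Qed.
End Family.

(** The value at [w] is that of the family at time 1, with [p0] at the origin. Near 0 this is the
    local section of [Z0], which settles the origin where rays meet; continuous induction along each
    ray does the rest. *)
Lemma exponential : exists q : 'rV[R]_n -> M, [/\ q 0 = p0,
 \forall b \near (0 : 'rV[R]_n), csim (Z0 (q b)) (lift e L b)
 & forall w, dom w -> \forall b \near w, lifts (lift e L) q b].
have [G HG] := radial_family.
pose q w := if w == 0 then p0 else G w 1.
have q0 : q 0 = p0 by rewrite /q eqxx.
have qE w (t : R) : w != 0 -> 0 < t -> q (t *: w) = G w t.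
move=> w0 t0; have [_ _ h _] := HG w w0; rewrite -[t]mul1r -h// mul1r /q scaler_eq0 gt_eqF//.
by rewrite (negbTE w0).
have lG w : w != 0 -> forall t : R, dom (t *: w) -> lifts (fun s : R => lift e L (s *: w)) (G w) t.
by move=> /HG[].
have lift0 : lift e L 0 = e by rewrite /lift mul0mx addr0.
have zl0 : aff e L (Z0 p0) = 0.
by rewrite (_ : Z0 p0 = lift e L 0); [rewrite (aff_lift eps2 etaT etaJ F)|rewrite lift0].
have d0 : den e (Z0 p0) != 0 by rewrite (_ : Z0 p0 = lift e L 0); [exact: den_lift_neq0|rewrite lift0].
have [r0 [psi0 [r00 psi0p H0]]] := isdev_inverse RM KJ eps2 etaT etaJ dZ0 F d0.
rewrite zl0 in psi0p H0.
have {}H0 w : `|w| < r0 -> [/\ isdev (psi0 w) Z0, csim (Z0 (psi0 w)) (lift e L w),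
 {for w, continuous psi0} & \forall q \near psi0 w, psi0 (aff e L (Z0 q)) = q].
move=> wr; have := H0 w; rewrite sub0r normrN => /(_ wr)[h1 h2 h3 h4]; split=> //.
by apply: filterS h4 => x [].
have nr0 w : `|w| < r0 -> \forall b \near w, `|b| < r0.
by rewrite -{1}[w]subr0 => /(near_dist (V := 'rV[R]_n)); apply: filterS => b; rewrite subr0.
have psi0_lifts w : `|w| < r0 -> lifts (lift e L) psi0 w.
move=> wr; have [h1 h2 h3 _] := H0 w wr; split=> //.
by exists Z0 => //; apply: filterS (nr0 w wr) => b /H0[].
have n0 : `|0 : 'rV[R]_n| < r0 by rewrite normr0.
(* Both lift the ray from 0 to [w] and agree near time 0, so they agree at time 1. *)
have q_psi0 w : `|w| < r0 -> q w = psi0 w.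
move=> wr; have [->|w0] := eqVneq w 0; first by rewrite q0 psi0p.
have sr (s : R) : 0 <= s <= 1 -> `|s *: w| < r0.
by move=> /andP[s0 s1]; rewrite normrZ ger0_norm// (le_lt_trans _ wr)// ler_piMl.
have [G0 nG _ _] := HG w w0.
have domr (s : R) : 0 <= s <= 1 -> dom (s *: w).
move=> /sr/H0[h1 h2 _ _]; rewrite -(gip_lift etaT F).
by apply: (csim_pos etaT etaJ (csim_sym h2)); rewrite (isdev_gip h1).
rewrite (_ : q w = G w 1); last by rewrite -[in LHS](scale1r w) qE ?ltr01.
rewrite -[w in RHS]scale1r.
apply: (@nbhs_singleton _ _ (fun s : R => G w s = psi0 (s *: w))).
have s0 : 0 <= (0 : R) <= 1 by rewrite lexx ler01.
apply: (lifts_path RM KJ eps2 etaT etaJ eta2 (f := G w) (f' := fun s : R => psi0 (s *: w)) (c := id) (rigid_ray w0)).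
 - by move=> s _; exact: cvg_id.
 - move=> s s01; split; first exact: lG w0 _ (domr s s01).
exact: (lifts_comp (h := fun s : R => s *: w) (lc (w := w) (t := s)) (psi0_lifts _ (sr s s01))).
 - have [Gc _] := lG w w0 0 (domr 0 s0).
have [_ _ _ np] := H0 0 n0; rewrite psi0p -G0 in np.
apply: filterS (filterI (cont_near Gc np) nG) => s [h1 h2].
by rewrite -{1}h1 (aff_csim eps etaJ e L h2) (aff_lift eps2 etaT etaJ F).
 - by rewrite ler01 lexx.
have base : \forall b \near (0 : 'rV[R]_n), lifts (lift e L) q b.
apply: filterS (nr0 0 n0) => b br; apply: lifts_congr (psi0_lifts b br).
by apply: filterS (nr0 b br) => b' /q_psi0 ->.
exists q; split=> //.
by apply: filterS (nr0 0 n0) => b br; rewrite q_psi0//; have [] := H0 b br.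
move=> w dw; have [->//|w0] := eqVneq w 0.
have K : forall s : R, 0 <= s <= 1 -> \forall b \near s *: w, lifts (lift e L) q b.
apply: segment_induction => [|s _ h|s s01]; first by rewrite scale0r.
exact: cont_near (lc (w := w) (t := s)) (nbhs_interior h).
exact: (exponential_closed lG qE w0 dw s01).
by have := K 1; rewrite scale1r; apply; rewrite ler01 lexx.
Qed.
End Frame.
End Exponential.

(** * Covering properties of the inverse development on the positive cone *)

Section Covering.
Variables (R : realType) (m : nat) (eps : R) (M : riemData R (m + m)).
Notation n := (m + m)%N.
Notation N := (m.+1 + m.+1)%N.
Notation JJ := (J0 R m.+1).
Hypotheses (RM : riemannian M).
Variables (J : chart M -> 'rV[R]_n -> 'M[R]_n).
Hypotheses (KJ : kahler J) (eps2 : eps ^+ 2 = 1)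
 (curvM : hol_curv eps M J).
Variables (eta : 'M[R]_N).
Hypotheses (etaT : eta^T = eta) (etaJ : JJ *m eta = eta *m JJ) (eta2 : eta *m eta = 1%:M).
Implicit Types (p x : M) (Z : M -> 'rV[R]_N) (w : 'rV[R]_n) (a b v y z : 'rV[R]_N).
Notation S := (gip eta).
Notation isdev := (isdev eps J eta).
Notation aframe := (aframe eps eta).
Notation aff := (aff eps eta).
Notation den := (den eta).
Notation lift := lift_aff.
Notation lifts := (lifts eps J eta).
Notation lid := (lifts (X := 'rV[R]_N) id).
Let SNl y z : S (- y) z = - S y z. by rewrite /gip !mulNmx mxE. Qed.
Lemma cmul_cont (s t : R) z : {for z, continuous (@cmul R m s t)}.
have -> : @cmul R m s t = fun y => y *m (s%:M + t *: JJ).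
by apply/funext => y; rewrite mulmxDr mul_mx_scalar -scalemxAr.
exact: mulmxr_cont.
Qed.
Variables (e : 'rV[R]_N) (L : 'M[R]_(n, N)).
Hypotheses (F : aframe e L) (m0 : (0 < m)%N).

Lemma lift_cont w : {for w, continuous (lift e L)}.
apply: (@mxCk_cont R n 1 N setT _ 0) => //; apply: (mxCkD openT); first exact: mxCk_cst.
apply: (mxCkM openT); last exact: mxCk_cst.
by move=> i j; rewrite ord1; exact: Ck_coord.
Qed.

Lemma line_cont a v (s : R) : {for s, continuous (fun t : R => a + t *: v)}.
exact: cont_line. Qed.
(** On the hyperplane orthogonal to [e], a small multiple of [e] moves the vector off it. *)
Lemma den_dense a A : nbhs a A -> exists2 b, A b & den e b != 0.
move=> nA; have [d0|d0] := eqVneq (den e a) 0; last by exists a => //; exact: nbhs_singleton.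
have nA' : nbhs (a + 0 *: e) A by rewrite scale0r addr0.
have [d d1 Hd] := near_ball (cont_near (line_cont (a := a) (v := e) (s := 0)) nA').
exists (a + (d / 2) *: e).
by apply: Hd; rewrite sub0r normrN gtr0_norm ?divr_gt0// ltr_pdivrMr// ltr_pMr// ltr1n.
have ra : re eta e a = 0.
by move/eqP: d0; rewrite denE paddr_eq0 ?sqr_ge0// sqrf_eq0 => /andP[/eqP].
have ee : S e e = 1 by rewrite /gip (af_ee F) mxE eqxx.
rewrite denE {1}/re gipDl gipZl -/(re eta e a) ra add0r ee mulr1.
by rewrite gt_eqF// ltr_pwDl ?sqr_ge0// exprn_gt0// divr_gt0.
Qed.

Lemma rigid_id : rigid eta (id : 'rV[R]_N -> 'rV[R]_N).
move=> a g [_ gJ] na b.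
have [a' na' d0] := den_dense (nbhs_interior na).
have [[s t]/= [st aE]] := csim_sym (lift_aff_csim eps2 etaT etaJ F d0).
have nw : \forall w \near aff e L a', csim (lift e L w *m g) (lift e L w).
have c : {for aff e L a', continuous (fun w : 'rV[R]_n => cmul s t (lift e L w))}.
by apply: cont_comp; [exact: lift_cont|exact: cmul_cont].
have := cont_near c (_ : nbhs _ _); rewrite -aE => /(_ _ na'); apply: filterS => w h.
have k := csim_mulmx gJ (csim_cmul (lift e L w) st).
exact: csim_trans (csim_sym k) (csim_trans h (csim_cmul _ st)).
have [ab ab0 E] := rigid_scalar eps2 etaT etaJ F gJ nw m0.
by rewrite /= E; exact: csim_cmul.
Qed.
Let lpath f f' (c : R -> 'rV[R]_N) := lifts_path RM KJ eps2 etaT etaJ eta2 (f := f) (f' := f') (c := c) rigid_id.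

(** If S(y, z) is nonnegative, the segment from y to z stays in the positive cone and the lifts can
    be compared along it. Otherwise z is replaced by -z, on which both maps take the same values. *)
Lemma lid_unique f f' y z : (forall b, 0 < S b b -> lid f b /\ lid f' b) ->
 (forall b, 0 < S b b -> f (- b) = f b /\ f' (- b) = f' b) -> 0 < S y y ->
 (\forall b \near y, f b = f' b) -> 0 < S z z -> f z = f' z.
move=> ll ff' y0 ny.
have [SDr SZr] := (gipDr etaT, gipZr etaT).
wlog yz : z / 0 <= S y z.
move=> W z0; have [h|h] := leP 0 (S y z); first exact: W.
have SN : S (- z) (- z) = S z z by rewrite SNl (gipC etaT) SNl opprK.
have := W (- z); rewrite SN (gipC etaT y) SNl (gipC etaT) oppr_ge0 => /(_ (ltW h) z0).
by have [-> ->] := ff' z z0.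
move=> z0; have k s : 0 <= s <= 1 -> 0 < S (y + s *: (z - y)) (y + s *: (z - y)).
move=> /andP[s0 s1].
have -> : y + s *: (z - y) = (1 - s) *: y + s *: z by mxlin.
rewrite !gipDl !gipZl !SDr !SZr (gipC etaT z y).
have -> : (1 - s) * ((1 - s) * S y y + s * S y z) + s * ((1 - s) * S y z + s * S z z) =
 2 * (s * (1 - s) * S y z) + ((1 - s) ^+ 2 * S y y + s ^+ 2 * S z z) by ring.
apply: ltr_wpDl; first by rewrite !mulr_ge0// subr_ge0.
have [->|sn0] := eqVneq s 0; first by rewrite subr0 !expr2 !mul1r !mul0r addr0.
apply: ltr_wpDl; first by rewrite mulr_ge0 ?sqr_ge0 ?(ltW y0).
by rewrite mulr_gt0// exprn_even_gt0.
have := lpath (f := f) (f' := f') (c := fun s : R => y + s *: (z - y)) (fun s _ => line_cont (s := s)) (fun s h => ll _ (k s h)).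
rewrite scale0r addr0 => /(_ ny 1); rewrite ler01 lexx scale1r addrC subrK => /(_ isT).
exact: nbhs_singleton.
Qed.
Variables (Q : 'rV[R]_N -> M).
Hypotheses (Ql : forall z, 0 < S z z -> lid Q z) (Qs : forall y z, csim y z -> 0 < S z z -> Q y = Q z).

(** The development at [Q z] is inverse to [Q] up to complex factors: [Q] of a rescaled developed
    line is close to the given point and has the same development, so local injectivity applies. *)
Lemma covering_near z : 0 < S z z -> exists Z, [/\ isdev (Q z) Z,
 \forall b \near z, csim (Z (Q b)) b & \forall x \near Q z, Q (Z x) = x].
move=> z0; have [Qc [Z dZ nZ]] := Ql z0; exists Z; split=> //.
have [[s t]/= [st zE]] := csim_sym (nbhs_singleton nZ).
have [B nB injB] := isdev_injective RM KJ eps2 etaT etaJ dZ.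
have c : {for Q z, continuous (fun x => cmul s t (Z x))}.
by apply: cont_comp; [exact: isdev_cont dZ|exact: cmul_cont].
have n1 : \forall x \near Q z, csim (Z (Q (cmul s t (Z x)))) (cmul s t (Z x)) /\ B (Q (cmul s t (Z x))).
by apply: (cont_near (P := fun b => csim (Z (Q b)) b /\ B (Q b)) c); rewrite -zE; exact: filterI nZ (cont_near Qc nB).
apply: filterS (filterI (filterI n1 nB) (isdev_near RM dZ)) => x [[[h1 h2] h3] dx].
have s1 := csim_cmul (Z x) st.
rewrite -(Qs s1); last by rewrite (isdev_gip dx).
by apply: injB => //; exact: csim_trans h1 s1.
Qed.

(** The image is open and closed. Around any point [x], a preimage of one point is moved to a
    preimage of another along an affine segment of the developed ball, where [Q] agrees with the
    local section by uniqueness of lifts. *)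
Lemma covering_surjective z0 : connected [set: M] -> 0 < S z0 z0 -> forall x, exists2 z, 0 < S z z & Q z = x.
move=> cM z00; apply: (connected_near (x0 := Q z0) cM); last by exists z0.
move=> x; have [Z [dZ Zx]] := isdev_exists RM KJ curvM etaT etaJ x F.
have d0 : den e (Z x) != 0.
have -> : Z x = lift e L 0 by rewrite Zx /lift mul0mx addr0.
exact: den_lift_neq0 etaT etaJ _ _ _ F.
have [r [psi [r0 psix H]]] := isdev_inverse RM KJ eps2 etaT etaJ dZ F d0.
have h0 : `|aff e L (Z x) - aff e L (Z x)| < r by rewrite subrr normr0.
have [_ _ _ nx] := H _ h0; rewrite psix in nx.
pose A x' := [/\ isdev x' Z, psi (aff e L (Z x')) = x', `|aff e L (Z x) - aff e L (Z x')| < r & den e (Z x') != 0].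
have nA : \forall x' \near x, A x' by apply: filterS (filterI (isdev_near RM dZ) nx) => x' [? []].
have K x1 x2 : A x1 -> A x2 -> (exists2 z, 0 < S z z & Q z = x1) -> exists2 z, 0 < S z z & Q z = x2.
move=> [d1 p1 r1 e1] [d2 p2 r2 e2] [z zz Qz].
have [Qc [Z' dZ' nZ']] := Ql zz; rewrite Qz in dZ'.
have [g ug ng] := isdev_unique RM KJ eps2 d1 dZ'.
have [g' [ug' gg' g'g]] := unitaryV etaT eta2 ug.
pose w1 := aff e L (Z x1); pose w2 := aff e L (Z x2).
have zs : csim z (lift e L w1 *m g).
apply: csim_trans (csim_sym (nbhs_singleton nZ')) _; rewrite Qz.
apply: csim_trans (nbhs_singleton ng) _.
exact: csim_mulmx ug.2 (csim_sym (lift_aff_csim eps2 etaT etaJ F e1)).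
have [[s t]/= [st zE]] := zs.
pose w u := w1 + u *: (w2 - w1); pose c u := cmul s t (lift e L (w u) *m g).
have cs u : csim (c u) (lift e L (w u) *m g) := csim_cmul _ st.
have c0 : c 0 = z by rewrite /c /w scale0r addr0 -zE.
have cg u : csim (c u *m g') (lift e L (w u)).
by have := csim_mulmx ug'.2 (cs u); rewrite -mulmxA gg' mulmx1.
have ca u : aff e L (c u *m g') = w u.
by rewrite (aff_csim eps etaJ e L (cg u)) (aff_lift eps2 etaT etaJ F).
have wr u : 0 <= u <= 1 -> `|aff e L (Z x) - w u| < r.
move=> u01; have -> : aff e L (Z x) - w u = (1 - u) *: (aff e L (Z x) - w1) + u *: (aff e L (Z x) - w2).
by rewrite /w; mxlin.
exact: (ball_convex (V := 'rV[R]_n) u01 r1 r2).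
have kc u : 0 <= u <= 1 -> 0 < S (c u) (c u).
move=> /wr/H[h1 h2 _ _]; apply: (csim_pos etaT etaJ (cs u)); rewrite (unitary_gip _ _ ug).
by apply: (csim_pos etaT etaJ (csim_sym h2)); rewrite (isdev_gip h1).
pose f b := psi (aff e L (b *m g')).
have fl u : 0 <= u <= 1 -> lid f (c u).
move=> u01; have h := section_lifts eps2 etaT etaJ F H ug g'g (X := 'rV[R]_N) (sig := id) (a := c u).
apply: h.
 - exact: cvg_id.
 - by apply: (den_csim etaJ (cg u)); exact: den_lift_neq0 etaT etaJ _ _ _ F.
 - by rewrite ca; exact: wr.
have n0 : \forall b \near c 0, f b = Q b.
rewrite c0; apply: (section_eq etaJ H ug' gg' (w := w1) (sig := id) r1 _ Qc).
 - by rewrite Qz /w1 p1.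
have ng' : \forall b \near z, csim (Z' (Q b)) (Z (Q b) *m g).
by apply: (cont_near (P := fun x => csim (Z' x) (Z x *m g)) Qc); rewrite Qz.
by apply: filterS (filterI nZ' ng') => b [k1 k2]; exact: csim_trans (csim_sym k2) k1.
have cc u : {for u, continuous c}.
apply: (@cont_comp _ _ _ (fun u : R => lift e L (w u) *m g) (cmul s t)); last exact: cmul_cont.
apply: (@cont_comp _ _ _ (fun u : R => lift e L (w u)) (fun z => z *m g)); last exact: mulmxr_cont.
apply: (@cont_comp _ _ _ w (lift e L)); last exact: lift_cont.
exact: cont_line.
have h1 : 0 <= (1 : R) <= 1 by rewrite ler01 lexx.
have := lpath (f := f) (f' := Q) (fun u _ => cc u) (fun u h => conj (fl u h) (Ql (kc u h))) n0 h1.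
move=> /nbhs_singleton E; exists (c 1); first exact: kc.
by rewrite -E /f ca /w scale1r addrC subrK.
have xA := nbhs_singleton nA.
by apply: filterS nA => x' Ax'; split; exact: K.
Qed.

(** The matrix [g] relates the developments at the two preimages. Both [Q] and its composite with
    [g] are lifts, they agree near [y], hence on the whole cone. *)
Lemma deck y z : 0 < S y y -> 0 < S z z -> Q y = Q z -> exists g, [/\ unitary eta g, csim z (y *m g)
 & forall b, 0 < S b b -> Q (b *m g) = Q b].
move=> y0 z0 yz; have [Qyc [Zy dZy nZy]] := Ql y0; have [_ [Zz dZz nZz]] := Ql z0.
rewrite -yz in dZz.
have [g ug ng] := isdev_unique RM KJ eps2 dZy dZz.
have [g' [ug' gg' g'g]] := unitaryV etaT eta2 ug.
have zs : csim z (y *m g).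
apply: csim_trans (csim_sym (nbhs_singleton nZz)) _; rewrite -yz.
exact: csim_trans (nbhs_singleton ng) (csim_mulmx ug.2 (nbhs_singleton nZy)).
have kg b : 0 < S b b -> 0 < S (b *m g) (b *m g) by rewrite (unitary_gip _ _ ug).
have gc b : {for b, continuous (fun b : 'rV[R]_N => b *m g)} := @mulmxr_cont R N N g b.
have Qgc b : 0 < S b b -> {for b, continuous (fun b => Q (b *m g))}.
by move=> /kg/Ql[c _]; exact: cont_comp (gc b) c.
exists g; split=> // b b0; apply/esym.
apply: (lid_unique (f := Q) (f' := fun b => Q (b *m g)) (y := y)) => //.
- move=> a a0; split; first exact: Ql.
split; first exact: Qgc.
have [_ [Z dZ nZ]] := Ql (kg a a0); exists (fun x => Z x *m g'); first exact: isdev_unitary.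
by apply: filterS (cont_near (gc a) nZ) => a' /(csim_mulmx ug'.2); rewrite -mulmxA gg' mulmx1.
- have sN a : csim (- a) a by rewrite -scaleN1r -cmulZ; apply: csim_cmul; rewrite sqrrN expr1n expr0n/= addr0 oner_neq0.
move=> a a0; split; first exact: Qs.
by rewrite mulNmx; apply: Qs => //; exact: kg.
have [B nB injB] := isdev_injective RM KJ eps2 etaT etaJ dZy.
have [[s t]/= [st zE]] := zs.
have Qyg : Q (y *m g) = Q y by rewrite yz; apply/esym/Qs => //; exact: kg.
have n1 : \forall a \near y, csim (Zz (Q (cmul s t (a *m g)))) (cmul s t (a *m g)).
apply: (cont_near (f := fun a : 'rV[R]_N => cmul s t (a *m g)) _ (P := fun a => csim (Zz (Q a)) a)); last by rewrite -zE.
exact: (@cont_comp _ _ _ (fun a => a *m g) (@cmul R m s t) y (gc y) (@cmul_cont s t _)).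
have n2 : \forall a \near y, csim (Zz (Q (a *m g))) (Zy (Q (a *m g)) *m g) /\ B (Q (a *m g)).
by apply: (cont_near (Qgc y y0) (P := fun x => csim (Zz x) (Zy x *m g) /\ B x)); rewrite Qyg; exact: filterI.
have n3 : \forall a \near y, 0 < S a a.
by apply: filterS (filterI nZy (cont_near Qyc (isdev_near RM dZy))) => a [/csim_sym/(csim_pos etaT etaJ) h da]; apply: h; rewrite (isdev_gip da).
apply: filterS (filterI (filterI n1 n2) (filterI (filterI n3 nZy) (cont_near Qyc nB))) => a [[h1 [h2 h3]] [[h4 h5] h6]].
have cs := csim_cmul (a *m g) st; rewrite (Qs cs (kg _ h4)) in h1.
apply: injB => //; apply: csim_trans h5 _; apply: (csim_unitary etaT eta2 ug).
exact: csim_trans (csim_sym cs) (csim_trans (csim_sym h1) h2).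
Qed.

(** Near a fixed line, [b] and [b *m g] have the same image and both stay where the development
    inverts [Q], so [g] fixes all nearby lines; rigidity extends this. *)
Lemma deck_fixed g v : unitary eta g -> (forall b, 0 < S b b -> Q (b *m g) = Q b) -> 0 < S v v ->
 csim (v *m g) v -> forall b, csim (b *m g) b.
move=> ug Qg v0 gv; have [Qc [Z dZ nZ]] := Ql v0.
apply: (rigid_id (a := v) ug); have [[s t]/= [st vE]] := csim_sym gv.
have n1 : \forall b \near v, csim (Z (Q (cmul s t (b *m g)))) (cmul s t (b *m g)).
apply: (cont_near (f := fun a : 'rV[R]_N => cmul s t (a *m g)) _ (P := fun a => csim (Z (Q a)) a)); last by rewrite -vE.
exact: (@cont_comp _ _ _ (fun a => a *m g) (@cmul R m s t) v (@mulmxr_cont R N N g v) (@cmul_cont s t _)).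
have n3 : \forall a \near v, 0 < S a a.
by apply: filterS (filterI nZ (cont_near Qc (isdev_near RM dZ))) => a [/csim_sym/(csim_pos etaT etaJ) h da]; apply: h; rewrite (isdev_gip da).
apply: filterS (filterI (filterI n1 n3) nZ) => b [[h1 h2] h3].
have cs := csim_cmul (b *m g) st.
rewrite (Qs cs) ?(unitary_gip _ _ ug)// Qg// in h1.
exact: csim_trans (csim_sym cs) (csim_trans (csim_sym h1) h3).
Qed.
End Covering.

(** A common rotation of two nonzero complex numbers after which neither is a negative real. The
    conjugate of the first makes it positive; if the second then becomes a negative real, an extra
    quarter turn makes both imaginary. *)
Lemma phase_choice (R : realType) (a1 a2 b1 b2 : R) : a1 ^+ 2 + a2 ^+ 2 != 0 -> b1 ^+ 2 + b2 ^+ 2 != 0 ->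
exists s t, [/\ s ^+ 2 + t ^+ 2 != 0, s * a2 + t * a1 = 0 -> 0 < s * a1 - t * a2
 & s * b2 + t * b1 = 0 -> 0 < s * b1 - t * b2].
move=> a0 b0; have apos : 0 < a1 ^+ 2 + a2 ^+ 2 by rewrite lt_neqAle eq_sym a0 addr_ge0 ?sqr_ge0.
have [h|h] := pselect (a1 * b2 + - a2 * b1 = 0 -> 0 < a1 * b1 - - a2 * b2).
exists a1, (- a2); split=> //; first by rewrite sqrrN.
by move=> _; rewrite (_ : _ - _ = a1 ^+ 2 + a2 ^+ 2)//; ring.
have [q0 p0] : a1 * b2 + - a2 * b1 = 0 /\ a1 * b1 - - a2 * b2 <= 0.
have [q0|q0] := eqVneq (a1 * b2 + - a2 * b1) 0; last by case: h => q1; rewrite q1 eqxx in q0.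
by split=> //; rewrite leNgt; apply/negP => p0; apply: h.
exists a2, a1; split; first by rewrite addrC.
move=> k; exfalso; move: apos; have -> : a1 ^+ 2 + a2 ^+ 2 = a2 * a2 + a1 * a1 by ring.
by rewrite k ltxx.
move=> k; exfalso; have : (a1 ^+ 2 + a2 ^+ 2) * (b1 ^+ 2 + b2 ^+ 2) = 0.
have -> : (a1 ^+ 2 + a2 ^+ 2) * (b1 ^+ 2 + b2 ^+ 2) =
 (a1 * b2 + - a2 * b1) ^+ 2 + (a2 * b2 + a1 * b1) ^+ 2 by ring.
by rewrite q0 k expr0n/= addr0.
by move/eqP; rewrite mulf_eq0 (negbTE a0) (negbTE b0).
Qed.

(** A segment in the plane that starts off 0 can meet 0 only if its endpoint is a nonpositive
    multiple of its origin. *)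
Lemma segment_nonzero (R : realType) (p1 q1 p2 q2 s : R) : p1 ^+ 2 + q1 ^+ 2 != 0 -> 0 <= s <= 1 ->
 (q2 * p1 - p2 * q1 = 0 -> 0 < p2 * p1 + q2 * q1) ->
 ((1 - s) * p1 + s * p2) ^+ 2 + ((1 - s) * q1 + s * q2) ^+ 2 != 0.
move=> n0 /andP[s0 s1] good; apply/eqP => /eqP; rewrite paddr_eq0 ?sqr_ge0// !sqrf_eq0 => /andP[/eqP P /eqP Q].
have n1 : 0 < p1 ^+ 2 + q1 ^+ 2 by rewrite lt_neqAle eq_sym n0 addr_ge0 ?sqr_ge0.
have e1 : s * (q2 * p1 - p2 * q1) = 0.
have -> : s * (q2 * p1 - p2 * q1) = ((1 - s) * q1 + s * q2) * p1 - ((1 - s) * p1 + s * p2) * q1 by ring.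
by rewrite P Q !mul0r subr0.
have e2 : (1 - s) * (p1 ^+ 2 + q1 ^+ 2) + s * (p2 * p1 + q2 * q1) = 0.
have -> : (1 - s) * (p1 ^+ 2 + q1 ^+ 2) + s * (p2 * p1 + q2 * q1) =
 ((1 - s) * p1 + s * p2) * p1 + ((1 - s) * q1 + s * q2) * q1 by ring.
by rewrite P Q !mul0r addr0.
have [s00|sn0] := eqVneq s 0; first by move: e2 n1; rewrite s00 subr0 mul1r mul0r addr0 => ->; rewrite ltxx.
have /good h : q2 * p1 - p2 * q1 = 0 by move/eqP: e1; rewrite mulf_eq0 (negbTE sn0) => /eqP.
have : 0 < (1 - s) * (p1 ^+ 2 + q1 ^+ 2) + s * (p2 * p1 + q2 * q1).
by apply: ltr_wpDl; [rewrite mulr_ge0 ?subr_ge0// ltW|rewrite mulr_gt0// lt_neqAle eq_sym sn0].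
by rewrite e2 ltxx.
Qed.

(** * Extension of the inverse development to the whole positive cone *)

Section Extension.
Variables (R : realType) (m : nat) (eps : R) (M : riemData R (m + m)).
Notation n := (m + m)%N.
Notation N := (m.+1 + m.+1)%N.
Notation JJ := (J0 R m.+1).
Hypotheses (RM : riemannian M).
Variables (J : chart M -> 'rV[R]_n -> 'M[R]_n).
Hypotheses (KJ : kahler J) (eps2 : eps ^+ 2 = 1)
 (curvM : hol_curv eps M J).
Variables (eta : 'M[R]_N).
Hypotheses (etaT : eta^T = eta) (etaJ : JJ *m eta = eta *m JJ) (eta2 : eta *m eta = 1%:M).
Implicit Types (p x : M) (Z : M -> 'rV[R]_N) (w : 'rV[R]_n) (a b v y z e : 'rV[R]_N).
Notation S := (gip eta).
Notation isdev := (isdev eps J eta).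
Notation aframe := (aframe eps eta).
Notation aff := (aff eps eta).
Notation den := (den eta).
Notation lift := lift_aff.
Notation lid := (lifts eps J eta (X := 'rV[R]_N) id).
Notation dom w := (0 < 1 + eps * sqnorm w).
Hypotheses (complete : complete_riem M) (m0 : (0 < m)%N).
Variables (C Sn ang : R -> R).
Hypotheses (tr : modeltrig eps C Sn) (an : modelangle eps C Sn ang).

Lemma den_csim2 e e' z : csim e e' -> den e z != 0 -> den e' z != 0.
move=> [[s t]/= [st ->]]; rewrite !denE /re /im cmulJ /cmul !gipDr// !gipZr//.
have -> : S z (e' *m JJ *m JJ) = - S z e'.
by rewrite -mulmxA J0_sq mulmxN mulmx1 (gipC etaT) /gip !mulNmx mxE -/(gip eta e' z) (gipC etaT).
set p := S z e'; set q := S z (e' *m JJ).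
have -> : (s * p + t * q) ^+ 2 + (s * q + t * - p) ^+ 2 = (s ^+ 2 + t ^+ 2) * (p ^+ 2 + q ^+ 2) by ring.
by rewrite mulf_eq0 negb_or => /andP[].
Qed.

Lemma affine_lid e L q z : aframe e L -> (forall w, dom w -> \forall b \near w, lifts eps J eta (lift e L) q b) ->
 den e z != 0 -> 0 < S z z -> lid (fun y => q (aff e L y)) z.
move=> F ql d0 z0; have s1 := lift_aff_csim eps2 etaT etaJ F d0.
have dz : dom (aff e L z) by rewrite -(gip_lift etaT F); apply: (csim_pos etaT etaJ s1).
have [qc [Z dZ nZ]] := nbhs_singleton (ql _ dz).
have ac := aff_cont eps2 etaT etaJ F d0; split; first exact: cont_comp ac qc.
exists Z => //; apply: filterS (filterI (cont_near ac nZ) (den_near_pt d0)) => y [h1 h2].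
exact: csim_trans h1 (lift_aff_csim eps2 etaT etaJ F h2).
Qed.
Variables (e : 'rV[R]_N) (L : 'M[R]_(n, N)) (p0 : M).
Hypotheses (F : aframe e L).

Lemma affine_development : exists2 Q : 'rV[R]_N -> M,
 forall z, den e z != 0 -> 0 < S z z -> lid Q z & forall y z, csim y z -> Q y = Q z.
have [Z0 [dZ0 Z0p]] := isdev_exists RM KJ curvM etaT etaJ p0 F.
have [q [_ _ ql]] := exponential RM KJ eps2 curvM etaT etaJ eta2 F tr an complete m0 dZ0 Z0p.
exists (fun z => q (aff e L z)); first by move=> z; exact: affine_lid F ql.
by move=> y z /(aff_csim eps etaJ e L) ->.
Qed.

(** The form is negative on the complement of [e], so the positive cone avoids the hyperplane at
    infinity and one affine chart suffices. *)
Lemma hyperbolic_den z : eps = -1 -> 0 < S z z -> den e z != 0.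
move=> e1; apply: contraL => /eqP d0; rewrite -leNgt (af_decomp eps2 etaT etaJ F z).
have [-> ->] : re eta e z = 0 /\ im eta e z = 0.
by move/eqP: d0; rewrite denE paddr_eq0 ?sqr_ge0// !sqrf_eq0 => /andP[/eqP -> /eqP ->].
rewrite /cmul !scale0r !add0r scalemxAl (gip_L F) e1 mulN1r oppr_le0.
exact: sqnorm_ge0.
Qed.
Hypotheses (pos : forall z, z != 0 -> 0 < S z z).

Lemma den_neq0 y z : den y z != 0 -> 0 < S z z.
by move=> d; apply: pos; apply: contraNneq d => ->; rewrite denE /re /im /gip !mul0mx !mxE expr0n/= addr0. Qed.

Section Glue.
Variables (Q0 : 'rV[R]_N -> M).
Hypotheses (Q0l : forall z, den e z != 0 -> 0 < S z z -> lid Q0 z)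
 (Q0s : forall y z, csim y z -> Q0 y = Q0 z).

(** The same construction started from [Q0 y]: its affine chart is the complement of the hyperplane
    orthogonal to [y], and it agrees with [Q0] near [y] by local injectivity. *)
Lemma extension_at y : den e y != 0 -> exists f : 'rV[R]_N -> M, [/\ forall z, den y z != 0 -> lid f z,
 forall b z, csim b z -> f b = f z & \forall z \near y, f z = Q0 z].
move=> d0; have [Qc [Z dZ nZ]] := Q0l d0 (den_neq0 d0).
have [L' F'] := isdev_frame RM KJ dZ; set e' := Z _ in F'.
have [q [q0 nq ql]] := exponential RM KJ eps2 curvM etaT etaJ eta2 F' tr an complete m0 dZ (erefl e').
have ye : csim y e' := csim_sym (nbhs_singleton nZ).
pose f z := q (aff e' L' z).
have fl z : den y z != 0 -> lid f z.
by move=> dz; apply: (affine_lid F' ql (den_csim2 ye dz)); exact: den_neq0 dz.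
have e'0 : lift e' L' 0 = e' by rewrite /lift mul0mx addr0.
have ay : aff e' L' y = 0.
by rewrite (aff_csim eps etaJ e' L' ye) -{2}e'0 (aff_lift eps2 etaT etaJ F').
have fs b z : csim b z -> f b = f z by move=> h; rewrite /f (aff_csim eps etaJ e' L' h).
exists f; split=> //.
have [B nB injB] := isdev_injective RM KJ eps2 etaT etaJ dZ.
have de : den e' y != 0.
by apply: (den_csim etaJ ye); rewrite -{2}e'0; exact: den_lift_neq0 etaT etaJ _ _ _ F'.
have ac := aff_cont eps2 etaT etaJ F' de; rewrite -ay in nq.
have [fc _] : lid f y by apply: (affine_lid F' ql de); exact: den_neq0 d0.
have n1 : \forall z \near y, B (f z) by apply: (cont_near fc); rewrite /f ay q0.
apply: filterS (filterI (filterI (cont_near ac nq) (den_near_pt de)) (filterI (filterI n1 nZ) (cont_near Qc nB))).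
move=> z [[h1 h2] [[h3 h4] h5]]; apply: injB => //.
apply: csim_trans h1 (csim_trans (lift_aff_csim eps2 etaT etaJ F' h2) (csim_sym h4)).
Qed.
Let E0 : exists E : 'rV[R]_N -> 'rV[R]_N -> M, forall y, den e y != 0 -> [/\ forall z, den y z != 0 -> lid (E y) z,
 forall b z, csim b z -> E y b = E y z & \forall z \near y, E y z = Q0 z].
have ex y : exists f : 'rV[R]_N -> M, den e y != 0 -> [/\ forall z, den y z != 0 -> lid f z,
 forall b z, csim b z -> f b = f z & \forall z \near y, f z = Q0 z].
have [d0|d0] := pselect (den e y != 0); last by exists Q0 => /d0.
by have [f] := extension_at d0; exists f.
by have [E HE] := choice ex; exists E.
Qed.

Lemma re_im_line e1 y z (s : R) : re eta e1 (y + s *: (z - y)) = (1 - s) * re eta e1 y + s * re eta e1 z.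
have -> : y + s *: (z - y) = (1 - s) *: y + s *: z by mxlin.
by rewrite /re gipDl !gipZl.
Qed.

(** The complement of two hyperplanes is to be joined by a path. After multiplying z by a suitable
    complex number, which changes neither value, the segment from y to z avoids both. *)
Lemma agree f y z : (forall z, den y z != 0 -> lid f z) -> (forall b z, csim b z -> f b = f z) ->
 (\forall z \near y, f z = Q0 z) -> den e y != 0 -> den e z != 0 -> den y z != 0 -> f z = Q0 z.
move=> fl fs ny ey ez yz; have y0 := den_neq0 ey; have imre u b : im eta u b = re eta (u *m JJ) b by [].
have yy : re eta y y = S y y by [].
have yJ : im eta y y = 0 by rewrite /im (gipC etaT); exact: gip_self_J.
have dyy : re eta y y ^+ 2 + im eta y y ^+ 2 != 0 by rewrite yJ expr0n addr0 expf_neq0// yy gt_eqF.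
pose pe := re eta e y; pose qe := im eta e y; pose pz := re eta e z; pose qz := im eta e z.
have a0 : (pz * pe + qz * qe) ^+ 2 + (qz * pe - pz * qe) ^+ 2 != 0.
have -> : (pz * pe + qz * qe) ^+ 2 + (qz * pe - pz * qe) ^+ 2 = (pz ^+ 2 + qz ^+ 2) * (pe ^+ 2 + qe ^+ 2) by ring.
by rewrite mulf_neq0// -denE.
have [s [t [st g1 g2]]] := phase_choice a0 yz.
pose z' := cmul s t z; have zz' : csim z' z := csim_cmul z st.
pose c (u : R) := y + u *: (z' - y).
have dc u : 0 <= u <= 1 -> den e (c u) != 0 /\ den y (c u) != 0.
move=> u01; rewrite !denE !imre !re_im_line -!imre; split.
apply: segment_nonzero => //; rewrite /z' re_cmul// im_cmul// -/pe -/qe -/pz -/qz => h.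
have -> : (s * pz - t * qz) * pe + (s * qz + t * pz) * qe = s * (pz * pe + qz * qe) - t * (qz * pe - pz * qe) by ring.
by apply: g1; rewrite -h; ring.
apply: segment_nonzero => //; rewrite /z' re_cmul// im_cmul// yJ yy !mulr0 subr0 addr0 => h.
rewrite mulr_gt0//; apply: g2; move/eqP: h; rewrite mulf_eq0 => /orP[/eqP //|].
by rewrite gt_eqF.
have h1 : 0 <= (1 : R) <= 1 by rewrite ler01 lexx.
have c0 : c 0 = y by rewrite /c scale0r addr0.
have n0 : \forall b \near c 0, f b = Q0 b by rewrite c0.
have cc (u : R) : {for u, continuous c} by exact: cont_line.
have := lifts_path RM KJ eps2 etaT etaJ eta2 (rigid_id eps2 etaT etaJ F m0) (f := f) (f' := Q0) (fun u _ => cc u)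
 (fun u u01 => conj (fl _ (dc u u01).2) (Q0l (dc u u01).1 (den_neq0 (dc u u01).1))) n0 h1.
by move=> /nbhs_singleton; rewrite /c scale1r addrC subrK (fs _ _ zz') (Q0s zz').
Qed.

(** Points at infinity are reached from the auxiliary centre [e + z]. Two auxiliary maps agree with
    [Q0] off its hyperplane, hence everywhere on their common domain by density and uniqueness of
    lifts. *)
Lemma glue : exists2 Q : 'rV[R]_N -> M,
 forall z, 0 < S z z -> lid Q z & forall y z, csim y z -> 0 < S z z -> Q y = Q z.
have [E HE] := E0.
have ag y z : den e y != 0 -> den e z != 0 -> den y z != 0 -> E y z = Q0 z.
by move=> ey; have [h1 h2 h3] := HE y ey; exact: agree.
have ag2 y y' b : den e y != 0 -> den e y' != 0 -> den y b != 0 -> den y' b != 0 -> E y b = E y' b.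
move=> ey ey' yb yb'; have [h1 _ _] := HE y ey; have [h2 _ _] := HE y' ey'.
have fr A : nbhs b A -> exists2 b1, A b1 & \forall b2 \near b1, E y b2 = E y' b2.
move=> nA; have [b1 k d1] := den_dense F (nbhs_interior (filterI nA (filterI (den_near_pt yb) (den_near_pt yb')))).
exists b1; first by have [] := nbhs_singleton k.
by apply: filterS (filterI k (den_near_pt d1)) => b2 [[_ [k1 k2]] k3]; rewrite ag// ag.
exact: nbhs_singleton (lifts_agree RM KJ eps2 etaT etaJ eta2 (rigid_id eps2 etaT etaJ F m0) (h1 b yb) (h2 b yb') fr).
pose Q z := if den e z != 0 then Q0 z else E (e + z) z.
(* For [z] orthogonal to [e], the products of [e + z] with [e] and with [z] have real parts 1 and
   S(z, z), so neither vanishes. *)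
have ez z : den e z = 0 -> 0 < S z z -> den e (e + z) != 0 /\ den (e + z) z != 0.
move=> /eqP; rewrite denE paddr_eq0 ?sqr_ge0// !sqrf_eq0 => /andP[/eqP r0 /eqP i0] z0.
have ee : S e e = 1 by rewrite /gip (af_ee F) mxE eqxx.
have eJ : im eta e e = 0 by rewrite /im (gipC etaT); exact: gip_self_J.
split; rewrite denE.
have -> : re eta e (e + z) = 1 by rewrite /re gipDl ee -/(re eta e z) r0 addr0.
by rewrite gt_eqF// expr1n ltr_pwDl// sqr_ge0.
have -> : re eta (e + z) z = S z z by rewrite /re gipDr// -/(re eta e z) r0 add0r.
by rewrite gt_eqF// ltr_pwDl ?exprn_gt0// sqr_ge0.
have Qs y z : csim y z -> 0 < S z z -> Q y = Q z.
move=> yz z0; have y0 := csim_pos etaT etaJ yz z0; rewrite /Q.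
have [d|d] := eqVneq (den e z) 0; last by rewrite (den_csim etaJ yz d)/= (Q0s yz).
have d' : den e y = 0 by apply/eqP; apply/negPn/negP => h; have := den_csim etaJ (csim_sym yz) h; rewrite d eqxx.
have [k1 k2] := ez z d z0; have [k3 k4] := ez y d' y0; have [_ h _] := HE _ k1.
by rewrite d' eqxx/= (ag2 _ _ y k3 k1 k4 (den_csim etaJ yz k2)); exact: h.
exists Q => // z z0; have [d|d] := eqVneq (den e z) 0.
have [k1 k2] := ez z d z0; have [h _ _] := HE _ k1.
apply: (lifts_congr _ (h z k2)).
have n0 : \forall b \near z, 0 < S b b by apply: filterS (den_near_pt k2) => b; exact: den_neq0.
apply: filterS (filterI n0 (den_near_pt k2)) => b [b0 h1]; rewrite /Q.
have [d'|d'] := eqVneq (den e b) 0; last by rewrite ag.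
by have [k3 k4] := ez b d' b0; apply: ag2.
apply: (lifts_congr _ (Q0l d z0)); apply: filterS (den_near_pt d) => b h.
by rewrite /Q h.
Qed.
End Glue.

Lemma elliptic_development : exists2 Q : 'rV[R]_N -> M,
 forall z, 0 < S z z -> lid Q z & forall y z, csim y z -> 0 < S z z -> Q y = Q z.
by have [Q Ql Qs] := affine_development; exact: glue Ql Qs. Qed.
End Extension.

Lemma smooth_local (R : realType) n (U : set 'rV[R]_n) (f : 'rV[R]_n -> R) :
 (forall x, U x -> exists V g, [/\ open V, V x, smooth V g & forall y, V y -> f y = g y]) -> smooth U f.
move=> H k; elim: k f H => [|k IH] f H; split=> //.
- by move=> x /H[V [g [oV Vx sg fg]]]; apply: (Ck_cont (Ck_ext oV (fun y Vy => esym (fg y Vy)) (sg 0%N))).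
- by move=> x /H[V [g [oV Vx sg fg]]]; apply: (Ck_cont (Ck_ext oV (fun y Vy => esym (fg y Vy)) (sg 0%N))).
move=> i; split=> [x /H[V [g [oV Vx sg fg]]]|].
by have [d _] := (Ck_ext oV (fun y Vy => esym (fg y Vy)) (sg 1%N)).2 i; exact: d.
apply: IH => x /H[V [g [oV Vx sg fg]]]; exists V, (partial g i); split=> //.
exact: smooth_partial.
by move=> y Vy; apply: partial_near; exact: open_near oV Vy fg.
Qed.

Transparent partial.

(** * Scaling of the metric and the trigonometric functions of the two models *)

Section Scaling.
Variables
 (R : realType) (m : nat) (M : riemData R (m + m)) (J : chart M -> 'rV[R]_(m + m) -> 'M[R]_(m + m)).
Notation n := (m + m)%N.
Hypotheses (RM : riemannian M) (KJ : kahler J).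
Variables (k : R).
Hypotheses (k0 : 0 < k).
Notation sM := (scale k M).
Let kn0 : k != 0. by rewrite gt_eqF. Qed.
Lemma scale_riemannian : riemannian sM.
have [h1 h2 h3 h4 h5 h6 h7 h8 h9 sg symg posg trg] := RM.
split=> //.
- move=> c i j l; apply: (Ck_ext (h5 c) (f := fun x => k * @metric R n M c x i j)); first by move=> x _; rewrite /= [RHS]mxE.
by apply: (CkM (h5 c) (f := fun=> k)); [exact: Ck_cst|exact: sg].
- by move=> c x cx; rewrite /= linearZ/= symg.
- by move=> c x v cx v0; rewrite /= -scalemxAr -scalemxAl mxE mulr_gt0// posg.
- by move=> c d x cx; rewrite /= (trg c d x cx) -scalemxAr -scalemxAl.
Qed.

(** The factor of the derivatives of the metric cancels against that of its inverse; geodesics,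
    parallel tensors and [curvmx] are thus unchanged. *)
Lemma christoffel_scale (c : chart M) l i j x : cimg c x ->
 @christoffel R n sM c l i j x = @christoffel R n M c l i j x.
move=> cx; rewrite /christoffel; congr (_ * _); apply: eq_bigr => a _.
have dp b d i' : partial (fun y => (k *: metric c y) b d) i' x = k * partial (fun y => metric c y b d) i' x.
have -> : (fun y => (k *: metric c y) b d) = k \*: (fun y => metric c y b d).
by apply/funext => y; rewrite !mxE.
have [df _] := (riem_metric_smooth RM c b d 1%N).2 i'.
by rewrite /partial deriveZ//; exact: df.
have iE : invmx (k *: metric c x) l a = k^-1 * invmx (metric c x) l a.
by rewrite invmxZ ?mxE// unitmxZ ?unitfE// (metric_unit RM cx).
by rewrite /= !dp iE -!mulrDr -mulrBr mulrACA mulVf// mul1r.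
Qed.

Lemma scale_complete : complete_riem M -> complete_riem sM.
move=> H c p v cp; have [g [[gc gg] g0 gv]] := H c p v cp; exists g; split; [|exact: g0|exact: gv].
split; first exact: gc.
move=> d t dt l x; have [d1 d2 E] := gg d t dt l; split; [exact: d1|exact: d2|].
apply: etrans E; apply: f_equal2; first by [].
apply: eq_bigr => i _; apply: eq_bigr => j _; rewrite christoffel_scale//.
exact: (@cimg_coord R n M d (g t) dt).
Qed.

Lemma scale_kahler : @kahler R n sM J.
have [h1 h2 h3 h4 h5] := KJ; split=> //.
- by move=> c x cx; rewrite /= -scalemxAr -scalemxAl h3.
- move=> c x cx l i j; rewrite -[RHS](h5 c x cx l i j); congr (_ + _); apply: eq_bigr => a _.
by rewrite !christoffel_scale.
Qed.

Lemma curvmx_scale c i j x : cimg c x -> @curvmx R n sM c i j x = @curvmx R n M c i j x.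
move=> cx; have cE l y : cimg c y -> @conn R n sM c l y = @conn R n M c l y.
by move=> cy; apply/matrixP => a b; rewrite !connE christoffel_scale.
by rewrite !curvmx.unlock !cE// !(dmx_open _ (@open_cimg _ _ _ RM c) (cE _) cx).
Qed.

Lemma holmx_scale c i j x : @holmx R m sM J c i j x = k *: @holmx R m M J c i j x.
rewrite /holmx /kform /= -scalemxAr mxE -scalemxAl scalerDr !scalerA; congr (_ *: _ + _).
by ring.
Qed.
End Scaling.

Opaque partial.

Lemma elliptic_trig (R : realType) : modeltrig 1 (@cos R) (@sin R) /\ modelangle 1 (@cos R) (@sin R) (@atan R).
split; split.
- by move=> t; apply/sder_is; rewrite mulN1r; exact: is_derive_cos.
- by move=> t; apply/sder_is; exact: is_derive_sin.
- exact: cos0.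
- exact: sin0.
- by move=> t; rewrite mul1r cos2Dsin2.
- by move=> s t; rewrite mul1r cosD.
- by move=> s t; rewrite sinD.
- exact: atan0.
- by move=> s _; rewrite cos_atan invr_neq0// gt_eqF// sqrtr_gt0 ltr_pwDl// sqr_ge0.
- move=> s _; have c0 : cos (atan s) != 0 by rewrite cos_atan invr_neq0// gt_eqF// sqrtr_gt0 ltr_pwDl// sqr_ge0.
by rewrite -{2}[s]atanK /tan divfK.
- by move=> s _; exact: continuous_atan.
Qed.

Section HyperbolicTrig.
Variables (R : realType).
Let ch (t : R) := (expR t + expR (- t)) / 2.
Let sh (t : R) := (expR t - expR (- t)) / 2.
Let ath (s : R) := (ln (1 + s) - ln (1 - s)) / 2.
Let dexpN (t : R) : is_derive t 1 (fun t : R => expR (- t)) (- expR (- t)).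
have h : is_derive t 1 (fun t : R => - t) (-1) by apply: is_deriveN.
have := @is_derive1_comp R expR (fun t : R => - t) t _ _ (is_derive_expR (- t)) h.
by rewrite mulrN1.
Qed.
Let half (f : R -> R) (t df : R) : is_derive t 1 f df -> sder (fun t : R => f t / 2) t (df / 2).
move=> h; apply/sder_is; have -> : (fun t : R => f t / 2) = 2^-1 \*: f by apply/funext => s; rewrite mulrC.
by rewrite mulrC; exact: is_deriveZ.
Qed.
Let ath_bound (s : R) : 0 < 1 + -1 * s ^+ 2 -> -1 < s < 1.
rewrite mulN1r subr_gt0 => h; have : `|s| ^+ 2 < 1 ^+ 2 by rewrite real_normK ?num_real// expr1n.
by rewrite ltr_pXn2r ?nnegrE// ltr_norml.
Qed.

(** Hyperbolic cosine and sine, and the inverse hyperbolic tangent on ]-1, 1[. *)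
Lemma hyperbolic_trig : exists C Sn ang, modeltrig (-1) C Sn /\ @modelangle R (-1) C Sn ang.
have eN (t : R) : expR t * expR (- t) = 1 by rewrite -expRD subrr expR0.
exists ch, sh, ath; split; split.
- move=> t; rewrite opprK mul1r.
by have := half (is_deriveD (is_derive_expR t) (dexpN t)).
- move=> t; have := half (is_deriveB (is_derive_expR t) (dexpN t)).
by rewrite opprK.
- by rewrite /ch oppr0 expR0 -mulr2n -mulr_natr mul1r mulfV.
- by rewrite /sh oppr0 subrr mul0r.
- move=> t; have -> : ch t ^+ 2 + -1 * sh t ^+ 2 = expR t * expR (- t) by rewrite /ch /sh; field.
exact: eN.
- by move=> s t; rewrite /ch /sh opprD !expRD; field.
- by move=> s t; rewrite /ch /sh opprD !expRD; field.
- by rewrite /ath addr0 subr0 subrr mul0r.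
- by move=> s _; rewrite /ch gt_eqF// divr_gt0// addr_gt0// expR_gt0.
- move=> s /ath_bound/andP[s1 s2].
have [p1 p2] : 0 < 1 + s /\ 0 < 1 - s by split; rewrite ?subr_gt0// -ltrBlDl sub0r.
set E := expR (ath s); have E0 : E != 0 by rewrite gt_eqF// expR_gt0.
have EE : E ^+ 2 * (1 - s) = 1 + s.
rewrite expr2 /E -expRD (_ : ath s + ath s = ln (1 + s) - ln (1 - s)); last by rewrite /ath; field.
by rewrite expRD expRN !lnK ?posrE// mulfVK// gt_eqF.
rewrite /ch /sh expRN -/E; apply/eqP; rewrite -subr_eq0.
have -> : (E - E^-1) / 2 - s * ((E + E^-1) / 2) = (E ^+ 2 * (1 - s) - (1 + s)) / (2 * E) by field.
by rewrite EE subrr mul0r.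
- move=> s /ath_bound/andP[s1 s2].
have [p1 p2] : 0 < 1 + s /\ 0 < 1 - s by split; rewrite ?subr_gt0// -ltrBlDl sub0r.
apply: (cont_comp (f := fun s : R => ln (1 + s) - ln (1 - s)) (g := fun t => t / 2)); last exact: mulrr_continuous.
apply: continuousB.
by apply: (cont_comp (g := @ln R) (f := fun s : R => 1 + s)); [exact: cont_addl|exact: continuous_ln].
apply: (cont_comp (g := @ln R) (f := fun s : R => 1 - s)); last exact: continuous_ln.
by apply: continuousB; [exact: cst_continuous|exact: cvg_id].
Qed.
End HyperbolicTrig.

(** * Standard affine charts and the local form of the covering *)

Section StandardFrames.
Variables (R : realType) (m : nat) (eps : R).
Hypotheses (eps2 : eps ^+ 2 = 1).
Variables (k : 'I_m.+1).
Notation JJ := (J0 R m.+1).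

Definition std_e : 'rV[R]_(m.+1 + m.+1) := row_mx (delta_mx 0 k) 0.
Definition std_A : 'M[R]_(m, m.+1) := \matrix_(j, i) (i == lift k j)%:R.
Definition std_L : 'M[R]_(m + m, m.+1 + m.+1) := block_mx std_A 0 0 std_A.
(** Diagonal, with 1 at the place [k] and [eps] elsewhere. *)
Definition std_D : 'M[R]_m.+1 := eps%:M + (1 - eps) *: delta_mx k k.
Definition std_eta : 'M[R]_(m.+1 + m.+1) := block_mx std_D 0 0 std_D.
Let kA : (delta_mx 0 k : 'rV[R]_m.+1) *m std_A^T = 0.
by apply/rowP => j; rewrite -rowE !mxE (negbTE (neq_lift _ _)). Qed.
Let dd p (i : 'I_p) : (delta_mx i k : 'M[R]_(p, m.+1)) *m delta_mx k k = delta_mx i k.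
exact: mul_delta_mx. Qed.
Let Ad : std_A *m (delta_mx k k : 'M[R]_m.+1) = 0.
apply: trmx_inj; rewrite trmx_mul trmx_delta -(mul_delta_mx (0 : 'I_1)) -mulmxA kA mulmx0 trmx0.
by [].
Qed.

Lemma std_eta_props : [/\ std_eta^T = std_eta, JJ *m std_eta = std_eta *m JJ & std_eta *m std_eta = 1%:M].
split; rewrite /std_eta.
- by rewrite tr_block_mx !trmx0 /std_D linearD/= linearZ/= tr_scalar_mx trmx_delta.
- by rewrite /J0 !mulmx_block !mul0mx !mulmx0 !add0r !addr0 mulmxN mulNmx mul1mx mulmx1.
- rewrite mulmx_block !mul0mx !mulmx0 !addr0 !add0r [RHS]scalar_mx_block.
suff -> : std_D *m std_D = 1%:M by [].
rewrite /std_D mulmxDl !mulmxDr -!scalemxAr -!scalemxAl dd !mul_scalar_mx !mul_mx_scalar !scalerA.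
rewrite scale_scalar_mx -expr2 eps2 -!addrA -!scalerDl -[RHS]addr0; congr (_ + _).
rewrite (_ : (1 - eps) * eps + _ = 1 - eps ^+ 2); last by ring.
by rewrite eps2 subrr scale0r.
Qed.

Lemma std_frame : aframe eps std_eta std_e std_L.
have kD : (delta_mx 0 k : 'rV[R]_m.+1) *m std_D = delta_mx 0 k.
by rewrite /std_D mulmxDr -scalemxAr dd mul_mx_scalar -scalerDl addrC subrK scale1r.
have AA : std_A *m std_A^T = 1%:M.
apply/matrixP => i j; rewrite !mxE (bigD1 (lift k i))//= !mxE eqxx mul1r (inj_eq lift_inj) big1 ?addr0//.
by move=> a /negbTE h; rewrite !mxE h mul0r.
have AD : std_A *m std_D = eps *: std_A by rewrite /std_D mulmxDr -scalemxAr Ad scaler0 addr0 mul_mx_scalar.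
have eE : std_e *m std_eta = std_e by rewrite /std_e /std_eta mul_row_block !mulmx0 !mul0mx !addr0 kD.
split.
- by rewrite eE /std_e tr_row_mx mul_row_col trmx0 mulmx0 addr0 trmx_delta mul_delta_mx; apply/matrixP => i j; rewrite !ord1 !mxE.
- rewrite /std_L /std_eta tr_block_mx !trmx0 !mulmx_block !(mul0mx, mulmx0, addr0, add0r) AD -scalemxAl AA.
by rewrite [RHS]scalar_mx_block scalemx1.
- by rewrite eE /std_e /std_L tr_block_mx !trmx0 mul_row_block !mulmx0 !mul0mx !addr0 kA row_mx0.
- by rewrite /std_L /J0 !mulmx_block !mul0mx !mulmx0 !add0r !addr0 mulmxN mulNmx mul1mx mulmx1.
Qed.
End StandardFrames.

Lemma cont_set_type (T X : topologicalType) (A : set T) (f : X -> A) x :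
 {for x, continuous (fun y => val (f y))} -> {for x, continuous f}.
move=> h C; rewrite nbhsE => -[D [[U oU UD] Dx] DC].
have nU : nbhs (val (f x)) U by apply: open_nbhs_nbhs; split=> //; move: Dx; rewrite -UD.
have h' : \forall y \near x, C (f y) by apply: filterS (cont_near h nU) => y Uy; apply: DC; rewrite -UD.
exact: h'.
Qed.

Lemma jac_local (R : realType) n p (V : set 'rV[R]_n) (f h : 'rV[R]_n -> 'rV[R]_p) x :
 open V -> mxsmooth V h -> V x -> (forall y, V y -> f y = h y) -> 'J f x = 'J h x.
move=> oV /(smooth_Ck 1) h1 Vx E; apply: (jac_near_C1 oV _ Vx oV h1 Vx); last exact: open_near oV Vx E.
by apply: (mxCk_ext oV _ h1) => y /E.
Qed.

Section LocalStructure.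
Variables (R : realType) (m : nat) (eps : R) (M : riemData R (m + m)).
Notation n := (m + m)%N.
Notation N := (m.+1 + m.+1)%N.
Notation JJ := (J0 R m.+1).
Hypotheses (RM : riemannian M).
Variables (J : chart M -> 'rV[R]_n -> 'M[R]_n).
Hypotheses (KJ : kahler J) (eps2 : eps ^+ 2 = 1)
 (curvM : hol_curv eps M J).
Variables (eta : 'M[R]_N).
Hypotheses (etaT : eta^T = eta) (etaJ : JJ *m eta = eta *m JJ) (eta2 : eta *m eta = 1%:M) (m0 : (0 < m)%N).
Implicit Types (Z : M -> 'rV[R]_N) (w : 'rV[R]_n).
Notation S := (gip eta).
Notation aff := (aff eps eta).
Notation lift := lift_aff.
Variables (e : 'rV[R]_N) (L : 'M[R]_(n, N)).
Hypotheses (F : aframe eps eta e L).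
Variables (Q : 'rV[R]_N -> M).
Hypotheses (Ql : forall z, 0 < S z z -> lifts eps J eta (X := 'rV[R]_N) id Q z)
 (Qs : forall y z, csim y z -> 0 < S z z -> Q y = Q z).

(** Combines the local isometry of a development with the fact that the development is a local
    inverse of [Q]: in a chart, [Q] is the inverse [h] of a developed affine coordinate [W]. *)
Lemma local_structure w0 c : 0 < S (lift e L w0) (lift e L w0) -> cdom c (Q (lift e L w0)) ->
exists U V h W, [/\ [/\ open U, open V, V w0 & U `<=` cimg c],
 forall x, U x -> [/\ V (W x), h (W x) = x & Q (lift e L (W x)) = param c x],
 forall w, V w -> [/\ U (h w), W (h w) = w, 0 < S (lift e L w) (lift e L w) & param c (h w) = Q (lift e L w)],
 mxsmooth U W /\ mxsmooth V h & forall x, U x -> metric c x = 'J W x *m model_metric eps (W x) *m ('J W x)^T].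
move=> k0 cQ; have [Z [dZ nZ nQ]] := covering_near RM KJ eps2 etaT etaJ Ql Qs k0.
have s0 := nbhs_singleton nZ.
have dn0 := den_csim etaJ s0 (den_lift_neq0 etaT etaJ w0 F).
have [U0 [V0 [h [[oU0 U0p U0c oV0] HU HV [sW sh] HM]]]] := isdev_local RM KJ eps2 etaT etaJ dZ cQ F dn0.
pose W x := aff e L (Z (param c x)).
have Wp : W (coord c (Q (lift e L w0))) = w0.
by rewrite /W (riem_coordK RM cQ) (aff_csim eps etaJ e L s0) (aff_lift eps2 etaT etaJ F).
have [_ _ Vp hp] := HU _ U0p; rewrite -/(W _) Wp in Vp hp.
have oP : \forall x \near coord c (Q (lift e L w0)), Q (Z (param c x)) = param c x.
apply: (cont_near (P := fun p => Q (Z p) = p) (param_cont RM (cimg_coord cQ))).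
by rewrite (riem_coordK RM cQ).
have [r r0 Hr] := near_ball (filterI (open_near oU0 U0p (fun y h => h)) oP).
pose x0 := coord c (Q (lift e L w0)).
pose U := [set x : 'rV[R]_n | `|x - x0| < r].
have oU : open U by exact: open_ball_norm.
have HU' x : U x -> U0 x /\ Q (Z (param c x)) = param c x by rewrite /U /= distrC => /Hr[].
pose V := V0 `&` h @^-1` U.
have oV : open V.
rewrite openE => w [V0w Uw]; apply: filterI; first exact: open_near oV0 V0w (fun y h => h).
exact: (cont_near (mxCk_cont (smooth_Ck 0 sh) V0w) (open_near oU Uw (fun y h => h))).
have Ux x : U x -> [/\ V (W x), h (W x) = x & Q (lift e L (W x)) = param c x].
move=> /[dup] Ux /HU'[U0x Qx]; have [dx dnx V0x hx] := HU x U0x; split=> //.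
by split=> //; rewrite /= hx.
rewrite -[RHS]Qx; apply: Qs; first exact: lift_aff_csim.
by rewrite (isdev_gip dx).
have U0s : U `<=` U0 by move=> x /HU'[].
exists U, V, h, W; split=> //.
- split=> //; last by move=> x /U0s; exact: U0c.
by split=> //; rewrite /= hp /U /= subrr normr0.
- move=> w [V0w Uw]; have [_ hw] := HV w V0w; have [dx dnx _ _] := HU _ (U0s _ Uw).
have [_ _ Qw] := Ux _ Uw; have Whw : W (h w) = w by [].
split=> //; last by rewrite -Qw Whw.
rewrite -{1 2}Whw; apply: (csim_pos etaT etaJ (lift_aff_csim eps2 etaT etaJ F dnx)).
by rewrite (isdev_gip dx).
- split; first exact: mxsmooth_sub U0s sW.
by apply: mxsmooth_sub sh => w [].
- by move=> x /U0s; exact: HM.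
Qed.

Lemma local_metric w0 c : 0 < S (lift e L w0) (lift e L w0) -> cdom c (Q (lift e L w0)) ->
exists V h, [/\ [/\ open V, V w0, mxsmooth V h & forall w, V w -> cimg c (h w)],
 forall w, V w -> 0 < S (lift e L w) (lift e L w) /\ coord c (Q (lift e L w)) = h w &
 forall w, V w -> model_metric eps w = 'J h w *m metric c (h w) *m ('J h w)^T].
move=> k0 cQ; have [U [V [h [W [[oU oV Vw0 Uc] HU HV [sW sh] HM]]]]] := local_structure k0 cQ.
exists V, h; split; [by split=> // w /HV[/Uc]| |].
by move=> w /HV[/Uc cw _ Sw Qw]; split=> //; rewrite -Qw; have [_ ->] := cimg_param RM cw.
move=> w Vw; have [Uh Wh _ _] := HV w Vw.
have E : 'J h w *m 'J W (h w) = 1%:M.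
have h1 := smooth_Ck 1 sh; have W1 := smooth_Ck 1 sW.
rewrite -(jac_comp oV oU _ h1 W1 Vw); last by move=> y /HV[].
rewrite -(jac_id w); apply: (jac_near_C1 oV _ Vw oV _ Vw).
 - by apply: (mxCk_comp oV oU _ h1 W1) => y /HV[].
 - by move=> i j; rewrite ord1; exact: Ck_coord.
 - by apply: open_near oV Vw _ => y /HV[].
rewrite (HM _ Uh) Wh !mulmxA E mul1mx -mulmxA -trmx_mul E trmx1 mulmx1.
by [].
Qed.
End LocalStructure.

Lemma std_gip (R : realType) m (eps : R) (k : 'I_m.+1) : eps ^+ 2 = 1 -> forall w : 'rV[R]_(m + m),
 gip (std_eta eps k) (lift_aff (std_e R k) (std_L R k) w) (lift_aff (std_e R k) (std_L R k) w) = 1 + eps * sqnorm w.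
by move=> e2 w; have [h1 _ _] := std_eta_props e2 k; rewrite (gip_lift h1 (std_frame eps k)). Qed.

(** * The hyperbolic case: the deck group on the ball *)

Section HyperbolicQuotient.
Variables (R : realType) (m : nat) (M : riemData R (m + m)).
Notation n := (m + m)%N.
Notation N := (m.+1 + m.+1)%N.
Notation JJ := (J0 R m.+1).
Hypotheses (RM : riemannian M).
Variables (J : chart M -> 'rV[R]_n -> 'M[R]_n).
Hypotheses (KJ : kahler J)
 (curvM : hol_curv (-1) M J) (m0 : (0 < m)%N)
 (cM : connected [set: M]) (complete : complete_riem M).
Let eps2 : (-1 : R) ^+ 2 = 1. by rewrite sqrrN expr1n. Qed.
Let eta := std_eta (-1 : R) (ord0 : 'I_m.+1).
Let e := std_e R (ord0 : 'I_m.+1).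
Let L := std_L R (ord0 : 'I_m.+1).
Let etaT : eta^T = eta. by have [] := std_eta_props eps2 (ord0 : 'I_m.+1). Qed.
Let etaJ : JJ *m eta = eta *m JJ. by have [] := std_eta_props eps2 (ord0 : 'I_m.+1). Qed.
Let eta2 : eta *m eta = 1%:M. by have [] := std_eta_props eps2 (ord0 : 'I_m.+1). Qed.
Let F : aframe (-1) eta e L. exact: std_frame. Qed.
Notation S := (gip eta).
Notation lift := (lift_aff e L).
Notation aff := (aff (-1) eta e L).
Notation B := (@unit_ball R m).
Notation H := (CH R m).
Let pos w : (0 < S (lift w) (lift w)) = (sqnorm w < 1).
by rewrite std_gip// mulN1r subr_gt0. Qed.
Let valB (x : H) : sqnorm (val x) < 1. exact: set_mem (valP x). Qed.
Let posB (x : H) : 0 < S (lift (val x)) (lift (val x)). by rewrite pos. Qed.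
Let mk w : H := insubd (ball_origin R m) w.
Let mkK w : sqnorm w < 1 -> val (mk w) = w.
by move=> w1; rewrite /mk insubdK//; apply/mem_set. Qed.
Let metricE w : @metric R n H tt w = model_metric (-1) w.
by rewrite /= /bergman /model_metric mul_iE mulN1r scaleN1r opprK addrA. Qed.
Let oB : open B.
rewrite openE => w w1; exact: (cont_near (P := fun t : R => t < 1) (@sqnorm_cont R n w) (lt_nbhsl w1)).
Qed.
Let val_cont : continuous (val : H -> 'rV[R]_n). exact: initial_continuous. Qed.
Let den_pos z : 0 < S z z -> den eta e z != 0.
by move=> z0; apply: (hyperbolic_den eps2 etaT etaJ F). Qed.
Variables (Q : 'rV[R]_N -> M).
Hypotheses (Ql : forall z, 0 < S z z -> lifts (-1) J eta (X := 'rV[R]_N) id Q z)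
 (Qs : forall y z, csim y z -> 0 < S z z -> Q y = Q z).
Let q (x : H) : M := Q (lift (val x)).
Let q_surj : set_surj setT setT q.
move=> x _; have z0 : 0 < S (lift 0) (lift 0) by rewrite pos sqnormE big1 ?ltr01// => i _; rewrite mxE expr0n.
have [z Kz <-] := covering_surjective RM KJ eps2 curvM etaT etaJ eta2 F m0 Ql cM z0 x.
have zs := lift_aff_csim eps2 etaT etaJ F (den_pos Kz).
have a1 : sqnorm (aff z) < 1 by rewrite -pos (csim_pos etaT etaJ zs).
by exists (mk (aff z)) => //; rewrite /q mkK//; exact: Qs.
Qed.
Let q_cont : continuous q.
move=> x; apply: (cont_comp (f := fun x : H => lift (val x))).
by apply: (cont_comp (val_cont (x := x))); exact: lift_cont.
by have [] := Ql (posB x).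
Qed.
Let q_local (x : H) c : cdom c (q x) ->
exists V h, [/\ [/\ open V, V (val x), mxsmooth V h & forall w, V w -> cimg c (h w)],
 forall w, V w -> 0 < S (lift w) (lift w) /\ coord c (Q (lift w)) = h w &
 forall w, V w -> model_metric (-1) w = 'J h w *m metric c (h w) *m ('J h w)^T].
exact: (local_metric RM KJ eps2 etaT etaJ F Ql Qs (posB x)). Qed.
Let repE (c : chart M) w : sqnorm w < 1 -> @local_rep R n H M q tt c w = coord c (Q (lift w)).
by move=> w1; rewrite /local_rep /q /= mkK. Qed.
Let domE (c : chart M) w : @local_dom R n H M q tt c w -> sqnorm w < 1 /\ cdom c (Q (lift w)).
by move=> [x [_ cx] <-]; split=> //; exact: valB. Qed.
Let q_smooth : smooth_fun q.
split=> // -[] c j; apply: smooth_local => w [x [_ /q_local[V [h [[oV Vw sh _] hE _]]]] <-].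
exists V, (fun y => h y 0 j); split=> // y /hE[]; rewrite pos => y1 <-.
by rewrite repE.
Qed.
Let q_metric : preserves_metric q.
move=> [] c w [x [_ /q_local[V [h [[oV Vw sh _] hE mE]]]] <-]; rewrite (metricE (val x)) (mE _ Vw).
have hE' y : V y -> @local_rep R n H M q tt c y = h y.
by move=> /hE[]; rewrite pos => y1 <-; rewrite repE.
by rewrite (hE' _ Vw) (jac_local oV sh Vw hE').
Qed.
Let deckg g := unitary eta g /\ forall b, 0 < S b b -> Q (b *m g) = Q b.
(** The maps of the ball induced by deck transformations. They are described by the matrix up to
    complex factors, as matrices differing by a phase give the same map. *)
Let G := [set f : H -> H | exists2 g, deckg g & forall x, csim (lift (val (f x))) (lift (val x) *m g)].
Let act g (x : H) : H := mk (aff (lift (val x) *m g)).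
Let kg g b : unitary eta g -> 0 < S b b -> 0 < S (b *m g) (b *m g).
by move=> ug; rewrite (unitary_gip _ _ ug). Qed.
Let actP g x : unitary eta g -> csim (lift (val (act g x))) (lift (val x) *m g).
move=> ug; have k := kg ug (posB x); have s1 := lift_aff_csim eps2 etaT etaJ F (den_pos k).
by rewrite /act mkK// -pos (csim_pos etaT etaJ s1).
Qed.
Let lift_inj (x y : H) : csim (lift (val x)) (lift (val y)) -> x = y.
by move=> /(aff_csim (-1) etaJ e L); rewrite !(aff_lift eps2 etaT etaJ F) => /val_inj. Qed.
Let G_q f x : G f -> q (f x) = q x.
by move=> [g [ug Qg] fg]; rewrite /q -(Qg _ (posB x)); apply: Qs => //; exact: kg ug (posB x). Qed.
Let G_act g : deckg g -> G (act g).
by move=> dg; exists g => // x; exact: actP dg.1. Qed.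
Let G_inv f : G f -> exists2 f', G f' & cancel f f' /\ cancel f' f.
move=> [g [ug Qg] fg]; have [g' [ug' gg' g'g]] := unitaryV etaT eta2 ug.
have dg' : deckg g'.
by split=> // b b0; rewrite -(Qg (b *m g')) ?kg// -mulmxA g'g mulmx1.
exists (act g'); first exact: G_act.
split=> x; apply: lift_inj.
by apply: csim_trans (actP _ ug') _; have := csim_mulmx ug'.2 (fg x); rewrite -mulmxA gg' mulmx1.
by apply: csim_trans (fg _) _; have := csim_mulmx ug.2 (actP x ug'); rewrite -mulmxA g'g mulmx1.
Qed.
Let G_comp f f' : G f -> G f' -> G (f \o f').
move=> [g [ug Qg] fg] [g' [ug' Qg'] fg']; exists (g' *m g).
split=> [|b b0]; last by rewrite mulmxA Qg ?Qg'// kg.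
by split; [rewrite trmx_mul !mulmxA -(mulmxA g' g) -(mulmxA g' (g *m eta)) ug.1 ug'.1|rewrite -mulmxA ug.2 mulmxA ug'.2 mulmxA].
by move=> x; apply: csim_trans (fg _) _; rewrite mulmxA; exact: csim_mulmx ug.2 (fg' x).
Qed.
Let G_free f x : G f -> f x = x -> f = id.
move=> [g [ug Qg] fg] fx; apply/funext => y; apply: lift_inj; apply: csim_trans (fg y) _.
have K : csim (lift (val x) *m g) (lift (val x)) by apply: csim_sym; have := fg x; rewrite fx.
have DF := deck_fixed RM eps2 etaT etaJ F m0 Ql Qs ug Qg (posB x) K.
exact: DF.
Qed.
(** Smoothness is that of a projective transformation in affine coordinates. The metric is preserved
    because [q] composed with [f] is [q], and [q] is a local isometry at both points. *)
Let G_smooth f : G f -> smooth_fun f /\ preserves_metric f.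
move=> Gf; have [g [ug Qg] fg] := Gf.
have fE x : val (f x) = aff (lift (val x) *m g).
by rewrite -(aff_csim (-1) etaJ e L (fg x)) (aff_lift eps2 etaT etaJ F).
have dB w : B w -> den eta e (lift w *m g) != 0.
by move=> w1; apply: den_pos; apply: kg ug _; rewrite pos.
have sg : mxsmooth B (fun w => aff (lift w *m g)).
apply: (aff_smooth eps2 etaT etaJ F oB _ dB).
apply: (mxsmoothM oB _ (mxsmooth_cst _ _)); apply: (mxsmoothD oB (mxsmooth_cst _ _)).
apply: (mxsmoothM oB _ (mxsmooth_cst _ _)).
by move=> i j k; rewrite ord1; exact: Ck_coord.
have rep w : B w -> @local_rep R n H H f tt tt w = aff (lift w *m g).
by move=> w1; rewrite /local_rep /= fE mkK.
have fc : continuous f.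
move=> x; apply: cont_set_type.
have -> : (fun y => val (f y)) = (fun y : H => aff (lift (val y) *m g)) by apply/funext.
apply: (cont_comp (val_cont (x := x)) (g := fun w => aff (lift w *m g))).
exact: (mxCk_cont (smooth_Ck 0 sg) (valB x : B (val x))).
split.
split=> // -[] [] j; apply: smooth_local => w [x [_ _] <-].
exists B, (fun w => aff (lift w *m g) 0 j); split=> //; first exact: valB.
by move=> y By; rewrite rep.
move=> [] [] w [x [_ _] <-]; have [c cx] := riem_cover RM (q x).
have [V [h [[oV Vx sh hc] hE hM]]] := q_local cx.
have cfx : cdom c (q (f x)) by rewrite G_q.
have [V' [h' [[oV' Vx' sh' hc'] hE' hM']]] := q_local cfx.
rewrite -[@coord R n H tt x]/(val x) (rep _ (valB x : B (val x))) (jac_local oB sg (valB x : B (val x)) rep).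
rewrite (metricE (val x)) (metricE (aff _)) -fE (hM _ Vx) (hM' _ Vx').
have fc' : {for val x, continuous (fun w => aff (lift w *m g))} by exact: (mxCk_cont (smooth_Ck 0 sg) (valB x : B (val x))).
pose W := [set w | B w /\ V' (aff (lift w *m g))].
have nW : \forall y \near val x, W y.
apply: filterI; first exact: open_near oB (valB x) (fun y h => h).
by apply: (cont_near fc'); rewrite -fE; exact: open_near oV' Vx' (fun y h => h).
have oW : open (W°) := open_interior W.
have sW : W° `<=` B by move=> y /interior_subset[].
have hh : forall y, (W° `&` V) y -> h y = h' (aff (lift y *m g)).
move=> y [/interior_subset[By V'y] Vy]; have [Sy <-] := hE y Vy; have [_ <-] := hE' _ V'y.
congr (coord c _); rewrite -(Qg _ Sy); apply/esym/Qs; last exact: kg.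
by apply: lift_aff_csim => //; exact: dB.
have jE : 'J h (val x) = 'J (fun w => aff (lift w *m g)) (val x) *m 'J h' (val (f x)).
have oWV := openI oW oV; have sWV : mxsmooth (W° `&` V) h by apply: mxsmooth_sub sh => y [].
rewrite -(jac_local oWV sWV (conj nW Vx) (f := h' \o (fun w => aff (lift w *m g)))); last by move=> y /hh.
rewrite fE; apply: (jac_comp oW oV' _ (smooth_Ck 1 (mxsmooth_sub sW sg)) (smooth_Ck 1 sh') nW).
by move=> y /interior_subset[].
have hx : h (val x) = h' (val (f x)) by rewrite fE; apply: hh.
by rewrite jE hx trmx_mul !mulmxA.
Qed.
(** If the images of x and y differ, disjoint neighbourhoods of them in [M] exclude all elements of
    [G]. Otherwise the only candidate is the element sending x to y: any other one, composed with
    its inverse, would have a fixed point near x. *)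
Let G_local (x y : H) : exists A C : set H, [/\ nbhs x A, nbhs y C & forall f f', G f -> G f' ->
 (exists2 a, A a & C (f a)) -> (exists2 a, A a & C (f' a)) -> f = f'].
have [qxy|qxy] := pselect (q x = q y); last first.
have [U [V [nU nV UV]]] : exists U V, [/\ nbhs (q x) U, nbhs (q y) V & ~ (U `&` V !=set0)].
apply: contrapT => h; apply: qxy; apply: (riem_hausdorff RM) => U V nU nV.
by apply: contrapT => k; apply: h; exists U, V.
exists (q @^-1` U), (q @^-1` V); split; [exact: cont_near (q_cont (x := x)) nU|exact: cont_near (q_cont (x := y)) nV|].
by move=> f f' Gf _ [a Ua Va]; exfalso; apply: UV; exists (q a); split=> //; rewrite -(G_q a Gf).
have [g [ug gs Qg]] := deck RM KJ eps2 etaT etaJ eta2 F m0 Ql Qs (posB x) (posB y) qxy.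
pose f0 := act g; have Gf0 : G f0 := G_act (conj ug Qg).
have f0x : f0 x = y by apply: lift_inj; apply: csim_trans (actP x ug) (csim_sym gs).
have [f1 Gf1 [f01 f10]] := G_inv Gf0.
have [_ [Z dZ nZ]] := Ql (posB x).
pose W := [set a : H | csim (Z (q a)) (lift (val a))].
have nW : nbhs x W.
apply: (cont_near (f := fun a : H => lift (val a)) _ nZ).
by apply: (cont_comp (val_cont (x := x))); exact: lift_cont.
exists W, (f1 @^-1` W); split=> //.
by apply: (cont_near ((G_smooth Gf1).1.1 y)); rewrite -f0x f01.
have K f : G f -> (exists2 a, W a & W (f1 (f a))) -> f = f0.
move=> Gf [a Wa Wb]; have E : f1 (f a) = a.
apply: lift_inj; apply: csim_trans (csim_sym Wb) _.
by rewrite (G_q _ Gf1) (G_q _ Gf).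
have E1 := G_free (G_comp Gf1 Gf) E; apply/funext => b.
by rewrite -(f10 (f b)) -[f1 (f b)]/((f1 \o f) b) E1.
by move=> f f' Gf Gf' /(K f Gf) -> /(K f' Gf') ->.
Qed.
Let G_proper (K : set H) : compact K -> finite_set [set f | G f /\ (f @` K) `&` K !=set0].
move=> cK; have /compact_near_coveringP cov := compact_setX cK cK.
(* The filter of finite sets ordered by inclusion. Compactness of K x K turns the finiteness around
   each pair of points into one finite set of maps containing every [f] that returns to [K]. *)
pose FF : set_system (set (H -> H)) := [set X | exists2 D0, finite_set D0 &
 forall D, finite_set D -> D0 `<=` D -> X D].
have fF : Filter FF.
split=> [|X Y [D1 f1 h1] [D2 f2 h2]|X Y XY [D1 f1 h1]].
 - by exists set0.
 - exists (D1 `|` D2); first by rewrite finite_setU.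
by move=> D fD DD; split; [apply: h1 => // f ?|apply: h2 => // f ?]; apply: DD; [left|right].
 - by exists D1 => // D fD /(h1 D fD); exact: XY.
have [xy _|D fD /(_ D fD (fun f h => h)) DK] := cov _ FF (fun D xy => forall f, G f -> f xy.1 = xy.2 -> D f) fF.
have [A [C [nA nC u]]] := G_local xy.1 xy.2.
have [D0 fD0 hD0] : exists2 D0, finite_set D0 & forall f, G f -> (exists2 a, A a & C (f a)) -> D0 f.
have [[f0 [Gf0 h0]]|none] := pselect (exists f0, G f0 /\ exists2 a, A a & C (f0 a)).
by exists [set f0] => // f Gf h; exact: u.
by exists set0 => // f Gf h; exfalso; apply: none; exists f.
exists (A `*` C, [set D | D0 `<=` D]); first by split; [exists (A, C)|exists D0].
by move=> [[a b] D] [/= [Aa Cb] DD] f Gf fab; apply: DD; apply: hD0 => //; exists a; rewrite ?fab.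
apply: sub_finite_set fD => f [Gf [y [[x Kx xy] Ky]]].
by apply: (DK (x, f x)) => //; split=> //=; rewrite xy.
Qed.

Lemma hyperbolic_quotient_of : isometric_to_quotient M H.
exists G; split.
split.
 - move=> f Gf; have [sf pf] := G_smooth Gf; split=> //.
by have [f' Gf' [k1 k2]] := G_inv Gf; exists f'; split=> //; exact: (G_smooth Gf').1.
 - exists 1%:M; last by move=> x; rewrite mulmx1; exact: csim_refl.
by split=> [|b _]; [split; rewrite ?mul1mx ?mulmx1 ?trmx1 ?mulmx1|rewrite mulmx1].
 - exact: G_comp.
 - exact: G_inv.
 - exact: G_free.
 - exact: G_proper.
exists q; split=> // x y; split=> [qxy|[f Gf <-]]; last by rewrite G_q.
have [g [ug gs Qg]] := deck RM KJ eps2 etaT etaJ eta2 F m0 Ql Qs (posB x) (posB y) qxy.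
by exists (act g); [exact: G_act|apply: lift_inj; apply: csim_trans (actP x ug) (csim_sym gs)].
Qed.
End HyperbolicQuotient.

(** * Complex lines, and homogeneous coordinates of projective space *)

Section ComplexLines.
Variables (R : realType) (m : nat).
Notation n := (m + m)%N.
Notation N := (m.+1 + m.+1)%N.
Notation JJ := (J0 R m.+1).
Implicit Types (z y : 'rV[R]_N) (k : 'I_m.+1).

Lemma to_complexK p : cancel (@to_complex R p) (@of_complex R p).
move=> v; rewrite -[RHS]hsubmxK /of_complex /to_complex; congr row_mx; apply/rowP => j; rewrite !mxE;
by rewrite ?mxE.
Qed.

Lemma to_complex_cmul (a b : R) z : to_complex (cmul a b z) = (a +i* b)%C *: to_complex z.
have tcE (u : 'rV[R]_N) j : to_complex u 0 j = (u 0 (lshift m.+1 j) +i* u 0 (rshift m.+1 j))%C.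
by rewrite mxE !mxE.
apply/rowP => j; rewrite [RHS]mxE !tcE /cmul -mul_iE /mul_i.
have lin (u v : 'rV[R]_N) i : (a *: u + b *: v) 0 i = a * u 0 i + b * v 0 i by rewrite !mxE.
rewrite !lin row_mxEl row_mxEr.
rewrite [(- rsubmx z) _ _]mxE ![lsubmx _ _ _]mxE ![rsubmx _ _ _]mxE; apply/eqP; rewrite eq_complex /=; apply/andP; split; apply/eqP; ring.
Qed.

Lemma same_lineP (z y : @nonzero_vec R m) : reflect (csim (val z) (val y)) (same_line z y).
apply: (iffP (asboolP _)) => [[[a b] ab E]|[[a b]/= [ab ->]]].
exists (a, b); split; last by apply: (can_inj (@to_complexK _)); rewrite to_complex_cmul.
by apply: contra ab; rewrite paddr_eq0 ?sqr_ge0// !sqrf_eq0 eq_complex.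
exists (a +i* b)%C; last exact: to_complex_cmul.
by apply: contra ab; rewrite eq_complex /= => /andP[/eqP -> /eqP ->]; rewrite expr0n addr0.
Qed.

Lemma std_eta1 k : std_eta (1 : R) k = 1%:M.
by rewrite /std_eta /std_D subrr scale0r addr0 -scalar_mx_block. Qed.
Lemma aframe1 k : aframe 1 (1%:M : 'M[R]_N) (std_e R k) (std_L R k).
by rewrite -(std_eta1 k); exact: std_frame. Qed.
Lemma cp_liftE k (w : 'rV[R]_n) : cp_lift k w = lift_aff (std_e R k) (std_L R k) w.
have hA (v : 'rV[R]_m) i : (v *m std_A R k) 0 i = if unlift k i is Some j then v 0 j else 0.
rewrite mxE; case: unliftP => [j ->|->]; last by rewrite big1// => a _; rewrite mxE (negbTE (neq_lift _ _)) mulr0.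
rewrite (bigD1 j)//= mxE eqxx mulr1 big1 ?addr0// => a aj.
by rewrite mxE (inj_eq lift_inj) eq_sym (negbTE aj) mulr0.
rewrite /lift_aff /std_e /std_L -[w in RHS]hsubmxK mul_row_block !mulmx0 addr0 add0r add_row_mx.
rewrite add0r /cp_lift /of_complex; congr row_mx; apply/rowP => i.
rewrite [RHS]mxE hA !mxE eqxx /=.
by case: unliftP => [j ->|->]; rewrite ?mxE/= ?(eq_sym (lift k j)) ?(negbTE (neq_lift _ _)) ?eqxx ?add0r ?addr0 ?mxE.
by rewrite hA !mxE /=; case: unliftP => [j _|_]; rewrite ?mxE.
Qed.

Lemma den_std k z : (den 1%:M (std_e R k) z != 0) = (to_complex z 0 k != 0).
have hr : re 1%:M (std_e R k) z = lsubmx z 0 k.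
rewrite /re /gip mulmx1 /std_e -[z in LHS]hsubmxK tr_row_mx mul_row_col trmx0 mulmx0 addr0 trmx_delta -colE.
by rewrite mxE.
have hi : im 1%:M (std_e R k) z = rsubmx z 0 k.
rewrite /im /gip mulmx1 -mul_iE /mul_i /std_e row_mxKl row_mxKr oppr0 -[z in LHS]hsubmxK tr_row_mx mul_row_col.
by rewrite trmx0 mulmx0 add0r trmx_delta -colE mxE.
by rewrite denE hr hi paddr_eq0 ?sqr_ge0// !sqrf_eq0 [to_complex z 0 k]mxE eq_complex.
Qed.

(** A real matrix commuting with J is a complex matrix [Gc] of size m + 1, and its characteristic
    polynomial has a root. *)
Lemma complex_eigenvector (g : 'M[R]_N) : g *m JJ = JJ *m g -> exists z a b, z != 0 /\ z *m g = cmul a b z.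
move=> gJ; pose E i : 'rV[R]_N := row_mx (delta_mx 0 i) 0.
pose Gc : 'M[R[i]]_m.+1 := \matrix_(i, j) to_complex (E i *m g) 0 j.
have zE z : z = \sum_i cmul (lsubmx z 0 i) (rsubmx z 0 i) (E i).
rewrite -[LHS]hsubmxK {1}(row_sum_delta (lsubmx z)) {1}(row_sum_delta (rsubmx z)).
have -> : row_mx (\sum_j lsubmx z 0 j *: delta_mx 0 j) (\sum_j rsubmx z 0 j *: delta_mx 0 j) =
 \sum_j row_mx (lsubmx z 0 j *: delta_mx 0 j) (rsubmx z 0 j *: delta_mx 0 j) :> 'rV[R]_N.
by apply/esym; elim/big_rec3: _ => [|i a b c _ ->]; rewrite ?row_mx0// add_row_mx.
apply: eq_bigr => i _; rewrite /cmul -mul_iE /mul_i row_mxKl row_mxKr oppr0 !scale_row_mx !scaler0 add_row_mx.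
by rewrite add0r addr0.
have tcD (I : finType) (f : I -> 'rV[R]_N) : to_complex (\sum_i f i) = \sum_i to_complex (f i).
apply/rowP => j; rewrite summxE !mxE; apply/eqP; rewrite eq_complex; apply/andP.
by split; rewrite /= raddf_sum /= summxE; apply/eqP/eq_bigr => i _; rewrite mxE /= !mxE.
have tG z : to_complex (z *m g) = to_complex z *m Gc.
rewrite {1}(zE z) mulmx_suml tcD; apply/rowP => j; rewrite summxE [RHS]mxE; apply: eq_bigr => i _.
by rewrite (cmul_mulmx _ _ _ gJ) to_complex_cmul !mxE.
have [a ra] : exists a, root (char_poly Gc) a by apply/closed_rootP; rewrite size_char_poly.
have /eigenvalueP[v vG v0] : eigenvalue Gc a by rewrite eigenvalue_root_char.
exists (of_complex v), (complex.Re a), (complex.Im a); split.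
by apply: contra v0 => /eqP /(congr1 (@to_complex _ _)); rewrite of_complexK => ->; apply/eqP/rowP => j; rewrite !mxE.
apply: (can_inj (@to_complexK _)); rewrite tG to_complex_cmul of_complexK vG.
by case: a {ra vG}.
Qed.
End ComplexLines.

Local Open Scope quotient_scope.

(** * The projective case *)

Section EllipticQuotient.
Variables (R : realType) (m : nat) (M : riemData R (m + m)).
Notation n := (m + m)%N.
Notation N := (m.+1 + m.+1)%N.
Notation JJ := (J0 R m.+1).
Hypotheses (RM : riemannian M).
Variables (J : chart M -> 'rV[R]_n -> 'M[R]_n).
Hypotheses (KJ : kahler J)
 (curvM : hol_curv 1 M J) (m0 : (0 < m)%N)
 (cM : connected [set: M]).
Let one2 : (1 : R) ^+ 2 = 1. exact: expr1n. Qed.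
Let eta : 'M[R]_N := 1%:M.
Let etaT : eta^T = eta. exact: trmx1. Qed.
Let etaJ : JJ *m eta = eta *m JJ. by rewrite mulmx1 mul1mx. Qed.
Let eta2 : eta *m eta = 1%:M. exact: mulmx1. Qed.
Notation S := (gip eta).
Notation e k := (std_e R (k : 'I_m.+1)).
Notation L k := (std_L R (k : 'I_m.+1)).
Notation lift k := (lift_aff (e k) (L k)).
Notation aff k := (aff 1 eta (e k) (L k)).
Let F k : aframe 1 eta (e k) (L k) := aframe1 R k.
Notation P := (CP R m).
Notation V := (@nonzero_vec R m).

Lemma gip1_pos (z : 'rV[R]_N) : z != 0 -> 0 < S z z.
by move=> z0; rewrite /gip mulmx1; exact: sqnorm_gt0. Qed.
Variables (Q : 'rV[R]_N -> M).
Hypotheses (Ql : forall z, 0 < S z z -> lifts 1 J eta (X := 'rV[R]_N) id Q z)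
 (Qs : forall y z, csim y z -> 0 < S z z -> Q y = Q z).
Let v0 (z : V) : 0 < S (val z) (val z). by apply: gip1_pos; exact: set_mem (valP z). Qed.
(** Two lines with the same image are exchanged by a deck transformation. This has an eigenvector,
    hence a fixed point since the whole of projective space is available, so it is trivial. *)
Lemma Q_injective y z : 0 < S y y -> 0 < S z z -> Q y = Q z -> csim y z.
move=> y0 z0 yz; have [g [ug zs Qg]] := deck RM KJ one2 etaT etaJ eta2 (F ord0) m0 Ql Qs y0 z0 yz.
have [v [a [b [vn0 vE]]]] := complex_eigenvector ug.2.
have vp := gip1_pos vn0.
(* The eigenvalue is nonzero because [g] preserves the positive definite form. *)
have gv : csim (v *m g) v.
rewrite vE; apply: csim_cmul; apply/eqP => ab.
have := unitary_gip v v ug; rewrite vE gip_cmul// ab mul0r => E; by rewrite -E ltxx in vp.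
have K := deck_fixed RM one2 etaT etaJ (F ord0) m0 Ql Qs ug Qg vp gv.
exact: csim_trans (csim_sym (K y)) (csim_sym zs).
Qed.
Let z1 : V := exist _ (cp_lift ord0 0) (cp_lift_neq0 ord0 0).
Let mkV z : V := insubd z1 z.
Let mkVK z : z != 0 -> val (mkV z) = z.
by move=> h; rewrite /mkV insubdK//; apply/mem_set. Qed.
Let pi (z : V) : P := \pi_({eq_quot (@same_line_rel R m)}) z.
Let rp (p : P) : V := repr (p : {eq_quot (@same_line_rel R m)}).
Let rpK p : pi (rp p) = p. exact: reprK. Qed.
Let pi_eq z y : csim (val z) (val y) -> pi z = pi y.
by move=> h; apply/eqquotP; exact/same_lineP. Qed.
Let rp_pi z : csim (val (rp (pi z))) (val z).
by apply/same_lineP; have /eqquotP := reprK (pi z : {eq_quot (@same_line_rel R m)}). Qed.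
Let cdomE (k : 'I_m.+1) p : @cdom R n P k p <-> den eta (e k) (val (rp p)) != 0.
by rewrite den_std. Qed.
Let coordE (k : 'I_m.+1) p : @cdom R n P k p -> @coord R n P k p = aff k (val (rp p)).
move=> kp; have z0 : cp_repr p 0 k != 0 := kp.
rewrite -[LHS](aff_lift one2 etaT etaJ (F k)); apply: (aff_csim 1 etaJ); rewrite -cp_liftE.
have E : to_complex (cp_lift k (@coord R n P k p)) = (cp_repr p 0 k)^-1 *: to_complex (val (rp p)).
apply/rowP => i; rewrite /cp_lift of_complexK mxE [RHS]mxE -/(cp_repr p).
by case: unliftP => [j ->|->]; rewrite ?mulVf// [coord _ _]/= of_complexK mxE mulrC.
move: E; case: (cp_repr p 0 k)^-1 (invr_neq0 z0) => a b ab E.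
exists (a, b); split; last by apply: (can_inj (@to_complexK R m.+1)); rewrite to_complex_cmul.
by apply: contra ab; rewrite paddr_eq0 ?sqr_ge0// !sqrf_eq0 eq_complex.
Qed.
Let ex x : exists z : V, Q (val z) = x.
have z0 := v0 z1; have [z zp <-] := covering_surjective RM KJ one2 curvM etaT etaJ eta2 (F ord0) m0 Ql cM z0 x.
exists (mkV z); rewrite mkVK//; apply: contraTneq zp => ->.
by rewrite /gip !mul0mx mxE ltxx.
Qed.

(** [Q] descends to a bijection from the projective space, by surjectivity and injectivity; the two
    directions are smooth and metric through [local_structure] and [local_metric]. *)
Lemma projective_isometry : isometric M P.
have [zz zzE] := choice ex.
pose f x := pi (zz x); pose g p := Q (val (rp p)).
have fQ z : 0 < S z z -> csim (val (rp (f (Q z)))) z.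
by move=> z0; apply: csim_trans (rp_pi _) _; apply: Q_injective => //; exact: v0.
have fg : cancel f g by move=> x; rewrite /g (Qs (rp_pi _)) ?v0// zzE.
have gf : cancel g f.
by move=> p; rewrite -[RHS]rpK; apply: pi_eq; apply: Q_injective; rewrite ?v0// zzE.
have metricE k w : @metric R n P k w = model_metric 1 w.
by rewrite /= /fubini_study /model_metric mul_iE mul1r scale1r opprD addrA.
have lp k w : 0 < S (lift k w) (lift k w).
by rewrite (gip_lift etaT (F k)) mul1r ltr_pwDl// sqnorm_ge0.
have fstr (c : chart M) k x : @local_dom R n M P f c k x -> exists U W, [/\ open U, U x, mxsmooth U W,
 forall y, U y -> @local_rep R n M P f c k y = W y
 & metric c x = 'J W x *m model_metric 1 (W x) *m ('J W x)^T].
move=> [p [cp kp] <-]; pose w0 := aff k (val (rp (f p))).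
have s0 : csim (lift k w0) (val (rp (f p))) by apply: lift_aff_csim => //; exact/cdomE.
have Qw : Q (lift k w0) = p by rewrite (Qs s0) ?v0// -[RHS]fg.
have cQ : cdom c (Q (lift k w0)) by rewrite Qw.
have [U [V' [h [W [[oU oV Vw Uc] HU HV [sW sh] HM]]]]] := local_structure RM KJ one2 etaT etaJ (F k) Ql Qs (lp k w0) cQ.
have [Up Wp _ pE] := HV _ Vw; have hE : h w0 = coord c p.
by have [_ <-] := cimg_param RM (Uc _ Up); rewrite pE Qw.
exists U, W; split=> //; [by rewrite -hE| |by apply: HM; rewrite -hE].
move=> y Uy; have [_ _ Qy] := HU y Uy.
have s1 : csim (val (rp (f (param c y)))) (lift k (W y)) by rewrite -Qy; apply: fQ; exact: lp.
rewrite /local_rep coordE.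
by rewrite (aff_csim 1 etaJ _ _ s1) (aff_lift one2 etaT etaJ (F k)).
by apply/cdomE/(den_csim etaJ s1); exact: den_lift_neq0 etaT etaJ _ _ _ (F k).
(* [zz] is an arbitrary choice of preimages, but near [x] the line of a preimage is also that of a
   development, which is continuous. *)
have fc : continuous f.
move=> x; have [Z [dZ _ nQ]] := covering_near RM KJ one2 etaT etaJ Ql Qs (v0 (zz x)).
rewrite zzE in dZ nQ.
have Zn q : isdev 1 J eta q Z -> Z q != 0.
move=> dq; apply/eqP => Z0; have := isdev_gip dq.
by rewrite Z0 /gip !mul0mx mxE => /eqP; rewrite eq_sym oner_eq0.
have h : {for x, continuous (fun y => pi (mkV (Z y)))}.
apply: (cont_comp (f := fun y => mkV (Z y))); last exact: pi_continuous.
apply: cont_set_type => A; rewrite mkVK ?Zn// => nA.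
have h' : \forall y \near x, A (val (mkV (Z y))).
have Zx : \forall y \near x, A (Z y) := cont_near (isdev_cont RM dZ) nA.
by apply: filterS2 Zx (isdev_near RM dZ) => y Ay /Zn Zy; rewrite mkVK.
exact: h'.
have E : \forall y \near x, pi (mkV (Z y)) = f y.
apply: filterS2 nQ (isdev_near RM dZ) => y Qy dy.
apply: pi_eq; apply: Q_injective; rewrite ?v0// zzE mkVK//; exact: Zn.
move=> A; rewrite -(nbhs_singleton E) => nA.
have h1 : \forall y \near x, A (pi (mkV (Z y))) := cont_near h nA.
have h' : \forall y \near x, A (f y) by apply: filterS2 E h1 => y <-.
exact: h'.
exists f; split.
- split=> // c k j; apply: smooth_local => x /fstr[U [W [oU Ux sW E _]]].
by exists U, (fun y => W y 0 j); split=> // y /E ->.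
- move=> c k x /fstr[U [W [oU Ux sW E ->]]].
by rewrite metricE (E _ Ux) (jac_local oU sW Ux E).
exists g; split=> //; split.
apply/quotient_continuous => z; have E : g \o pi = fun z : V => Q (val z).
by apply/funext => y; rewrite /= /g; apply: Qs; [exact: rp_pi|exact: v0].
rewrite -[_ \o _]/(g \o pi) E.
apply: (cont_comp (f := val : V -> 'rV[R]_N)); first exact: initial_continuous.
by have [] := Ql (v0 z).
move=> k c j; apply: smooth_local => w [p [kp cp] <-].
have s0 : csim (lift k (@coord R n P k p)) (val (rp p)).
by rewrite coordE//; apply: lift_aff_csim => //; exact/cdomE.
have cQ : cdom c (Q (lift k (@coord R n P k p))) by rewrite (Qs s0) ?v0.
have [V' [h [[oV Vw sh _] hE _]]] := local_metric RM KJ one2 etaT etaJ (F k) Ql Qs (lp k _) cQ.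
exists V', (fun y => h y 0 j); split=> // y /hE[_ <-].
rewrite /local_rep /g (Qs (rp_pi _)) ?v0//= cp_liftE.
by [].
Qed.
End EllipticQuotient.

(** With the scaling factor s l the model matrix is multiplied by s l while [curvmx] stays the same,
    and s (s l) = l. *)
Lemma scaled_curvature (R : realType) m (M : riemData R (m + m)) (J : chart M -> 'rV[R]_(m + m) -> 'M[R]_(m + m)) (s l : R) :
 riemannian M -> @kahler R (m + m) M J -> s ^+ 2 = 1 -> 0 < s * l ->
 (forall (c : chart M) x i j, cimg c x -> curvmx c i j x = l *: holmx J c i j x) ->
 forall (c : chart M) x i j, cimg c x ->
 @curvmx R (m + m) (scale (s * l) M) c i j x = s *: @holmx R m (scale (s * l) M) J c i j x.
move=> RM KJ s2 k0 h c x i j cx.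
by rewrite (curvmx_scale RM k0)// holmx_scale h// scalerA mulrA -expr2 s2 mul1r.
Qed.


Theorem corollary1p5 (R : realType) (m : nat) (M : riemData R (m + m))
  (J : chart M -> 'rV[R]_(m + m) -> 'M[R]_(m + m))
  (m_ge2 : (2 <= m)%N)
  (M_riemannian : riemannian M)
  (M_kahler : kahler J)
  (M_connected : connected [set: M])
  (M_complete : complete_riem M)
  (M_nonflat : ~ flat M) :
  (alpha_nonnegative (3 / 2 * (m%:R ^+ 2 - 1)) M ->
     exists2 k : R, 0 < k & isometric (scale k M) (CP R m)) /\
  (alpha_nonpositive (3 / 2 * (m%:R ^+ 2 - 1)) M ->
     exists2 k : R, 0 < k & isometric_to_quotient (scale k M) (CH R m)).
Proof.
have m0 : (0 < m)%N by exact: ltnW.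
(* A base point is needed; an empty [M] would be flat. *)
have [p0 _] : exists p : M, True.
  apply: contrapT => h; apply: M_nonflat => c x cx; by case: h; exists (param c x).
have hol := constant_holomorphic_curvature M_riemannian M_kahler m_ge2 M_connected M_nonflat.
split=> alpha.
  have one2 : (1 : R) ^+ 2 = 1 by exact: expr1n.
  have [l l0 lE] := hol 1 one2 (fun c x E phi cx fE ob => eq_ind_r (fun t => 0 <= t) (alpha c x E phi cx fE ob) (mul1r _)).
  exists (1 * l) => //.
  have RM := scale_riemannian M_riemannian l0; have KJ := scale_kahler M_riemannian M_kahler l0.
  have curvM := scaled_curvature M_riemannian M_kahler one2 l0 lE.
  have comp := scale_complete M_riemannian l0 M_complete.
  have [tr an] := elliptic_trig R.
  (* For eps = 1 the form [eta] is the identity, so that all nonzero vectors are positive. *)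
  have [Q Ql Qs] := elliptic_development RM KJ one2 curvM (trmx1 _ _) (etrans (mulmx1 _) (esym (mul1mx _))) (mulmx1 _)
    comp m0 tr an p0 (aframe1 R ord0) (@gip1_pos R m).
  exact: (@projective_isometry R m (scale (1 * l) M) RM J KJ curvM m0 M_connected Q Ql Qs).
have m12 : (-1 : R) ^+ 2 = 1 by rewrite sqrrN expr1n.
have [l l0 lE] : exists2 l, 0 < -1 * l & forall (c : chart M) x i j, cimg c x -> curvmx c i j x = l *: holmx J c i j x.
  by apply: hol => // c x E phi cx fE ob; rewrite mulN1r oppr_ge0; exact: alpha.
exists (-1 * l) => //.
have RM := scale_riemannian M_riemannian l0; have KJ := scale_kahler M_riemannian M_kahler l0.
have curvM := scaled_curvature M_riemannian M_kahler m12 l0 lE.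
have comp := scale_complete M_riemannian l0 M_complete.
have [C [Sn [ang [tr an]]]] := hyperbolic_trig R.
have [etaT etaJ eta2] := std_eta_props m12 (ord0 : 'I_m.+1).
have F := std_frame (-1 : R) (ord0 : 'I_m.+1).
have [Q Ql Qs] := affine_development RM KJ m12 curvM etaT etaJ eta2 comp m0 tr an p0 F.
apply: (@hyperbolic_quotient_of R m (scale (-1 * l) M) RM J KJ curvM m0 M_connected Q).
  by move=> z z0; apply: (Ql z _ z0); apply: (hyperbolic_den m12 etaT etaJ F _ z0).
by move=> y z yz _; exact: Qs.
Qed.
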